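(* Let $\Phi^1:\mathbf M\to\mathbf M_1$ be the unique dynamics preserving homeomorphism between the Mandelbrot set and the parabolic Mandelbrot set. For a dense set of parameters $c_0\in\partial\mathbf M$, the homeomorphism $\Phi^1$ is not Hölder at $c_0$ for any exponent; that is, for every $\kappa>0$ there are no constant $C$ and neighbourhood $N$ of $c_0$ such that $|\Phi^1(c)-\Phi^1(c_0)|\le C|c-c_0|^\kappa$ for all $c\in\mathbf M\cap N$.
   Context: For $c\in\mathbb C$ let $Q_c(z)=z^2+c$, with Julia set $J_c$ and filled-in Julia set $K(Q_c)=\{z\in\mathbb C : (Q_c^n(z))_n \text{ is bounded}\}$. The Mandelbrot set is $\mathbf M=\{c\in\mathbb C : J_c\text{ is connected}\}$. $\mathcal M_2=\mathrm{Rat}_2/PSL(2,\mathbb C)$ is the moduli space of rational maps of degree two, and $Per_1(1)=\{[g]\in\mathcal M_2 : g\text{ has a fixed point with multiplier }1\}$. The map $\sigma^1:Per_1(1)\to\mathbb C$ sending $[g]$ to the product of the two remaining fixed point multipliers is an isomorphism, and $Per_1(1)$ is identified with $\mathbb C$ via $\sigma^1$. Concretely, every class is represented by some $g_B(z)=z+B+1/z$, $B\in\mathbb C$, and $\sigma^1([g_B])=1-B^2$. The parabolic Mandelbrot set is $\mathbf M_1=\{[g]\in Per_1(1) : J(g)\text{ is connected}\}$. For $[g]\in Per_1(1)$ the external basin is the parabolic basin of the fixed point of multiplier $1$ if $\sigma^1([g])\ne1$ (this basin is then connected); if $\sigma^1([g])=1$ this basin has two symmetric components and one of them is chosen as the external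 basin. The filled Julia set $K(g)$ is the complement of the external basin. A map $\Phi^1:\mathbf M\to\mathbf M_1$ is dynamics preserving if for every $c\in\mathbf M$, with $[g]=\Phi^1(c)$, there exists a homeomorphism $\rho_c:\widehat{\mathbb C}\to\widehat{\mathbb C}$ which is conformal almost everywhere on $K(Q_c)$ (in the sense used for hybrid equivalences: $\bar\partial\rho_c=0$ a.e. on $K(Q_c)$), which maps $K(Q_c)$ onto $K(g)$ and satisfies $\rho_c\circ Q_c=g\circ\rho_c$ on $K(Q_c)$. There exists exactly one dynamics preserving homeomorphism $\Phi^1:\mathbf M\to\mathbf M_1$. *)

(* Defs.v *)
From HB Require Import structures.
From mathcomp Require Import all_boot all_order all_algebra.
From mathcomp Require Import all_classical all_reals all_analysis.
From mathcomp Require Import complex.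

Set Implicit Arguments.
Unset Strict Implicit.
Unset Printing Implicit Defensive.

Import Order.TTheory GRing.Theory Num.Theory numFieldNormedType.Exports.

Local Open Scope classical_set_scope.
Local Open Scope ring_scope.

(* The library only provides the norm topology on abstract numFieldTypes;
   transfer it to R[i]. *)
HB.instance Definition _ (R : realType) := GRing.ComAlgebra.copy R[i] R[i]^o.
HB.instance Definition _ (R : realType) := Vector.copy R[i] R[i]^o.
HB.instance Definition _ (R : realType) := NormedModule.copy R[i] R[i]^o.

(* `|z| : R[i] is a real complex number; this is the same number in R. *)
Definition modulus (R : realType) (z : R[i]) : R := complex.Re `|z|.

Definition boundary (T : topologicalType) (A : set T) : set T :=
  closure A `\` A°.

Definition homeomorphism_on (T U : topologicalType) (A : set T) (B : set U)
    (f : T -> U) : Prop :=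
  [/\ set_bij A B f, {within A, continuous f} &
      exists2 g : U -> T, {within B, continuous g} & {in A, cancel f g}].

(* The Riemann sphere: Some z is the finite point z, None is infinity. *)
Definition sphere (R : realType) : topologicalType :=
  one_point_compactification R[i].

Definition finite_point (R : realType) (z : R[i]) : sphere R := Some z.

Definition infinity (R : realType) : sphere R := None.

(* The chart at finite points, with the junk value 0 at infinity. *)
Definition coord (R : realType) (p : sphere R) : R[i] :=
  if p is Some z then z else 0.

Definition sphere_inv (R : realType) (p : sphere R) : sphere R :=
  if p is Some z then (if z == 0 then infinity R else finite_point z^-1)
  else finite_point 0.

Definition chordal (R : realType) (p q : sphere R) : R :=
  match p, q with
  | Some z, Some w => 2 * modulus (z - w) /
      (Num.sqrt (1 + modulus z ^+ 2) * Num.sqrt (1 + modulus w ^+ 2))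
  | Some z, None | None, Some z => 2 / Num.sqrt (1 + modulus z ^+ 2)
  | None, None => 0
  end.

(* Every sequence of members of the family (F n)_n has a subsequence that
   converges, uniformly on compact subsets of U, for the chordal metric. *)
Definition normal_family (R : realType) (U : set (sphere R))
    (F : nat -> sphere R -> sphere R) : Prop :=
  forall n : nat -> nat,
  exists (k : nat -> nat) (h : sphere R -> sphere R),
    {homo k : i j / (i < j)%N} /\
    forall A : set (sphere R), compact A -> A `<=` U ->
    forall e : R, 0 < e ->
    \forall m \near \oo, forall p, A p -> chordal (F (n (k m)) p) (h p) < e.

Definition Fatou_set (R : realType) (f : sphere R -> sphere R) :
    set (sphere R) :=
  [set p | exists U : set (sphere R),
    [/\ open U, U p & normal_family U (fun n => iter n f)]].

Definition Julia_set (R : realType) (f : sphere R -> sphere R) :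
    set (sphere R) := ~` Fatou_set f.

Definition quad (R : realType) (c z : R[i]) : R[i] := z ^+ 2 + c.

Definition quad_sphere (R : realType) (c : R[i]) (p : sphere R) : sphere R :=
  omap (quad c) p.

Definition filled_quad (R : realType) (c : R[i]) : set R[i] :=
  [set z | bounded_set (range (fun n => iter n (quad c) z))].

Definition Mandelbrot (R : realType) : set R[i] :=
  [set c | connected (Julia_set (quad_sphere c))].

Record rat2 (R : realType) := Rat2 {
  num : {poly R[i]};
  den : {poly R[i]};
  coprime_num_den : coprimep num den;
  degree_two : maxn (size num) (size den) = 3%N
}.

(* At infinity, the value is the ratio of the coefficients of degree two; if
   that of den is zero then that of num is not. *)
Definition rat_map (R : realType) (g : rat2 R) (p : sphere R) : sphere R :=
  match p with
  | Some z => if (den g).[z] == 0 then infinity R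
              else finite_point ((num g).[z] / (den g).[z])
  | None => if (den g)`_2 == 0 then infinity R
            else finite_point ((num g)`_2 / (den g)`_2)
  end.

(* The derivative of f at a fixed point p, read in the chart z at a finite
   point and in the chart 1/z at infinity. *)
Definition multiplier (R : realType) (f : sphere R -> sphere R)
    (p : sphere R) : R[i] :=
  if p is Some z then derive1 (fun w : R[i] => coord (f (finite_point w))) z
  else derive1 (fun w : R[i] =>
    coord (sphere_inv (f (sphere_inv (finite_point w))))) 0.

(* s lists the three fixed points of g with multiplicity: the finite ones are
   the roots of num - X den, and infinity makes up for the missing degree. *)
Definition fixed_points (R : realType) (g : rat2 R) (s : seq (sphere R)) :
    Prop :=
  size s = 3%N /\
  exists2 a : R[i], a != 0 &
    num g - 'X * den g = a *: \prod_(z <- pmap id s) ('X - z%:P).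

(* The class [g] lies in Per_1(1), and sigma^1([g]) = t. Since sigma^1 identifies
   Per_1(1) with the complex plane, this also says that g represents the point t
   of Per_1(1). The fixed point of multiplier 1 is multiple, so it occurs again
   among the two remaining ones. *)
Definition represents (R : realType) (g : rat2 R) (t : R[i]) : Prop :=
  exists p1 p2 p3 : sphere R,
    [/\ fixed_points g [:: p1; p2; p3],
        multiplier (rat_map g) p1 = 1 &
        t = multiplier (rat_map g) p2 * multiplier (rat_map g) p3].

(* As a subset of Per_1(1), identified with the complex plane by sigma^1. *)
Definition parabolic_Mandelbrot (R : realType) : set R[i] :=
  [set t | exists2 g : rat2 R,
     represents g t & connected (Julia_set (rat_map g))].

(* Orbits that land on p are excluded: p and its iterated preimages belong to
   the Julia set, not to the basin. *)
Definition parabolic_basin (R : realType) (f : sphere R -> sphere R)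
    (p : sphere R) : set (sphere R) :=
  [set q | (iter n f q @[n --> \oo] --> p) /\ forall n, iter n f q != p].

(* W is an admissible external basin of g, where g represents t. For t = 1 both
   components of the basin are admissible; they are exchanged by an automorphism
   of g. *)
Definition external_basin (R : realType) (g : rat2 R) (t : R[i])
    (W : set (sphere R)) : Prop :=
  exists p : sphere R,
    [/\ rat_map g p = p, multiplier (rat_map g) p = 1,
        t != 1 -> W = parabolic_basin (rat_map g) p &
        t = 1 -> exists2 q, parabolic_basin (rat_map g) p q &
          W = connected_component (parabolic_basin (rat_map g) p) q].

Definition to_complex (R : realType) (x : R * R) : R[i] := (x.1 +i* x.2)%C.

Definition of_complex (R : realType) (z : R[i]) : R * R :=
  (complex.Re z, complex.Im z).

Definition real_form (R : realType) (rho : sphere R -> sphere R) :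
    R * R -> R * R :=
  fun x => of_complex (coord (rho (finite_point (to_complex x)))).

Definition dbar (R : realType) (F : R * R -> R * R) (x : R * R) : R[i] :=
  (to_complex ('D_(1, 0) F x) + 'i%C * to_complex ('D_(0, 1) F x)) / 2.

(* Nothing is required at the single point that a homeomorphism rho sends to
   infinity. *)
Definition dbar_zero_at (R : realType) (rho : sphere R -> sphere R)
    (z : R[i]) : Prop :=
  rho (finite_point z) != infinity R ->
  differentiable (real_form rho) (of_complex z) /\
  dbar (real_form rho) (of_complex z) = 0.

(* dbar rho = 0 almost everywhere on K, as for hybrid equivalences. There dbar
   is a distributional derivative, and by Weyl's lemma its vanishing makes rho
   holomorphic on the interior of K; this is the first clause. It does not
   follow from the second one, which only involves pointwise derivatives: for
   a singular function s, x + iy |-> x + s(x) + iy has dbar = 0 almost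
   everywhere. *)
Definition conformal_ae (R : realType) (rho : sphere R -> sphere R)
    (K : set R[i]) : Prop :=
  (forall z, K° z -> dbar_zero_at rho z) /\
  ((@lebesgue_measure R) \x (@lebesgue_measure R))%E.-negligible
    [set x : R * R | K (to_complex x) /\ ~ dbar_zero_at rho (to_complex x)].

Definition dynamics_preserving (R : realType) (Phi : R[i] -> R[i]) : Prop :=
  forall c : R[i], Mandelbrot c ->
  forall g : rat2 R, represents g (Phi c) ->
  exists (W : set (sphere R)) (rho : sphere R -> sphere R),
    [/\ external_basin g (Phi c) W,
        homeomorphism_on setT setT rho,
        conformal_ae rho (filled_quad c),
        rho @` (@finite_point R @` filled_quad c) = ~` W &
        forall z, filled_quad c z ->
          rho (finite_point (quad c z)) = rat_map g (rho (finite_point z))].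

(* Main.v *)
Require Import Defs.
From HB Require Import structures.
From mathcomp Require Import all_boot all_order all_algebra.
From mathcomp Require Import all_classical all_reals all_analysis.
From mathcomp Require Import complex ring lra zify.
Set Implicit Arguments.
Unset Strict Implicit.
Unset Printing Implicit Defensive.
Import Order.TTheory GRing.Theory Num.Theory numFieldNormedType.Exports.
Local Open Scope classical_set_scope.
Local Open Scope ring_scope.

(** The bifurcation locus contains a dense set of parameters [c0] whose critical
    orbit lands on a repelling fixed point [y]. Rescaling around such a [c0]
    gives parameters [c_k] exponentially close to it, [|c_k - c0| <= C 64^-k],
    for which the critical point has a period [N_k] at most linear in [k]. If the
    conjugacy sends [y] to the parabolic point, then the critical orbit of
    [Phi c_k] starts close to a neutral fixed point and moves away from it only
    linearly, so that [|Phi c_k - Phi c0| >= c / N_k], and no Hoelder estimate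
    holds. The same happens if [y] is sent to the other fixed point [- 1 / b] and
    that point is not repelling. If it is repelling, its prepoles accumulate on
    it, and rescaling in the parabolic family gives parameters near [Phi c0]
    whose critical orbit lands on the parabolic point; their preimages under
    [Phi] are the required ones. *)

(** * Modulus and Fourier coefficients *)

(** The mechanism is a mismatch of multipliers. Near a repelling landing point a perturbation of
    size [64 ^- k] is magnified to a fixed size in O(k) steps. In the parabolic family the deviation
    d is multiplied by at most [1 + C (e + d)] per step, where e is the change of parameter, so
    about [1 / e] steps are needed. A landing point sent to infinity has to be repelling: topology
    excludes attracting ones, and an arithmetic argument excludes multipliers of modulus one.
    Quadratic parameters are written as [kap l], because the marked fixed point [l / 2] is then
    polynomial in the parameter; the price is the branch point [c = 1 / 4], which is treated as a
    limit of other boundary points. The complex analysis is built from polynomials: discrete Fourier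
    sums give Harnack's inequality for [ln |A / B|], which takes over the roles of the theorems of
    Schwarz, Hurwitz and Montel. The number 64 is [8 * 8]: a covering argument loses a factor 8 in
    the radius, and Hurwitz's argument another one. *)

Section Modulus.
Context {R : realType}.
Implicit Types (z w : R[i]) (x : R).

Lemma normCE z : `|z| = (modulus z)%:C%C.
Proof. by rewrite /modulus normc_def. Qed.

Lemma modulusE z : modulus z = Num.sqrt (complex.Re z ^+ 2 + complex.Im z ^+ 2).
Proof. by rewrite /modulus normc_def. Qed.

Lemma modulus_ge0 z : 0 <= modulus z.
Proof. by rewrite modulusE sqrtr_ge0. Qed.

Lemma modulus0 : modulus (0 : R[i]) = 0.
Proof. by rewrite /modulus normr0. Qed.

Lemma modulus1 : modulus (1 : R[i]) = 1.
Proof. by rewrite /modulus normr1. Qed.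

Lemma modulus_eq0 z : (modulus z == 0) = (z == 0).
Proof.
rewrite -[RHS]normr_eq0 normCE; apply/eqP/eqP => [->//|].
by move/(congr1 (@complex.Re R)).
Qed.

Lemma modulus_gt0 z : (0 < modulus z) = (z != 0).
Proof. by rewrite lt_neqAle modulus_ge0 andbT eq_sym modulus_eq0. Qed.

Lemma modulusM z w : modulus (z * w) = modulus z * modulus w.
Proof. by rewrite /modulus normrM !normCE -(rmorphM (real_complex R)). Qed.

Lemma modulusV z : modulus z^-1 = (modulus z)^-1.
Proof. by rewrite /modulus normfV normCE -(fmorphV (real_complex R)). Qed.

Lemma modulusX z n : modulus (z ^+ n) = modulus z ^+ n.
Proof. by elim: n => [|n IH]; rewrite ?expr0 ?modulus1// !exprS modulusM IH. Qed.

Lemma modulusN z : modulus (- z) = modulus z.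
Proof. by rewrite /modulus normrN. Qed.

Lemma modulusBC z w : modulus (z - w) = modulus (w - z).
Proof. by rewrite /modulus distrC. Qed.

Lemma modulus_real x : modulus x%:C%C = `|x|.
Proof. by rewrite modulusE /= expr0n addr0 sqrtr_sqr. Qed.

Lemma modulus_nat n : modulus (n%:R : R[i]) = n%:R.
Proof. by rewrite -(rmorph_nat (real_complex R)) modulus_real normr_nat. Qed.

Lemma ler_modulusD z w : modulus (z + w) <= modulus z + modulus w.
Proof. by have := ler_normD z w; rewrite !normCE -(rmorphD (real_complex R)) lecR. Qed.

Lemma ler_modulusB z w : modulus (z - w) <= modulus z + modulus w.
Proof. by rewrite -(modulusN w) ler_modulusD. Qed.

Lemma lerB_modulusD z w : modulus z - modulus w <= modulus (z + w).
Proof. by rewrite lerBlDr -{1}[z](addrK w) -(modulusN w) ler_modulusD. Qed.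

Lemma lerB_modulus z w : modulus z - modulus w <= modulus (z - w).
Proof. by rewrite -(modulusN w) lerB_modulusD. Qed.

Lemma ler_dist_modulus z w : `|modulus z - modulus w| <= modulus (z - w).
Proof. by rewrite ler_norml lerB_modulus lerNl opprB modulusBC lerB_modulus. Qed.

Lemma modulus_triangle w z u : modulus (z - u) <= modulus (z - w) + modulus (w - u).
Proof. by rewrite -{1}[z](subrK w) -addrA ler_modulusD. Qed.

Lemma sqr_modulus z : modulus z ^+ 2 = complex.Re z ^+ 2 + complex.Im z ^+ 2.
Proof. by rewrite modulusE sqr_sqrtr// addr_ge0 ?sqr_ge0. Qed.

Lemma ler_Re_modulus z : `|complex.Re z| <= modulus z.
Proof. by have := normc_ge_Re z; rewrite normCE lecR. Qed.

Lemma ler_Im_modulus z : `|complex.Im z| <= modulus z.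
Proof. by rewrite modulusE -sqrtr_sqr ler_wsqrtr// lerDr sqr_ge0. Qed.

Lemma ler_modulus_ReIm z : modulus z <= `|complex.Re z| + `|complex.Im z|.
Proof.
rewrite modulusE -[leRHS]ger0_norm ?addr_ge0// -sqrtr_sqr ler_wsqrtr//.
rewrite sqrrD !real_normK ?num_real// lerD2r lerDl.
by rewrite mulrn_wge0 // mulr_ge0.
Qed.

Lemma ler_modulus_sum (I : Type) (r : seq I) (P : pred I) (F : I -> R[i]) :
  modulus (\sum_(i <- r | P i) F i) <= \sum_(i <- r | P i) modulus (F i).
Proof.
elim/big_ind2 : _ => //; first by rewrite modulus0.
by move=> a b c d ha hb; rewrite (le_trans (ler_modulusD _ _))// lerD.
Qed.

Lemma nbhs_modulusP z (A : set R[i]) : nbhs z A <->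
  exists2 r : R, 0 < r & forall w, modulus (w - z) < r -> A w.
Proof.
rewrite -nbhs_ballE; split=> [[e e0 h]|[r r0 h]].
  have Ie : complex.Im e = 0 by apply: ger0_Im; exact: ltW.
  have ee : e = (complex.Re e)%:C%C by rewrite [LHS]complexE Ie mulr0 addr0.
  exists (complex.Re e); first by move: e0; rewrite /= ltcE => /andP[].
  move=> w wz; apply: h.
  have : `|w - z| < e by rewrite ee normCE ltcR.
  by rewrite distrC.
exists (r%:C)%C => /=; first by rewrite ltcE /= eqxx.
move=> w zw; apply: h.
have : `|w - z| < r%:C%C by rewrite distrC.
by rewrite normCE ltcR.
Qed.

End Modulus.

Section Fourier.
Context {R : realType}.
Implicit Types (P : {poly R[i]}) (z w : R[i]) (r c e : R).

Lemma ReD z w : complex.Re (z + w) = complex.Re z + complex.Re w.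
Proof. by case: z w => [a b] [c d]. Qed.

Lemma ReN z : complex.Re (- z) = - complex.Re z.
Proof. by case: z. Qed.

Lemma ReB z w : complex.Re (z - w) = complex.Re z - complex.Re w.
Proof. by rewrite ReD ReN. Qed.

Lemma ReZ r z : complex.Re (r%:C%C * z) = r * complex.Re z.
Proof. by case: z => [a b] /=; rewrite mul0r subr0. Qed.

(** Roots of unity of these orders come from repeated square roots of -1. Averages over them take
    the place of contour integrals. *)
Lemma primitive_root_2exp k : exists w : R[i], (2 ^ k.+1).-primitive_root w.
Proof.
have [w wN1] : exists w : R[i], w ^+ (2 ^ k) = -1.
  elim: k => [|k [w wk]]; first by exists (-1); rewrite expr1.
  by exists (sqrtc w); rewrite expnS exprM sqr_sqrtc.
have w1 : w ^+ (2 ^ k.+1) = 1 by rewrite expnS mulnC exprM wN1 sqrrN expr1n.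
have [m wm mk] := prim_order_exists (expn_gt0 2 k.+1) w1.
have [j jk mj] := dvdn_pfactor m k.+1 (isT : prime 2) mk.
exists w; suff -> : (2 ^ k.+1)%N = m by [].
rewrite mj; move: jk; rewrite leq_eqVlt => /orP[/eqP->//|]; rewrite ltnS => jk.
have : w ^+ (2 ^ k) = 1.
  by apply/eqP; rewrite -(prim_order_dvd wm) mj dvdn_exp2l.
by rewrite wN1 => /eqP; rewrite eq_sym -addr_eq0 -(mulr2n 1) pnatr_eq0.
Qed.

Lemma primitive_root_modulus n w : n.-primitive_root w -> modulus w = 1.
Proof.
move=> wn; have /(congr1 (@modulus R)) := prim_expr_order wn.
rewrite modulusX modulus1 => /eqP; rewrite pexpr_eq1 ?modulus_ge0 ?(prim_order_gt0 wn)//.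
by move/eqP.
Qed.

Lemma primitive_root_sum n w m : n.-primitive_root w ->
  \sum_(j < n) w ^+ (j * m) = if (n %| m)%N then n%:R else 0.
Proof.
move=> wn; case: ifPn => nm.
  rewrite (eq_bigr (fun=> 1)) ?sumr_const ?card_ord// => j _.
  by apply/eqP; rewrite -(prim_order_dvd wn) dvdn_mull.
have wm : w ^+ m - 1 != 0 by rewrite subr_eq0 -(prim_order_dvd wn).
apply/eqP; rewrite -(mulrI_eq0 _ (lregP wm)).
have := subrX1 (w ^+ m) n.
rewrite -exprM mulnC exprM (prim_expr_order wn) expr1n subrr => /esym/eqP.
by under eq_bigr do rewrite -exprM mulnC.
Qed.

Lemma conj_primitive_root n w : n.-primitive_root w -> (w^*)%C = w ^+ n.-1.
Proof.
move=> wn; have w0 : w != 0 by rewrite -modulus_eq0 (primitive_root_modulus wn) oner_eq0.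
apply: (mulfI w0); rewrite -exprS prednK ?(prim_order_gt0 wn)//.
rewrite (prim_expr_order wn) -sqr_normc normCE (primitive_root_modulus wn).
by rewrite expr1n.
Qed.

Lemma horner_coef_le n P z : (size P <= n)%N -> P.[z] = \sum_(i < n) P`_i * z ^+ i.
Proof. exact: horner_coef_wide. Qed.

(** Writing [2 Re P] as P plus its conjugate, orthogonality keeps from P only the degree k. The
    conjugate contributes the exponents [-(k + i)] modulo n, never zero because [0 < k + i < n];
    here [2 * size P <= n] prevents aliasing. *)
Lemma sum_root_coef n w P r k : n.-primitive_root w -> (2 * size P <= n)%N ->
    (0 < k < size P)%N ->
  \sum_(j < n) w ^+ (j * (n - k)) * (2 * complex.Re P.[r%:C%C * w ^+ j])%:C%C
   = n%:R * (P`_k * (r%:C%C) ^+ k).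
Proof.
move=> wn Pn /andP[k0 kP]; have n0 := prim_order_gt0 wn.
have kn : (k <= n)%N by lia.
pose A (j : 'I_n) (i : 'I_(size P)) := P`_i * (r%:C%C) ^+ i * w ^+ (j * (n - k + i)).
pose A' (j : 'I_n) (i : 'I_(size P)) :=
  ((P`_i)^*)%C * (r%:C%C) ^+ i * w ^+ (j * (n - k + n.-1 * i)).
rewrite (eq_bigr (fun j => \sum_(i < size P) A j i + \sum_(i < size P) A' j i)); last first.
  move=> j _; rewrite rmorphM/= rmorph_nat -addcJ mulrDr.
  rewrite (horner_coef_le _ (leqnn (size P))) rmorph_sum/= !mulr_sumr.
  congr (_ + _); apply: eq_bigr => i _.
    rewrite /A exprMn -!exprM mulrCA -mulrA; congr (_ * _).
    by rewrite mulrCA -exprD -mulnDr.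
  have -> : ((P`_i * (r%:C%C * w ^+ j) ^+ i)^*)%C =
      (P`_i)^*%C * (r%:C%C * (w^*)%C ^+ j) ^+ i.
    rewrite rmorphM rmorphXn rmorphM rmorphXn; congr (_ * (_ * _) ^+ _).
    exact: conjc_real.
  rewrite /A'.
  rewrite (conj_primitive_root wn) exprMn -!exprM mulrCA -mulrA; congr (_ * _).
  by rewrite mulrCA -exprD; congr (_ * _ ^+ _); rewrite mulnDr; ring.
rewrite big_split/= exchange_big [X in _ + X]exchange_big/=.
rewrite [X in _ + X]big1 ?addr0; last first.
  move=> i _; rewrite -mulr_sumr (primitive_root_sum _ wn).
  suff -> : (n %| n - k + n.-1 * i)%N = false by rewrite mulr0.
  apply/negP => h; have ni : (n %| (n - k + n.-1 * i) + (k + i))%N.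
    have -> : (n - k + n.-1 * i + (k + i) = n * i.+1)%N.
      by rewrite mulnS; have : (n.-1 * i + i = n * i)%N; [rewrite -mulSnr prednK|lia].
    exact: dvdn_mulr.
  have := dvdn_sub ni h; rewrite addKn => /dvdn_leq; rewrite addn_gt0 k0 => /(_ isT).
  have iP : (i < size P)%N by [].
  move=> nki; have := leq_trans Pn nki; rewrite mul2n -addnn leqNgt.
  by rewrite -addnS leq_add// ltnW.
rewrite (bigD1 (Ordinal kP))//= [X in _ + X]big1 ?addr0.
  by rewrite -mulr_sumr (primitive_root_sum _ wn)/= subnK// dvdnn mulrC.
move=> i; rewrite -val_eqE/= => ik.
rewrite -mulr_sumr (primitive_root_sum _ wn).
suff -> : (n %| n - k + i)%N = false by rewrite mulr0.
have aux (l s m N : nat) : (l < s)%N -> (m < s)%N -> (0 < m)%N -> (2 * s <= N)%N ->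
    l != m -> (N %| N - m + l)%N = false.
  move=> ls ms m0 sN lm; apply/negP => /dvdnP[[|[|q]]]; rewrite ?mul0n ?mul1n ?mulSn; lia.
exact: (aux _ (size P)).
Qed.

Lemma sum_root_coef0 n w P r : n.-primitive_root w -> (size P <= n)%N ->
  \sum_(j < n) complex.Re P.[r%:C%C * w ^+ j] = n%:R * complex.Re P.[0].
Proof.
move=> wn Pn; have n0 := prim_order_gt0 wn.
have ReS (I : Type) (s : seq I) (F : I -> R[i]) :
  complex.Re (\sum_(i <- s) F i) = \sum_(i <- s) complex.Re (F i).
  by elim/big_rec2 : _ => // i x y _; rewrite ReD => ->.
rewrite -ReS -[n%:R * _](ReZ n%:R) rmorph_nat; congr complex.Re.
under eq_bigr => j _.
  rewrite (horner_coef_le _ (leqnn (size P))).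
  under eq_bigr do rewrite exprMn mulrA -exprM.
  over.
rewrite exchange_big/= horner_coef0.
under eq_bigr do rewrite -mulr_sumr (primitive_root_sum _ wn).
have [->|P0] := eqVneq P 0; first by rewrite size_poly0 big_ord0 coef0 mulr0.
have sP : (0 < size P)%N by rewrite size_poly_gt0.
rewrite (bigD1 (Ordinal sP))//= dvdn0 expr0 mulr1 mulrC big1 ?addr0// => i.
rewrite -val_eqE/= => i0; case: ifPn; last by rewrite mulr0.
by move=> /dvdn_leq; rewrite lt0n i0 => /(_ isT) ni; have := leq_ltn_trans ni (ltn_ord i); rewrite ltnNge Pn.
Qed.

Lemma sum_geo_half (x : R) n : 0 <= x <= 2^-1 -> \sum_(k < n) x ^+ k.+1 <= 2 * x.
Proof.
move=> /andP[x0 x1].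
suff : \sum_(k < n) x ^+ k.+1 <= 2 * x * (1 - x ^+ n).
  move=> /le_trans; apply; rewrite ler_piMr ?mulr_ge0//.
  by rewrite gerBl exprn_ge0.
elim: n => [|n IH]; first by rewrite big_ord0 expr0 subrr mulr0.
rewrite big_ord_recr/= (le_trans (lerD IH (lexx _)))// !exprS.
have : 0 <= x * x ^+ n * (1 - 2 * x) by rewrite !mulr_ge0 ?exprn_ge0//; lra.
by nra.
Qed.

(** A Borel-Caratheodory estimate: a coefficient of positive degree is a Fourier coefficient of
    [2 Re P], hence controlled by the mean of [|Re P|] over a circle. *)
Lemma coef_le_Re P r (B : R) k : 0 <= r -> (0 < k)%N ->
    (forall n w, n.-primitive_root w -> (2 * size P <= n)%N ->
     \sum_(j < n) `|complex.Re P.[r%:C%C * w ^+ j]| <= n%:R * B) ->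
  modulus P`_k * r ^+ k <= 2 * B.
Proof.
move=> r0 k0 PB.
have [w wn] := primitive_root_2exp (2 * size P); set n := (2 ^ _)%N in wn.
have Pn : (2 * size P <= n)%N.
  by rewrite (leq_trans _ (ltnW (ltn_expl _ (isT : 1 < 2)%N))).
have n0 : (0 : R) < n%:R by rewrite ltr0n (prim_order_gt0 wn).
have {}PB := PB _ _ wn Pn.
have B0 : 0 <= B.
  by rewrite -(pmulr_rge0 _ n0) (le_trans _ PB)// sumr_ge0.
case: (ltnP k (size P)) => kP; last by rewrite nth_default// modulus0 mul0r mulr_ge0.
have := sum_root_coef r wn Pn (introT andP (conj k0 kP)).
move=> /(congr1 (@modulus R)); rewrite !modulusM modulus_nat modulusX modulus_real ger0_norm// => e.
rewrite -(ler_pM2l n0) -e (le_trans (ler_modulus_sum _ _ _))//.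
rewrite mulrCA (le_trans _ (ler_wpM2l _ PB))// mulr_sumr ler_sum// => j _.
rewrite modulusM modulusX (primitive_root_modulus wn) expr1n mul1r modulus_real.
by rewrite normrM ger0_norm.
Qed.

Lemma coef_le_Re_ge0 P r k : 0 <= r -> (0 < k)%N ->
    (forall z, modulus z <= r -> 0 <= complex.Re P.[z]) ->
  modulus P`_k * r ^+ k <= 2 * complex.Re P.[0].
Proof.
move=> r0 k0 P0; apply: coef_le_Re => // n w wn Pn.
rewrite (eq_bigr (fun j : 'I_n => complex.Re P.[r%:C%C * w ^+ j])) => [|j _].
  by rewrite (sum_root_coef0 _ wn)//; lia.
rewrite ger0_norm// P0// modulusM modulusX (primitive_root_modulus wn) expr1n.
by rewrite mulr1 modulus_real ger0_norm.
Qed.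

Lemma coef_le_Re_norm P r (B : R) k : 0 <= r -> (0 < k)%N ->
    (forall z, modulus z <= r -> `|complex.Re P.[z]| <= B) ->
  modulus P`_k * r ^+ k <= 2 * B.
Proof.
move=> r0 k0 PB; apply: coef_le_Re => // n w wn Pn.
rewrite -[n in n%:R]card_ord mulr_natl -sumr_const ler_sum// => j _.
rewrite PB// modulusM modulusX (primitive_root_modulus wn) expr1n.
by rewrite mulr1 modulus_real ger0_norm.
Qed.

Lemma modulus_hornerB0 P z :
  modulus (P.[z] - P.[0]) <= \sum_(k < (size P).-1) modulus P`_k.+1 * modulus z ^+ k.+1.
Proof.
have -> : P.[z] - P.[0] = \sum_(k < (size P).-1) P`_k.+1 * z ^+ k.+1.
  rewrite horner_coef0 horner_coef; case: (size P) (size_poly_eq0 P) => [|n] /=.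
    by rewrite eqxx => /esym/eqP->; rewrite !big_ord0 coef0 subrr.
  by move=> _; rewrite big_ord_recl expr0 mulr1 addrC addKr.
rewrite (le_trans (ler_modulus_sum _ _ _))// ler_sum// => k _.
by rewrite modulusM modulusX.
Qed.

(** The coefficient bounds [2 Re P(0) / r ^ k] are summed as a geometric series of ratio
    [|z| / r <= 1 / 2], which costs the second factor 2. *)
Lemma harnack_poly P r z : 0 < r ->
    (forall z, modulus z <= r -> 0 <= complex.Re P.[z]) -> modulus z <= r / 2 ->
  modulus (P.[z] - P.[0]) <= 4 * complex.Re P.[0] * (modulus z / r).
Proof.
move=> r0 P0 zr; rewrite (le_trans (modulus_hornerB0 _ _))//.
have a0 : 0 <= complex.Re P.[0] by rewrite P0// modulus0 ltW.
rewrite (_ : 4 * _ * _ = 2 * complex.Re P.[0] * (2 * (modulus z / r))); last by ring.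
have th : 0 <= modulus z / r <= 2^-1.
  apply/andP; split; first by rewrite divr_ge0 ?modulus_ge0// ltW.
  by rewrite ler_pdivrMr// mulrC.
rewrite (le_trans _ (ler_wpM2l _ (sum_geo_half (size P).-1 th))) ?mulr_ge0//.
rewrite mulr_sumr ler_sum// => k _.
have := coef_le_Re_ge0 (ltW r0) (ltn0Sn k) P0.
rewrite expr_div_n => h.
have rk : 0 < r ^+ k.+1 by rewrite exprn_gt0.
rewrite mulrA ler_pdivlMr// mulrAC ler_wpM2r//.
by rewrite exprn_ge0 ?modulus_ge0.
Qed.

(* The coefficients up to degree [K] are bounded on the small disc, the others on
   the large one, where they contribute [2 ^- K]. *)
Lemma propagation_poly P (r s B e : R) K z : 0 < r -> 0 < s <= 1 -> 0 <= e -> 0 <= B ->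
    (forall z, modulus z <= r -> `|complex.Re P.[z]| <= B) ->
    (forall z, modulus z <= s * r -> `|complex.Re P.[z]| <= e) ->
    modulus z <= r / 4 ->
  `|complex.Re P.[z]| <= e * (1 + s ^- K) + 2 * B / 2 ^+ K.
Proof.
move=> r0 /andP[s0 s1] e0 B0 PB Pe zr.
have z0 := modulus_ge0 z.
rewrite -(subrK P.[0] P.[z]) addrC ReD (le_trans (ler_normD _ _))// mulrDr mulr1 -addrA.
apply: lerD; first by rewrite Pe// modulus0 mulr_ge0// ltW.
rewrite (le_trans (ler_Re_modulus _))// (le_trans (modulus_hornerB0 _ _))//.
have q4 : modulus z / r <= 4^-1 by rewrite ler_pdivrMr// mulrC.
have q0 : 0 <= modulus z / r by rewrite divr_ge0// ltW.
have coefle k : modulus P`_k.+1 * modulus z ^+ k.+1 <= (e * s ^- K + 2 * B / 2 ^+ K) * 2^-1 ^+ k.+1.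
  have -> : modulus z ^+ k.+1 = r ^+ k.+1 * (modulus z / r) ^+ k.+1.
    by rewrite -exprMn mulrCA mulfV ?mulr1// gt_eqF.
  have qk : (modulus z / r) ^+ k.+1 <= 4^-1 ^+ k.+1 by rewrite lerXn2r// ?nnegrE ?invr_ge0.
  (* Half of the decay of [4 ^- k] makes the coefficient bound uniform in the degree; the other half
     makes the sum over the degrees converge. *)
  have h4 : (4^-1 : R) ^+ k.+1 = 2^-1 ^+ k.+1 * 2^-1 ^+ k.+1.
    by rewrite -exprMn; congr (_ ^+ _); lra.
  have hk0 : (0 : R) < 2^-1 ^+ k.+1 by rewrite exprn_gt0// invr_gt0.
  have hk1 : (2^-1 : R) ^+ k.+1 <= 2^-1.
    by rewrite exprS ler_piMr ?invr_ge0// exprn_ile1 ?invr_ge0// invf_le1 ?ler1n//.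
  have sK : 0 < s ^- K by rewrite invr_gt0 exprn_gt0.
  have K2 : 0 < (2 ^+ K)^-1 :> R by rewrite invr_gt0 exprn_gt0.
  rewrite mulrA; set a := modulus _ * _.
  have a0 : 0 <= a by rewrite mulr_ge0 ?modulus_ge0// exprn_ge0// ltW.
  have : a * (modulus z / r) ^+ k.+1 <= a * (2^-1 ^+ k.+1 * 2^-1 ^+ k.+1).
    by rewrite ler_wpM2l// -h4.
  move/le_trans; apply; rewrite mulrA ler_wpM2r ?(ltW hk0)//.
  case: (leqP k.+1 K) => kK.
    have : a * s ^+ k.+1 <= 2 * e.
      rewrite /a -mulrA -exprMn [r * s]mulrC.
      by apply: coef_le_Re_norm Pe => //; rewrite mulr_ge0// ltW.
    have sk : s ^+ K <= s ^+ k.+1 by rewrite ler_wiXn2l// ltW.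
    move=> as_; have : a * s ^+ K <= 2 * e by rewrite (le_trans _ as_)// ler_wpM2l.
    rewrite -ler_pdivlMr ?exprn_gt0// => aK.
    have : a * 2^-1 ^+ k.+1 <= 2 * e / s ^+ K * 2^-1.
      by rewrite ler_pM// ltW.
    move/le_trans; apply; rewrite -[leLHS]addr0 lerD//; first by lra.
    by rewrite !mulr_ge0// ltW.
  have aB : a <= 2 * B by apply: coef_le_Re_norm PB => //; exact: ltW.
  have kk : (2^-1 : R) ^+ k.+1 <= (2 ^+ K)^-1.
    by rewrite -exprVn ler_wiXn2l ?invr_ge0// ?invf_le1 ?ler1n// ltnW.
  have : a * 2^-1 ^+ k.+1 <= 2 * B / 2 ^+ K by rewrite ler_pM// ltW.
  move/le_trans; apply; rewrite lerDr mulr_ge0// ltW//.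
rewrite (le_trans (ler_sum _ (fun (k : 'I__) _ => coefle k)))// -mulr_sumr ler_piMr//.
  by rewrite addr_ge0// ?mulr_ge0// ?invr_ge0 ?exprn_ge0// ltW.
rewrite (le_trans (sum_geo_half _ _))//; first by rewrite invr_ge0 ler0n lexx.
by rewrite mulfV.
Qed.

End Fourier.

(** * Harnack inequalities *)

Section Harmonic.
Context {R : realType}.
Implicit Types (P : {poly R[i]}) (z w p a : R[i]) (r c e : R).

Lemma Re_sum (I : Type) (s : seq I) (Q : pred I) (F : I -> R[i]) :
  complex.Re (\sum_(i <- s | Q i) F i) = \sum_(i <- s | Q i) complex.Re (F i).
Proof. by elim/big_rec2 : _ => // i x y _; rewrite ReD => ->. Qed.

Lemma ln1w_derive w (N : nat) (t : R) : t * modulus w < 1 -> 0 <= t ->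
  is_derive t 1 (fun t : R => 2^-1 * ln (1 - 2 * complex.Re w * t + modulus w ^+ 2 * t ^+ 2)
    + \sum_(k < N) complex.Re (w ^+ k.+1) / k.+1%:R * t ^+ k.+1)
  (2^-1 * ((1 - 2 * complex.Re w * t + modulus w ^+ 2 * t ^+ 2)^-1
     * (- 2 * complex.Re w + 2 * modulus w ^+ 2 * t))
    + \sum_(k < N) complex.Re (w ^+ k.+1) * t ^+ k).
Proof.
move=> tw t0.
set q := fun t : R => 1 - 2 * complex.Re w * t + modulus w ^+ 2 * t ^+ 2.
have qt : 0 < q t.
  have := ler_Re_modulus w; rewrite ler_norml => /andP[_ h].
  rewrite /q; have : t * complex.Re w <= t * modulus w by rewrite ler_wpM2l.
  have : 0 < (1 - t * modulus w) ^+ 2 by rewrite exprn_gt0// subr_gt0.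
  nra.
have dq : is_derive t 1 q (- 2 * complex.Re w + 2 * modulus w ^+ 2 * t).
  rewrite /q; apply: is_derive_eq.
  by rewrite /GRing.scale/=; ring.
have dl := is_derive1_comp (is_derive1_ln qt) dq.
have dS k : is_derive t 1 (fun t : R => complex.Re (w ^+ k.+1) / k.+1%:R * t ^+ k.+1)
    (complex.Re (w ^+ k.+1) * t ^+ k).
  have -> : (fun t : R => complex.Re (w ^+ k.+1) / k.+1%:R * t ^+ k.+1) =
      (complex.Re (w ^+ k.+1) / k.+1%:R) *: ((@idfun R) ^+ k.+1).
    by apply/funext => x; rewrite /= exprfctE.
  apply: (is_derive_eq (is_deriveZ _ (is_deriveX k.+1 (is_derive_id t 1)))).
  by rewrite /GRing.scale/= mulr1 -mulrA mulKf// pnatr_eq0.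
have -> : (fun t => 2^-1 * ln (q t) +
    \sum_(k < N) complex.Re (w ^+ k.+1) / k.+1%:R * t ^+ k.+1) =
   (2^-1 *: (@ln R \o q)) + \sum_(k < N) (fun t : R => complex.Re (w ^+ k.+1) / k.+1%:R * t ^+ k.+1).
  by apply/funext => x; rewrite /= fctE fct_sumE.
exact: (is_deriveD (is_deriveZ 2^-1 dl) (is_derive_sum (fun k : 'I_N => dS k))).
Qed.

Lemma modulus_1Bw w (t : R) :
  modulus (1 - t%:C%C * w) ^+ 2 = 1 - 2 * complex.Re w * t + modulus w ^+ 2 * t ^+ 2.
Proof. by rewrite !sqr_modulus; case: w => a b /=; ring. Qed.

(** No complex logarithm occurs: along the segment from 0 to w the mean value theorem applies to a
    real function, whose derivative is the real part of the remainder [- w (c w) ^ N / (1 - c w)] of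
    a geometric series. *)
Lemma ln_modulus_1B w (q : R) (N : nat) : modulus w <= q -> q < 1 ->
  `|ln (modulus (1 - w)) + complex.Re (\sum_(k < N) w ^+ k.+1 / k.+1%:R)|
    <= q ^+ N / (1 - q).
Proof.
move=> wq q1; have w0 := modulus_ge0 w; have q0 := le_trans w0 wq.
pose f (t : R) := 2^-1 * ln (1 - 2 * complex.Re w * t + modulus w ^+ 2 * t ^+ 2)
    + \sum_(k < N) complex.Re (w ^+ k.+1) / k.+1%:R * t ^+ k.+1.
pose df (t : R) := 2^-1 * ((1 - 2 * complex.Re w * t + modulus w ^+ 2 * t ^+ 2)^-1
     * (- 2 * complex.Re w + 2 * modulus w ^+ 2 * t))
    + \sum_(k < N) complex.Re (w ^+ k.+1) * t ^+ k.
have tw (t : R) : 0 <= t <= 1 -> t * modulus w < 1.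
  move=> /andP[t0 t1]; rewrite (le_lt_trans _ q1)// (le_trans _ wq)//.
  by rewrite ler_piMl.
have dfE (t : R) : 0 <= t <= 1 -> is_derive t 1 f (df t).
  by move=> /[dup] /tw twl /andP[t0 _]; exact: ln1w_derive.
have f1 : f 1 = ln (modulus (1 - w)) + complex.Re (\sum_(k < N) w ^+ k.+1 / k.+1%:R).
  rewrite /f -modulus_1Bw mul1r lnXn; last first.
    by rewrite modulus_gt0 subr_eq0; apply/eqP => w1; move: (tw 1);
      rewrite lexx ler01 -w1 mul1r modulus1 ltxx => /(_ isT).
  rewrite -[ln _ *+ 2]mulr_natl mulKf ?pnatr_eq0//; congr (_ + _).
  rewrite Re_sum; apply: eq_bigr => k _.
  rewrite expr1n mulr1 mulrC -ReZ fmorphV rmorph_nat.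
  by rewrite mulrC.
have f0 : f 0 = 0.
  rewrite /f mulr0 expr0n mulr0 subr0 addr0 ln1 mulr0 add0r.
  by rewrite big1// => k _; rewrite expr0n mulr0.
have [||c c01 fc] := @MVT R f df 0 1 ltr01.
- by move=> x; rewrite in_itv/= => /andP[/ltW x0 /ltW x1]; apply: dfE; rewrite x0.
- apply: derivable_within_continuous => x; rewrite in_itv/= => x01.
  by have [] := dfE x x01.
move: fc; rewrite f0 !subr0 mulr1 f1 => ->.
have {c01} c01 : 0 <= c <= 1 by move: c01; rewrite in_itv/= => /andP[/ltW-> /ltW->].
have cw := tw _ c01; have /andP[c0 c1] := c01.
have cqn : 1 - q <= modulus (1 - c%:C%C * w).
  have := lerB_modulus 1 (c%:C%C * w).
  rewrite modulus1 modulusM modulus_real ger0_norm//; apply: le_trans.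
  by rewrite lerB// (le_trans _ wq)// ler_piMl.
have n0 : 1 - c%:C%C * w != 0.
  by rewrite -modulus_gt0 (lt_le_trans _ cqn)// subr_gt0.
have -> : df c = complex.Re (- w * (c%:C%C * w) ^+ N / (1 - c%:C%C * w)).
  have -> : - w * (c%:C%C * w) ^+ N / (1 - c%:C%C * w) =
     - w / (1 - c%:C%C * w) + \sum_(k < N) w ^+ k.+1 * (c%:C%C) ^+ k.
    rewrite (eq_bigr (fun k : 'I_N => w * (c%:C%C * w) ^+ k)); last first.
      by move=> k _; rewrite exprMn exprS; ring.
    rewrite -mulr_sumr; have := subrX1 (c%:C%C * w) N; set S := \sum_(_ < _) _.
    move=> h; have -> : (c%:C%C * w) ^+ N = 1 + (c%:C%C * w - 1) * S by rewrite -h; ring.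
    by field.
  rewrite ReD /df; congr (_ + _).
    rewrite -modulus_1Bw.
    have -> : - w / (1 - c%:C%C * w) =
       ((modulus (1 - c%:C%C * w) ^+ 2)^-1)%:C%C * (- w * (1 - c%:C%C * w)^*%C).
      rewrite fmorphV rmorphXn/= -normCE sqr_normc invfM -mulrA.
      by rewrite [(_^*%C)^-1 * _]mulrCA mulVf ?conjc_eq0// mulr1 mulrC.
    rewrite ReZ mulrCA; congr (_ * _).
    have -> : (1 - c%:C%C * w)^*%C = 1 - c%:C%C * w^*%C.
      by case: (w) => ? ?; apply/eqP; rewrite eq_complex/=; apply/andP; split; apply/eqP; ring.
    by rewrite sqr_modulus; case: (w) => ? ? /=; lra.
  elim/big_ind2 : _ => // [x x' y y' -> ->|k _]; first by rewrite ReD.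
  by rewrite mulrC -ReZ rmorphXn mulrC.
rewrite (le_trans (ler_Re_modulus _))// !modulusM modulusN modulusV modulusX.
rewrite modulusM modulus_real (ger0_norm c0).
apply: ler_pM; rewrite ?invr_ge0 ?mulr_ge0 ?modulus_ge0 ?exprn_ge0//.
- by rewrite mulr_ge0.
- rewrite -[leRHS]mul1r ler_pM ?exprn_ge0 ?mulr_ge0//; first by rewrite (le_trans wq) ?ltW.
  by rewrite lerXn2r ?nnegrE ?mulr_ge0// (le_trans _ wq)// ler_piMl.
- by rewrite lef_pV2// posrE ?subr_gt0// modulus_gt0.
Qed.

(* The only facts needed about harmonic functions are Harnack's inequality and
   [propagation]; both pass to uniform limits of real parts of polynomials. *)
Definition harmonic_on p r (u : R[i] -> R) : Prop := forall e, 0 < e ->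
  exists P, forall z, modulus z <= r -> `|u (p + z) - complex.Re P.[z]| <= e.

Lemma harmonic_on_ext p r u v : (forall z, modulus (z - p) <= r -> u z = v z) ->
  harmonic_on p r u -> harmonic_on p r v.
Proof.
move=> uv hu e /hu[P hP]; exists P => z zr; rewrite -uv ?hP//.
by rewrite [p + z]addrC addrK.
Qed.

Lemma harmonic_on_le p r r' u : r' <= r -> harmonic_on p r u -> harmonic_on p r' u.
Proof. by move=> rr hu e /hu[P hP]; exists P => z zr; rewrite hP// (le_trans zr). Qed.

Lemma harmonic_on_cst p r c : harmonic_on p r (fun=> c).
Proof.
move=> e e0; exists (c%:C%C)%:P => z _; rewrite hornerC/= subrr normr0 ltW//.
Qed.

Lemma harmonic_onD p r u v : harmonic_on p r u -> harmonic_on p r v ->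
  harmonic_on p r (fun z => u z + v z).
Proof.
move=> hu hv e e0; have e2 : 0 < e / 2 by rewrite divr_gt0.
have [P hP] := hu _ e2; have [Q hQ] := hv _ e2; exists (P + Q) => z zr.
rewrite hornerD ReD opprD.
have -> : u (p + z) + v (p + z) + (- complex.Re P.[z] - complex.Re Q.[z]) =
  (u (p + z) - complex.Re P.[z]) + (v (p + z) - complex.Re Q.[z]) by ring.
by rewrite (le_trans (ler_normD _ _))// [e]splitr lerD ?hP ?hQ.
Qed.

Lemma harmonic_onZ p r c u : harmonic_on p r u -> harmonic_on p r (fun z => c * u z).
Proof.
move=> hu e e0; have c0 : 0 < `|c| + 1 by rewrite ltr_wpDl.
have [|P hP] := hu (e / (`|c| + 1)); first by rewrite divr_gt0.
exists (c%:C%C *: P) => z zr; rewrite hornerZ ReZ -mulrBr normrM.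
have := hP _ zr; rewrite ler_pdivlMr// mulrC; apply: le_trans.
by rewrite ler_wpM2r// lerDl.
Qed.

Lemma harmonic_onN p r u : harmonic_on p r u -> harmonic_on p r (fun z => - u z).
Proof.
by move=> /(harmonic_onZ (-1)); apply: harmonic_on_ext => z _; rewrite mulN1r.
Qed.

Lemma harmonic_onB p r u v : harmonic_on p r u -> harmonic_on p r v ->
  harmonic_on p r (fun z => u z - v z).
Proof. by move=> hu /harmonic_onN; exact: harmonic_onD. Qed.

(** Around p the function is [ln |p - a| + ln |1 + z / (p - a)|], and the ratio
    [q = r / |p - a| < 1] makes the logarithmic series converge uniformly on the disc. *)
Lemma harmonic_ln_linear p r a : 0 <= r -> r < modulus (p - a) ->
  harmonic_on p r (fun z => ln (modulus (z - a))).
Proof.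
move=> r0 ra e e0; have pa0 : 0 < modulus (p - a) by exact: le_lt_trans ra.
have pan : p - a != 0 by rewrite -modulus_gt0.
set q := r / modulus (p - a).
have q0 : 0 <= q by rewrite divr_ge0// ltW.
have q1 : q < 1 by rewrite ltr_pdivrMr// mul1r.
have [N hN] : exists N, q ^+ N / (1 - q) <= e.
  have /cvgrPdist_lt/(_ (e * (1 - q))) : GRing.exp q @ \oo --> (0 : R).
    by apply: cvg_expr; rewrite ger0_norm.
  rewrite mulr_gt0// ?subr_gt0// => /(_ isT)[N _ /(_ N)]/=.
  rewrite leqnn => /(_ isT); rewrite sub0r normrN ger0_norm ?exprn_ge0// => h.
  by exists N; rewrite ler_pdivrMr ?subr_gt0// ltW.
exists ((ln (modulus (p - a)))%:C%C%:P -
  \sum_(k < N) ((- (p - a)^-1) *: 'X) ^+ k.+1 * ((k.+1%:R)^-1)%:P) => z zr.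
have wq : modulus (- (p - a)^-1 * z) <= q.
  by rewrite modulusM modulusN modulusV mulrC ler_wpM2r// invr_ge0 ltW.
have := ln_modulus_1B N wq q1; move=> /le_trans/(_ hN).
rewrite hornerD hornerN hornerC horner_sum ReB/=.
under [X in _ - (_ - complex.Re X)]eq_bigr do
  rewrite hornerM hornerC horner_exp hornerZ hornerX.
rewrite opprB addrCA addrC.
have -> : p + z - a = (p - a) * (1 - (- (p - a)^-1 * z)) by field.
rewrite modulusM lnM ?posrE//; last first.
  rewrite modulus_gt0 subr_eq0; apply/eqP => w1.
  by move: wq; rewrite -w1 modulus1 leNgt q1.
by rewrite (addrC (ln (modulus (p - a)))) addrK.
Qed.

Lemma harmonic_ln_poly p r (A : {poly R[i]}) : 0 <= r ->
    (forall z, modulus (z - p) <= r -> A.[z] != 0) ->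
  harmonic_on p r (fun z => ln (modulus A.[z])).
Proof.
move=> r0 A0; have An0 : A != 0.
  by apply/eqP => A_0; have := A0 p; rewrite A_0 subrr modulus0 horner0 eqxx => /(_ r0).
have [s As] := closed_field_poly_normal A.
have sr x : x \in s -> r < modulus (p - x).
  move=> xs; rewrite modulusBC ltNge; apply/negP => /A0; rewrite As hornerZ.
  by rewrite (_ : _.[x] = 0) ?mulr0 ?eqxx//; apply/eqP; rewrite -/(root _ x) root_prod_XsubC.
rewrite As; elim: s {As} sr => [|x s IH] sr.
  apply: harmonic_on_ext (harmonic_on_cst p r (ln (modulus (lead_coef A)))) => z _.
  by rewrite big_nil hornerZ hornerC mulr1.
have sr' y : y \in s -> r < modulus (p - y) by move=> ys; rewrite sr// inE ys orbT.
have nz y z : y \in x :: s -> modulus (z - p) <= r -> 0 < modulus (z - y).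
  move=> /sr ry zp; rewrite modulus_gt0 subr_eq0; apply: contraTneq ry => <-.
  by rewrite -leNgt modulusBC.
apply: harmonic_on_ext (harmonic_onD (IH sr') (harmonic_ln_linear r0 (sr x (mem_head _ _)))) => z zp.
rewrite big_cons !hornerZ hornerM hornerXsubC mulrCA (modulusM (z - x)).
rewrite [in RHS]lnM ?posrE ?(nz x) ?mem_head// 1?addrC//.
rewrite modulus_gt0 mulf_eq0 negb_or lead_coef_eq0 An0/= horner_prod prodf_seq_neq0.
apply/allP => y ys /=; rewrite hornerXsubC -modulus_gt0.
by rewrite (nz y)// inE ys orbT.
Qed.

Lemma harnack p r u z : 0 < r -> harmonic_on p r u ->
    (forall z, modulus (z - p) <= r -> 0 <= u z) -> modulus (z - p) <= r / 2 ->
  `|u z - u p| <= 4 * u p * (modulus (z - p) / r).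
Proof.
move=> r0 hu u0 zr; apply/ler_addgt0Pl => e e0.
have d0 : 0 < e / 10 by rewrite divr_gt0.
have [P hP] := hu _ d0.
(* The approximation error may make [Re P] slightly negative; adding it back makes [Re Q]
   nonnegative, as [harnack_poly] requires. *)
pose Q := P + ((e / 10)%:C%C)%:P.
have ReQ y : complex.Re Q.[y] = complex.Re P.[y] + e / 10.
  by rewrite hornerD hornerC ReD.
have uQ y : modulus (y - p) <= r -> complex.Re Q.[y - p] - e / 5 <= u y <= complex.Re Q.[y - p].
  move=> /hP; rewrite [p + _]addrC subrK ler_norml ReQ => /andP[h1 h2].
  by apply/andP; split; lra.
have Q0 y : modulus y <= r -> 0 <= complex.Re Q.[y].
  move=> yr; have pyr : modulus (p + y - p) <= r by rewrite [p + y]addrC addrK.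
  have /andP[_] := uQ _ pyr; rewrite [p + y]addrC addrK; apply: le_trans.
  by rewrite u0// addrK.
have zr' : modulus (z - p) <= r by lra.
have pr : modulus (p - p) <= r by rewrite subrr modulus0 ltW.
have := harnack_poly r0 Q0 zr.
move=> /(le_trans (ler_Re_modulus _)); rewrite ReB.
have := uQ _ zr'; have := uQ _ pr; rewrite subrr => /andP[h1 h2] /andP[h3 h4].
have := u0 _ pr; set th := modulus (z - p) / r => up0.
have th0 : 0 <= th by rewrite divr_ge0 ?modulus_ge0// ltW.
have th1 : th <= 2^-1 by rewrite ler_pdivrMr// mulrC.
move: (complex.Re Q.[0]) (complex.Re Q.[z - p]) h1 h2 h3 h4 => q0 qz h1 h2 h3 h4.
have : 4 * q0 * th <= 4 * u p * th + 2 * e / 5.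
  have : (q0 - u p) * th <= e / 5 * 2^-1 by apply: ler_pM; lra.
  by lra.
by rewrite !ler_norml => hh /andP[h5 h6]; apply/andP; split; lra.
Qed.

Lemma propagation p (r s : R) (u : R[i] -> R) (e B : R) K z : 0 < r -> 0 < s <= 1 -> 0 <= e -> 0 <= B ->
    harmonic_on p r u ->
    (forall z, modulus (z - p) <= r -> `|u z| <= B) ->
    (forall z, modulus (z - p) <= s * r -> `|u z| <= e) ->
    modulus (z - p) <= r / 4 ->
  `|u z| <= e * (1 + s ^- K) + 2 * B / 2 ^+ K.
Proof.
move=> r0 /[dup] s01 /andP[s0 s1] e0 B0 hu uB ue zr; apply/ler_addgt0Pl => h h0.
have sK : 0 < s ^- K by rewrite invr_gt0 exprn_gt0.
have K2 : 0 < (2 ^+ K)^-1 :> R by rewrite invr_gt0 exprn_gt0.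
have K1 : (2 ^+ K)^-1 <= 1 :> R by rewrite -exprVn exprn_ile1 ?invr_ge0// invf_le1 ?ler1n.
have c0 : 0 < 4 + s ^- K by rewrite addr_gt0.
pose d := h / (4 + s ^- K); have d0 : 0 < d by rewrite divr_gt0.
have dh : d * (4 + s ^- K) = h by rewrite mulfVK// gt_eqF.
have [P hP] := hu _ d0.
have up (y : R[i]) : p + y - p = y by rewrite addrC addKr.
have near (C : R) y : `|u (p + y)| <= C -> `|u (p + y) - complex.Re P.[y]| <= d -> `|complex.Re P.[y]| <= C + d.
  by rewrite !ler_norml => /andP[h1 h2] /andP[h3 h4]; apply/andP; split; lra.
have PB y : modulus y <= r -> `|complex.Re P.[y]| <= B + d.
  by move=> yr; rewrite near ?hP// uB// up.
have Pe y : modulus y <= s * r -> `|complex.Re P.[y]| <= e + d.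
  move=> yr; rewrite near ?hP ?ue ?up//.
  by rewrite (le_trans yr)// ler_piMl// ltW.
have Bd : 0 <= B + d by rewrite addr_ge0// ltW.
have ed : 0 <= e + d by rewrite addr_ge0// ltW.
have := propagation_poly K r0 s01 ed Bd PB Pe zr.
have zr' : modulus (z - p) <= r by have := modulus_ge0 (z - p); lra.
have := hP _ zr'; rewrite [p + _]addrC subrK.
have : 2 * d / 2 ^+ K <= 2 * d by rewrite ler_piMr// mulr_ge0// ltW.
rewrite !ler_norml => h1 /andP[h3 h4] /andP[h5 h6].
have E : (e + d) * (1 + s ^- K) + 2 * (B + d) / 2 ^+ K =
  e * (1 + s ^- K) + 2 * B / 2 ^+ K + d + d * s ^- K + 2 * d / 2 ^+ K by ring.
rewrite E in h5 h6; clear E; have : d * 4 + d * s ^- K = h by rewrite -mulrDr.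
by move=> ?; apply/andP; split; lra.
Qed.

End Harmonic.

(** * Lipschitz, Hurwitz and covering estimates from Harnack's inequality *)

Section HarmonicApplications.
Context {R : realType}.
Implicit Types (A B : {poly R[i]}) (z w p x : R[i]) (r M : R).

Lemma poly_bounded A p r : exists2 C : R, 0 < C &
  forall z, modulus (z - p) <= r -> modulus A.[z] <= C.
Proof.
exists (1 + \sum_(i < size A) modulus A`_i * (`|r| + modulus p) ^+ i).
  by rewrite ltr_pwDl// sumr_ge0// => i _; rewrite mulr_ge0 ?modulus_ge0 ?exprn_ge0 ?addr_ge0 ?modulus_ge0.
move=> z zr; rewrite horner_coef (le_trans (ler_modulus_sum _ _ _))// ler_wpDl// ler_sum// => i _.
rewrite modulusM modulusX ler_wpM2l ?modulus_ge0// lerXn2r ?nnegrE ?modulus_ge0 ?addr_ge0 ?modulus_ge0//.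
have := ler_norm r; have := lerB_modulus z p; lra.
Qed.

Lemma harmonic_ln_frac p r A B : 0 <= r ->
    (forall z, modulus (z - p) <= r -> A.[z] != 0) ->
    (forall z, modulus (z - p) <= r -> B.[z] != 0) ->
  harmonic_on p r (fun z => ln (modulus (A.[z] / B.[z]))).
Proof.
move=> r0 A0 B0.
apply: harmonic_on_ext (harmonic_onB (harmonic_ln_poly r0 A0) (harmonic_ln_poly r0 B0)) => z zr.
by rewrite modulusM modulusV ln_div// posrE modulus_gt0 ?A0 ?B0.
Qed.

Lemma ln_diff (X Y c : R) : 0 < X -> 0 < Y -> `|ln X - ln Y| <= c ->
  `|X - Y| <= c * Num.max X Y.
Proof.
wlog XY : X Y / Y <= X => [hw X0 Y0|].
  have /orP[YX|XY] := le_total Y X; first by move=> h; apply: (hw X Y).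
  by rewrite distrC => /(hw _ _ XY Y0 X0); rewrite distrC maxC.
move=> X0 Y0; rewrite (max_l XY) [`|X - Y|]ger0_norm ?subr_ge0// => h.
have {}h := le_trans (ler_norm _) h.
have : ln (Y / X) <= Y / X - 1.
  have := le_ln1Dx (x := Y / X - 1); rewrite addrCA subrr addr0; apply.
  by rewrite ltrBDr addNr divr_gt0.
rewrite ln_div ?posrE//.
rewrite -(ler_pM2r X0) [leRHS]mulrBl mul1r mulfVK ?gt_eqF// => h1.
have := ler_wpM2r (ltW X0) h; nra.
Qed.

Lemma harnack8 p r (u : R[i] -> R) z : 0 < r -> harmonic_on p r u ->
    (forall z, modulus (z - p) <= r -> 0 <= u z) -> modulus (z - p) <= r / 8 ->
  u p / 2 <= u z <= 3 / 2 * u p.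
Proof.
move=> r0 hu u0 zr.
have pr : modulus (p - p) <= r by rewrite subrr modulus0 ltW.
have zr2 : modulus (z - p) <= r / 2 by lra.
have := harnack r0 hu u0 zr2.
have th : modulus (z - p) / r <= 8^-1 by rewrite ler_pdivrMr// mulrC.
have : 4 * u p * (modulus (z - p) / r) <= 4 * u p * 8^-1.
  by rewrite ler_wpM2l// mulr_ge0 ?u0.
by rewrite ler_norml => h /andP[h1 h2]; apply/andP; split; lra.
Qed.

(** A Schwarz type estimate from Harnack alone. For a unit number c the function [F + 2 M c] has
    modulus between M and 3 M, so [ln |F + 2 M c| - ln M] is harmonic and nonnegative. Opposite
    values of c recover the real part by [|y + 2 M|^2 - |y - 2 M|^2 = 8 M Re y], and the imaginary
    part in the same way. *)
Lemma frac_lipschitz p r A B M z : 0 < r -> 0 < M ->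
    (forall z, modulus (z - p) <= r -> B.[z] != 0) ->
    (forall z, modulus (z - p) <= r -> modulus (A.[z] / B.[z]) <= M) ->
    modulus (z - p) <= r / 2 ->
  modulus (A.[z] / B.[z] - A.[p] / B.[p]) <= 72 * M * (modulus (z - p) / r).
Proof.
move=> r0 M0 B0 FM zr; pose F y := A.[y] / B.[y]; rewrite -!/(F _).
have th0 : 0 <= modulus (z - p) / r by rewrite divr_ge0 ?modulus_ge0 ?ltW.
set th := modulus (z - p) / r in th0 *.
have zr' : modulus (z - p) <= r by have := modulus_ge0 (z - p); lra.
have pr : modulus (p - p) <= r by rewrite subrr modulus0 ltW.
have step c : modulus c = 1 ->
    `|modulus (F z + (2 * M)%:C%C * c) ^+ 2 - modulus (F p + (2 * M)%:C%C * c) ^+ 2| <= 144 * M ^+ 2 * th.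
  move=> c1; pose cM := (2 * M)%:C%C * c.
  have mc : modulus cM = 2 * M by rewrite modulusM c1 mulr1 modulus_real ger0_norm// mulr_ge0 ?ltW.
  have Fc y : modulus (y - p) <= r -> M <= modulus (F y + cM) <= 3 * M.
    move=> /FM; rewrite -/(F y) => Fy; apply/andP; split.
      by have := lerB_modulusD cM (F y); rewrite mc [cM + _]addrC; lra.
    by have := ler_modulusD (F y) cM; rewrite mc; lra.
  pose u y := ln (modulus (F y + cM)) - ln M.
  have hu : harmonic_on p r u.
    apply: harmonic_onB (harmonic_on_cst _ _ _).
    have := @harmonic_ln_frac p r (A + cM *: B) B (ltW r0).
    have E y : modulus (y - p) <= r -> (A + cM *: B).[y] / B.[y] = F y + cM.
      by move=> /B0 By; rewrite hornerD hornerZ mulrDl mulfK.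
    move=> h; apply: harmonic_on_ext (h _ B0) => y yr; first by rewrite E.
    apply/eqP => y0; have := E _ yr; rewrite y0 mul0r => e.
    by have := Fc _ yr; rewrite -e modulus0 leNgt M0.
  have u0 y : modulus (y - p) <= r -> 0 <= u y.
    move=> /Fc/andP[h _]; rewrite subr_ge0 ler_ln ?posrE//.
    exact: lt_le_trans h.
  have up : u p <= 2.
    have /andP[h1 h2] := Fc _ pr.
    rewrite /u -ln_div ?posrE//; last exact: lt_le_trans h1.
    have h3 : modulus (F p + cM) / M <= 3 by rewrite ler_pdivrMr.
    have := le_ln1Dx (x := modulus (F p + cM) / M - 1).
    rewrite addrCA subrr addr0 => /(_ _)/le_trans; apply; last by lra.
    by rewrite ltrBDr addNr divr_gt0// (lt_le_trans M0).
  have := harnack r0 hu u0 zr; rewrite -/th => h.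
  have /andP[z1 z2] := Fc _ zr'; have /andP[p1 p2] := Fc _ pr.
  have {}h : `|ln (modulus (F z + cM)) - ln (modulus (F p + cM))| <= 8 * th.
    have -> : ln (modulus (F z + cM)) - ln (modulus (F p + cM)) = u z - u p.
      by rewrite /u; ring.
    by rewrite (le_trans h)// ler_wpM2r//; lra.
  have := ln_diff (lt_le_trans M0 z1) (lt_le_trans M0 p1) h.
  rewrite -/cM; move: z1 z2 p1 p2; set X := modulus _; set Y := modulus _ => z1 z2 p1 p2 h1.
  have h2 : `|X - Y| <= 24 * M * th.
    rewrite (le_trans h1)//.
    have : Num.max X Y <= 3 * M by rewrite ge_max z2.
    move=> /(ler_wpM2l (mulr_ge0 (ler0n R 8) th0)); lra.
  rewrite subr_sqr normrM (_ : 144 * M ^+ 2 * th = (24 * M * th) * (6 * M)); last by ring.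
  apply: ler_pM => //; rewrite ger0_norm ?addr_ge0 ?modulus_ge0//; lra.
have id2 (y : R[i]) : modulus (y + (2 * M)%:C%C * 1) ^+ 2 - modulus (y + (2 * M)%:C%C * -1) ^+ 2 = 8 * M * complex.Re y.
  by rewrite !sqr_modulus; case: y => a b /=; ring.
have id3 (y : R[i]) : modulus (y + (2 * M)%:C%C * 'i%C) ^+ 2 - modulus (y + (2 * M)%:C%C * - 'i%C) ^+ 2 = 8 * M * complex.Im y.
  by rewrite !sqr_modulus; case: y => a b /=; ring.
have i1 : modulus ('i%C : R[i]) = 1 by rewrite modulusE /= expr0n expr1n add0r sqrtr1.
have M8 : 0 < 8 * M by rewrite mulr_gt0.
have half (a b c d : R) : `|a - b| <= 144 * M ^+ 2 * th -> `|c - d| <= 144 * M ^+ 2 * th ->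
    forall x y : R, a - c = 8 * M * x -> b - d = 8 * M * y -> `|x - y| <= 36 * M * th.
  move=> h1 h2 X Y hx hy; rewrite -(ler_pM2l M8) -{1}(ger0_norm (ltW M8)) -normrM mulrBr -hx -hy.
  have -> : a - c - (b - d) = (a - b) - (c - d) by ring.
  rewrite (le_trans (ler_normB _ _))//; apply: (le_trans (lerD h1 h2)).
  by rewrite le_eqVlt; apply/orP; left; apply/eqP; ring.
have hRe := half _ _ _ _ (step 1 (@modulus1 R)) (step (-1) (etrans (modulusN 1) (@modulus1 R)))
   _ _ (id2 _) (id2 _).
have hIm := half _ _ _ _ (step _ i1) (step (- 'i%C) (etrans (modulusN _) i1))
   _ _ (id3 _) (id3 _).
have := ler_modulus_ReIm (F z - F p).
have -> : complex.Re (F z - F p) = complex.Re (F z) - complex.Re (F p) by case: (F z) (F p) => ? ? [].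
have -> : complex.Im (F z - F p) = complex.Im (F z) - complex.Im (F p) by case: (F z) (F p) => ? ? [].
by move=> h; lra.
Qed.

(** Hurwitz's theorem in quantitative form: Harnack for [ln M - ln |A / B|] shows that a
    nonvanishing fraction bounded by M cannot be much smaller near p than at p. *)
Lemma frac_hurwitz p r A B M z : 0 < r -> 0 < M ->
    (forall z, modulus (z - p) <= r -> A.[z] != 0) ->
    (forall z, modulus (z - p) <= r -> B.[z] != 0) ->
    (forall z, modulus (z - p) <= r -> modulus (A.[z] / B.[z]) <= M) ->
    modulus (z - p) <= r / 8 ->
  (ln M - ln (modulus (A.[p] / B.[p]))) / 2 <= ln M - ln (modulus (A.[z] / B.[z]))
    <= 3 / 2 * (ln M - ln (modulus (A.[p] / B.[p]))).
Proof.
move=> r0 M0 A0 B0 FM zr.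
apply: (@harnack8 p r (fun z => ln M - ln (modulus (A.[z] / B.[z])))) => //.
  exact: harmonic_onB (harmonic_on_cst _ _ _) (harmonic_ln_frac (ltW r0) A0 B0).
move=> y yr; rewrite subr_ge0 ler_ln ?posrE ?FM//.
by rewrite modulus_gt0 mulf_eq0 invr_eq0 negb_or A0 ?B0.
Qed.

(* An omitted [w] close to [x] would make [ln |F - w|] vary too fast for
   Harnack's inequality. *)
Lemma frac_cover p r A B x (d1 d2 : R) z w : 0 < r -> 0 < d2 <= d1 ->
    (forall z, modulus (z - p) <= r -> B.[z] != 0) ->
    (forall z, modulus (z - p) <= r -> modulus (A.[z] / B.[z] - x) <= d1) ->
    A.[p] / B.[p] = x -> modulus (z - p) <= r / 8 -> d2 <= modulus (A.[z] / B.[z] - x) ->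
    modulus (w - x) < d2 ^+ 2 / (16 * d1) ->
  exists2 y, modulus (y - p) <= r & A.[y] / B.[y] = w.
Proof.
move=> r0 /andP[d20 d21] B0 Fx Fp zr zx wx.
have d10 := lt_le_trans d20 d21.
have wx2 : modulus (w - x) <= d2 / 2.
  rewrite (le_trans (ltW wx))// ler_pdivrMr ?mulr_gt0// expr2 mulrAC -mulrA ler_pM2l//; lra.
have [->|wx0] := eqVneq w x; first by exists p; rewrite // subrr modulus0 ltW.
apply: contrapT => nex.
have pr : modulus (p - p) <= r by rewrite subrr modulus0 ltW.
have E y : modulus (y - p) <= r -> (A - w *: B).[y] / B.[y] = A.[y] / B.[y] - w.
  by move=> yr; rewrite hornerD hornerN hornerZ mulrBl mulfK ?B0.
have Aw y : modulus (y - p) <= r -> (A - w *: B).[y] != 0.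
  move=> yr; apply/eqP => y0; apply: nex; exists y => //.
  by apply/eqP; rewrite -subr_eq0 -E// y0 mul0r.
have bnd y : modulus (y - p) <= r -> modulus ((A - w *: B).[y] / B.[y]) <= 2 * d1.
  move=> yr; rewrite E// (le_trans (modulus_triangle x _ _))// [modulus (x - w)]modulusBC.
  by have := Fx _ yr; lra.
have d12 : 0 < 2 * d1 by rewrite mulr_gt0.
have /andP[h _] := frac_hurwitz r0 d12 Aw B0 bnd zr.
have zr' : modulus (z - p) <= r by have := modulus_ge0 (z - p); lra.
rewrite !E// Fp in h.
have h1 : d2 / 2 <= modulus (A.[z] / B.[z] - w).
  by have := modulus_triangle w (A.[z] / B.[z]) x; lra.
have h2 : ln (d2 / 2) <= ln (modulus (A.[z] / B.[z] - w)).
  by rewrite ler_ln ?posrE// ?divr_gt0// (lt_le_trans _ h1)// divr_gt0.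
have h3 : ln (modulus (x - w)) < ln (d2 ^+ 2 / (16 * d1)).
  by rewrite ltr_ln ?posrE 1?modulusBC ?modulus_gt0 ?subr_eq0// divr_gt0 ?exprn_gt0 ?mulr_gt0.
(* [|F - w|] is at most [2 d1] on the disc and at least [d2 / 2] at z, so Harnack gives [|x - w| >=
   (d2 / 2)^2 / (2 d1) = d2^2 / (8 d1)]. The 16 of the hypothesis leaves a factor 2. *)
have h4 : ln (d2 ^+ 2 / (16 * d1)) = 2 * ln (d2 / 2) - 2 * ln (2 * d1) + ln (2 * d1) - ln 2.
  have d22 : 0 < d2 / 2 by rewrite divr_gt0.
  have -> : d2 ^+ 2 / (16 * d1) = (d2 / 2) ^+ 2 / ((2 * d1) * 2) by field; rewrite gt_eqF.
  move: d22; set a := d2 / 2 => a0.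
  rewrite ln_div ?posrE ?exprn_gt0 ?mulr_gt0// lnXn// [ln (2 * d1 * 2)]lnM ?posrE//.
  by rewrite -[ln a *+ 2]mulr_natl; ring.
have l2 : 0 < ln (2 : R) by rewrite ln_gt0// ltr1n.
lra.
Qed.

Lemma exp2_small (c e : R) : 0 < e -> exists K, forall n, (K <= n)%N -> c / 2 ^+ n <= e.
Proof.
move=> e0; have c0 : 0 < `|c| + 1 by rewrite ltr_wpDl.
have /cvgrPdist_le/(_ (e / (`|c| + 1))) : GRing.exp (2^-1 : R) @ \oo --> (0 : R).
  by apply: cvg_expr; rewrite ger0_norm ?invr_ge0// invf_lt1 ?ltr1n.
rewrite divr_gt0// => /(_ isT)[K _ hK]; exists K => n /hK /=.
rewrite sub0r normrN ger0_norm ?exprn_ge0 ?invr_ge0// ler_pdivlMr// exprVn mulrC.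
apply: le_trans; rewrite ler_wpM2r ?invr_ge0 ?exprn_ge0//.
by rewrite (le_trans (ler_norm _))// lerDl.
Qed.

(** The analytic core of [hit_of_two_targets], with u and v standing for the two rescaled
    logarithms. Harnack for [C - u] and [C - v] bounds both from below near q; then their difference
    is small on a larger disc, so that [u >= - eta] there, and Harnack for [u + eta] carries the
    positive value at q to p. The radius is divided by 8, 4 and 8, hence the 256. *)
Lemma two_harmonic (C g s : R) : 0 <= C -> 0 < g -> 0 < s <= 1 ->
  exists2 e0 : R, 0 < e0 & forall q r (u v : R[i] -> R) p (e : R), 0 <= e <= e0 -> 0 < r ->
    harmonic_on q r u -> harmonic_on q r v ->
    (forall z, modulus (z - q) <= r -> u z <= C /\ v z <= C) ->
    (forall z, modulus (z - q) <= r -> - e <= u z \/ - e <= v z) ->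
    (forall z, modulus (z - q) <= s * r -> `|u z - v z| <= e) ->
    g <= u q -> 0 <= v q -> modulus (p - q) <= r / 256 -> e < u p.
Proof.
move=> C0 g0 /[dup] s01 /andP[s0 s1].
have [K hK] := exp2_small (4 * C) (divr_gt0 g0 (ltr0n R 4)).
have {}hK := hK _ (leqnn K).
have sK : 0 < s ^- K by rewrite invr_gt0 exprn_gt0.
have D0 : 0 < 4 + s ^- K by rewrite addr_gt0.
exists (g / 8 / (4 + s ^- K)); first by rewrite !divr_gt0.
move=> q r u v p e /andP[e0 ee] r0 hu hv uvC uve uvs gu vq pq.
have eg : e * (4 + s ^- K) <= g / 8 by rewrite -ler_pdivlMr.
have es : 0 <= e * s ^- K by rewrite mulr_ge0// ltW.
have sub (a b : R) z : modulus (z - q) <= a -> a <= b -> modulus (z - q) <= b.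
  exact: le_trans.
have uvlow z : modulus (z - q) <= r / 8 -> - C / 2 <= u z /\ - C / 2 <= v z.
  have low (f : R[i] -> R) : harmonic_on q r f -> (forall y, modulus (y - q) <= r -> f y <= C) ->
      0 <= f q -> modulus (z - q) <= r / 8 -> - C / 2 <= f z.
    move=> hf fC fq zr.
    have h : harmonic_on q r (fun y => C - f y) by exact: harmonic_onB (harmonic_on_cst _ _ _) hf.
    have h0 y : modulus (y - q) <= r -> 0 <= C - f y by rewrite subr_ge0; exact: fC.
    by have /andP[_] := harnack8 r0 h h0 zr; lra.
  move=> zr; split; apply: low => //; last by move=> y /uvC[].
  - by move=> y /uvC[].
  - exact: le_trans (ltW g0) gu.
have r8 : 0 < r / 8 by rewrite divr_gt0.
have r88 : r / 8 <= r by lra.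
have huv := harmonic_on_le r88 (harmonic_onB hu hv).
have uvB z : modulus (z - q) <= r / 8 -> `|u z - v z| <= 2 * C.
  move=> zr; have [h1 h2] := uvlow _ zr; have [h3 h4] := uvC _ (sub _ _ _ zr r88).
  by rewrite ler_norml; apply/andP; split; lra.
have uvs' z : modulus (z - q) <= s * (r / 8) -> `|u z - v z| <= e.
  by move=> zr; apply: uvs; rewrite (sub _ _ _ zr)// ler_wpM2l// ltW.
have C20 : 0 <= 2 * C by rewrite mulr_ge0.
pose eta := e * (2 + s ^- K) + 2 * (2 * C) / 2 ^+ K.
have ulow z : modulus (z - q) <= r / 8 / 4 -> - eta <= u z.
  move=> zr.
  have := propagation K r8 s01 e0 C20 huv uvB uvs' zr.
  have /uve : modulus (z - q) <= r by rewrite (sub _ _ _ zr)//; lra.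
  rewrite ler_norml /eta => h /andP[h1 h2].
  by case: h => h; lra.
have r32 : 0 < r / 8 / 4 by rewrite divr_gt0.
have r32r : r / 8 / 4 <= r by lra.
have hue : harmonic_on q (r / 8 / 4) (fun z => u z + eta).
  exact: harmonic_onD (harmonic_on_le r32r hu) (harmonic_on_cst _ _ _).
have pq' : modulus (p - q) <= r / 8 / 4 / 8 by lra.
have ue0 z : modulus (z - q) <= r / 8 / 4 -> 0 <= u z + eta.
  by move=> /ulow; lra.
have /andP[h _] := harnack8 r32 hue ue0 pq'.
have etag : eta <= g / 2.
  rewrite /eta; have : e * 2 <= g / 16 by lra.
  lra.
by lra.
Qed.

Lemma poly_continuous A p (e : R) : 0 < e ->
  exists2 d : R, 0 < d & forall z, modulus (z - p) <= d -> modulus (A.[z] - A.[p]) <= e.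
Proof.
move=> e0; have [C C0 AC] := poly_bounded A p 1.
have d0 : 0 < e / (72 * C) by rewrite divr_gt0// mulr_gt0.
exists (Num.min (1 / 2) (e / (72 * C))); first by rewrite lt_min d0 divr_gt0.
move=> z; rewrite le_min => /andP[z1 z2].
have n0 (y : R[i]) : modulus (y - p) <= 1 -> (1 : {poly R[i]}).[y] != 0.
  by rewrite hornerE oner_eq0.
have AC1 y : modulus (y - p) <= 1 -> modulus (A.[y] / (1 : {poly R[i]}).[y]) <= C.
  by move=> y1; rewrite hornerE divr1 AC.
have := frac_lipschitz ltr01 C0 n0 AC1 z1.
have one (y : R[i]) : (1 : {poly R[i]}).[y] = 1 by rewrite hornerE.
rewrite !one !divr1 => /le_trans; apply.
by move: z2; rewrite ler_pdivlMr ?mulr_gt0// mulrC.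
Qed.

Section Omitted.
Variables (kappa tau1 tau2 : {poly R[i]}) (F : nat -> {poly R[i]}) (c0 : R[i]) (r : R).
Variables (d K : R).
Hypotheses (FS : forall i, F i.+1 = F i ^+ 2 + kappa) (r0 : 0 < r) (d0 : 0 < d).
Hypothesis tau_sep : forall z, modulus (z - c0) <= r -> d <= modulus (tau1.[z] - tau2.[z]).
Hypothesis near_bounded : forall e, 0 < e ->
  exists2 p, modulus (p - c0) < e & forall i, modulus (F i).[p] <= K.
Hypothesis near_escaping : forall e, 0 < e ->
  exists2 q, modulus (q - c0) < e & forall M, exists i, M < modulus (F i).[q].

(* Otherwise [2 ^- i * ln |F i - tau1|] and the same with [tau2] are harmonic.
   They agree near an escaping point, where they are positive, hence also on a
   larger disc by [propagation]. As they are never both very negative, they are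
   almost nonnegative, and Harnack's inequality keeps them away from [0] near a
   bounded point, where they tend to [0]. *)
Lemma hit_of_two_targets : exists i z, modulus (z - c0) <= r /\
  ((F i).[z] = tau1.[z] \/ (F i).[z] = tau2.[z]).
Proof.
apply: contrapT => nex.
have miss i z : modulus (z - c0) <= r -> (F i - tau1).[z] != 0 /\ (F i - tau2).[z] != 0.
  move=> zr; rewrite !hornerE; split; rewrite subr_eq0; apply/eqP => E; apply: nex;
    exists i, z; split=> //; [by left|by right].
have [C C1 hC] : exists2 C : R, 2 <= C & forall z, modulus (z - c0) <= r ->
    [/\ modulus kappa.[z] <= C, modulus tau1.[z] <= C, modulus tau2.[z] <= C & modulus (F 0).[z] <= C].
  have [C1 C10 h1] := poly_bounded kappa c0 r; have [C2 C20 h2] := poly_bounded tau1 c0 r.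
  have [C3 C30 h3] := poly_bounded tau2 c0 r; have [C4 C40 h4] := poly_bounded (F 0) c0 r.
  exists (2 + C1 + C2 + C3 + C4); first by lra.
  by move=> z zr; split; [have := h1 _ zr|have := h2 _ zr|have := h3 _ zr|have := h4 _ zr]; lra.
have FSz i z : (F i.+1).[z] = (F i).[z] ^+ 2 + kappa.[z] by rewrite FS !hornerE.
pose L := 2 * C.
(* Keeping [+ C] on the left lets the induction absorb [kappa] at each squaring. The doubly
   exponential bound makes [u i] and [v i] at most [ln L] for all i. *)
have upper i z : modulus (z - c0) <= r -> modulus (F i).[z] + C <= L ^+ (2 ^ i).
  move=> zr; have [k1 _ _ f1] := hC _ zr.
  elim: i => [|i IH]; first by rewrite expr1 /L; lra.
  rewrite FSz expnSr exprM.
  have := ler_modulusD ((F i).[z] ^+ 2) kappa.[z]; rewrite modulusX => h.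
  have X0 := modulus_ge0 (F i).[z].
  have : (modulus (F i).[z] + C) ^+ 2 <= (L ^+ (2 ^ i)) ^+ 2.
    have XC : 0 <= modulus (F i).[z] + C by lra.
    by rewrite lerXn2r ?nnegrE// (le_trans XC).
  have : 0 <= modulus (F i).[z] * C by rewrite mulr_ge0//; lra.
  by have : 2 * C <= C ^+ 2; [rewrite expr2 ler_pM2r//; lra|lra].
(* The scaling by [2 ^+ i] is that of the Green function, the rate of escape of the orbit. *)
pose u i z := ln (modulus (F i - tau1).[z]) / 2 ^+ i.
pose v i z := ln (modulus (F i - tau2).[z]) / 2 ^+ i.
have i2 i : 0 < (2 ^+ i : R) by rewrite exprn_gt0.
have lnL : 0 <= ln L by rewrite ln_ge0// /L; lra.
have uvC i z : modulus (z - c0) <= r -> u i z <= ln L /\ v i z <= ln L.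
  move=> zr; have [m1 m2] := miss i _ zr; have [_ t1 t2 _] := hC _ zr.
  have := upper i _ zr => h.
  rewrite /u /v !ler_pdivrMr// -natrX !mulr_natr -!lnXn ?(lt_le_trans _ C1)//; last first.
    by rewrite /L mulr_gt0// (lt_le_trans _ C1).
  have L0 : 0 < L ^+ (2 ^ i) by rewrite exprn_gt0// /L mulr_gt0// (lt_le_trans _ C1).
  rewrite !ler_ln ?posrE ?modulus_gt0// !hornerE; split.
    by have := ler_modulusB (F i).[z] tau1.[z]; lra.
  by have := ler_modulusB (F i).[z] tau2.[z]; lra.
have e400 : 0 < r / 40 / 40 by rewrite !divr_gt0 ?ltr0n.
have [p pc pK] := near_bounded e400; have [q qc qM] := near_escaping e400.
have r2 : 0 < r / 2 by rewrite divr_gt0.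
have sub z : modulus (z - q) <= r / 2 -> modulus (z - c0) <= r.
  by move=> zq; have := modulus_triangle q z c0; lra.
have [i0 qi0] := qM (4 * C + 5).
have [s0 s00 hs0] := poly_continuous (F i0) q (ltr01 : 0 < 1).
(* From the time [i0] on, iterates near q grow doubly exponentially, so [u] and [v] stay above
   [ln 2 / 2 ^+ i0] there at all later times. *)
have near_q i z : modulus (z - q) <= r / 2 -> modulus (z - q) <= s0 ->
    2 ^+ (2 ^ i) <= modulus (F (i0 + i)).[z] / 2 /\ 2 * C <= modulus (F (i0 + i)).[z].
  move=> zr zs; have [k1 _ _ _] := hC _ (sub _ zr).
  elim: i => [|i [IH1 IH2]].
    rewrite addn0 expr1; have := lerB_modulus (F i0).[q] ((F i0).[q] - (F i0).[z]).
    rewrite subKr [modulus (_ - (F i0).[z])]modulusBC => h; have := hs0 _ zs.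
    by move=> h1; split; lra.
  rewrite addnS FSz.
  have := lerB_modulusD ((F (i0 + i)).[z] ^+ 2) kappa.[z]; rewrite modulusX => h.
  have X4 : 4 <= modulus (F (i0 + i)).[z].
    have : (2 : R) <= 2 ^+ (2 ^ i) by rewrite -{1}(expr1 2) ler_weXn2l ?expn_gt0// ler1n.
    by lra.
  move: IH1 IH2 h X4; set X := modulus (F (i0 + i)).[z] => IH1 IH2 h X4.
  split.
    rewrite expnSr exprM.
    have : (2 ^+ (2 ^ i)) ^+ 2 <= (X / 2) ^+ 2 by rewrite lerXn2r ?nnegrE ?exprn_ge0//; lra.
    by nra.
  by nra.
have g0 : 0 < ln 2 / 2 ^+ i0 :> R by rewrite divr_gt0// ln_gt0// ltr1n.
pose s := Num.min 1 (s0 / (r / 2)).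
have s01 : 0 < s <= 1 by rewrite /s lt_min ltr01 divr_gt0//= ge_min lexx.
have [e0 e00 he0] := two_harmonic lnL g0 s01.
have K0 : 0 <= K by exact: le_trans (modulus_ge0 _) (pK 0%N).
(* D collects the errors to be divided by [2 ^+ i]: 2 for the difference of the logarithms near q,
   [ln (d / 2)] for the separation of the targets, [ln (K + C)] for the value at the bounded point
   p. *)
pose D := 2 + `|ln (d / 2)| + `|ln (K + C)|.
have [N hN] := exp2_small D e00.
pose i := (i0 + N)%N.
have Di : D / 2 ^+ i <= e0 by apply: hN; rewrite leq_addl.
have D0 : 0 <= D by rewrite !addr_ge0.
have pq : modulus (p - q) <= r / 2 / 256.
  by have := modulus_triangle c0 p q; rewrite [modulus (c0 - q)]modulusBC; lra.
have qq : modulus (q - q) <= r / 2 by rewrite subrr modulus0 ltW.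
have pr : modulus (p - c0) <= r by have := ltW pc; lra.
have logq i' z : modulus (z - q) <= r / 2 -> modulus (z - q) <= s0 -> (i0 <= i')%N ->
    [/\ ln 2 / 2 ^+ i0 <= u i' z, ln 2 / 2 ^+ i0 <= v i' z & `|u i' z - v i' z| <= 2 / 2 ^+ i'].
  move=> zr zs ii; have [h1 h2] := near_q (i' - i0)%N _ zr zs.
  rewrite subnKC// in h1 h2.
  have [k1 t1 t2 _] := hC _ (sub _ zr).
  have [m1 m2] := miss i' _ (sub _ zr).
  have m1p := m1; have m2p := m2; rewrite -modulus_gt0 in m1p; rewrite -modulus_gt0 in m2p.
  have a1 : modulus (F i').[z] / 2 <= modulus (F i' - tau1).[z].
    by rewrite !hornerE; have := lerB_modulus (F i').[z] tau1.[z]; lra.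
  have a2 : modulus (F i').[z] / 2 <= modulus (F i' - tau2).[z].
    by rewrite !hornerE; have := lerB_modulus (F i').[z] tau2.[z]; lra.
  have E : 2 ^+ i' = 2 ^+ i0 * 2 ^+ (i' - i0) :> R by rewrite -exprD subnKC.
  have low (X : R) : modulus (F i').[z] / 2 <= X -> ln 2 / 2 ^+ i0 <= ln X / 2 ^+ i'.
    move=> hX; rewrite E invfM mulrA [leRHS]mulrAC.
    rewrite ler_pM2r ?invr_gt0// ler_pdivlMr// -natrX mulr_natr -lnXn//.
    by rewrite ler_ln ?posrE ?exprn_gt0// ?(le_trans h1)// (lt_le_trans _ (le_trans h1 hX))// exprn_gt0.
  split; [exact: low|exact: low|].
  have i2' : 0 <= (2 ^+ i')^-1 :> R by rewrite invr_ge0 ltW.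
  rewrite /u /v -mulrBl normrM (ger0_norm i2') ler_wpM2r//.
  have close (X Y : R) : 0 < X -> 0 < Y -> X <= 3 * Y -> ln X - ln Y <= 2.
    move=> X0 Y0 XY; rewrite -ln_div ?posrE//.
    have h3 : X / Y <= 3 by rewrite ler_pdivrMr.
    have := le_ln1Dx (x := X / Y - 1); rewrite addrCA subrr addr0 => /(_ _)/le_trans; apply; last by lra.
    by rewrite ltrBDr addNr divr_gt0.
  rewrite ler_norml lerNl opprB; apply/andP; split; apply: close => //; move: a1 a2; rewrite !hornerE => a1 a2.
    have := ler_modulusB ((F i').[z] - tau1.[z]) (tau2.[z] - tau1.[z]).
    rewrite (_ : (F i').[z] - tau1.[z] - (tau2.[z] - tau1.[z]) = (F i').[z] - tau2.[z]); last by ring.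
    by have := ler_modulusB tau2.[z] tau1.[z]; lra.
  have := ler_modulusB ((F i').[z] - tau2.[z]) (tau1.[z] - tau2.[z]).
  rewrite (_ : (F i').[z] - tau2.[z] - (tau1.[z] - tau2.[z]) = (F i').[z] - tau1.[z]); last by ring.
  by have := ler_modulusB tau1.[z] tau2.[z]; lra.
have qs0 : modulus (q - q) <= s0 by rewrite subrr modulus0 ltW.
have [gu gv _] := logq i q qq qs0 (leq_addr _ _).
have D0i : 0 <= D / 2 ^+ i <= e0 by rewrite Di divr_ge0// ltW.
have hu : harmonic_on q (r / 2) (u i).
  apply: harmonic_on_ext (harmonic_onZ (2 ^+ i)^-1 (harmonic_ln_poly (p := q) (A := F i - tau1) (ltW r2) _)).
    by move=> z _; rewrite mulrC.
  by move=> z /sub /(miss i)[].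
have hv : harmonic_on q (r / 2) (v i).
  apply: harmonic_on_ext (harmonic_onZ (2 ^+ i)^-1 (harmonic_ln_poly (p := q) (A := F i - tau2) (ltW r2) _)).
    by move=> z _; rewrite mulrC.
  by move=> z /sub /(miss i)[].
have := he0 q (r / 2) (u i) (v i) p (D / 2 ^+ i) D0i r2 hu hv _ _ _ gu (le_trans (ltW g0) gv) pq.
rewrite ltNge => /(_ _ _ _)/negP; apply.
- by move=> z /sub /uvC.
- move=> z /sub zr; have := tau_sep zr; have [m1 m2] := miss i _ zr.
  rewrite /u /v -!mulNr !ler_pM2r ?invr_gt0// => h.
  have d2 : 0 < d / 2 by rewrite divr_gt0.
  have low (X : R) : d / 2 <= X -> - D <= ln X.
    move=> dX; rewrite lerNl; have : ln (d / 2) <= ln X by rewrite ler_ln ?posrE// (lt_le_trans d2).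
    have := ler_normlP _ _ (lexx `|ln (d / 2)|) => -[h1 h2]; rewrite /D.
    have := normr_ge0 (ln (K + C)); lra.
  have := modulus_triangle (F i).[z] tau1.[z] tau2.[z]; rewrite [modulus (tau1.[z] - (F i).[z])]modulusBC.
  have [h3|h3] := lerP (d / 2) (modulus ((F i).[z] - tau1.[z])).
    by move=> _; left; apply: low; rewrite !hornerE.
  by move=> h4; right; apply: low; rewrite !hornerE; lra.
- move=> z zs; have [a b] : modulus (z - q) <= r / 2 /\ modulus (z - q) <= s0.
    have /andP[sp s1] := s01; split; first by rewrite (le_trans zs)// ler_piMl// ltW.
    rewrite (le_trans zs)// -ler_pdivlMr// /s ge_min lexx orbT//.
  have [_ _ h] := logq i z a b (leq_addr _ _).
  by rewrite (le_trans h)// ler_pM2r ?invr_gt0// /D; have := normr_ge0 (ln (K + C)); have := normr_ge0 (ln (d / 2)); lra.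
- rewrite /u ler_pM2r ?invr_gt0//.
  have [m1 _] := miss i _ pr.
  have h1 : ln (modulus (F i - tau1).[p]) <= ln (K + C).
    have [_ t1 _ _] := hC _ pr.
    rewrite ler_ln ?posrE ?modulus_gt0//; last by lra.
    by rewrite !hornerE; have := ler_modulusB (F i).[p] tau1.[p]; have := pK i; lra.
  rewrite (le_trans h1)// /D; have := ler_norm (ln (K + C)); have := normr_ge0 (ln (d / 2)); lra.
Qed.
End Omitted.

End HarmonicApplications.

(** * Topology of the sphere *)

Section SphereTopology.
Context {R : realType}.
Implicit Types (z w : R[i]) (p q : sphere R) (r M : R).

Lemma to_complex_continuous : continuous (@to_complex R).
Proof.
move=> [a b] A /nbhs_modulusP[r r0 rA].
have r2 : 0 < r / 2 by rewrite divr_gt0.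
exists (ball a (r / 2), ball b (r / 2)); first by split; apply: nbhsx_ballx.
case=> x y [/= xa yb]; apply: rA.
apply: le_lt_trans (ler_modulus_ReIm _) _ => /=.
by rewrite [r]splitr ltrD// distrC.
Qed.

Lemma modulus_continuous : continuous (@modulus R).
Proof.
move=> z A /nbhs_ballP[e e0 eA].
apply/nbhs_modulusP; exists e => // w wz; apply: eA.
by rewrite /ball/= distrC (le_lt_trans (ler_dist_modulus _ _)).
Qed.

Lemma closed_ball_modulus_compact M : compact [set z : R[i] | modulus z <= M].
Proof.
apply: (@subclosed_compact _ _ (@to_complex R @` (`[- M, M] `*` `[- M, M]))).
- apply: (@preimage_closed _ _ (@modulus R) [set x | x <= M]); last exact: closed_le.
  by move=> z _; exact: modulus_continuous.
- apply: continuous_compact.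
    by apply: continuous_subspaceT => x; exact: to_complex_continuous.
  by apply: compact_setX; exact: segment_compact.
- move=> z /= zM; exists (complex.Re z, complex.Im z); last by case: (z).
  split=> /=; rewrite in_itv/= -ler_norml (le_trans _ zM)//.
    exact: ler_Re_modulus.
  exact: ler_Im_modulus.
Qed.

Lemma compact_modulus_bounded (A : set R[i]) : compact A ->
  exists M, forall z, A z -> modulus z <= M.
Proof.
move=> cA; have : compact (@modulus R @` A).
  by apply: continuous_compact => //; apply: continuous_subspaceT => x; exact: modulus_continuous.
move=> /compact_bounded [M [_ hM]]; exists (M + 1) => z Az.
have h : M < M + 1 by rewrite ltrDl.
by apply: le_trans (ler_norm _) (hM _ h (modulus z) _); exists z.
Qed.

Lemma nbhs_finiteP z (A : set (sphere R)) : nbhs (finite_point z) A <->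
  exists2 r, 0 < r & forall w, modulus (w - z) < r -> A (finite_point w).
Proof. exact: (iff_trans _ (nbhs_modulusP z (Some @^-1` A))). Qed.

Lemma nbhs_infinityP (A : set (sphere R)) : nbhs (infinity R) A <->
  A (infinity R) /\ exists M, forall w, M < modulus w -> A (finite_point w).
Proof.
split=> [[U [cU clU] UA]|[A0 [M MA]]].
  split; first by apply: UA; right.
  have [M hM] := compact_modulus_bounded cU; exists M => w Mw.
  by apply: UA; left; exists w => // /hM; rewrite leNgt Mw.
exists [set z : R[i] | modulus z <= M].
  split; first exact: closed_ball_modulus_compact.
  apply: (@preimage_closed _ _ (@modulus R) [set x | x <= M]); last exact: closed_le.
  by move=> z _; exact: modulus_continuous.
move=> _ [[w /= /negP wM <-]|->//]; apply: MA.
by move: wM; rewrite -ltNge.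
Qed.

Lemma sphere_hausdorff : hausdorff_space (sphere R).
Proof.
move=> p q pq; apply: contrapT => npq.
have sep_inf z : ~ cluster (nbhs (finite_point z)) (infinity R).
  pose A : set (sphere R) := [set p | if p is Some w then modulus (w - z) < 1 else False].
  pose B : set (sphere R) := [set p | if p is Some w then modulus z + 1 < modulus w else True].
  move=> /(_ A B)[||[w|] [//=]].
  - by apply/nbhs_finiteP; exists 1.
  - by apply/nbhs_infinityP; split => //; exists (modulus z + 1).
  - by have := lerB_modulus w z; lra.
case: p q pq npq => [z|] [w|] pq npq //; last 2 first.
- exact: (sep_inf z).
- by apply: (sep_inf w) => A B hA hB; have := pq B A hB hA; rewrite setIC.
have zw : 0 < modulus (z - w) by rewrite modulus_gt0 subr_eq0; apply/eqP => e; apply: npq; rewrite e.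
pose A (y : R[i]) : set (sphere R) :=
  [set p | if p is Some x then modulus (x - y) < modulus (z - w) / 2 else False].
have [||[x|] [//=]] := pq (A z) (A w).
- by apply/nbhs_finiteP; exists (modulus (z - w) / 2); rewrite ?divr_gt0.
- by apply/nbhs_finiteP; exists (modulus (z - w) / 2); rewrite ?divr_gt0.
- by have := modulus_triangle x z w; rewrite [modulus (z - x)]modulusBC; lra.
Qed.

Lemma sphere_compact : compact [set: sphere R].
Proof. exact: one_point_compactification_compact. Qed.

Lemma closed_sphere_compact (A : set (sphere R)) : closed A -> compact A.
Proof. by move=> cA; exact: subclosed_compact cA sphere_compact _. Qed.

Lemma compact_sphere_closed (A : set (sphere R)) : compact A -> closed A.
Proof. exact: compact_closed sphere_hausdorff. Qed.

Lemma continuous_sphere_closed_map (f : sphere R -> sphere R) (A : set (sphere R)) :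
  continuous f -> closed A -> closed (f @` A).
Proof.
move=> cf cA; apply: compact_sphere_closed; apply: continuous_compact.
  exact: continuous_subspaceT.
exact: closed_sphere_compact.
Qed.

Definition stereo z : R := Num.sqrt (1 + modulus z ^+ 2).

Lemma stereo_gt0 z : 0 < stereo z.
Proof. by rewrite sqrtr_gt0 ltr_pwDl// sqr_ge0. Qed.

Lemma stereo_ge0 z : 0 <= stereo z.
Proof. exact: sqrtr_ge0. Qed.

Lemma sqr_stereo z : stereo z ^+ 2 = 1 + modulus z ^+ 2.
Proof. by rewrite sqr_sqrtr// addr_ge0// sqr_ge0. Qed.

Lemma stereo_ge1 z : 1 <= stereo z.
Proof.
by rewrite -[leLHS]sqrtr1 ler_wsqrtr// lerDl sqr_ge0.
Qed.

Lemma stereo_ge z : modulus z <= stereo z.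
Proof.
by rewrite -[leLHS]ger0_norm ?modulus_ge0// -sqrtr_sqr ler_wsqrtr// lerDr.
Qed.

(** This bound and [modulusB_stereo] are the two halves of [(1 + |z|^2)(1 + |w|^2) = |1 + conj z
    w|^2 + |z - w|^2]. *)
Lemma modulus_1DJM z w : modulus (1 + (z^*)%C * w) <= stereo z * stereo w.
Proof.
rewrite -ler_sqr ?nnegrE ?modulus_ge0// ?mulr_ge0 ?stereo_ge0// exprMn !sqr_stereo.
rewrite !sqr_modulus; case: z w => [a b] [c d] /=.
have := sqr_ge0 (a - c); have := sqr_ge0 (b - d); nra.
Qed.

Lemma modulusB_stereo z w : modulus (z - w) <= stereo z * stereo w.
Proof.
rewrite -ler_sqr ?nnegrE ?modulus_ge0// ?mulr_ge0 ?stereo_ge0// exprMn !sqr_stereo.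
rewrite !sqr_modulus; case: z w => [a b] [c d] /=.
have := sqr_ge0 (1 + a * c + b * d); have := sqr_ge0 (a * d - b * c); nra.
Qed.

Lemma stereo_lip z w : stereo w <= modulus (z - w) + stereo z.
Proof.
rewrite -ler_sqr ?nnegrE ?addr_ge0 ?modulus_ge0 ?stereo_ge0// sqrrD !sqr_stereo.
have := lerB_modulus w z; rewrite modulusBC => h.
have : modulus w ^+ 2 <= (modulus (z - w) + modulus z) ^+ 2.
  by rewrite ler_sqr ?nnegrE ?addr_ge0 ?modulus_ge0//; lra.
have := ler_wpM2l (modulus_ge0 (z - w)) (stereo_ge z).
rewrite -mulr_natl; nra.
Qed.

Lemma chordal_finite z w :
  chordal (finite_point z) (finite_point w) = 2 * modulus (z - w) / (stereo z * stereo w).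
Proof. by []. Qed.

Lemma chordal_finite_infinity z : chordal (finite_point z) (infinity R) = 2 / stereo z.
Proof. by []. Qed.

Lemma chordalC p q : chordal p q = chordal q p.
Proof. by case: p q => [z|] [w|] //=; rewrite modulusBC [_ * Num.sqrt _]mulrC. Qed.

Lemma chordal_refl p : chordal p p = 0.
Proof. by case: p => [z|] //=; rewrite subrr modulus0 mulr0 mul0r. Qed.

(** The case of three finite points rests on [(z - w)(1 + |u|^2) = (z - u)(1 + conj u w) + (u - w)(1
    + conj u z)]. *)
Lemma chordal_triangle q p p' : chordal p p' <= chordal p q + chordal q p'.
Proof.
have chordal_mul2 (a b m : R) : 0 < a -> 0 < b ->
    (2 / a <= 2 * m / (a * b) + 2 / b) = (b <= m + a).
  move=> a0 b0; rewrite -(ler_pM2r (mulr_gt0 a0 b0)).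
  have -> : 2 / a * (a * b) = 2 * b by field; rewrite !gt_eqF.
  have -> : (2 * m / (a * b) + 2 / b) * (a * b) = 2 * (m + a) by field; rewrite !gt_eqF.
  by rewrite ler_pM2l.
case: p q p' => [z|] [u|] [w|] //=; rewrite -?/(stereo _) ?addr0 ?add0r//.
- have z0 := stereo_gt0 z; have w0 := stereo_gt0 w; have u0 := stereo_gt0 u.
  have id : modulus (z - w) * stereo u ^+ 2 <=
      modulus (z - u) * (stereo u * stereo w) + modulus (u - w) * (stereo u * stereo z).
    have -> : modulus (z - w) * stereo u ^+ 2 =
       modulus ((z - u) * (1 + (u^*)%C * w) + (u - w) * (1 + (u^*)%C * z)).
      rewrite -[stereo u ^+ 2]ger0_norm ?sqr_ge0// -modulus_real -modulusM sqr_stereo.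
      congr modulus; rewrite rmorphD rmorphXn/= -normCE sqr_normc rmorph1.
      by ring.
    by rewrite (le_trans (ler_modulusD _ _))// !modulusM lerD// ler_wpM2l ?modulus_ge0// modulus_1DJM.
  rewrite -!mulrA -mulrDr ler_pM2l// ler_pdivrMr ?mulr_gt0// mulrDl.
  have -> : modulus (z - u) / (stereo z * stereo u) * (stereo z * stereo w) =
    modulus (z - u) * (stereo u * stereo w) / stereo u ^+ 2 by field; rewrite !gt_eqF.
  have -> : modulus (u - w) / (stereo u * stereo w) * (stereo z * stereo w) =
    modulus (u - w) * (stereo u * stereo z) / stereo u ^+ 2 by field; rewrite !gt_eqF.
  by rewrite -mulrDl ler_pdivlMr ?exprn_gt0.
- by rewrite chordal_mul2 ?stereo_gt0//; have := stereo_lip z u; lra.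
- rewrite -(ler_pM2r (mulr_gt0 (stereo_gt0 z) (stereo_gt0 w))).
  rewrite divfK ?gt_eqF ?mulr_gt0 ?stereo_gt0//.
  have := lerB_modulus z w; have := stereo_ge z; have := stereo_ge w; have := ler_modulusB z w.
  have z0 := stereo_gt0 z; have w0 := stereo_gt0 w.
  have -> : (2 / stereo z + 2 / stereo w) * (stereo z * stereo w) = 2 * (stereo z + stereo w).
    by field; rewrite !gt_eqF.
  by lra.
- rewrite [leRHS]addrC [stereo u * _]mulrC chordal_mul2 ?stereo_gt0//.
  by have := stereo_lip w u; rewrite modulusBC; lra.
Qed.

Lemma chordal_continuous p (e : R) : 0 < e -> \forall q \near p, chordal q p < e.
Proof.
move=> e0; case: p => [z|].
  apply/nbhs_finiteP; exists (e / 2); first by rewrite divr_gt0.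
  move=> w wz; rewrite chordal_finite ltr_pdivrMr ?mulr_gt0 ?stereo_gt0//.
  rewrite (@lt_le_trans _ _ e)//; first by lra.
  by rewrite ler_peMr ?(ltW e0)// -[leLHS]mulr1 ler_pM ?stereo_ge1.
apply/nbhs_infinityP; split; first by rewrite chordal_refl.
exists (2 / e) => w; rewrite chordal_finite_infinity ltr_pdivrMr// => h.
rewrite ltr_pdivrMr ?stereo_gt0// (lt_le_trans h)// mulrC ler_pM2l//.
exact: stereo_ge.
Qed.

Lemma chordal_infinity_modulus z M : 0 <= M -> chordal (finite_point z) (infinity R) < 2 / (1 + M) ->
  M < modulus z.
Proof.
move=> M0; rewrite chordal_finite_infinity.
have M1 : 0 < 1 + M by rewrite ltr_pwDl.
rewrite ltr_pM2l// ltf_pV2 ?posrE ?stereo_gt0// => h.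
rewrite ltNge; apply/negP => zM.
have : stereo z <= 1 + M.
  rewrite -ler_sqr ?nnegrE ?(ltW M1) ?(ltW (stereo_gt0 _))// sqr_stereo.
  by have := modulus_ge0 z; nra.
by rewrite leNgt h.
Qed.

End SphereTopology.

(** * Continuous square roots on subsets of a space *)

Section ContOn.
Context {R : realType} {T : topologicalType}.
Implicit Types (A : set T) (f g s t : T -> R[i]).

Definition cont_on A f := forall x, A x -> forall e : R, 0 < e ->
  \forall y \near x, A y -> modulus (f y - f x) < e.

Lemma cont_on_sub A B f : B `<=` A -> cont_on A f -> cont_on B f.
Proof.
by move=> BA cf x Bx e e0; apply: filterS (cf _ (BA _ Bx) _ e0) => y h /BA.
Qed.

Lemma cont_on_cst A (c : R[i]) : cont_on A (fun=> c).
Proof. by move=> x _ e e0; apply: nearW => y _; rewrite subrr modulus0. Qed.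

Lemma cont_onN A f : cont_on A f -> cont_on A (fun x => - f x).
Proof.
move=> cf x Ax e e0; apply: filterS (cf _ Ax _ e0) => y h /h.
by rewrite -opprD modulusN.
Qed.

Lemma cont_onD A f g : cont_on A f -> cont_on A g -> cont_on A (fun x => f x + g x).
Proof.
move=> cf cg x Ax e e0; have e2 : 0 < e / 2 by rewrite divr_gt0.
apply: filterS2 (cf _ Ax _ e2) (cg _ Ax _ e2) => y h1 h2 Ay.
have -> : f y + g y - (f x + g x) = (f y - f x) + (g y - g x) by ring.
by rewrite (le_lt_trans (ler_modulusD _ _))// [e]splitr ltrD ?h1 ?h2.
Qed.

Lemma cont_onM A f g : cont_on A f -> cont_on A g -> cont_on A (fun x => f x * g x).
Proof.
move=> cf cg x Ax e e0.
have a0 : 0 < modulus (f x) + modulus (g x) + 1 by rewrite ltr_wpDl// addr_ge0 ?modulus_ge0.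
pose d := Num.min 1 (e / (modulus (f x) + modulus (g x) + 1)).
have d0 : 0 < d by rewrite lt_min ltr01 divr_gt0.
apply: filterS2 (cf _ Ax _ d0) (cg _ Ax _ d0) => y h1 h2 Ay.
have {}h1 := h1 Ay; have {}h2 := h2 Ay.
have -> : f y * g y - f x * g x = (f y - f x) * (g y - g x) + f x * (g y - g x) + g x * (f y - f x) by ring.
have dle1 : d <= 1 by rewrite ge_min lexx.
have dle : d * (modulus (f x) + modulus (g x) + 1) <= e.
  by rewrite -ler_pdivlMr// ge_min lexx orbT.
rewrite (lt_le_trans _ dle)//.
have := ler_modulusD ((f y - f x) * (g y - g x) + f x * (g y - g x)) (g x * (f y - f x)).
have := ler_modulusD ((f y - f x) * (g y - g x)) (f x * (g y - g x)).
rewrite !modulusM.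
have := modulus_ge0 (f x); have := modulus_ge0 (g x); have := modulus_ge0 (f y - f x); have := modulus_ge0 (g y - g x).
move: (modulus (f y - f x)) (modulus (g y - g x)) h1 h2 => a b h1 h2 b0' a0' g0 f0.
have : modulus (f x) * b <= modulus (f x) * d by rewrite ler_wpM2l// ltW.
have : modulus (g x) * a <= modulus (g x) * d by rewrite ler_wpM2l// ltW.
have : a * b < d.
  case: (eqVneq a 0) => [->|an0]; first by rewrite mul0r.
  rewrite (@lt_le_trans _ _ (a * 1))//; last by rewrite mulr1 ltW.
  have ap : 0 < a by rewrite lt_neqAle a0' eq_sym an0.
  by rewrite ltr_pM2l// (lt_le_trans h2).
by lra.
Qed.

Lemma cont_onV A f : (forall x, A x -> f x != 0) -> cont_on A f -> cont_on A (fun x => (f x)^-1).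
Proof.
move=> f0 cf x Ax e e0; have fx := f0 _ Ax.
have m0 : 0 < modulus (f x) by rewrite modulus_gt0.
pose d := Num.min (modulus (f x) / 2) (e * (modulus (f x) ^+ 2 / 2)).
have d0 : 0 < d by rewrite lt_min divr_gt0// mulr_gt0// divr_gt0// exprn_gt0.
apply: filterS (cf _ Ax _ d0) => y h Ay; have {}h := h Ay.
have fy := f0 _ Ay.
have -> : (f y)^-1 - (f x)^-1 = (f x - f y) / (f x * f y) by field; rewrite fx fy.
rewrite modulusM modulusV modulusM modulusBC.
move: h; rewrite lt_min => /andP[h1 h2].
have fy2 : modulus (f x) / 2 <= modulus (f y).
  by have := lerB_modulus (f x) (f y); rewrite modulusBC; lra.
rewrite ltr_pdivrMr ?mulr_gt0 ?modulus_gt0// (lt_le_trans h2)// ler_pM2l//.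
by rewrite expr2 -mulrA ler_pM2l.
Qed.

Definition has_sqrt A f := exists2 s, cont_on A s & forall x, A x -> s x ^+ 2 = f x.

Lemma has_sqrt_ext A f g : (forall x, A x -> f x = g x) -> has_sqrt A f -> has_sqrt A g.
Proof. by move=> fg [s cs sf]; exists s => // x Ax; rewrite sf ?fg. Qed.

Lemma has_sqrtM A f g : has_sqrt A f -> has_sqrt A g -> has_sqrt A (fun x => f x * g x).
Proof.
move=> [s cs sf] [t ct tg]; exists (fun x => s x * t x); first exact: cont_onM.
by move=> x Ax; rewrite exprMn sf ?tg.
Qed.

Lemma has_sqrt_cst A (c : R[i]) : has_sqrt A (fun=> c).
Proof. by exists (fun=> sqrtc c) => [|x _]; [exact: cont_on_cst|rewrite sqr_sqrtc]. Qed.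

(** The branch with positive real part is continuous, because
    [|s y - s x| |s y + s x| = |f y - f x|] and the second factor is at least [Re (s x)]. *)
Lemma has_sqrt_Re_gt0 A f : cont_on A f -> (forall x, A x -> 0 < complex.Re (f x)) -> has_sqrt A f.
Proof.
move=> cf fp.
pose s x := if complex.Re (sqrtc (f x)) < 0 then - sqrtc (f x) else sqrtc (f x).
have s2 x : s x ^+ 2 = f x by rewrite /s; case: ifP; rewrite ?sqrrN sqr_sqrtc.
have sp x : A x -> 0 < complex.Re (s x).
  move=> Ax; have : 0 <= complex.Re (s x).
    rewrite /s; case: ltP => // h.
    by case: (sqrtc _) h => a b /= ?; rewrite oppr_ge0 ltW.
  rewrite le_eqVlt => /orP[/eqP e|//].
  have := fp _ Ax; rewrite -s2; case: (s x) e => a b /= <-.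
  by rewrite mul0r sub0r oppr_gt0 -expr2 ltNge sqr_ge0.
exists s => // x Ax e e0.
have h0 : 0 < e * complex.Re (s x) by rewrite mulr_gt0// sp.
apply: filterS (cf _ Ax _ h0) => y h Ay; have {}h := h Ay.
have : modulus (s y - s x) * modulus (s y + s x) < e * complex.Re (s x).
  by rewrite -modulusM -subr_sqr !s2.
have : complex.Re (s x) <= modulus (s y + s x).
  apply: le_trans (ler_Re_modulus _); rewrite ger0_norm.
    by have := sp _ Ay; case: (s y) (s x) => ? ? [] ? ? /= /ltW; rewrite lerDr.
  by have := sp _ Ay; have := sp _ Ax; case: (s y) (s x) => ? ? [] ? ? /= /ltW ? /ltW ?; rewrite addr_ge0.
move=> h1 h2; rewrite ltNge; apply/negP => h3.
by move: h2; rewrite ltNge (ler_pM (ltW e0) (ltW (sp _ Ax)) h3 h1).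
Qed.

(** The quotient [f / g] stays in the disc of radius 1 about 1, hence in the right half-plane, where
    a square root exists. *)
Lemma has_sqrt_perturb A f g : cont_on A f -> cont_on A g ->
    (forall x, A x -> modulus (f x - g x) < modulus (g x)) -> has_sqrt A g -> has_sqrt A f.
Proof.
move=> cf cg fg sg.
have g0 x : A x -> g x != 0.
  by move=> /fg h; rewrite -modulus_gt0 (le_lt_trans (modulus_ge0 _) h).
apply: (@has_sqrt_ext _ (fun x => g x * (f x * (g x)^-1))).
  by move=> x /g0 gx; rewrite mulrCA mulfV ?mulr1.
apply: has_sqrtM => //; apply: has_sqrt_Re_gt0.
  by apply: cont_onM => //; exact: cont_onV.
move=> x Ax; have : modulus (f x * (g x)^-1 - 1) < 1.
  rewrite -[X in _ - X](mulfV (g0 _ Ax)) -mulrBl modulusM modulusV.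
  by rewrite ltr_pdivrMr ?mul1r ?fg// modulus_gt0 g0.
move=> h; have := ler_Re_modulus (f x * (g x)^-1 - 1).
case: (f x * _) h => a b /= h; rewrite ler_norml => /andP[h1 _].
by lra.
Qed.

(** A locally constant property is constant on a connected set. In this form it serves the
    continuation arguments below. *)
Lemma connected_dichotomy (A : set T) (P : T -> Prop) : connected A ->
    (forall x, A x -> P x -> \forall y \near x, A y -> P y) ->
    (forall x, A x -> ~ P x -> \forall y \near x, A y -> ~ P y) ->
  (forall x, A x -> P x) \/ (forall x, A x -> ~ P x).
Proof.
move=> cA hP hN; case: (pselect (exists2 x, A x & P x)) => [[x Ax Px]|nex]; last first.
  by right=> x Ax Px; apply: nex; exists x.
left; have := cA (A `&` [set y | P y]); rewrite /= => /(_ _ _ _) h.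
suff -> : A = A `&` [set y | P y] by move=> y [].
symmetry; apply: h; first by exists x.
- exists [set y | \forall z \near y, A z -> P z].
    rewrite openE => y /=; exact: nbhs_interior.
  by apply/seteqP; split=> y [Ay] /= => [Py|/nbhs_singleton/(_ Ay)]; split=> //; exact: hP.
- exists (~` [set y | \forall z \near y, A z -> ~ P z]).
    rewrite closedC; rewrite openE => y /=; exact: nbhs_interior.
  apply/seteqP; split=> y [Ay] /= Py; split=> //.
    by move=> /nbhs_singleton/(_ Ay).
  by apply: contrapT => /(hN _ Ay).
Qed.

Lemma sqrt_sign A s t : connected A -> cont_on A s -> cont_on A t ->
    (forall x, A x -> t x != 0) -> (forall x, A x -> s x ^+ 2 = t x ^+ 2) ->
  (forall x, A x -> s x = t x) \/ (forall x, A x -> s x = - t x).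
Proof.
move=> cA cs ct t0 st.
have stp x : A x -> s x = t x \/ s x = - t x.
  by move=> /st/eqP; rewrite eqf_sqr => /orP[]/eqP; [left|right].
have near_neq (c : R[i]) x : c = 1 \/ c = -1 -> A x -> s x = c * t x ->
    \forall y \near x, A y -> s y = c * t y.
  move=> c1 Ax sx; have m0 : 0 < modulus (t x) / 2 by rewrite divr_gt0// modulus_gt0 t0.
  apply: filterS2 (cs _ Ax _ m0) (ct _ Ax _ m0) => y h1 h2 Ay.
  have {}h1 := h1 Ay; have {}h2 := h2 Ay.
  have c2 : modulus c = 1 by case: c1 => ->; rewrite ?modulusN modulus1.
  have [//|sy] : s y = c * t y \/ s y = - c * t y.
    by case: (stp _ Ay) => ->; case: c1 => ->; rewrite ?opprK ?mul1r ?mulN1r; auto.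
  exfalso.
  have : modulus (c * (t y + t x)) < modulus (t x) / 2.
    by rewrite -modulusN; move: h1; rewrite sy sx; congr (modulus _ < _); ring.
  rewrite modulusM c2 mul1r => h3.
  have := ler_modulusB (t y + t x) (t y - t x).
  have -> : t y + t x - (t y - t x) = 2 * t x by ring.
  by rewrite modulusM modulus_nat; have := modulus_ge0 (t x); lra.
have hP x : A x -> s x = t x -> \forall y \near x, A y -> s y = t y.
  move=> Ax sx; have := near_neq 1 x (or_introl erefl) Ax; rewrite mul1r => /(_ sx).
  by apply: filterS => y h /h; rewrite mul1r.
have hN x : A x -> s x <> t x -> \forall y \near x, A y -> s y <> t y.
  move=> Ax sx; have sx' : s x = - t x by case: (stp _ Ax).
  have := near_neq (-1) x (or_intror erefl) Ax; rewrite mulN1r => /(_ sx').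
  apply: filterS => y h Ay; rewrite h// mulN1r => /eqP.
  by rewrite eq_sym -addr_eq0 -mulr2n mulrn_eq0/= (negPf (t0 _ Ay)).
have [h|h] := connected_dichotomy cA hP hN; first by left.
by right=> x Ax; case: (stp _ Ax) => // /(h _ Ax).
Qed.

(** Turns a radius valid near each point into one valid on the whole compact set, for properties
    that are inherited by smaller radii. *)
Lemma compact_uniform A (P : R -> T -> Prop) : compact A ->
    (forall e e' x, e' <= e -> P e x -> P e' x) ->
    (forall x, A x -> exists2 e : R, 0 < e & \forall y \near x, A y -> P e y) ->
  exists2 e : R, 0 < e & forall x, A x -> P e x.
Proof.
move=> cA Pmon Ploc.
have : \forall e \near (0 : R)^'+, A `<=` (fun x => A x -> P e x).
  apply: (compact_near_coveringP A).1 => // x /Ploc[e e0 eP].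
  exists ([set y | A y -> P e y], `]0, e[%classic); first split => //=.
    have : \forall y \near (0 : R)^'+, 0 < y /\ y < e.
      by near=> y; split; near: y; [exact: nbhs_right_gt|exact: nbhs_right_lt].
    by apply: filterS => y [y0 ye] /=; rewrite in_itv/= y0 ye.
  case=> y e' /= [yP]; rewrite in_itv/= => /andP[_ /ltW e'e] Ay.
  exact: Pmon e'e (yP Ay).
move=> h; have : \forall e \near (0 : R)^'+, 0 < e /\ A `<=` (fun x => A x -> P e x).
  by near=> e; split; near: e => //; exact: nbhs_right_gt.
move=> /filter_ex[e [e0 eP]].
by exists e => // x Ax; exact: eP.
Unshelve. all: by end_near. Qed.

End ContOn.

(** * Unicoherence of the sphere *)

Section Unicoherence.
Context {R : realType}.

Lemma separated_closed (T : topologicalType) (A : set T) (E : bool -> set T) :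
  closed A -> A = E false `|` E true -> separated (E false) (E true) -> forall b, closed (E b).
Proof.
move=> clA AE [s1 s2] b.
have sub : closure (E b) `<=` A.
  rewrite [X in _ `<=` X](closure_id _).1//; apply: closureS.
  by rewrite AE; case: b; [right|left].
move=> p pE; have := sub _ pE; rewrite AE => hp.
clear sub; case: b pE => pE; case: hp => // h; exfalso.
  by have : (E false `&` closure (E true)) p by []; rewrite s2.
by have : (closure (E false) `&` E true) p by []; rewrite s1.
Qed.
Implicit Types (z w : R[i]).

Lemma cont_on_min (A : set R[i]) (f : R[i] -> R[i]) : compact A -> cont_on A f ->
    (forall z, A z -> f z != 0) ->
  exists2 m : R, 0 < m & forall z, A z -> m <= modulus (f z).
Proof.
move=> cA cf f0; apply: (compact_uniform cA) => [e e' z|z Az]; first exact: le_trans.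
have m0 : 0 < modulus (f z) / 2 by rewrite divr_gt0// modulus_gt0 f0.
exists (modulus (f z) / 2) => //; apply: filterS (cf _ Az _ m0) => w h /h.
by have := lerB_modulus (f z) (f w); rewrite modulusBC; lra.
Qed.

Lemma cont_on_unif (A : set R[i]) (f : R[i] -> R[i]) (e : R) : compact A -> cont_on A f -> 0 < e ->
  exists2 d : R, 0 < d &
    forall z, A z -> forall w, A w -> modulus (w - z) < d -> modulus (f w - f z) < e.
Proof.
move=> cA cf e0.
apply: (compact_uniform (P := fun d z => forall w, A w -> modulus (w - z) < d -> modulus (f w - f z) < e) cA).
  by move=> d d' z dd h w Aw wz; apply: h => //; exact: lt_le_trans dd.
move=> z Az; have e2 : 0 < e / 2 by rewrite divr_gt0.
have /nbhs_modulusP[d d0 hd] := cf _ Az _ e2.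
have d2 : 0 < d / 2 by rewrite divr_gt0.
exists (d / 2) => //; apply/nbhs_modulusP; exists (d / 2) => // y yz Ay w Aw wy.
have h1 := hd _ (lt_trans yz _) Ay.
have h2 : modulus (f w - f z) < e / 2.
  by apply: hd => //; have := modulus_triangle y w z; lra.
have {}h1 : modulus (f y - f z) < e / 2 by apply: h1; lra.
by have := modulus_triangle (f z) (f w) (f y); rewrite [modulus (f z - _)]modulusBC; lra.
Qed.

(** The maps [z -> f (k z / (N + 1))] join the constant [f 0] to f. For N large, consecutive ones
    differ by less than a lower bound of [|f|], and [has_sqrt_perturb] passes from each to the
    next. *)
Lemma has_sqrt_ball (r : R) (f : R[i] -> R[i]) : 0 < r ->
    cont_on [set z | modulus z <= r] f -> (forall z, modulus z <= r -> f z != 0) ->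
  has_sqrt [set z | modulus z <= r] f.
Proof.
move=> r0; set A := [set z | _] => cf f0; have cA : compact A by exact: closed_ball_modulus_compact.
have [m m0 hm] := cont_on_min cA cf f0.
have [d d0 hd] := cont_on_unif cA cf m0.
have [N hN] : exists N : nat, r / N.+1%:R < d.
  have := archi_boundP (divr_ge0 (ltW r0) (ltW d0)); set N := Num.bound _ => h.
  exists N; rewrite ltr_pdivrMr// mulrC -ltr_pdivrMr// (lt_trans h)// ltr_nat//.
pose c (k : nat) := k%:R / N.+1%:R : R.
have c01 k : (k <= N.+1)%N -> 0 <= c k <= 1.
  by move=> kN; rewrite divr_ge0//= ler_pdivrMr// mul1r ler_nat.
have cA' k z : (k <= N.+1)%N -> A z -> A ((c k)%:C%C * z).
  move=> /c01/andP[c0 c1] Az; rewrite /A/= modulusM modulus_real ger0_norm//.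
  by rewrite (le_trans _ Az)// ler_piMl ?modulus_ge0.
pose fk k z := f ((c k)%:C%C * z).
have cfk k : (k <= N.+1)%N -> cont_on A (fk k).
  move=> kN z Az e e0.
  have /nbhs_modulusP[h h0 hh] := cf _ (cA' k z kN Az) e e0.
  apply/nbhs_modulusP; exists h => // w wz Aw; apply: hh; last exact: cA'.
  have /andP[c0 c1] := c01 _ kN.
  by rewrite -mulrBr modulusM modulus_real ger0_norm// (le_lt_trans _ wz)// ler_piMl ?modulus_ge0.
suff : has_sqrt A (fk N.+1).
  by apply: has_sqrt_ext => z _; rewrite /fk /c mulfV ?pnatr_eq0// mul1r.
have : (N.+1 <= N.+1)%N by [].
elim: {-2}N.+1 => [_|k IH kN].
  apply: has_sqrt_ext (has_sqrt_cst A (f 0)) => z _.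
  by rewrite /fk /c mul0r mul0r.
apply: has_sqrt_perturb (cfk _ kN) (cfk _ (ltnW kN)) _ (IH (ltnW kN)) => z Az.
rewrite /fk (@lt_le_trans _ _ m)//; last by apply: hm; exact: cA' (ltnW kN) Az.
apply: hd; [exact: cA' (ltnW kN) Az|exact: cA'|].
rewrite -mulrBl -rmorphB modulusM modulus_real /c -mulrBl -natrB// subSnn.
rewrite ger0_norm ?divr_ge0// (le_lt_trans _ hN)// mulrC mulr1n mul1r ler_pM2r ?invr_gt0//.
Qed.

Lemma to_complex_pair_continuous (T : topologicalType) (g1 g2 : T -> R) :
  continuous g1 -> continuous g2 -> continuous (fun x => to_complex (g1 x, g2 x)).
Proof.
move=> c1 c2 x A /nbhs_modulusP[e e0 eA]; have e2 : 0 < e / 2 by rewrite divr_gt0.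
have /cvgrPdist_lt/(_ _ e2) h1 := c1 x; have /cvgrPdist_lt/(_ _ e2) h2 := c2 x.
apply: filterS2 h1 h2 => y h1 h2; apply: eA; apply: le_lt_trans (ler_modulus_ReIm _) _ => /=.
by rewrite [e]splitr ltrD// distrC.
Qed.

Lemma continuous_cont_on (T : topologicalType) (f : T -> R[i]) (A : set T) :
  continuous f -> cont_on A f.
Proof.
move=> cf x _ e e0; have : nbhs (f x) [set z | modulus (z - f x) < e].
  by apply/nbhs_modulusP; exists e.
move=> h; have h' : nbhs x (f @^-1` [set z | modulus (z - f x) < e]) := cf x _ h.
by apply: filterS h' => y h2 _.
Qed.

Lemma circle_connected (r : R) : 0 < r -> connected [set z : R[i] | modulus z = r].
Proof.
move=> r0; pose h (s : R) (x : R) : R[i] := to_complex (x, s * Num.sqrt (r ^+ 2 - x ^+ 2)).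
have hc s : connected (h s @` `[- r, r]).
  apply: connected_continuous_connected; first exact/connected_intervalP/interval_is_interval.
  apply: continuous_subspaceT; apply: to_complex_pair_continuous; first by move=> x; exact: cvg_id.
  move=> x; apply: cvgM; first exact: cvg_cst.
  apply: (@continuous_comp _ _ _ (fun x : R => r ^+ 2 - x ^+ 2)); last exact: sqrt_continuous.
  by apply: cvgB; [exact: cvg_cst|apply: exprn_continuous].
have -> : [set z : R[i] | modulus z = r] = (h 1 @` `[- r, r]) `|` (h (-1) @` `[- r, r]).
  apply/seteqP; split=> [[a b] /= ab|z].
    have abr : a ^+ 2 + b ^+ 2 = r ^+ 2 by rewrite -ab sqr_modulus.
    have ar : a \in `[- r, r].
      rewrite in_itv/= -ler_norml -ler_sqr ?nnegrE ?(ltW r0)// real_normK ?num_real//.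
      by rewrite -abr lerDl sqr_ge0.
    have bE : b ^+ 2 = r ^+ 2 - a ^+ 2 by rewrite -abr addrAC subrr add0r.
    have [b0|b0] := leP 0 b; [left|right]; exists a => //; rewrite /h /to_complex/= -bE sqrtr_sqr.
      by rewrite mul1r ger0_norm.
    by rewrite mulN1r ltr0_norm// opprK.
  have key (s x : R) : s ^+ 2 = 1 -> x \in `[- r, r] -> modulus (h s x) = r.
    move=> s1; rewrite in_itv/= -ler_norml => xr; apply/eqP.
    rewrite -(@eqrXn2 _ 2)// ?modulus_ge0 ?(ltW r0)// sqr_modulus /= exprMn s1 mul1r sqr_sqrtr.
      by rewrite addrCA subrr addr0.
    by rewrite subr_ge0 -[x ^+ 2]real_normK ?num_real// ler_sqr ?nnegrE ?(ltW r0).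
  by case=> -[x xr <-]; apply: key => //; rewrite ?sqrrN expr1n.
have rr : - r <= r by lra.
apply: connectedU => //; exists (r%:C)%C; split; exists r => //=;
  by rewrite ?in_itv/= ?lexx ?rr// /h subrr sqrtr0 mulr0.
Qed.

(** Outside a large disc F is close to its value at infinity, and on the disc [has_sqrt_ball]
    applies. On the connected circle between them the two roots differ by one global sign, and
    correcting this sign glues them. *)
Lemma sphere_has_sqrt (F : sphere R -> R[i]) : cont_on setT F -> (forall p, F p != 0) ->
  has_sqrt setT F.
Proof.
move=> cF F0.
have m0 : 0 < modulus (F (infinity R)) by rewrite modulus_gt0 F0.
have /nbhs_infinityP[_ [M MF]] := cF (infinity R) I _ m0.
pose r : R := `|M| + 1.
have r0 : 0 < r by rewrite ltr_wpDl.
have rM : M < r by rewrite (le_lt_trans (ler_norm _))// ltrDl.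
pose E : set (sphere R) := [set p | if p is Some z then r <= modulus z else True].
have [so cso soE] : has_sqrt E F.
  have cFE : cont_on E F by exact: cont_on_sub cF.
  apply: (@has_sqrt_perturb _ _ E F (fun=> F (infinity R)) cFE); [exact: cont_on_cst| |exact: has_sqrt_cst].
  move=> [z|] /= rz; last by rewrite subrr modulus0.
  by apply: MF => //; exact: lt_le_trans rz.
have [si csi siE] : has_sqrt [set z | modulus z <= r] (fun z => F (finite_point z)).
  apply: has_sqrt_ball => // z zr e e0.
  have /nbhs_finiteP[d d0 hd] := cF (finite_point z) I _ e0.
  by apply/nbhs_modulusP; exists d => // w wz _; apply: hd.
pose so' z := so (finite_point z).
have sgn : (forall z, modulus z = r -> si z = so' z) \/ (forall z, modulus z = r -> si z = - so' z).
  apply: (sqrt_sign (circle_connected r0)).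
  - by apply: cont_on_sub csi => z /= ->.
  - move=> z /= zr e e0; have Ez : E (finite_point z) by rewrite /E/= zr.
    have /nbhs_finiteP[d d0 hd] := cso _ Ez _ e0.
    by apply/nbhs_modulusP; exists d => // w wz wr; apply: hd => //; rewrite /E/= wr.
  - move=> z /= zr; apply/eqP => so0; have Ez : E (finite_point z) by rewrite /E/= zr.
    have := soE _ Ez; rewrite -/(so' z) so0 expr0n => /esym/eqP.
    by rewrite (negPf (F0 _)).
  - move=> z /= zr; rewrite siE/= ?zr// soE// /E/= zr//.
have [c c1 sc] : exists2 c : R[i], c ^+ 2 = 1 & forall z, modulus z = r -> si z = c * so' z.
  case: sgn => h; [exists 1|exists (-1)]; rewrite ?sqrrN ?expr1n// => z zr.
    by rewrite mul1r h.
  by rewrite mulN1r h.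
pose s p := if p is Some z then (if modulus z <= r then si z else c * so p) else c * so p.
have sE p : E p -> s p = c * so p.
  by case: p => [z|] //= rz; case: leP => // zr; apply: sc; apply/eqP; rewrite eq_le zr.
have cso' : cont_on E (fun p => c * so p) by apply: cont_onM => //; exact: cont_on_cst.
exists s; last first.
  move=> [z|] _ /=; last by rewrite exprMn c1 mul1r soE.
  case: leP => zr; first by rewrite siE.
  by rewrite exprMn c1 mul1r soE//= /E/= ltW.
have inn z : modulus z <= r -> forall e : R, 0 < e -> \forall q \near finite_point z,
    (if q is Some w then modulus w <= r else false) -> modulus (s q - s (finite_point z)) < e.
  move=> zr e e0; have /nbhs_modulusP[d d0 hd] := csi z zr e e0.
  apply/nbhs_finiteP; exists d => // w wz /= wr.
  by rewrite zr wr hd.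
have out p : E p -> forall e : R, 0 < e -> \forall q \near p, E q -> modulus (s q - s p) < e.
  by move=> Ep e e0; apply: filterS (cso' _ Ep _ e0) => q h Eq; rewrite !sE//; exact: h.
move=> [z|] _ e e0; last first.
  near=> q => _; have Eq : E q.
    near: q; apply/nbhs_infinityP; split => //; exists r => w; exact: ltW.
  by move: Eq; near: q; exact: (out (infinity R) I e e0).
have [zr|rz|zr] := ltgtP (modulus z) r.
- have := inn z (ltW zr) e e0; have : \forall q \near finite_point z, (if q is Some w then modulus w <= r else false).
    apply/nbhs_finiteP; exists (r - modulus z); first by rewrite subr_gt0.
    by move=> w wz /=; have := lerB_modulus w z; lra.
  by apply: filterS2 => q h1 h2 _; exact: h2.
- have := out (finite_point z) (ltW rz) e e0; have : \forall q \near finite_point z, E q.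
    apply/nbhs_finiteP; exists (modulus z - r); first by rewrite subr_gt0.
    by move=> w wz; rewrite /E/=; have := lerB_modulus z w; rewrite modulusBC; lra.
  by apply: filterS2 => q h1 h2 _; exact: h2.
- have Ez : E (finite_point z) by rewrite /E/= zr.
  have zr' : modulus z <= r by rewrite zr.
  have := inn z zr' e e0; have := out _ Ez e e0.
  apply: filterS2 => -[w|] h1 h2 _; last exact: h1.
  by have /orP[h|h] := le_total (modulus w) r; [exact: h2|exact: h1].
Unshelve. all: by end_near. Qed.

(* If [f = 0] and [f = 1] separate the intersection, the squares of [1 - f + i f]
   on [X] and of [1 - f - i f] on [Y] glue to a nonvanishing function. It has a
   continuous square root, whose signs on [X] and [Y] contradict each other. *)
Lemma unicoherence (X Y : set (sphere R)) : closed X -> closed Y -> connected X -> connected Y ->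
  X `|` Y = setT -> connected (X `&` Y).
Proof.
move=> clX clY cX cY XY; apply: contrapT => /connectedPn[E [Ene EU Esep]].
have clXY : closed (X `&` Y) by exact: closedI.
have Ecl := separated_closed clXY EU Esep.
have E0 : E false `&` E true = set0 by exact: separated_disjoint.
have nS : normal_space (sphere R) by exact: compact_normal sphere_hausdorff sphere_compact.
have [f [cf f0 f1 _]] := urysohn_ext_itv nS (Ecl false) (Ecl true) E0 (ltr01 : (0 : R) < 1).
have {}f0 p : E false p -> f p = 0 by move=> Ep; apply: f0; exists p.
have {}f1 p : E true p -> f p = 1 by move=> Ep; apply: f1; exists p.
pose rX p := to_complex (1 - f p, f p); pose rY p := to_complex (1 - f p, - f p).
have c1f : continuous (fun p => 1 - f p) by move=> p; exact: (cvgB (cvg_cst _) (cf p)).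
have cNf : continuous (fun p => - f p) by move=> p; exact: (cvgN (cf p)).
have crX : cont_on setT rX by exact/continuous_cont_on/to_complex_pair_continuous.
have crY : cont_on setT rY by exact/continuous_cont_on/to_complex_pair_continuous.
have rX0 p : rX p != 0.
  by rewrite /rX eq_complex/= negb_and subr_eq0; have [<-|//] := eqVneq 1 (f p); rewrite oner_eq0.
have rY0 p : rY p != 0.
  rewrite /rY eq_complex/= negb_and subr_eq0; have [<-|//] := eqVneq 1 (f p).
  by rewrite oppr_eq0 oner_eq0.
have rXY0 p : E false p -> rX p = rY p by move=> Ep; rewrite /rX /rY f0// oppr0.
have rXY1 p : E true p -> rX p = - rY p.
  by move=> Ep; rewrite /rX /rY f1// subrr /to_complex/=; apply/eqP; rewrite eq_complex/= opprK oppr0 !eqxx.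
have rXYsq p : X p -> Y p -> rX p ^+ 2 = rY p ^+ 2.
  move=> Xp Yp; have : (X `&` Y) p by []. rewrite EU => -[Ep|Ep].
    by rewrite rXY0.
  by rewrite rXY1// sqrrN.
pose F p := if pselect (X p) then rX p ^+ 2 else rY p ^+ 2.
have FX p : X p -> F p = rX p ^+ 2 by rewrite /F; case: pselect.
have FY p : Y p -> F p = rY p ^+ 2 by rewrite /F; case: pselect => // Xp Yp; exact: rXYsq.
have cX2 : cont_on setT (fun p => rX p ^+ 2) by exact: cont_onM.
have cY2 : cont_on setT (fun p => rY p ^+ 2) by exact: cont_onM.
have part (Z : set (sphere R)) r p (e : R) : closed Z -> cont_on setT r -> (forall p, Z p -> F p = r p) -> 0 < e ->
    \forall q \near p, Z q -> modulus (F q - F p) < e.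
  move=> clZ cr' FZ e0; case: (pselect (Z p)) => Zp.
    by apply: filterS (cr' p I e e0) => q h Zq; rewrite !FZ//; exact: h.
  have : \forall q \near p, (~` Z) q by apply: open_nbhs_nbhs; split => //; exact: closed_openC.
  by apply: filterS.
have cF : cont_on setT F.
  move=> p _ e e0; apply: filterS2 (part X _ p e clX cX2 FX e0) (part Y _ p e clY cY2 FY e0) => q hX hY _.
  by have : setT q by []; rewrite -XY => -[]; [exact: hX|exact: hY].
have F0 p : F p != 0.
  by have : setT p by []; rewrite -XY => -[h|h]; [rewrite FX//|rewrite FY//]; rewrite expf_eq0/=.
have [s cs sF] := sphere_has_sqrt cF F0.
have sgX := sqrt_sign cX (cont_on_sub (@subsetT _ X) cs) (cont_on_sub (@subsetT _ X) crX) (fun p _ => rX0 p)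
  (fun p Xp => etrans (sF p I) (FX p Xp)).
have sgY := sqrt_sign cY (cont_on_sub (@subsetT _ Y) cs) (cont_on_sub (@subsetT _ Y) crY) (fun p _ => rY0 p)
  (fun p Yp => etrans (sF p I) (FY p Yp)).
have [p0 Ep0] := Ene false; have [p1 Ep1] := Ene true.
have [Xp0 Yp0] : (X `&` Y) p0 by rewrite EU; left.
have [Xp1 Yp1] : (X `&` Y) p1 by rewrite EU; right.
have absurd (z : R[i]) : z != 0 -> z = - z -> False.
  by move=> z0 /eqP; rewrite -addr_eq0 -mulr2n mulrn_eq0/= (negPf z0).
case: sgX sgY => hX [] hY.
- by have := hX _ Xp1; rewrite hY// rXY1// => /(absurd _ (rY0 p1)).
- by have := hX _ Xp0; rewrite hY// rXY0// => /esym/(absurd _ (rY0 p0)).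
- by have := hX _ Xp0; rewrite hY// rXY0// => /(absurd _ (rY0 p0)).
- by have := hX _ Xp1; rewrite hY// rXY1// opprK => /esym/(absurd _ (rY0 p1)).
Qed.

End Unicoherence.

(** * Connected Julia sets *)

Section Connectedness.
Context {R : realType}.

(** If the intersection splits into two closed parts, disjoint open sets contain these; by
    compactness some [L n] already lies in the union of the open sets and meets both. *)
Lemma nested_connected (L : nat -> set (sphere R)) : (forall n, closed (L n)) ->
    (forall n, connected (L n)) -> (forall n, L n.+1 `<=` L n) ->
  connected (\bigcap_n L n).
Proof.
move=> clL cL decL; apply: contrapT => /connectedPn[E [Ene EU Esep]].
have clB : closed (\bigcap_n L n) by apply: closed_bigI => n _; exact: clL.
have clE := separated_closed clB EU Esep.
have nS : normal_space (sphere R) by exact: compact_normal sphere_hausdorff sphere_compact.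
have [U [V [oU oV EU0 EV1 UV]]] := (@normal_openP R (sphere R)).1 nS _ _ (clE false) (clE true) (separated_disjoint Esep).
have mon m n : (m <= n)%N -> L n `<=` L m.
  by move=> /subnK <-; elim: (n - m)%N => [//|k IH]; rewrite addSn; exact: subset_trans (decL _) IH.
have : \forall n \near \oo, [set: sphere R] `<=` (fun p => L n p -> (U `|` V) p).
  apply: (compact_near_coveringP _).1; first exact: sphere_compact.
  move=> p _; case: (pselect ((\bigcap_n L n) p)) => [Lp|].
    exists (U `|` V, setT); last by case=> q n /= [].
    split; last exact: filterT.
    apply: open_nbhs_nbhs; split; first exact: openU.
    by move: Lp; rewrite EU => -[/EU0|/EV1]; [left|right].
  move=> /existsNP[m /not_implyP[_ Lmp]].
  exists (~` L m, [set n | (m <= n)%N]).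
    split=> /=; last by exists m.
    by apply: open_nbhs_nbhs; split => //; exact: closed_openC.
  by case=> q n /= [nLq /mon mn] /mn.
move=> [n _ /(_ n (leqnn n)) nUV].
have [p0 Ep0] := Ene false; have [p1 Ep1] := Ene true.
have L0 : L n p0 by have : (\bigcap_n L n) p0 by [rewrite EU; left]; exact.
have L1 : L n p1 by have : (\bigcap_n L n) p1 by [rewrite EU; right]; exact.
have disj q : U q -> V q -> False by move=> Uq Vq; have : (U `&` V) q by []; rewrite UV.
have hP q : L n q -> U q -> \forall q' \near q, L n q' -> U q'.
  by move=> _ Uq; apply: (@filterS _ _ (nbhs_filter q) _ _ _ (open_nbhs_nbhs (conj oU Uq))).
have hN q : L n q -> ~ U q -> \forall q' \near q, L n q' -> ~ U q'.
  move=> Lq nUq; have Vq : V q by case: (nUV q I Lq).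
  apply: (@filterS _ _ (nbhs_filter q) _ _ _ (open_nbhs_nbhs (conj oV Vq))).
  by move=> q' Vq' _ Uq'; exact: disj Uq' Vq'.
have [h|h] := connected_dichotomy (cL n) hP hN.
  by apply: (disj _ (h _ L1)); exact: EV1.
by apply: (h _ L0); exact: EU0.
Qed.

(** As f is open and closed, a nonempty clopen part of the preimage is mapped onto X and so contains
    a preimage of [f a]. The only one is a, so two disjoint parts cannot exist. *)
Lemma connected_preimage (f : sphere R -> sphere R) (X : set (sphere R)) a : continuous f ->
    (forall A, open A -> open (f @` A)) -> connected X -> X (f a) ->
    (forall b, f b = f a -> b = a) ->
  connected (f @^-1` X).
Proof.
move=> cf fop cX Xv a_uniq B; case=> b0 Bb0; case=> S4 oO BO; case=> S3 clC BC.
have fO (D S : set (sphere R)) : D = f @^-1` X `&` S -> f @` D = X `&` f @` S.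
  move=> ->; apply/seteqP; split=> y; [case=> p [Xp Sp] <-|case=> Xp [p Sp E]; move: Xp; rewrite -E => Xp].
    by split=> //; exists p.
  by exists p.
have full (D : set (sphere R)) : D !=set0 -> (exists2 S, open S & D = f @^-1` X `&` S) ->
    (exists2 S, closed S & D = f @^-1` X `&` S) -> D a.
  move=> [d Dd] [S1 oS1 DS1] [S2 clS2 DS2].
  have E : f @` D = X.
    apply: cX; first by exists (f d), d.
    - by exists (f @` S1); [exact: fop|exact: fO].
    - by exists (f @` S2); [exact: continuous_sphere_closed_map|exact: fO].
  by move: Xv; rewrite -E => -[b Db /a_uniq <-].
have Ba : B a by apply: full; [exists b0|exists S4|exists S3].
apply: contrapT => neq.
have : (f @^-1` X `\` B) a; last by case.
apply: full.
- apply: contrapT => /set0P/negP/negPn/eqP h; apply: neq; apply/seteqP; split=> p.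
    by rewrite BO => -[].
  move=> Xp; apply: contrapT => nB; have : (f @^-1` X `\` B) p by [].
  by rewrite h.
- exists (~` S3); first exact: closed_openC.
  by rewrite BC; apply/seteqP; split=> p [Xp h]; split=> //; [move=> Cp; apply: h|move=> []].
- exists (~` S4); first exact: open_closedC.
  by rewrite BO; apply/seteqP; split=> p [Xp h]; split=> //; [move=> Cp; apply: h|move=> []].
Qed.

End Connectedness.

(** * Normal families and the set absorbed by a trap near infinity *)

Section Normality.
Context {R : realType}.
Variable f : sphere R -> sphere R.
Hypothesis cf : continuous f.
Implicit Types (p q : sphere R).

Definition equicontinuous_at p := forall e : R, 0 < e ->
  \forall q \near p, forall n, chordal (iter n f q) (iter n f p) < e.

Lemma iter_continuous n : continuous (iter n f).
Proof.
elim: n => [|n IH] p /=; first exact: cvg_id.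
by apply: continuous_comp; [exact: IH|exact: cf].
Qed.

Lemma chordal_ultralimit (T : Type) (G : set_system T) (u : T -> sphere R) : UltraFilter G ->
  exists h, forall e : R, 0 < e -> G [set m | chordal (u m) h < e].
Proof.
move=> UG; have PG : ProperFilter G by exact: ultra_proper.
have [h [_ hcl]] := @sphere_compact R (u @ G) _ (filterT : (u @ G) setT).
exists h => e e0; have [//|GC] := in_ultra_setVsetC [set m | chordal (u m) h < e] UG.
have [q [q1 q2]] := hcl [set q | ~ (chordal q h < e)] _ GC (chordal_continuous h e0).
by [].
Qed.

(* Pointwise limits along an ultrafilter are locally uniform by equicontinuity,
   which replaces the diagonal argument of Arzela-Ascoli. *)
Lemma equicontinuous_normal p : (\forall q \near p, equicontinuous_at q) -> Fatou_set f p.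
Proof.
move=> eq_p.
have [N Np Ncl] := compact_regular sphere_hausdorff sphere_compact (filterT : nbhs p setT) eq_p.
exists N°; split; [exact: open_interior|exact: nbhs_singleton (nbhs_interior Np)|].
move=> nu.
have [G [UG ooG]] := @ultraFilterLemma nat \oo _.
pose F m := iter (nu m) f.
have [h hlim] : exists h : sphere R -> sphere R, forall q (e : R), 0 < e -> G [set m | chordal (F m q) (h q) < e].
  have := fun q => chordal_ultralimit (fun m => F m q) UG.
  by move=> /choice[h hh]; exists h.
have clN : compact (closure N) by apply: closed_sphere_compact; exact: closed_closure.
have unif (e : R) : 0 < e -> G [set m | forall q, closure N q -> chordal (F m q) (h q) < e].
  move=> e0; have e8 : 0 < e / 8 by rewrite divr_gt0.
  have := (compact_near_coveringP _).1 clN nat G (fun m q => chordal (F m q) (h q) < e) _.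
  apply => q /Ncl eq_q.
  exists ([set q' | forall n, chordal (iter n f q') (iter n f q) < e / 8],
          [set m | chordal (F m q) (h q) < e / 8]).
    by split => /=; [exact: eq_q|exact: hlim].
  case=> q' m /= [h1 h2].
  (* A common index at which both limits are approximated bounds the distance from [h q] to
     [h q']. *)
  have [m' [h3 h4]] := filter_ex (filterI (hlim q _ e8) (hlim q' _ e8)).
  have t1 := chordal_triangle (F m q) (F m q') (h q').
  have t2 := chordal_triangle (h q) (F m q) (h q').
  have t3 := chordal_triangle (F m' q) (h q) (h q').
  have t4 := chordal_triangle (F m' q') (F m' q) (h q').
  have := h1 (nu m); have := h1 (nu m'); rewrite -/(F m q') -/(F m q) -/(F m' q') -/(F m' q).
  rewrite /= in h2 h3 h4; rewrite [chordal (h q) (F m' q)]chordalC in t3; rewrite (chordalC (F m' q) (F m' q')) in t4.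
  by move=> h5 h6; lra.
(* Members of G contain arbitrarily large indices, so an increasing sequence of indices with errors
   below [1 / (j + 1)] can be chosen. *)
have step j k0 : exists m, (k0 < m)%N /\ forall q, closure N q -> chordal (F m q) (h q) < j.+1%:R^-1.
  have j0 : (0 : R) < j.+1%:R^-1 by rewrite invr_gt0.
  have Gk : G [set m | (k0 < m)%N] by apply: ooG; exists k0.+1.
  have [m [km hm]] := filter_ex (filterI Gk (unif _ j0)).
  by exists m.
pose g j k0 := projT1 (cid (step j k0)).
pose k := fix k j := if j is j'.+1 then g j (k j') else g 0%N 0%N.
have gP j k0 := projT2 (cid (step j k0)).
have kP j q : closure N q -> chordal (F (k j) q) (h q) < j.+1%:R^-1.
  by case: j => [|j]; exact: (gP _ _).2.
exists k, h; split.
  by apply: homo_ltn => [m n o|j]; [exact: ltn_trans|exact: (gP j.+1 (k j)).1].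
move=> A cA AN e e0.
near=> m => q Aq; rewrite (lt_trans (kP m q _))//.
  by apply: subset_closure; exact: interior_subset (AN _ Aq).
near: m; exact: near_infty_natSinv_lt (PosNum e0).
Unshelve. all: by end_near. Qed.

Variable H : set (sphere R).
Hypotheses (oH : open H) (fH : forall p, H p -> H (f p)).
Hypothesis Hconv : forall e : R, 0 < e ->
  exists n0, forall n p, (n0 <= n)%N -> H p -> chordal (iter n f p) (infinity R) < e.

(** Common to both families: H is the exterior of a disc for quadratic polynomials and an attracting
    half-plane for [gmap b]. Infinity belongs to the first trap and not to the second. *)
Definition absorbed : set (sphere R) := [set p | exists n, H (iter n f p)].

Lemma iterH n p : H p -> H (iter n f p).
Proof. by elim: n => // n IH Hp /=; apply/fH/IH. Qed.

Lemma absorbed_open : open absorbed.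
Proof.
rewrite openE => p [n Hn]; have := @iter_continuous n p _ (open_nbhs_nbhs (conj oH Hn)).
move=> h; have : nbhs p absorbed by apply: (@filterS _ _ (nbhs_filter p) _ _ _ h) => q Hq; exists n.
by [].
Qed.

Lemma absorbed_f p : absorbed (f p) <-> absorbed p.
Proof.
split=> [[n Hn]|[n Hn]]; first by exists n.+1; rewrite iterSr.
by exists n; rewrite -iterSr /=; exact: fH.
Qed.

Lemma absorbed_iter n p : absorbed (iter n f p) <-> absorbed p.
Proof. by elim: n => //= n IH; rewrite absorbed_f. Qed.

Lemma absorbed_chordal p (e : R) : absorbed p -> 0 < e ->
  exists n0, forall n, (n0 <= n)%N -> chordal (iter n f p) (infinity R) < e.
Proof.
move=> [N HN] /Hconv[n0 h]; exists (n0 + N)%N => n hn.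
have -> : n = (n - N + N)%N by rewrite subnK//; lia.
by rewrite iterD; apply: h => //; lia.
Qed.

Lemma absorbed_equicontinuous p : absorbed p -> equicontinuous_at p.
Proof.
move=> [N HN] e e0; have e2 : 0 < e / 2 by rewrite divr_gt0.
have [n0 h] := Hconv e2.
have fin m : \forall q \near p, forall n, (n < m)%N -> chordal (iter n f q) (iter n f p) < e.
  elim: m => [|m IH]; first by apply: (@filterS _ _ (nbhs_filter p) _ _ _ filterT) => q _ n; rewrite ltn0.
  have := @iter_continuous m p _ (chordal_continuous (iter m f p) e0).
  apply: filterS2 IH => q h1 h2 n; rewrite ltnS leq_eqVlt => /orP[/eqP->//|]; exact: h1.
have nN := @iter_continuous N p _ (open_nbhs_nbhs (conj oH HN)).
apply: filterS2 (fin (n0 + N)%N) nN => q h1 h2 n.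
case: (ltnP n (n0 + N)) => hn; first exact: h1.
have hE : n = (n - N + N)%N by rewrite subnK//; lia.
have n0n : (n0 <= n - N)%N by lia.
rewrite hE !iterD (le_lt_trans (chordal_triangle (infinity R) _ _))//.
by rewrite [chordal (infinity R) _]chordalC [e]splitr ltrD// h.
Qed.

Lemma absorbed_Fatou : absorbed `<=` Fatou_set f.
Proof.
move=> p Wp; apply: equicontinuous_normal.
apply: filterS (open_nbhs_nbhs (conj absorbed_open Wp)) => q.
exact: absorbed_equicontinuous.
Qed.

(** If the orbit of p were far from infinity at infinitely many times, a uniform limit along these
    times would be far from infinity at p, yet close to it at absorbed points arbitrarily near p. *)
Lemma boundary_Fatou p : closure absorbed p -> Fatou_set f p -> forall e : R, 0 < e ->
  exists n0, forall n, (n0 <= n)%N -> chordal (iter n f p) (infinity R) < e.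
Proof.
move=> clp [U [oU Up Unorm]] e e0; apply: contrapT => nex.
have e8 : 0 < e / 8 by rewrite divr_gt0.
have step n0 : exists n, (n0 <= n)%N /\ e <= chordal (iter n f p) (infinity R).
  apply: contrapT => h; apply: nex; exists n0 => n hn; rewrite ltNge; apply/negP => he.
  by apply: h; exists n.
have [nu nuP] := choice step.
have [k [h [kmon hconv]]] := Unorm nu.
have kge m : (m <= k m)%N.
  by elim: m => // m IH; rewrite (leq_ltn_trans IH)// kmon.
have [N Np Ncl] := compact_regular sphere_hausdorff sphere_compact (filterT : nbhs p setT)
  (open_nbhs_nbhs (conj oU Up)).
have clN : compact (closure N) by apply: closed_sphere_compact; exact: closed_closure.
have := hconv _ clN Ncl _ e8 => -[m0 _ hm0].
have [nun nue] := nuP (k m0).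
have h1 q : closure N q -> chordal (iter (nu (k m0)) f q) (h q) < e / 8.
  by apply: hm0; exact: leqnn.
have nb := @filterI _ _ (nbhs_filter p) _ _ Np (@iter_continuous (nu (k m0)) p _ (chordal_continuous (iter (nu (k m0)) f p) e8)).
have [q [Wq [Nq hq]]] := clp _ nb.
have cNq : closure N q by exact: subset_closure.
have [n1 hn1] := absorbed_chordal Wq e8.
have hq2 : chordal (iter (nu (k (m0 + n1)%N)) f q) (h q) < e / 8.
  by apply: hm0 => //=; exact: leq_addr.
have hq3 : chordal (iter (nu (k (m0 + n1)%N)) f q) (infinity R) < e / 8.
  apply: hn1; apply: leq_trans (nuP _).1; apply: leq_trans (kge _); exact: leq_addl.
have t1 := chordal_triangle (iter (nu (k m0)) f q) (iter (nu (k m0)) f p) (infinity R).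
have t2 := chordal_triangle (h q) (iter (nu (k m0)) f q) (infinity R).
have t3 := chordal_triangle (iter (nu (k (m0 + n1)%N)) f q) (h q) (infinity R).
rewrite [chordal (iter _ f p) (iter _ f q)]chordalC in t1.
rewrite [chordal (h q) (iter _ f q)]chordalC in t3.
rewrite /= in hq; have := h1 _ cNq; lra.
Qed.

Lemma Julia_boundary :
    (forall p, (~` absorbed)° p -> equicontinuous_at p) ->
    (forall p, ~ absorbed p -> closure absorbed p -> ~ Fatou_set f p) ->
  Julia_set f = closure absorbed `&` ~` absorbed.
Proof.
move=> Keq Kn; apply/seteqP; split=> p; last by case=> clp Wp; exact: Kn.
move=> Jp; have nW : ~ absorbed p by move=> /absorbed_Fatou.
split=> //; apply: contrapT => ncl; apply: Jp; apply: equicontinuous_normal.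
have : nbhs p (~` closure absorbed).
  by apply: open_nbhs_nbhs; split => //; apply: closed_openC; exact: closed_closure.
move=> h; have : nbhs p (~` absorbed) by apply: filterS h => q h2 /subset_closure.
move=> /nbhs_interior; apply: filterS => q; exact: Keq.
Qed.

(** The Julia set is the intersection of the closure of the absorbed set with the complement of that
    set. Both are closed and connected, and they cover the sphere, so unicoherence applies. *)
Lemma Julia_connected :
    (forall p, (~` absorbed)° p -> equicontinuous_at p) ->
    (forall p, ~ absorbed p -> closure absorbed p -> ~ Fatou_set f p) ->
    connected absorbed -> connected (~` absorbed) ->
  connected (Julia_set f).
Proof.
move=> Keq Kn cW cK; rewrite Julia_boundary//; apply: unicoherence.
- exact: closed_closure.
- by apply: open_closedC; exact: absorbed_open.
- exact: connected_closure.
- exact: cK.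
- apply/seteqP; split=> // p _; case: (pselect (absorbed p)) => h; [left|by right].
  exact: subset_closure.
Qed.

Hypothesis fo : forall A : set (sphere R), open A -> open (f @` A).

(** The complement is the decreasing intersection of the iterated preimages of the complement of H.
    The critical point a, the only preimage of its value, keeps each of them connected. *)
Lemma nonabsorbed_connected a : connected (~` H) -> ~ absorbed (f a) ->
  (forall b, f b = f a -> b = a) -> connected (~` absorbed).
Proof.
move=> cH nW uniq.
have -> : ~` absorbed = \bigcap_n (iter n f @^-1` (~` H)).
  apply/seteqP; split=> p h; first by move=> n _ Hn; apply: h; exists n.
  by move=> [n Hn]; exact: (h n I).
apply: nested_connected.
- by move=> n; apply: preimage_closed; [move=> p _; exact: iter_continuous|exact: open_closedC].
- elim=> [|n IH]; first by [].
  have -> : iter n.+1 f @^-1` (~` H) = f @^-1` (iter n f @^-1` (~` H)).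
    by apply/seteqP; split=> p; rewrite /preimage/= -iterS iterSr.
  by apply: connected_preimage IH _ uniq => // Hn; apply: nW; exists n.
- by move=> n p /= h Hn; apply: h; exact: fH.
Qed.

(* [X] need not be open: it is only a connected seed of the absorbed set. *)
Lemma absorbed_connected a (X : set (sphere R)) : connected X -> H `<=` X ->
    X `<=` absorbed -> (forall p, X p -> X (f p)) -> X (f a) -> (forall b, f b = f a -> b = a) ->
    X !=set0 ->
  connected absorbed.
Proof.
move=> cX HX XW fX Xa uniq [x0 Xx0].
have mon n p : X p -> X (iter n f p) by elim: n => //= n IH /IH; exact: fX.
have -> : absorbed = \bigcup_(n in setT) (iter n f @^-1` X).
  apply/seteqP; split=> p; first by move=> [n Hn]; exists n => //; exact: HX.
  by move=> [n _ /XW]; rewrite absorbed_iter.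
apply: bigcup_connected.
  by exists x0 => n _; exact: mon.
move=> n _; elim: n => [|n IH]; first by [].
have -> : iter n.+1 f @^-1` X = f @^-1` (iter n f @^-1` X).
  by apply/seteqP; split=> p; rewrite /preimage/= -iterS iterSr.
by apply: connected_preimage IH _ uniq => //; exact: mon.
Qed.

End Normality.

(** * Maps of the sphere and a criterion for equicontinuity *)

Section SphereMaps.
Context {R : realType}.
Implicit Types (z w a : R[i]) (p q : sphere R) (M r e : R).

Lemma real_complex_continuous : continuous (fun t : R => t%:C%C : R[i]).
Proof.
move=> t; apply/cvgrPdist_lt => e e0.
have e1 : 0 < modulus e by rewrite modulus_gt0 gt_eqF.
near=> s; rewrite -rmorphB/= normCE modulus_real.
have -> : e = (modulus e)%:C%C by rewrite -normCE gtr0_norm.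
rewrite ltcR; near: s; exact: (@cvgr_dist_lt _ _ _ (nbhs t) _ id t).
Unshelve. all: by end_near. Qed.

Lemma segment_connected z w : connected [set z + (t%:C)%C * (w - z) | t in [set t : R | 0 <= t <= 1]].
Proof.
apply: connected_continuous_connected.
  have -> : [set t : R | 0 <= t <= 1] = [set` `[0, 1]].
    by apply/seteqP; split=> t /=; rewrite in_itv.
  exact: segment_connected.
apply: continuous_subspaceT => t; apply: cvgD; first exact: cvg_cst.
by apply: cvgMr_tmp; exact: real_complex_continuous.
Qed.

Lemma star_connected (A : set R[i]) a : A a ->
  (forall z (t : R), A z -> 0 <= t <= 1 -> A (a + (t%:C)%C * (z - a))) -> connected A.
Proof.
move=> Aa star.
have -> : A = \bigcup_(z in A) [set a + (t%:C)%C * (z - a) | t in [set t : R | 0 <= t <= 1]].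
  apply/seteqP; split=> [z Az|z [w Aw [t t01 <-]]]; last exact: star.
  by exists z => //; exists 1; [rewrite /= ler01 lexx|rewrite mul1r addrC subrK].
apply: bigcup_connected; last by move=> *; exact: segment_connected.
by exists a => z Az; exists 0; [rewrite /= ler01 lexx|rewrite mul0r addr0].
Qed.

Lemma ball_connected a r : connected [set z | modulus (z - a) <= r].
Proof.
case: (ltP r 0) => r0.
  have -> : [set z | modulus (z - a) <= r] = set0.
    apply/seteqP; split=> // z /= h; have := modulus_ge0 (z - a); lra.
  exact: connected0.
apply: (@star_connected _ a); first by rewrite /= subrr modulus0.
move=> z t /= h /andP[t0 t1]; rewrite addrAC subrr add0r modulusM modulus_real ger0_norm//.
by have := ler_wpM2r (modulus_ge0 (z - a)) t1; lra.
Qed.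

Lemma finite_point_continuous : continuous (@finite_point R).
Proof.
move=> z A /nbhs_finiteP[r r0 h]; apply/nbhs_modulusP; exists r => // w /h; exact.
Qed.

Lemma finite_connected (A : set R[i]) : connected A -> connected (@finite_point R @` A).
Proof.
move=> cA; apply: connected_continuous_connected => //.
by apply: continuous_subspaceT; exact: finite_point_continuous.
Qed.

Lemma subV z w : z != 0 -> w != 0 -> z^-1 - w^-1 = (w - z) / (z * w).
Proof.
move=> z0 w0; apply: (canRL (mulfK _)); first by rewrite mulf_neq0.
by rewrite mulrBl mulKf// mulrCA mulVf// mulr1.
Qed.

Lemma sphere_inv_continuous : continuous (@sphere_inv R).
Proof.
move=> [z|] A /=; last first.
  move=> /(@nbhs_finiteP _ 0)[r r0 h]; apply/nbhs_infinityP; split.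
    by apply: h; rewrite subr0 modulus0.
  exists r^-1 => w hw; have w0 : w != 0 by rewrite -modulus_gt0 (lt_trans _ hw)// invr_gt0.
  rewrite /= /preimage/= (negbTE w0); apply: h; rewrite subr0 modulusV.
  by rewrite -[r]invrK ltf_pV2// posrE ?invr_gt0// modulus_gt0.
case: eqP => [->|/eqP z0].
  move=> /nbhs_infinityP[A1 [M hM]]; apply/(@nbhs_finiteP _ 0).
  exists (1 + `|M|)^-1; first by rewrite invr_gt0 ltr_pwDl.
  move=> w; rewrite subr0 /preimage/= => hw; case: eqP => // /eqP w0; apply: hM.
  have M0 : 0 < 1 + `|M| by rewrite ltr_pwDl.
  rewrite modulusV (@lt_trans _ _ (1 + `|M|))//; first by have := ler_norm M; lra.
  by rewrite -[1 + _]invrK ltf_pV2// posrE ?invr_gt0// modulus_gt0.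
move=> /nbhs_finiteP[r r0 h]; apply/nbhs_finiteP.
have zp : 0 < modulus z by rewrite modulus_gt0.
exists (Num.min (modulus z / 2) (r * (modulus z ^+ 2 / 2))).
  by rewrite lt_min !(divr_gt0, mulr_gt0, exprn_gt0).
move=> w; rewrite lt_min => /andP[h1 h2].
have wz : modulus z / 2 < modulus w.
  by have := lerB_modulus z w; rewrite modulusBC; lra.
have w0 : w != 0 by rewrite -modulus_gt0; lra.
rewrite /preimage/= (negbTE w0); apply: h.
rewrite subV// [w * z]mulrC.
rewrite modulusM modulusV modulusM modulusBC ltr_pdivrMr ?mulr_gt0 ?modulus_gt0//.
apply: lt_le_trans h2 _; rewrite ler_wpM2l ?(ltW r0)// expr2 -mulrA ler_wpM2l ?(ltW zp)//.
exact: ltW.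
Qed.

Definition exterior M : set (sphere R) := [set p | if p is Some z then M < modulus z else True].

Lemma exterior_open M : open (exterior M).
Proof.
rewrite openE => -[z|] /= h; last by apply/nbhs_infinityP; split=> //; exists M.
apply/nbhs_finiteP; exists (modulus z - M) => [|w hw]; first by rewrite subr_gt0.
by rewrite /=; have := lerB_modulus z w; rewrite modulusBC; lra.
Qed.

Lemma exterior_connected M : 0 < M -> connected (exterior M).
Proof.
move=> M0.
have -> : exterior M = sphere_inv (R := R) @` (@finite_point R @` [set z | modulus z < M^-1]).
  apply/seteqP; split=> [[z|]|_ [_ [z /= hz <-] <-]] /=.
  - move=> hz; have z0 : z != 0 by rewrite -modulus_gt0; lra.
    exists (finite_point z^-1); last by rewrite /= invr_eq0 (negbTE z0) invrK.
    exists z^-1 => //=; rewrite modulusV ltf_pV2// posrE ?modulus_gt0//.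
  - by move=> _; exists (finite_point 0); [exists 0 => //=; rewrite modulus0 invr_gt0|rewrite /= eqxx].
  - case: eqP => // /eqP z0 /=.
    by rewrite modulusV -[M]invrK ltf_pV2// posrE ?invr_gt0// modulus_gt0.
apply: connected_continuous_connected; last first.
  by apply: continuous_subspaceT; exact: sphere_inv_continuous.
apply: finite_connected; apply: (@star_connected _ 0); first by rewrite /= modulus0 invr_gt0.
move=> z t /= h /andP[t0 t1]; rewrite add0r subr0 modulusM modulus_real ger0_norm//.
by have := ler_wpM2r (modulus_ge0 z) t1; lra.
Qed.

Lemma exteriorC_connected M : connected (~` exterior M).
Proof.
have -> : ~` exterior M = @finite_point R @` [set z | modulus (z - 0) <= M].
  apply/seteqP; split=> [[z|]|_ [z /= hz <-]] /=; last by rewrite subr0 in hz; apply/negP; rewrite -leNgt.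
    by move=> /negP; rewrite -leNgt => h; exists z; rewrite /= ?subr0.
  by move=> /(_ I).
by apply: finite_connected; exact: (@ball_connected 0 M).
Qed.

(* A Moebius coordinate vanishing at infinity and with its pole at [a]. *)
Definition pole_chart a p : R[i] := if p is Some z then (z - a)^-1 else 0.

Lemma chordal_pole_chart a p q : p != finite_point a -> q != finite_point a ->
  chordal p q <= 2 * (1 + modulus a ^+ 2) * modulus (pole_chart a p - pole_chart a q).
Proof.
have key z : z != a -> modulus (z - a) <= stereo z * stereo a.
  by move=> _; exact: modulusB_stereo.
have key1 z : z != a -> 2 / stereo z <= 2 * (1 + modulus a ^+ 2) * modulus ((z - a)^-1).
  move=> za; rewrite -mulrA ler_wpM2l// modulusV -sqr_stereo.
  have h := key _ za; have s0 := stereo_gt0 z; have s1 := stereo_ge1 a.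
  rewrite ler_pdivlMr ?modulus_gt0 ?subr_eq0// mulrC ler_pdivrMr//.
  apply: le_trans h _; rewrite mulrC ler_wpM2r ?(ltW s0)// expr2; nra.
have ne z : finite_point z != finite_point a -> z != a by apply: contraNneq => ->.
case: p q => [z|] [w|] /=.
- move=> /ne za /ne wa.
  rewrite -[X in X <= _]/(chordal (finite_point z) (finite_point w)) chordal_finite.
  have := key _ za; have := key _ wa.
  have z0 : z - a != 0 by rewrite subr_eq0.
  have w0 : w - a != 0 by rewrite subr_eq0.
  have -> : (z - a)^-1 - (w - a)^-1 = (w - z) / ((z - a) * (w - a)) by rewrite subV//; congr (_ / _); ring.
  rewrite modulusM modulusV modulusM (modulusBC w z) => h1 h2.
  rewrite -!mulrA ler_wpM2l// mulrCA ler_wpM2l ?modulus_ge0//.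
  rewrite ler_pdivlMr ?mulr_gt0 ?modulus_gt0// mulrC ler_pdivrMr ?mulr_gt0 ?stereo_gt0//.
  apply: le_trans (ler_pM (modulus_ge0 _) (modulus_ge0 _) h2 h1) _.
  by rewrite -sqr_stereo le_eqVlt; apply/orP; left; apply/eqP; ring.
- by move=> /ne za _; rewrite -[X in X <= _]/(chordal (finite_point z) (infinity R)) chordal_finite_infinity subr0; exact: key1.
- by move=> _ /ne za; rewrite -[X in X <= _]/(chordal (finite_point w) (infinity R)) chordal_finite_infinity sub0r modulusN; exact: key1.
- by rewrite subrr modulus0 mulr0.
Qed.

Definition frac_point (P Q : {poly R[i]}) z : sphere R :=
  if Q.[z] == 0 then infinity R else finite_point (P.[z] / Q.[z]).

(** Takes the place of Montel's theorem for iterates that omit a disc about a: in the chart with its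
    pole at a they are fractions bounded by [d^-1], for which [frac_lipschitz] gives a constant
    independent of n. *)
Lemma frac_equicontinuous (f : sphere R -> sphere R) (P Q : nat -> {poly R[i]}) z0 r a d :
    (forall n z, iter n f (finite_point z) = frac_point (P n) (Q n) z) ->
    (forall n z, (Q n).[z] = 0 -> (P n).[z] != 0) -> 0 < r -> 0 < d ->
    (forall n z w, modulus (z - z0) <= r -> iter n f (finite_point z) = finite_point w ->
       d <= modulus (w - a)) ->
  equicontinuous_at f (finite_point z0).
Proof.
move=> itE PQ r0 d0 far.
have nz n z : modulus (z - z0) <= r -> (P n - a *: Q n).[z] != 0.
  move=> hz; rewrite hornerD hornerN hornerZ subr_eq0; apply/eqP => E.
  have [Q0|Q0] := eqVneq (Q n).[z] 0.
    by have := PQ _ _ Q0; rewrite E Q0 mulr0 eqxx.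
  have := far n z a hz; rewrite itE /frac_point (negbTE Q0) E mulfK// => /(_ erefl).
  by rewrite subrr modulus0; lra.
have chartE n z : modulus (z - z0) <= r ->
    pole_chart a (iter n f (finite_point z)) = (Q n).[z] / (P n - a *: Q n).[z].
  move=> hz; have := nz n z hz; rewrite itE /frac_point hornerD hornerN hornerZ.
  have [Q0|Q0] := eqVneq (Q n).[z] 0 => nz0 /=; first by rewrite Q0 mul0r.
  rewrite [RHS](_ : _ = (((P n).[z] - a * (Q n).[z]) / (Q n).[z])^-1); last by rewrite invf_div.
  by rewrite mulrBl mulfK.
have bd n z : modulus (z - z0) <= r -> modulus ((Q n).[z] / (P n - a *: Q n).[z]) <= d^-1.
  move=> hz; rewrite -chartE//.
  have := far n z; case: (iter n f _) => [w|] /= h; last by rewrite modulus0 invr_ge0 ltW.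
  have dw := h w hz erefl; rewrite modulusV lef_pV2// posrE//; exact: lt_le_trans dw.
have ne n z : modulus (z - z0) <= r -> iter n f (finite_point z) != finite_point a.
  move=> hz; apply/eqP => E; have := far n z a hz E; rewrite subrr modulus0; lra.
move=> e e0.
pose C := 2 * (1 + modulus a ^+ 2) * (72 * d^-1 / r).
have C0 : 0 < C by rewrite !mulr_gt0 ?invr_gt0// ltr_pwDl// sqr_ge0.
apply/nbhs_finiteP; exists (Num.min (r / 2) (e / C)); first by rewrite lt_min !divr_gt0.
move=> w; rewrite lt_min => /andP[w1 w2] n.
have r2 : r / 2 <= r by lra.
have w3 : modulus (w - z0) <= r by lra.
have z3 : modulus (z0 - z0) <= r by rewrite subrr modulus0 ltW.
apply: le_lt_trans (chordal_pole_chart (ne n w w3) (ne n z0 z3)) _.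
rewrite !chartE//.
have d1 : 0 < d^-1 by rewrite invr_gt0.
have := @frac_lipschitz R z0 r (Q n) (P n - a *: Q n) d^-1 w r0 d1 (nz n) (bd n) (ltW w1).
move=> h; apply: le_lt_trans (_ : C * modulus (w - z0) < e); last by rewrite mulrC -ltr_pdivlMr.
have k0 : 0 <= 2 * (1 + modulus a ^+ 2) by rewrite mulr_ge0// addr_ge0// sqr_ge0.
apply: le_trans (ler_wpM2l k0 h) _; rewrite /C.
by rewrite le_eqVlt; apply/orP; left; apply/eqP; ring.
Qed.

End SphereMaps.

(** * Quadratic polynomials *)

Section Quadratic.
Context {R : realType}.
Implicit Types (z w a c : R[i]) (p q : sphere R) (M r e : R).

(** The distances from [z0] to the two square roots of w have the product [|w - z0 ^+ 2|], so one of
    them is below e. *)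
Lemma near_sqrt z0 w e : 0 < e -> modulus (w - z0 ^+ 2) < e ^+ 2 ->
  exists2 z, z ^+ 2 = w & modulus (z - z0) < e.
Proof.
move=> e0 h; pose s := sqrtC w; have sE : s ^+ 2 = w by exact: sqrtCK.
have E : (s - z0) * (s + z0) = w - z0 ^+ 2 by rewrite -sE; ring.
move: h; rewrite -E modulusM => h.
have [h1|h1] := ltP (modulus (s - z0)) e; first by exists s.
exists (- s); first by rewrite sqrrN.
rewrite -opprD modulusN ltNge; apply/negP => h2.
have := ler_pM (ltW e0) (ltW e0) h1 h2; rewrite -expr2; lra.
Qed.

Lemma quad_sphere_continuous c : continuous (quad_sphere c).
Proof.
move=> [z|] A.
  move=> /(@nbhs_finiteP _ (quad c z))[r r0 h].
  have [d d0 hd] := @poly_continuous R ('X ^+ 2 + c%:P) z (r / 2) (divr_gt0 r0 (ltr0n _ 2)).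
  apply/nbhs_finiteP; exists d => // w /ltW/hd; rewrite !hornerE => hw.
  apply: (h (quad c w)); rewrite /quad; lra.
move=> /nbhs_infinityP[A1 [M hM]]; apply/nbhs_infinityP; split=> //.
exists (1 + `|M| + modulus c) => w hw; apply: hM; rewrite /quad.
have := lerB_modulusD (w ^+ 2) c; rewrite modulusX expr2.
have := modulus_ge0 c; have := normr_ge0 M; have := ler_norm M; nra.
Qed.

Lemma open_mapP (f : sphere R -> sphere R) :
  (forall p A, nbhs p A -> nbhs (f p) (f @` A)) -> forall A, open A -> open (f @` A).
Proof.
move=> h A oA; rewrite openE => _ [p Ap <-].
by apply: h; apply: open_nbhs_nbhs.
Qed.

Lemma quad_sphere_open c (A : set (sphere R)) : open A -> open (quad_sphere c @` A).
Proof.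
apply: open_mapP => -[z|] B /=.
  move=> /nbhs_finiteP[r r0 h]; apply/(@nbhs_finiteP _ (quad c z)).
  exists (r ^+ 2) => [|w hw]; first by rewrite exprn_gt0.
  have [|s sE hs] := @near_sqrt z (w - c) r r0.
    by move: hw; rewrite /quad; congr (modulus _ < _); ring.
  by exists (finite_point s); [exact: h|rewrite /= /quad sE subrK].
move=> /nbhs_infinityP[A1 [M hM]]; apply/nbhs_infinityP; split.
  by exists (infinity R).
exists (`|M| ^+ 2 + modulus c) => w hw.
exists (finite_point (sqrtC (w - c))); last by rewrite /= /quad sqrtCK subrK.
apply: hM; apply: le_lt_trans (ler_norm M) _.
rewrite -(@ltr_pXn2r _ 2) ?nnegrE ?modulus_ge0// -modulusX sqrtCK.
by have := lerB_modulus w c; lra.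
Qed.

Lemma iter_quad_finite c n z :
  iter n (quad_sphere c) (finite_point z) = finite_point (iter n (quad c) z).
Proof. by elim: n => //= n ->. Qed.

Definition quad_poly c := fix P n : {poly R[i]} := if n is n'.+1 then P n' ^+ 2 + c%:P else 'X.

Lemma horner_quad_poly c n z : (quad_poly c n).[z] = iter n (quad c) z.
Proof. by elim: n => [|n IH] /=; rewrite ?hornerX// hornerD hornerC horner_exp IH. Qed.

Definition quad_exterior c := exterior (modulus c + 2).

Lemma quad_growth c z : modulus c + 2 <= modulus z -> 2 * modulus z <= modulus (quad c z).
Proof.
by move=> h; have := lerB_modulusD (z ^+ 2) c; rewrite modulusX expr2 /quad; have := modulus_ge0 c; nra.
Qed.

Lemma quad_exterior_f c p : quad_exterior c p -> quad_exterior c (quad_sphere c p).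
Proof.
case: p => [z|//]; rewrite /quad_exterior/exterior/= => h.
by have := quad_growth (ltW h); have := modulus_ge0 c; lra.
Qed.

Lemma iter_quad_growth c n z : modulus c + 2 <= modulus z ->
  2 ^+ n * modulus z <= modulus (iter n (quad c) z).
Proof.
move=> h; elim: n => [|n IH]; first by rewrite mul1r.
rewrite exprS -mulrA /=; have h2 : (1 : R) <= 2 ^+ n by rewrite exprn_ege1// ler1n.
have h3 : modulus z <= modulus (iter n (quad c) z).
  by apply: le_trans IH; rewrite ler_peMl// modulus_ge0.
by have := quad_growth (le_trans h h3); lra.
Qed.

Lemma exp2_large M : exists n, M < 2 ^+ n.
Proof.
exists (Num.bound `|M|); have h := archi_boundP (normr_ge0 M).
have h2 : (Num.bound `|M|)%:R <= (2 : R) ^+ (Num.bound `|M|).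
  by rewrite -natrX ler_nat ltnW// ltn_expl.
by apply: le_lt_trans (ler_norm M) _; apply: lt_le_trans h h2.
Qed.

Lemma chordal_infinity_lt z e : 0 < e -> 2 / e <= modulus z -> chordal (finite_point z) (infinity R) < e.
Proof.
move=> e0 h; rewrite chordal_finite_infinity.
rewrite ltr_pdivrMr ?stereo_gt0// mulrC -ltr_pdivrMr//; apply: le_lt_trans h _.
rewrite -(@ltr_pXn2r _ 2) ?nnegrE ?modulus_ge0 ?stereo_ge0// sqr_stereo; lra.
Qed.

Lemma quad_conv c e : 0 < e -> exists n0, forall n p, (n0 <= n)%N -> quad_exterior c p ->
  chordal (iter n (quad_sphere c) p) (infinity R) < e.
Proof.
move=> e0; have [n0 hn0] := exp2_large (2 / e); exists n0 => n [z|] hn; last first.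
  move=> _; have -> : iter n (quad_sphere c) (infinity R) = infinity R by elim: n {hn} => //= n ->.
  by rewrite chordal_refl.
move=> hz; have hz2 : modulus c + 2 < modulus z by [].
rewrite -/(finite_point z) iter_quad_finite; apply: chordal_infinity_lt => //.
apply: le_trans (iter_quad_growth n (ltW hz2)).
have h1 : (2 : R) ^+ n0 <= 2 ^+ n by rewrite ler_eXn2l// ltr1n.
have h2 : 1 <= modulus z by have := modulus_ge0 c; lra.
have h3 : 0 <= (2 : R) ^+ n by rewrite exprn_ge0.
by apply: le_trans (ltW hn0) _; apply: le_trans h1 _; rewrite ler_peMr.
Qed.

Notation quad_absorbed c := (absorbed (quad_sphere c) (quad_exterior c)).

Lemma quad_absorbedP c z : quad_absorbed c (finite_point z) <->
  exists n, modulus c + 2 < modulus (iter n (quad c) z).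
Proof. by split=> -[n hn]; exists n; move: hn; rewrite iter_quad_finite. Qed.

Lemma quad_nonabsorbedP c z : ~ quad_absorbed c (finite_point z) <->
  forall n, modulus (iter n (quad c) z) <= modulus c + 2.
Proof.
rewrite quad_absorbedP; split=> [h n|h [n]]; last by rewrite ltNge h.
by rewrite leNgt; apply/negP => hn; apply: h; exists n.
Qed.

Lemma filled_quadP c z : filled_quad c z <-> forall n, modulus (iter n (quad c) z) <= modulus c + 2.
Proof.
split=> [[M [Mr hM]] n|h]; last first.
  exists (modulus c + 2)%:C%C; split; first by rewrite complex_real.
  by move=> x hx _ [n _ <-]; rewrite /= normCE; apply: le_trans (ltW hx); rewrite lecR.
rewrite leNgt; apply/negP => hn.
pose M' : R := modulus M + 1.
have MM' : M < M'%:C%C.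
  by apply: le_lt_trans (real_ler_norm Mr) _; rewrite normCE ltcR /M' ltrDl.
have hb k : modulus (iter k (quad c) z) <= M'.
  by have := hM _ MM' (iter k (quad c) z); rewrite /= normCE lecR; apply; exists k.
have [k hk] := exp2_large M'.
have := iter_quad_growth k (ltW hn); rewrite -iterD => h1.
have h2 : 1 <= modulus (iter n (quad c) z) by have := modulus_ge0 c; lra.
have h3 : 0 <= (2 : R) ^+ k by rewrite exprn_ge0.
have := hb (k + n)%N; have := ler_peMr h3 h2; lra.
Qed.

Lemma filled_quadE c z : filled_quad c z <-> ~ quad_absorbed c (finite_point z).
Proof. by rewrite filled_quadP quad_nonabsorbedP. Qed.

Lemma quad_equicontinuous c p : (~` quad_absorbed c)° p -> equicontinuous_at (quad_sphere c) p.
Proof.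
case: p => [z|] hp; last first.
  have := nbhs_singleton hp; case; exists 0%N; exact: I.
have /nbhs_finiteP[r r0 hr] := hp.
(* Orbits starting near z keep their modulus at most [modulus c + 2], so they omit the unit disc
   about this point. *)
pose a : R[i] := (modulus c + 4)%:C%C.
apply: (@frac_equicontinuous R _ (quad_poly c) (fun=> 1) z (r / 2) a 1) => //.
- by move=> n w; rewrite iter_quad_finite /frac_point hornerE oner_eq0 divr1 horner_quad_poly.
- by move=> n w; rewrite hornerE => /eqP; rewrite oner_eq0.
- by rewrite divr_gt0.
move=> n w u hw E; have wr : modulus (w - z) < r by lra.
have /quad_nonabsorbedP/(_ n) := hr _ wr.
move: E; rewrite iter_quad_finite => -[->].
have := lerB_modulus a u; rewrite modulusBC {1}/a modulus_real ger0_norm; last by have := modulus_ge0 c; lra.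
lra.
Qed.

Lemma quad_not_Fatou c p : ~ quad_absorbed c p -> closure (quad_absorbed c) p ->
  ~ Fatou_set (quad_sphere c) p.
Proof.
move=> nW clp Fp; have e0 : 0 < 2 / (1 + (modulus c + 2)) by rewrite divr_gt0//; have := modulus_ge0 c; lra.
have [n0 /(_ n0 (leqnn _))] := boundary_Fatou (quad_sphere_continuous (c := c)) (@quad_conv c) clp Fp e0.
case: p nW {clp Fp} => [z|] nW; last by case: nW; exists 0%N; exact: I.
rewrite -/(finite_point z) iter_quad_finite => /chordal_infinity_modulus h.
move/quad_nonabsorbedP: nW => /(_ n0); rewrite leNgt h//; have := modulus_ge0 c; lra.
Qed.

Lemma quad_Julia c : Julia_set (quad_sphere c) = closure (quad_absorbed c) `&` ~` quad_absorbed c.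
Proof.
apply: Julia_boundary.
- exact: quad_sphere_continuous.
- exact: exterior_open.
- exact: quad_conv.
- exact: quad_equicontinuous.
- exact: quad_not_Fatou.
Qed.

Lemma quad_sphere_infinity c p : quad_sphere c p = quad_sphere c (infinity R) -> p = infinity R.
Proof. by case: p. Qed.

Lemma quad_sphere_0 c p : quad_sphere c p = quad_sphere c (finite_point 0) -> p = finite_point 0.
Proof. by case: p => [z|//] [] /addIr; rewrite expr0n/= => /eqP; rewrite sqrf_eq0 => /eqP ->. Qed.

Lemma quad_exterior_connected c : connected (quad_exterior c).
Proof. by apply: exterior_connected; rewrite ltr_wpDl ?modulus_ge0. Qed.

Lemma quad_absorbed_connected c : connected (quad_absorbed c).
Proof.
apply: (@absorbed_connected R _ (@quad_sphere_continuous c) _ (@quad_exterior_f c) (@quad_sphere_open c) (infinity R) (quad_exterior c)).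
- exact: quad_exterior_connected.
- by [].
- by move=> p hp; exists 0%N.
- exact: quad_exterior_f.
- exact: I.
- exact: quad_sphere_infinity.
- by exists (infinity R).
Qed.

(** The critical point 0 is the only preimage of c, and its bounded orbit is never absorbed; this is
    what [nonabsorbed_connected] asks for. *)
Lemma bounded_Mandelbrot c : (forall n, modulus (iter n (quad c) 0) <= modulus c + 2) -> Mandelbrot c.
Proof.
move=> h; have oH : open (quad_exterior c) by exact: exterior_open.
apply: (@Julia_connected R _ (@quad_sphere_continuous c) _ oH (@quad_conv c) (@quad_equicontinuous c) (@quad_not_Fatou c)).
  exact: quad_absorbed_connected.
apply: (@nonabsorbed_connected R _ (@quad_sphere_continuous c) _ oH (@quad_exterior_f c) (@quad_sphere_open c) (finite_point 0)).
- exact: exteriorC_connected.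
- by move=> /(absorbed_f (@quad_exterior_f c) _).1; apply/quad_nonabsorbedP.
- exact: quad_sphere_0.
Qed.

Lemma quad_absorbedN c z : quad_absorbed c (finite_point (- z)) <-> quad_absorbed c (finite_point z).
Proof.
rewrite -(absorbed_f (@quad_exterior_f c) (finite_point (- z))).
by rewrite -(absorbed_f (@quad_exterior_f c) (finite_point z)) /= /quad sqrrN.
Qed.

Lemma quad_fixed_point c : exists z, quad c z = z.
Proof.
exists ((1 + sqrtC (1 - 4 * c)) / 2); rewrite /quad.
have := sqrtCK (1 - 4 * c); set s := sqrtC _ => hs.
have -> : c = (1 - s ^+ 2) / 4 by rewrite hs; field.
by field.
Qed.

(** Otherwise being absorbed would be locally constant on the plane, hence constant; but a fixed
    point is not absorbed and far points are. *)
Lemma quad_Julia_nonempty c : exists z, Julia_set (quad_sphere c) (finite_point z).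
Proof.
apply: contrapT => nJ.
have cT : connected [set: R[i]] by apply: (@star_connected R _ 0).
have hP z : setT z -> quad_absorbed c (finite_point z) ->
    \forall w \near z, setT w -> quad_absorbed c (finite_point w).
  move=> _ Wz; have oW : open (quad_absorbed c) by apply: absorbed_open; [exact: quad_sphere_continuous|exact: exterior_open].
   have /nbhs_finiteP[r r0 h] := open_nbhs_nbhs (conj oW Wz).
  by apply/nbhs_modulusP; exists r => // w /h.
have hN z : setT z -> ~ quad_absorbed c (finite_point z) ->
    \forall w \near z, setT w -> ~ quad_absorbed c (finite_point w).
  move=> _ nW; have : ~ closure (quad_absorbed c) (finite_point z).
    by move=> clz; apply: nJ; exists z; rewrite quad_Julia.
  move=> ncl; have oC : open (~` closure (quad_absorbed c)) by apply: closed_openC; exact: closed_closure.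
  have /nbhs_finiteP[r r0 h] := open_nbhs_nbhs (conj oC ncl).
  by apply/nbhs_modulusP; exists r => // w /h hw _ /subset_closure.
have [h|h] := connected_dichotomy cT hP hN.
  have [z zE] := quad_fixed_point c; have /quad_absorbedP[n hn] := h z I.
  have E k : iter k (quad c) z = z by elim: k => //= k ->.
  rewrite E in hn; have := quad_growth (ltW hn); rewrite zE; have := modulus_ge0 c; lra.
have := h (modulus c + 3)%:C%C I; apply; apply/quad_absorbedP; exists 0%N => /=.
by rewrite modulus_real ger0_norm; have := modulus_ge0 c; lra.
Qed.

(* If the critical value [c] escapes then [z - c] has a continuous square root
   on a neighbourhood of the filled Julia set, and the sign in
   [s (z ^+ 2 + c) = z] or [- z] disconnects the Julia set. *)
Lemma Mandelbrot_bounded c : Mandelbrot c ->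
  forall n, modulus (iter n (quad c) 0) <= modulus c + 2.
Proof.
move=> cJ n; rewrite leNgt; apply/negP => hn.
case: n hn => [|m]; first by rewrite modulus0; have := modulus_ge0 c; lra.
rewrite iterSr /quad expr0n/= add0r -/(quad c) => hm.
pose U k := iter k (quad_sphere c) @^-1` quad_exterior c.
pose K := [set z | ~ U m (finite_point z)].
have oU k : open (U k).
  by apply: open_comp; [move=> p _; apply: iter_continuous; exact: quad_sphere_continuous|exact: exterior_open].
have cU k : connected (U k).
  elim: k => [|k IH]; first exact: quad_exterior_connected.
  have -> : U k.+1 = quad_sphere c @^-1` U k.
    by apply/seteqP; split=> p; rewrite /U /preimage/= -iterS iterSr.
  apply: (@connected_preimage R _ _ (infinity R)) (@quad_sphere_continuous c) (@quad_sphere_open c) IH _ (@quad_sphere_infinity c).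
  exact: (@iterH R _ _ (@quad_exterior_f c) k (infinity R)).
have Kb z : K z -> modulus z <= modulus c + 2.
  move=> Kz; rewrite leNgt; apply/negP => hz; apply: Kz; rewrite /U /preimage.
  by apply: iterH => //; exact: quad_exterior_f.
have cont_sub (a : R[i]) : cont_on K (fun z => z - a).
  by apply: cont_onD; [apply: continuous_cont_on => x; exact: cvg_id|exact: cont_on_cst].
have c0 := modulus_ge0 c.
(* The existence of a root of [z - a] is propagated along the connected set [U m] from infinity,
   near which [1 - z / a] lies in the right half-plane, to the critical value c. Here m is an escape
   time of c, one less than that of 0. *)
pose P (p : sphere R) := if p is Some a then has_sqrt K (fun z => z - a) else True.
have hP p : U m p -> P p -> \forall q \near p, U m q -> P q.
  case: p => [a|] Ua Pa.
    have /nbhs_finiteP[r r0 h] := open_nbhs_nbhs (conj (oU m) Ua).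
    apply/nbhs_finiteP; exists (r / 2); first by rewrite divr_gt0.
    move=> w hw _; apply: has_sqrt_perturb Pa => // z Kz.
    have -> : z - w - (z - a) = a - w by ring.
    rewrite modulusBC (lt_le_trans hw)// leNgt; apply/negP => h2; apply: Kz; apply: h; lra.
  apply/nbhs_infinityP; split=> //; exists (modulus c + 2) => w hw _.
  have w0 : w != 0 by rewrite -modulus_gt0; lra.
  apply: (@has_sqrt_ext _ _ _ (fun z => (- w) * (1 - z / w))).
    by move=> z _; rewrite mulrBr mulr1 mulNr mulrCA mulfV// mulr1 opprK addrC.
  apply: has_sqrtM; first exact: has_sqrt_cst.
  apply: has_sqrt_Re_gt0 => [|z Kz].
    apply: cont_onD; first exact: cont_on_cst.
    apply: cont_onN; apply: cont_onM; last exact: cont_on_cst.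
    by apply: continuous_cont_on => x; exact: cvg_id.
  rewrite ReB; have := ler_Re_modulus (z / w); rewrite modulusM modulusV.
  have : modulus z / modulus w < 1 by rewrite ltr_pdivrMr ?modulus_gt0//; have := Kb _ Kz; lra.
  by move=> h1 h2; have := ler_norm (complex.Re (z / w)); rewrite /=; lra.
have hN p : U m p -> ~ P p -> \forall q \near p, U m q -> ~ P q.
  case: p => [a|] Ua Pa; last by case: Pa.
  have /nbhs_finiteP[r r0 h] := open_nbhs_nbhs (conj (oU m) Ua).
  apply/nbhs_finiteP; exists (r / 2); first by rewrite divr_gt0.
  move=> w hw _ Pw; apply: Pa; apply: has_sqrt_perturb Pw => // z Kz.
  have -> : z - a - (z - w) = w - a by ring.
  rewrite (lt_le_trans hw)// leNgt; apply/negP => h2; apply: Kz; apply: h.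
  by have := modulus_triangle w z a; lra.
have [s cs sE] : has_sqrt K (fun z => z - c).
  have [h|h] := connected_dichotomy (cU m) hP hN.
    by apply: (h (finite_point c)); rewrite /U/preimage/= iter_quad_finite.
  have := h (infinity R); case=> //; rewrite /U/preimage/= /quad_exterior.
  by apply: (@iterH R _ _ (@quad_exterior_f c)).
pose J := Julia_set (quad_sphere c).
have JW p : J p -> ~ quad_absorbed c p by rewrite /J quad_Julia => -[].
have JK z : J (finite_point z) -> K (quad c z).
  move=> /JW nW Uz; apply: nW; exists m.+1; by rewrite iterSr.
have JN z : J (finite_point z) -> J (finite_point (- z)).
  rewrite /J quad_Julia => -[cl nW]; split; last by rewrite /setC/= quad_absorbedN.
  move=> B /nbhs_finiteP[r r0 h].
  have [|p [Wp]] := cl [set p | exists2 w, p = finite_point w & modulus (w - z) < r].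
    by apply/nbhs_finiteP; exists r => // w hw; exists w.
  case=> w pE hw; exists (finite_point (- w)); split; first by rewrite quad_absorbedN -pE.
  apply: h; have -> : - w - - z = - (w - z) by ring.
  by rewrite modulusN.
have J0 z : J (finite_point z) -> z != 0.
  move=> Jz; apply/eqP => z0; have := JK _ Jz; rewrite z0 /quad expr0n/= add0r; apply.
  by rewrite /U /preimage /= -/(finite_point c) iter_quad_finite.
have s2 z : J (finite_point z) -> s (quad c z) = z \/ s (quad c z) = - z.
  move=> /JK/sE; rewrite addrK => /eqP; rewrite eqf_sqr => /orP[]/eqP; by [left|right].
have near_s z : J (finite_point z) -> \forall w \near finite_point z, J w ->
    exists2 u, w = finite_point u & modulus (s (quad c u) - s (quad c z)) < modulus z / 2 /\ modulus (u - z) < modulus z / 2.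
  move=> Jz; have z0 : 0 < modulus z / 2 by rewrite divr_gt0// modulus_gt0 J0.
  have /nbhs_modulusP[r r0 h] := cs _ (JK _ Jz) _ z0.
  have [d d0 hd] := @poly_continuous R ('X ^+ 2 + c%:P) z (r / 2) (divr_gt0 r0 (ltr0n _ 2)).
  apply/nbhs_finiteP; exists (Num.min d (modulus z / 2)); first by rewrite lt_min d0.
  move=> w; rewrite lt_min => /andP[/ltW/hd]; rewrite !hornerE => h1 h2 Jw; exists w => //; split=> //.
  by apply: h; [rewrite /quad; lra|exact: JK].
pose P2 (p : sphere R) := exists2 z, p = finite_point z & s (quad c z) = z.
have hP2 p : J p -> P2 p -> \forall q \near p, J q -> P2 q.
  move=> Jp [z zE sz]; rewrite zE in Jp *; have z0 := J0 _ Jp; apply: filterS (near_s _ Jp) => q h Jq.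
  have [u uE [h1 h2]] := h Jq; rewrite uE in Jq; exists u => //.
  case: (s2 _ Jq) => // su; exfalso; move: h1; rewrite su sz -opprD modulusN => h1.
  have := ler_modulusD (u + z) (z - u); rewrite modulusBC in h2.
  have -> : u + z + (z - u) = 2 * z by ring.
  by rewrite modulusM modulus_nat; move: z0; rewrite -modulus_gt0; lra.
have hN2 p : J p -> ~ P2 p -> \forall q \near p, J q -> ~ P2 q.
  case: p => [z|] Jp nP; last by have := JW _ Jp; case; exists 0%N; exact: I.
  have z0 := J0 _ Jp; apply: filterS (near_s _ Jp) => q h Jq [v vE sv].
  have [u uE [h1 h2]] := h Jq; have uv : u = v by move: vE; rewrite uE => -[].
  rewrite -uv in sv; case: (s2 _ Jp) => [sz|sz]; first by apply: nP; exists z.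
  move: h1; rewrite sv sz opprK => h1.
  have := ler_modulusD (u + z) (z - u); rewrite modulusBC in h2.
  have -> : u + z + (z - u) = 2 * z by ring.
  by rewrite modulusM modulus_nat; move: z0; rewrite -modulus_gt0; lra.
have [z Jz] := quad_Julia_nonempty c; have z0 := J0 _ Jz.
have N0 : z != - z.
  by rewrite -subr_eq0 opprK -mulr2n -mulr_natl mulf_neq0// pnatr_eq0.
have [h|h] := connected_dichotomy cJ hP2 hN2.
  have [u [zu] su] := h _ Jz; have [v [zv] sv] := h _ (JN _ Jz).
  by move/eqP: N0; apply; rewrite -zu in su; rewrite -zv in sv; rewrite -[LHS]su -[RHS]sv /quad sqrrN.
have n1 := h _ Jz; have n2 := h _ (JN _ Jz).
case: (s2 _ Jz) => sz; first by apply: n1; exists z.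
by apply: n2; exists (- z) => //; rewrite -[RHS]sz /quad sqrrN.
Qed.

Lemma MandelbrotP c : Mandelbrot c <-> forall n, modulus (iter n (quad c) 0) <= modulus c + 2.
Proof. by split; [exact: Mandelbrot_bounded|exact: bounded_Mandelbrot]. Qed.

Definition critical_poly := fix P n : {poly R[i]} := if n is n'.+1 then P n' ^+ 2 + 'X else 0.

Lemma horner_critical_poly c n : (critical_poly n).[c] = iter n (quad c) 0.
Proof. by elim: n => [|n IH] /=; rewrite ?horner0// hornerD hornerX horner_exp IH. Qed.

Lemma Mandelbrot_closed : closed (@Mandelbrot R).
Proof.
have -> : @Mandelbrot R = ~` ~` (@Mandelbrot R) by rewrite setCK.
apply: open_closedC; rewrite openE => c nM.
have [n hn] : exists n, modulus c + 2 < modulus (iter n (quad c) 0).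
  apply: contrapT => h; apply: nM; apply/MandelbrotP => n; rewrite leNgt; apply/negP => hn.
  by apply: h; exists n.
pose e := (modulus (iter n (quad c) 0) - (modulus c + 2)) / 3.
have e0 : 0 < e by rewrite divr_gt0// subr_gt0.
have [d d0 hd] := poly_continuous (critical_poly n) c e0.
apply/nbhs_modulusP; exists (Num.min d e); first by rewrite lt_min d0.
move=> w; rewrite lt_min => /andP[/ltW/hd h1 h2] /MandelbrotP/(_ n).
rewrite !horner_critical_poly in h1; rewrite leNgt => /negP; apply.
have h3 := lerB_modulus (iter n (quad c) 0) (iter n (quad w) 0).
have h4 := lerB_modulus w c; rewrite modulusBC in h3.
by rewrite /e in h1 h2; lra.
Qed.

End Quadratic.

Section FatouSubsequence.
Context {R : realType}.
Variable f : sphere R -> sphere R.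
Hypothesis cf : continuous f.

(** Normality yields less than equicontinuity of all iterates, but on one fixed neighbourhood it
    gives arbitrarily high iterates of small oscillation, which is enough for
    [prepole_not_Fatou]. *)
Lemma Fatou_subsequence p (e : R) : Fatou_set f p -> 0 < e ->
  exists2 V, nbhs p V & forall N, exists2 n, (N <= n)%N & forall q, V q -> chordal (iter n f q) (iter n f p) < e.
Proof.
move=> [U [oU Up Unorm]] e0; have e8 : 0 < e / 8 by rewrite divr_gt0.
have [k [h [kmon hconv]]] := Unorm id.
have kge m : (m <= k m)%N by elim: m => // m IH; rewrite (leq_ltn_trans IH)// kmon.
have [N Np Ncl] := compact_regular sphere_hausdorff sphere_compact (filterT : nbhs p setT)
  (open_nbhs_nbhs (conj oU Up)).
have clN : compact (closure N) by apply: closed_sphere_compact; exact: closed_closure.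
have := hconv _ clN Ncl _ e8 => -[m0 _ hm0].
have Np' : closure N p by apply: subset_closure; exact: nbhs_singleton Np.
exists (N `&` [set q | chordal (iter (k m0) f q) (iter (k m0) f p) < e / 8]).
  apply: (@filterI _ _ (nbhs_filter p)) => //.
  exact: (@iter_continuous _ _ cf (k m0) p _ (chordal_continuous (iter (k m0) f p) e8)).
move=> M; exists (k (m0 + M)%N); first by apply: leq_trans (kge _); exact: leq_addl.
move=> q [Nq hq]; have Nq' : closure N q by exact: subset_closure.
have hm1 := hm0 (m0 + M)%N (leq_addr _ _); have hm2 := hm0 m0 (leqnn _).
have a1 := hm1 _ Nq'; have a2 := hm1 _ Np'; have a3 := hm2 _ Nq'; have a4 := hm2 _ Np'.
rewrite /= in a1 a2 a3 a4 hq.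
have t1 := chordal_triangle (h q) (iter (k (m0 + M)%N) f q) (iter (k (m0 + M)%N) f p).
have t2 := chordal_triangle (iter (k m0) f q) (h q) (iter (k (m0 + M)%N) f p).
have t3 := chordal_triangle (iter (k m0) f p) (iter (k m0) f q) (iter (k (m0 + M)%N) f p).
have t4 := chordal_triangle (h p) (iter (k m0) f p) (iter (k (m0 + M)%N) f p).
rewrite (chordalC (h q) (iter (k m0) f q)) in t2; rewrite (chordalC (h p) (iter (k (m0 + M)%N) f p)) in t4; lra.
Qed.

End FatouSubsequence.

(* Homogeneous coordinates of the orbit of x / y under z + b + 1 / z. *)
Fixpoint gpair (S : comNzRingType) (b x y : S) n : S * S :=
  if n is n'.+1 then let: (u, v) := gpair b x y n' in (u ^+ 2 + b * u * v + v ^+ 2, u * v) else (x, y).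

Lemma gpairS (S : comNzRingType) (b x y : S) n : gpair b x y n.+1 =
  ((gpair b x y n).1 ^+ 2 + b * (gpair b x y n).1 * (gpair b x y n).2 + (gpair b x y n).2 ^+ 2,
   (gpair b x y n).1 * (gpair b x y n).2).
Proof. by rewrite /=; case: (gpair b x y n). Qed.

Lemma gpair_rmorph (S T : comNzRingType) (f : {rmorphism S -> T}) (b x y : S) n :
  gpair (f b) (f x) (f y) n = (f (gpair b x y n).1, f (gpair b x y n).2).
Proof. by elim: n => [//|n IH]; rewrite !gpairS IH /= !(rmorphD, rmorphM, rmorphXn). Qed.

Lemma gpairZ (S : comNzRingType) (b k x y : S) n :
  gpair b (k * x) (k * y) n = (k ^+ (2 ^ n) * (gpair b x y n).1, k ^+ (2 ^ n) * (gpair b x y n).2).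
Proof.
elim: n => [|n IH]; first by rewrite expr1.
by rewrite !gpairS IH /= expnS mul2n -addnn exprD; congr (_, _); ring.
Qed.

Lemma gpairD (S : comNzRingType) (b x y : S) m n :
  gpair b x y (n + m) = gpair b (gpair b x y m).1 (gpair b x y m).2 n.
Proof. by elim: n => [|n IH]; [case: (gpair b x y m)|rewrite addSn !gpairS IH]. Qed.

(** * The family z + b + 1 / z *)

Section Parabolic.
Context {R : realType}.
Implicit Types (z w a b u v : R[i]) (p q : sphere R) (M r e : R).

Lemma gmap_num_den b : coprimep ('X ^+ 2 + b *: 'X + 1 : {poly R[i]}) 'X.
Proof.
rewrite coprimep_sym; have := coprimepX ('X ^+ 2 + b *: 'X + 1 : {poly R[i]}); rewrite coprimep_sym => ->.
by rewrite /root hornerD hornerC hornerD hornerXn hornerZ hornerX expr0n/= mulr0 !add0r oner_eq0.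
Qed.

Lemma gmap_degree b : maxn (size ('X ^+ 2 + b *: 'X + 1 : {poly R[i]})) (size ('X : {poly R[i]})) = 3%N.
Proof.
have h : (size (b *: 'X + 1 : {poly R[i]})%R <= 2)%N.
  rewrite (leq_trans (size_polyD _ _))// geq_max size_poly1 andbT.
  by rewrite (leq_trans (size_scale_leq _ _))// size_polyX.
rewrite -addrA size_polyDl size_polyXn ?size_polyX//.
Qed.

Definition g_rat b : rat2 R := Rat2 (gmap_num_den b) (gmap_degree b).

Definition gmap b p : sphere R := if p is Some z then
  (if z == 0 then infinity R else finite_point (z + b + z^-1)) else infinity R.

Lemma rat_map_g b : rat_map (g_rat b) = gmap b.
Proof.
apply: funext => -[z|] /=; last by rewrite coefX eqxx.
rewrite hornerX; case: eqP => // /eqP z0; congr finite_point.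
by rewrite !hornerE !mulrDl expr2 mulfK// -[b * z / z]mulrA divff// mulr1 mul1r.
Qed.

Definition proj u v : sphere R := if v == 0 then infinity R else finite_point (u / v).

Lemma gmap_proj b u v : (u != 0) || (v != 0) ->
  gmap b (proj u v) = proj (u ^+ 2 + b * u * v + v ^+ 2) (u * v).
Proof.
rewrite /proj mulf_eq0; have [->|u0] := eqVneq u 0; have [->|v0] := eqVneq v 0 => //= _.
  by rewrite mul0r eqxx.
rewrite mulf_eq0 invr_eq0 (negbTE u0) (negbTE v0) /=; congr finite_point.
by field; rewrite u0 v0.
Qed.

Lemma gpair_horner (P X Y : {poly R[i]}) n z : gpair P.[z] X.[z] Y.[z] n =
  ((gpair P X Y n).1.[z], (gpair P X Y n).2.[z]).
Proof. exact: (gpair_rmorph (horner_eval z)). Qed.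

Lemma gpair_neq0 b u v n : (u != 0) || (v != 0) ->
  ((gpair b u v n).1 != 0) || ((gpair b u v n).2 != 0).
Proof.
move=> h; elim: n => [//|n]; rewrite gpairS /= mulf_eq0 negb_or.
set x := (gpair b u v n).1; set y := (gpair b u v n).2.
have [->|x0] := eqVneq x 0; have [->|y0] := eqVneq y 0 => //= _.
- by rewrite mulr0 mul0r expr0n/= !add0r sqrf_eq0 y0.
- by rewrite mulr0 expr0n/= !addr0 sqrf_eq0 x0.
- by rewrite orbT.
Qed.

Lemma iter_gmap_proj b u v n : (u != 0) || (v != 0) ->
  iter n (gmap b) (proj u v) = proj (gpair b u v n).1 (gpair b u v n).2.
Proof.
move=> h; elim: n => [//|n IH]; rewrite iterS IH gmap_proj ?gpair_neq0//.
by rewrite gpairS.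
Qed.

Lemma iter_gmap_finite b z n :
  iter n (gmap b) (finite_point z) = proj (gpair b z 1 n).1 (gpair b z 1 n).2.
Proof.
have -> : finite_point z = proj z 1 by rewrite /proj oner_eq0 divr1.
by apply: iter_gmap_proj; rewrite oner_neq0 orbT.
Qed.

Lemma iter_gmap_infinity b n : iter n (gmap b) (infinity R) = infinity R.
Proof. by elim: n => //= n ->. Qed.

Lemma gmap_inv b p : gmap b (sphere_inv p) = gmap b p.
Proof.
case: p => [z|] /=; last by rewrite eqxx.
case: eqP => [//|/eqP z0] /=; rewrite invr_eq0 (negbTE z0) invrK; congr finite_point; ring.
Qed.

Lemma gmap_fiber b p q : gmap b p = gmap b q -> p = q \/ p = sphere_inv q.
Proof.
case: p q => [z|] [w|] //=; last by left.
- case: eqP => [->|/eqP z0]; case: eqP => [->|/eqP w0] //; [by left|].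
  move=> [E].
  have : (z - w) * (z * w - 1) = 0.
    have -> : (z - w) * (z * w - 1) = z * w * (z + b + z^-1 - (w + b + w^-1)) by field; rewrite z0 w0.
    by rewrite E subrr mulr0.
  move=> /eqP; rewrite mulf_eq0 !subr_eq0 => /orP[/eqP ->|/eqP zw]; [by left|right].
  by congr Some; apply: (mulIf w0); rewrite zw mulVf.
- by case: eqP => [->|//] _; right.
- by case: eqP => [_|//] _; right.
Qed.

Lemma gmap_critical1 b p : gmap b p = gmap b (finite_point 1) -> p = finite_point 1.
Proof. by move=> /gmap_fiber[->//|->]; rewrite /= oner_eq0 invr1. Qed.

Lemma gmap_criticalN1 b p : gmap b p = gmap b (finite_point (- 1)) -> p = finite_point (- 1).
Proof. by move=> /gmap_fiber[->//|->]; rewrite /= oppr_eq0 oner_eq0 invrN1. Qed.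

Lemma joukowski w : exists z, [/\ z != 0, z + z^-1 = w & 1 <= modulus z].
Proof.
pose s := sqrtC (w ^+ 2 - 4); have sE : s ^+ 2 = w ^+ 2 - 4 by exact: sqrtCK.
pose x := (w + s) / 2; pose y := (w - s) / 2.
have xy : x * y = 1.
  have -> : x * y = (w ^+ 2 - s ^+ 2) / 4 by rewrite /x /y; field.
  by rewrite sE; field.
have x0 : x != 0 by apply/eqP => x0; move: xy; rewrite x0 mul0r => /eqP; rewrite eq_sym oner_eq0.
have y0 : y != 0 by apply/eqP => y0; move: xy; rewrite y0 mulr0 => /eqP; rewrite eq_sym oner_eq0.
have xV : x^-1 = y by apply: (mulfI x0); rewrite mulfV.
have yV : y^-1 = x by rewrite -xV invrK.
have xyw : x + y = w by rewrite /x /y; field.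
have [h|h] := leP 1 (modulus x); first by exists x; rewrite xV.
exists y; rewrite yV addrC; split=> //; have := congr1 (@modulus R) xy.
by rewrite modulusM modulus1; have := modulus_ge0 y; nra.
Qed.

Lemma gmap_large b z M : 0 <= M -> 2 + `|M| + modulus b < modulus z -> z != 0 /\ M < modulus (z + b + z^-1).
Proof.
move=> M0 h; have b0 := modulus_ge0 b; have z0 : 0 < modulus z by have := normr_ge0 M; lra.
split; first by rewrite -modulus_gt0.
have h1 : modulus z^-1 <= 1 by rewrite modulusV invf_le1//; have := normr_ge0 M; lra.
have := lerB_modulusD z (b + z^-1); have := ler_modulusD b z^-1.
by rewrite addrA; have := ler_norm M; lra.
Qed.

Lemma gmap_continuous b : continuous (gmap b).
Proof.
have cinf A : nbhs (infinity R) A -> nbhs (infinity R) (gmap b @^-1` A).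
  move=> /nbhs_infinityP[A1 [M hM]]; apply/nbhs_infinityP; split=> //.
  exists (2 + `|(`|M|)| + modulus b) => w /(gmap_large (normr_ge0 M))[w0 hw].
  by rewrite /preimage/= (negbTE w0); apply: hM; apply: le_lt_trans (ler_norm M) hw.
move=> [z|] A; last exact: cinf.
have [->|z0] := eqVneq z 0.
  rewrite /= eqxx => /cinf hA.
  have : nbhs (sphere_inv (finite_point 0)) (gmap b @^-1` A) by rewrite /= eqxx.
  move=> /(@sphere_inv_continuous R (finite_point 0)); apply: (@filterS _ _ (nbhs_filter _)) => q.
  by rewrite /preimage/= gmap_inv.
rewrite /= (negbTE z0) => /nbhs_finiteP[r r0 h]; apply/nbhs_finiteP.
have zp : 0 < modulus z by rewrite modulus_gt0.
pose m := modulus z ^+ 2 / 2; have m0 : 0 < m by rewrite divr_gt0// exprn_gt0.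
pose k := 1 + m^-1; have k0 : 0 < k by rewrite addr_gt0 ?invr_gt0.
exists (Num.min (modulus z / 2) (r / k)); first by rewrite lt_min !divr_gt0.
move=> w; rewrite lt_min => /andP[h1 h2].
have wz : modulus z / 2 < modulus w by have := lerB_modulus z w; rewrite modulusBC; lra.
have w0 : w != 0 by rewrite -modulus_gt0; lra.
rewrite /preimage/= (negbTE w0); apply: h.
have -> : w + b + w^-1 - (z + b + z^-1) = (w - z) * (1 - (z * w)^-1) by field; rewrite z0 w0.
rewrite modulusM; apply: le_lt_trans (_ : modulus (w - z) * k < r); last by rewrite -ltr_pdivlMr.
rewrite ler_wpM2l ?modulus_ge0//; have := ler_modulusB 1 (z * w)^-1; rewrite modulus1 => h3.
apply: le_trans h3 _; rewrite /k lerD2l modulusV lef_pV2 ?posrE ?modulus_gt0 ?mulf_neq0// modulusM /m; nra.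
Qed.

(** The preimages x and [x^-1] of a finite w satisfy [(x - z)(x^-1 - z) = z (z + b + z^-1 - w)], so
    one of them is close to z. The pole 0 is reduced to infinity by the symmetry [gmap_inv]. *)
Lemma gmap_open b (A : set (sphere R)) : open A -> open (gmap b @` A).
Proof.
have oinf B : nbhs (infinity R) B -> nbhs (infinity R) (gmap b @` B).
  move=> /nbhs_infinityP[B1 [M hM]]; apply/nbhs_infinityP; split; first by exists (infinity R).
  exists (1 + `|M| + modulus b) => w hw; have [z [z0 zE z1]] := joukowski (w - b).
  exists (finite_point z); last by rewrite /= (negbTE z0) addrAC zE subrK.
  apply: hM; have := ler_modulusD z z^-1; rewrite zE.
  have : modulus z^-1 <= 1 by rewrite modulusV invf_le1//; lra.
  have := lerB_modulus w b; have := ler_norm M; lra.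
apply: open_mapP => -[z|] B; last exact: oinf.
have [->|z0] := eqVneq z 0.
  move=> h; rewrite /= eqxx; have := @sphere_inv_continuous R (infinity R) _ h => /oinf.
  apply: (@filterS _ _ (nbhs_filter _)) => _ [q Bq <-]; exists (sphere_inv q) => //.
  by rewrite gmap_inv.
move=> /nbhs_finiteP[r r0 h]; rewrite /= (negbTE z0); apply/nbhs_finiteP.
have zp : 0 < modulus z by rewrite modulus_gt0.
exists (r ^+ 2 / modulus z) => [|w hw]; first by rewrite divr_gt0 ?exprn_gt0.
have [x [x0 xE _]] := joukowski (w - b).
have gE y : y != 0 -> y + y^-1 = w - b -> gmap b (finite_point y) = finite_point w.
  by move=> y0 yE; rewrite /= (negbTE y0) addrAC yE subrK.
have E : (x - z) * (x^-1 - z) = z * (z + b + z^-1 - w).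
  have -> : (x - z) * (x^-1 - z) = 1 + z ^+ 2 - z * (x + x^-1) by field.
  by rewrite xE; field.
have hz : modulus (x - z) * modulus (x^-1 - z) < r ^+ 2.
  by rewrite -modulusM E modulusM mulrC -ltr_pdivlMr// modulusBC.
have [h1|h1] := ltP (modulus (x - z)) r; first by exists (finite_point x); [exact: h|exact: gE].
exists (finite_point x^-1); last by apply: gE; rewrite ?invr_eq0// invrK addrC.
apply: h; rewrite ltNge; apply/negP => h2; have := ler_pM (ltW r0) (ltW r0) h1 h2.
by rewrite -expr2; lra.
Qed.

End Parabolic.

(** * Multipliers, fixed points and the class of [z + b + 1 / z] *)

Section Represents.
Context {R : realType}.
Implicit Types (z w a b u v : R[i]) (p q : sphere R) (M r e : R).

Lemma derive1_slope (f phi : R[i] -> R[i]) z d : 0 < d ->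
    (forall h, h != 0 -> modulus h < d -> f (h + z) - f z = h * phi h) ->
    (forall e, 0 < e -> exists2 d', 0 < d' & forall h, modulus h < d' -> modulus (phi h - phi 0) < e) ->
  derive1 f z = phi 0.
Proof.
move=> d0 fE cphi; rewrite /derive1; apply: cvg_lim; first exact: norm_hausdorff.
move=> A /nbhs_modulusP[e e0 hA]; have [d' d'0 hd'] := cphi _ e0.
apply/nbhs_modulusP; exists (Num.min d d'); first by rewrite lt_min d0.
move=> h; rewrite subr0 lt_min => /andP[h1 h2] h0; apply: hA.
by rewrite fE// -mulr_algl scaler1 mulrA mulVf// mul1r hd'.
Qed.

Lemma polyV_continuous (P : {poly R[i]}) z e : P.[z] != 0 -> 0 < e ->
  exists2 d, 0 < d & forall w, modulus (w - z) < d -> modulus (P.[w]^-1 - P.[z]^-1) < e.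
Proof.
move=> P0 e0; pose m := modulus P.[z]; have m0 : 0 < m by rewrite modulus_gt0.
have e1 : 0 < Num.min (m / 2) (e * (m * m) / 4) by rewrite lt_min !(divr_gt0, mulr_gt0).
have [d d0 hd] := poly_continuous P z e1; exists d => // w /ltW/hd; rewrite le_min => /andP[h1 h2].
have h3 : m / 2 <= modulus P.[w] by have := lerB_modulus P.[z] P.[w]; rewrite modulusBC -/m; lra.
have Pw : P.[w] != 0 by rewrite -modulus_gt0; lra.
rewrite subV// modulusM modulusV modulusM modulusBC -/m ltr_pdivrMr ?mulr_gt0 ?modulus_gt0//.
apply: le_lt_trans h2 _; rewrite -mulrA ltr_pM2l// mulrC [X in X < _]mulrC; nra.
Qed.

Lemma multiplier_infinity b : multiplier (gmap b) (infinity R) = 1.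
Proof.
pose phi h : R[i] := (h * h + b * h + 1)^-1.
have phi0 : phi 0 = 1 by rewrite /phi !mulr0 !add0r invr1.
rewrite /multiplier /= -[RHS]phi0; apply: (@derive1_slope _ _ _ 1) => //.
- move=> h h0 _; rewrite addr0 (gmap_inv b (finite_point h)) (gmap_inv b (finite_point 0)) /= (negbTE h0) eqxx /= subr0.
  have E : h + b + h^-1 = (h * h + b * h + 1) / h by field.
  case: eqP => [h1|_] /=; rewrite ?E ?invf_div//.
  move: h1; rewrite E => /eqP; rewrite mulf_eq0 invr_eq0 (negbTE h0) orbF => /eqP h1.
  by rewrite /phi h1 invr0 mulr0.
have P0 : ('X * 'X + b%:P * 'X + 1 : {poly R[i]}).[0] != 0 by rewrite !hornerE oner_neq0.
move=> e e0; have [d d0 hd] := polyV_continuous P0 e0; exists d => // h hh.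
by rewrite phi0 /phi; have := hd h; rewrite subr0 !hornerE ?mulr0 ?add0r invr1 => /(_ hh).
Qed.

Lemma multiplier_finite b z : z != 0 -> multiplier (gmap b) (finite_point z) = 1 - z^-1 ^+ 2.
Proof.
move=> z0; pose phi h : R[i] := 1 - (z * (z + h))^-1.
have -> : 1 - z^-1 ^+ 2 = phi 0 by rewrite /phi addr0 -expr2 exprVn.
rewrite /multiplier; have zp : 0 < modulus z by rewrite modulus_gt0.
apply: (@derive1_slope _ _ _ (modulus z)) => //.
- move=> h h0 hz; have hz0 : h + z != 0.
    by rewrite -modulus_gt0 addrC; have := lerB_modulusD z h; lra.
  have hz1 : z + h != 0 by rewrite addrC.
  rewrite /= (negbTE z0) (negbTE hz0) /= /phi.
  by field; rewrite ?z0 ?hz1 ?hz0.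
have P0 : (z%:P * (z%:P + 'X) : {poly R[i]}).[0] != 0 by rewrite !hornerE mulf_neq0.
move=> e e0; have [d d0 hd] := polyV_continuous P0 e0; exists d => // h hh; rewrite /phi.
have -> : 1 - (z * (z + h))^-1 - (1 - (z * (z + 0))^-1) = - ((z * (z + h))^-1 - (z * (z + 0))^-1) by ring.
by rewrite modulusN; have := hd h; rewrite subr0 !hornerE => /(_ hh).
Qed.

(** For [b != 0] infinity is a double fixed point and [- b^-1] the third one, of multiplier
    [1 - b ^+ 2]; for [b = 0] infinity is triple. *)
Lemma g_rat_represents b : represents (g_rat b) (1 - b ^+ 2).
Proof.
have numE : Defs.num (g_rat b) - 'X * den (g_rat b) = b *: 'X + 1.
  by rewrite /= -mul_polyC; ring.
have [b0|b0] := eqVneq b 0.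
  exists (infinity R), (infinity R), (infinity R); split; rewrite ?rat_map_g ?multiplier_infinity//.
    split=> //; exists 1; first exact: oner_neq0.
    by rewrite numE b0 scale0r add0r big_nil scale1r.
  by rewrite b0 expr0n/= subr0 mulr1.
exists (infinity R), (infinity R), (finite_point (- b^-1)); split; rewrite ?rat_map_g ?multiplier_infinity//.
  split=> //; exists b => //; rewrite numE /= big_seq1.
  by rewrite scalerBr -[X in _ - X]mul_polyC -polyCM mulrN divff// polyCN polyC1 opprK.
by rewrite multiplier_finite ?oppr_eq0 ?invr_eq0// invrN invrK sqrrN mul1r.
Qed.

Lemma gmap_fixed b p : gmap b p = p -> b != 0 -> p = infinity R \/ p = finite_point (- b^-1).
Proof.
case: p => [z|] /=; last by left.
case: eqP => // /eqP z0 [E] b0; right; congr Some.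
have : b + z^-1 = 0 by apply: (addrI z); rewrite addrA E addr0.
by move=> /eqP; rewrite addr_eq0 => /eqP ->; rewrite invrN invrK opprK.
Qed.

Lemma gmap_fixed_infinity p : gmap 0 p = p -> p = infinity R.
Proof.
case: p => [z|//] /=; case: eqP => // /eqP z0 [E]; exfalso.
have : z^-1 = 0 by apply: (addrI z); move: E; rewrite !addr0.
by move/eqP; rewrite invr_eq0 (negbTE z0).
Qed.

Lemma external_basin_g b t W : b != 0 -> t != 1 -> external_basin (g_rat b) t W ->
  W = parabolic_basin (gmap b) (infinity R).
Proof.
move=> b0 t1 [p []]; rewrite rat_map_g => /gmap_fixed/(_ b0)[->|->] m1 /(_ t1)// _ _.
exfalso; move: m1; rewrite multiplier_finite ?oppr_eq0 ?invr_eq0// invrN invrK sqrrN => /eqP.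
by rewrite -subr_eq0 addrAC subrr add0r oppr_eq0 sqrf_eq0 (negbTE b0).
Qed.

End Represents.

(** * The parabolic basin of infinity and its Julia set *)

Section Basin.
Context {R : realType}.
Implicit Types (z w u v : R[i]) (p q : sphere R) (M r e : R).
Variables b0 b : R[i].
Hypotheses (b0_neq0 : b0 != 0) (b_near : modulus (b - b0) <= modulus b0 / 4).

Let b0_gt0 : 0 < modulus b0. Proof. by rewrite modulus_gt0. Qed.

(* An attracting petal at infinity, forward invariant for all [b] near [b0]. *)
Definition halfplane : set (sphere R) :=
  [set p | if p is Some z then 4 / modulus b0 ^+ 2 < complex.Re (z / b0) else False].

Local Notation basin := (absorbed (gmap b) halfplane).

(** In the coordinate [z / b0] the map is the translation by 1 up to the two errors [(b - b0) / b0]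
    and [1 / (z b0)], each of modulus at most 1/4. *)
Lemma Re_step z : 4 <= modulus z * modulus b0 -> z != 0 /\
  complex.Re (z / b0) + 1 / 2 <= complex.Re ((z + b + z^-1) / b0).
Proof.
move=> h; have z0 : 0 < modulus z.
  by rewrite lt0r modulus_ge0 andbT; apply: contraTneq h => ->; rewrite mul0r -ltNge.
have zn : z != 0 by rewrite -modulus_gt0.
split=> //; have -> : (z + b + z^-1) / b0 = z / b0 + 1 + (b - b0) / b0 + (z * b0)^-1 by field; rewrite zn b0_neq0.
rewrite !ReD; have -> : complex.Re (1 : R[i]) = 1 by [].
have h1 : - complex.Re ((b - b0) / b0) <= 1 / 4.
  apply: le_trans (ler_norm _) _; rewrite normrN; apply: le_trans (ler_Re_modulus _) _.
  by rewrite modulusM modulusV ler_pdivrMr//; apply: le_trans b_near _; lra.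
have h2 : - complex.Re ((z * b0)^-1) <= 1 / 4.
  apply: le_trans (ler_norm _) _; rewrite normrN; apply: le_trans (ler_Re_modulus _) _.
  by rewrite modulusV modulusM div1r lef_pV2 ?posrE ?mulr_gt0.
by lra.
Qed.

Lemma halfplane_modulus z : halfplane (finite_point z) -> 4 < modulus z * modulus b0.
Proof.
rewrite /halfplane/= => h; have := le_trans (ltW h) (le_trans (ler_norm _) (ler_Re_modulus _)).
have h3 := lt_le_trans h (le_trans (ler_norm _) (ler_Re_modulus _)).
move: h3; rewrite modulusM modulusV ltr_pdivlMr// expr2 invfM mulrA => h3 _.
by move: h3; rewrite mulfVK ?gt_eqF// ltr_pdivrMr.
Qed.

Lemma halfplane_f p : halfplane p -> halfplane (gmap b p).
Proof.
case: p => [z|//] h; have [z0 hz] := Re_step (ltW (halfplane_modulus h)).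
by rewrite /= (negbTE z0); move: h; rewrite /halfplane/=; lra.
Qed.

Lemma halfplane_open : open halfplane.
Proof.
rewrite openE => -[z|//] h; apply/(@nbhs_finiteP _ z).
pose x := complex.Re (z / b0) - 4 / modulus b0 ^+ 2.
have x0 : 0 < x by rewrite subr_gt0.
exists (x * modulus b0); first by rewrite mulr_gt0.
move=> w hw; rewrite /halfplane/=.
have : complex.Re ((z - w) / b0) < x.
  apply: le_lt_trans (le_trans (ler_norm _) (ler_Re_modulus _)) _.
  by rewrite modulusM modulusV ltr_pdivrMr// modulusBC.
by rewrite mulrBl ReB /x; lra.
Qed.

Lemma iter_halfplane n p : halfplane p -> exists2 z, iter n (gmap b) p = finite_point z &
  n%:R / 2 <= complex.Re (z / b0).
Proof.
move=> Hp; suff [z zE [_ hz]] : exists2 z, iter n (gmap b) p = finite_point z & halfplane (finite_point z) /\ n%:R / 2 <= complex.Re (z / b0) by exists z.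
elim: n => [|n [z zE [Hz hz]]].
  case: p Hp => [z|//] Hz; exists z => //; split=> //; rewrite mul0r.
  apply: ltW; apply: lt_trans (_ : 4 / modulus b0 ^+ 2 < _); last exact: Hz.
  by rewrite divr_gt0// exprn_gt0.
have [z0 hs] := Re_step (ltW (halfplane_modulus Hz)).
exists (z + b + z^-1); first by rewrite iterS zE /= (negbTE z0).
split; last by rewrite -natr1; lra.
by have := halfplane_f Hz; rewrite /= (negbTE z0).
Qed.

Lemma halfplane_conv e : 0 < e -> exists n0, forall n p, (n0 <= n)%N -> halfplane p ->
  chordal (iter n (gmap b) p) (infinity R) < e.
Proof.
move=> e0; exists (Num.bound (4 / (e * modulus b0))) => n p hn Hp.
have [z -> hz] := iter_halfplane n Hp; apply: chordal_infinity_lt => //.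
have h0 : 0 <= 4 / (e * modulus b0) by rewrite divr_ge0// mulr_ge0 ?modulus_ge0// ltW.
have h1 : 4 / (e * modulus b0) <= n%:R.
  by apply: le_trans (ltW (archi_boundP h0)) _; rewrite ler_nat.
have h2 := le_trans hz (le_trans (ler_norm _) (ler_Re_modulus _)).
rewrite modulusM modulusV ler_pdivlMr// in h2; apply: le_trans h2.
rewrite ler_pdivrMr ?mulr_gt0// in h1; rewrite ler_pdivrMr//; lra.
Qed.

(** As long as the orbit is finite and of modulus at least [4 / |b0|], it moves to the right by at
    least 1/2 at each step by [Re_step], and so reaches the half-plane. *)
Lemma finite_orbit_absorbed p M N : 4 / modulus b0 <= M ->
  (forall n, (N <= n)%N -> exists2 z, iter n (gmap b) p = finite_point z & M < modulus z) -> basin p.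
Proof.
move=> hM h; have [z zE _] := h N (leqnn _).
have step k : exists2 w, iter (k + N) (gmap b) p = finite_point w & complex.Re (z / b0) + k%:R / 2 <= complex.Re (w / b0).
  elim: k => [|k [w wE hw]]; first by exists z => //; rewrite mul0r addr0.
  have [w' w'E hw'] := h _ (leq_addl k N); have ww : w' = w by move: w'E; rewrite wE => -[].
  rewrite ww in hw'; have [|w0 hs] := @Re_step w.
    by rewrite -ler_pdivrMr//; lra.
  exists (w + b + w^-1); first by rewrite addSn iterS wE /= (negbTE w0).
  by rewrite -natr1; lra.
pose x := 2 * (4 / modulus b0 ^+ 2 + `|complex.Re (z / b0)| + 1).
have x0 : 0 <= x by rewrite mulr_ge0// !addr_ge0// divr_ge0// exprn_ge0// modulus_ge0.
have [w wE hw] := step (Num.bound x); exists (Num.bound x + N)%N; rewrite wE /halfplane/=.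
have h1 := archi_boundP x0; have h2 := ler_norm (- complex.Re (z / b0)); rewrite normrN in h2.
by apply: lt_le_trans hw; rewrite /x in h1; lra.
Qed.

Lemma basin_orbit_finite p n : basin p -> iter n (gmap b) p != infinity R.
Proof.
move=> [m Hm]; apply/eqP => E; have := iterH halfplane_f n Hm.
by rewrite -iterD addnC iterD E iter_gmap_infinity.
Qed.

Lemma parabolic_basinE : parabolic_basin (gmap b) (infinity R) = basin.
Proof.
apply/seteqP; split=> p.
  move=> [cp np]; pose M := 4 / modulus b0.
  have : nbhs (infinity R) (exterior M) by apply: open_nbhs_nbhs; split=> //; exact: exterior_open.
  move=> /cp [N _ hN]; apply: (@finite_orbit_absorbed p M N) => // n hn.
  by have := hN n hn; have := np n; rewrite /= /exterior/=; case: (iter n _ p) => [z _ hz|//]; exists z.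
move=> Wp; split; last by move=> n; exact: basin_orbit_finite.
move=> A /nbhs_infinityP[A1 [M hM]].
have e0 : 0 < 2 / (1 + `|M|) by rewrite divr_gt0// ltr_pwDl.
have [n0 hn0] := absorbed_chordal halfplane_conv Wp e0; exists n0 => // n hn.
have := hn0 n hn; have := basin_orbit_finite n Wp; rewrite /=; case: (iter n _ p) => [z _|//].
move=> /chordal_infinity_modulus h; apply: hM; apply: le_lt_trans (ler_norm M) _; exact: h.
Qed.

Lemma infinity_closure_halfplane A : nbhs (infinity R) A -> exists2 p, halfplane p & A p.
Proof.
move=> /nbhs_infinityP[_ [M hM]]; pose s := 4 / modulus b0 ^+ 2 + `|M| / modulus b0 + 1.
have s0 : 0 <= s by rewrite !addr_ge0// divr_ge0// ?modulus_ge0// exprn_ge0// modulus_ge0.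
exists (finite_point (s%:C%C * b0)).
  rewrite /halfplane/= mulfK//= /s; have : 0 <= `|M| / modulus b0 by rewrite divr_ge0// modulus_ge0.
  by lra.
apply: hM; rewrite modulusM modulus_real ger0_norm//; apply: le_lt_trans (ler_norm M) _.
rewrite -ltr_pdivrMr// /s; have : 0 <= 4 / modulus b0 ^+ 2 by rewrite divr_ge0// exprn_ge0// modulus_ge0.
by lra.
Qed.

Lemma basin_open : open basin.
Proof. by apply: absorbed_open; [exact: gmap_continuous|exact: halfplane_open]. Qed.

(** Orbits starting near p omit a small disc inside the half-plane, so [frac_equicontinuous]
    applies, with the iterates written in homogeneous coordinates. *)
Lemma gmap_equicontinuous p : (~` basin)° p -> equicontinuous_at (gmap b) p.
Proof.
case: p => [z|] hp; last first.
  have [q Hq] := infinity_closure_halfplane hp; case; exists 0%N; exact: Hq.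
have /nbhs_finiteP[r r0 hr] := hp.
have [q Hq _] := infinity_closure_halfplane (@filterT _ (nbhs (infinity R)) _).
case: q Hq => [a|//] Ha.
have /nbhs_finiteP[d d0 hd] := open_nbhs_nbhs (conj halfplane_open Ha).
apply: (@frac_equicontinuous R _ (fun n => (gpair b%:P 'X 1 n).1) (fun n => (gpair b%:P 'X 1 n).2) z (r / 2) a d) => //.
- move=> n w; rewrite iter_gmap_finite /frac_point.
  by have := gpair_horner b%:P 'X 1 n w; rewrite !hornerC hornerX => ->.
- move=> n w h; have := @gpair_neq0 R b w 1 n; rewrite oner_neq0 orbT => /(_ isT).
  have := gpair_horner b%:P 'X 1 n w; rewrite !hornerC hornerX => -> /=.
  by rewrite h eqxx orbF.
- by rewrite divr_gt0.
move=> n w u hw E; rewrite leNgt; apply/negP => hu.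
have : basin (finite_point w) by exists n; rewrite E; exact: hd.
by apply: hr; lra.
Qed.

(** A backward orbit along the repelling direction of infinity: far to the left, the inverse branch
    of modulus at least 1 moves further left by at least 1/2. *)
Lemma repelling_orbit : exists w : nat -> R[i], (forall n, gmap b (finite_point (w n.+1)) = finite_point (w n)) /\
  forall M, exists N, forall n, (N <= n)%N -> M < modulus (w n).
Proof.
(* The first term provides the bound [4 <= |z| |b0|] required by [Re_step]; the second pays for
   [|z^-1| <= 1] when w is replaced by its preimage z. *)
pose L := 4 / modulus b0 ^+ 2 + 1 / modulus b0.
have L0 : 0 <= L by rewrite addr_ge0// divr_ge0// ?modulus_ge0// exprn_ge0// modulus_ge0.
have step w : exists w', complex.Re (w / b0) <= - L ->
    gmap b (finite_point w') = finite_point w /\ complex.Re (w' / b0) <= complex.Re (w / b0) - 1 / 2.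
  have [z [z0 zE z1]] := joukowski (w - b); exists z => hw.
  have gz : z + b + z^-1 = w by rewrite addrAC zE subrK.
  split; first by rewrite /= (negbTE z0) gz.
  have [|_] := @Re_step z; last by rewrite gz; lra.
  have h1 : modulus z^-1 <= 1 by rewrite modulusV invf_le1//; lra.
  have h2 := ler_modulusD z z^-1; rewrite zE in h2.
  have h3 : (L + 3 / 4) * modulus b0 <= modulus (w - b).
    have : L + 3 / 4 <= - complex.Re ((w - b) / b0).
      rewrite mulrBl ReB.
      have -> : b / b0 = 1 + (b - b0) / b0 by field.
      rewrite ReD; have -> : complex.Re (1 : R[i]) = 1 by [].
      have : - complex.Re ((b - b0) / b0) <= 1 / 4.
        apply: le_trans (ler_norm _) _; rewrite normrN; apply: le_trans (ler_Re_modulus _) _.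
        by rewrite modulusM modulusV ler_pdivrMr//; apply: le_trans b_near _; lra.
      by lra.
    move=> h; have := le_trans h (le_trans (ler_norm _) _); rewrite normrN => /(_ _ (ler_Re_modulus _)).
    by rewrite modulusM modulusV ler_pdivlMr.
  have h4 : (L + 3 / 4) * modulus b0 * modulus b0 = 4 + modulus b0 + 3 / 4 * (modulus b0 * modulus b0).
    by rewrite /L; field; rewrite gt_eqF.
  have := ler_wpM2r (ltW b0_gt0) (le_trans h3 (le_trans h2 (lerD (lexx _) h1))); rewrite h4; nra.
have [f hf] := choice step.
pose w n := iter n f (- (L%:C%C * b0)).
have hw n : complex.Re (w n / b0) <= - L - n%:R / 2.
  elim: n => [|n IH]; first by rewrite /w/= mulNr mulfK//= mul0r subr0.
  have n0 : 0 <= n%:R / 2 :> R by rewrite divr_ge0.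
  have hn : complex.Re (w n / b0) <= - L by lra.
  have h : complex.Re (w n.+1 / b0) <= complex.Re (w n / b0) - 1 / 2 by exact: (hf (w n) hn).2.
  by rewrite -natr1; lra.
exists w; split.
  move=> n; have n0 : 0 <= n%:R / 2 :> R by rewrite divr_ge0.
  by have [] := hf (w n) ltac:(have := hw n; lra).
move=> M; pose x := 2 * (`|M| / modulus b0); have x0 : 0 <= x by rewrite mulr_ge0// divr_ge0// modulus_ge0.
exists (Num.bound x) => n hn; have h1 := archi_boundP x0.
have h2 : (Num.bound x)%:R <= n%:R :> R by rewrite ler_nat.
have h3 : `|M| / modulus b0 < - complex.Re (w n / b0) by have := hw n; rewrite /x in h1 h2 *; lra.
have := lt_le_trans h3 (le_trans (ler_norm _) _); rewrite normrN => /(_ _ (ler_Re_modulus _)).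
by rewrite modulusM modulusV ltr_pM2r ?invr_gt0//; apply: le_lt_trans; exact: ler_norm.
Qed.

(* Arbitrarily high iterates send points near [p] to [w 0], away from infinity. *)
Lemma prepole_not_Fatou p m : iter m (gmap b) p = infinity R -> ~ Fatou_set (gmap b) p.
Proof.
move=> pm Fp; have [w [wS winf]] := repelling_orbit.
pose e := chordal (finite_point (w 0%N)) (infinity R).
have e0 : 0 < e by rewrite /e chordal_finite_infinity divr_gt0// stereo_gt0.
have [V Vp hV] := Fatou_subsequence (@gmap_continuous R b) Fp e0.
have fV : nbhs (infinity R) (iter m (gmap b) @` V).
  have [U [oU Up UV]] : exists U, [/\ open U, U p & U `<=` V].
    by exists V°; split; [exact: open_interior|exact: Vp|exact: interior_subset].
  have oI k : open (iter k (gmap b) @` U).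
    elim: k => [|k IH]; first by rewrite image_id.
    have -> : iter k.+1 (gmap b) @` U = gmap b @` (iter k (gmap b) @` U).
      apply/seteqP; split=> [_ [q Uq <-]|_ [_ [q Uq <-] <-]]; last by exists q.
      by exists (iter k (gmap b) q) => //; exists q.
    exact: gmap_open.
  have : nbhs (infinity R) (iter m (gmap b) @` U).
    by apply: open_nbhs_nbhs; split=> //; exists p.
  by apply: (@filterS _ _ (nbhs_filter _)) => _ [q /UV Vq <-]; exists q.
have /nbhs_infinityP[_ [M hM]] := fV; have [N hN] := winf M.
have [n hn hnV] := hV (m + N)%N.
have [q Vq qE] := hM _ (hN (n - m)%N ltac:(lia)).
have := hnV q Vq; have -> : n = ((n - m) + m)%N by lia.
have wit k : iter k (gmap b) (finite_point (w k)) = finite_point (w 0%N).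
  by elim: k => // k IH; rewrite iterSr wS.
by rewrite !iterD qE pm iter_gmap_infinity wit /e ltxx.
Qed.

Lemma gmap_not_Fatou p : ~ basin p -> closure basin p -> ~ Fatou_set (gmap b) p.
Proof.
move=> nW clp Fp; pose M := 4 / modulus b0.
have M0 : 0 <= M by rewrite divr_ge0// modulus_ge0.
have e0 : 0 < 2 / (1 + M) by rewrite divr_gt0// ltr_pwDl.
have [n0 hn0] := boundary_Fatou (@gmap_continuous R b) halfplane_conv clp Fp e0.
case: (pselect (exists m, iter m (gmap b) p = infinity R)) => [[m pm]|np].
  exact: prepole_not_Fatou pm Fp.
apply: nW; apply: (@finite_orbit_absorbed p M n0) => // n hn.
have := hn0 n hn; case E : (iter n _ p) => [z|] h; last by case: np; exists n.
by exists z => //; exact: chordal_infinity_modulus M0 h.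
Qed.

Lemma halfplane_connected : connected halfplane.
Proof.
have -> : halfplane = @finite_point R @` [set z | 4 / modulus b0 ^+ 2 < complex.Re (z / b0)].
  by apply/seteqP; split=> [[z|//] h|_ [z h <-]//]; exists z.
pose k : R := 4 / modulus b0 ^+ 2.
apply: finite_connected; apply: (@star_connected R _ ((k + 1)%:C%C * b0)).
  by rewrite /= mulfK//= ltrDl.
move=> z t /= h /andP[t0 t1].
have -> : ((k + 1)%:C%C * b0 + t%:C%C * (z - (k + 1)%:C%C * b0)) / b0 =
    (k + 1)%:C%C + t%:C%C * (z / b0 - (k + 1)%:C%C) by field.
rewrite ReD ReZ ReB -/k; have -> : complex.Re (k + 1)%:C%C = k + 1 by [].
move: h; rewrite -/k; set x := complex.Re _ => h.
have h2 : 0 <= t * (x - k) by rewrite mulr_ge0// subr_ge0 ltW.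
have -> : k + 1 + t * (x - (k + 1)) = k + (1 - t) + t * (x - k) by ring.
have [t2|t2] := ltP t 1; first by lra.
have -> : t = 1 by apply/eqP; rewrite eq_le t1.
by lra.
Qed.

Lemma halfplaneC_connected : connected (~` halfplane).
Proof.
pose S := @finite_point R @` [set z | complex.Re (z / b0) <= 4 / modulus b0 ^+ 2].
have a0 : 0 <= 4 / modulus b0 ^+ 2 by rewrite divr_ge0// exprn_ge0// modulus_ge0.
have cS : connected S.
  apply: finite_connected; apply: (@star_connected R _ 0) => [|z t /= h /andP[t0 t1]].
    by rewrite /= mul0r.
  by rewrite add0r subr0 -mulrA ReZ; set x := complex.Re _ in h *; nra.
suff -> : ~` halfplane = closure S by exact: connected_closure.
apply/seteqP; split=> [[z|] h|]; last first.
- rewrite closureE; apply: smallest_sub; first by apply: open_closedC; exact: halfplane_open.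
  by move=> _ [z /= h <-]; rewrite /halfplane/=; apply/negP; rewrite -leNgt.
- move=> A /nbhs_infinityP[_ [M hM]]; pose s := (`|M| + 1) / modulus b0.
  have s0 : 0 <= s by rewrite divr_ge0// ?modulus_ge0// addr_ge0.
  exists (finite_point (- (s%:C%C * b0))); split.
    by exists (- (s%:C%C * b0)) => //=; rewrite mulNr mulfK//=; lra.
  apply: hM; rewrite modulusN modulusM modulus_real ger0_norm// mulfVK ?gt_eqF//.
  by have := ler_norm M; lra.
- by apply: subset_closure; exists z => //=; move: h; rewrite /halfplane/= => /negP; rewrite -leNgt.
Qed.

(* [A] carries the free critical point [-1] into the half-plane, which makes
   the basin connected. *)
Lemma parabolic_Julia_connected (A : set (sphere R)) : connected A -> A (finite_point (- 1)) ->
    A `<=` basin -> A `&` halfplane !=set0 -> ~ basin (finite_point 1) ->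
  connected (Julia_set (gmap b)).
Proof.
move=> cA A1 AW [a [Aa Ha]] n1.
apply: (@Julia_connected R _ (@gmap_continuous R b) _ halfplane_open halfplane_conv gmap_equicontinuous gmap_not_Fatou); last first.
  apply: (@nonabsorbed_connected R _ (@gmap_continuous R b) _ halfplane_open halfplane_f (@gmap_open R b) (finite_point 1)).
  - exact: halfplaneC_connected.
  - by move=> /(absorbed_f halfplane_f _).1.
  - exact: gmap_critical1.
pose X := \bigcup_(j in [set: nat]) (halfplane `|` iter j (gmap b) @` A).
have fX p : X p -> X (gmap b p).
  move=> [j _ [Hp|[q Aq <-]]]; first by exists j => //; left; exact: halfplane_f.
  by exists j.+1 => //; right; exists q.
apply: (@absorbed_connected R _ (@gmap_continuous R b) _ halfplane_f (@gmap_open R b) (finite_point (- 1)) X).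
- apply: bigcup_connected; first by exists a => j _; left.
  move=> j _; apply: connectedU; last 2 first.
  + exact: halfplane_connected.
  + apply: connected_continuous_connected cA _.
    by apply: continuous_subspaceT; apply: iter_continuous; exact: gmap_continuous.
  by exists (iter j (gmap b) a); split; [exact: iterH halfplane_f _ _ Ha|exists a].
- by move=> p Hp; exists 0%N => //; left.
- move=> p [j _ [Hp|[q /AW Wq <-]]]; first by exists 0%N.
  by apply/(absorbed_iter halfplane_f).
- exact: fX.
- by apply: fX; exists 0%N => //; right; exists (finite_point (- 1)).
- exact: gmap_criticalN1.
- by exists a; exists 0%N => //; left.
Qed.

End Basin.

(** * Rescaling in the parameter planes *)

Section ParameterPlane.
Context {R : realType}.
Implicit Types (z w p : R[i]) (A B : {poly R[i]}).

Lemma poly_lower A p : A != 0 -> exists e : nat, exists2 a : R, 0 < a & exists2 rho : R, 0 < rho &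
  forall z, modulus (z - p) <= rho -> a * modulus (z - p) ^+ e <= modulus A.[z].
Proof.
move=> A0; have [e [q qp AE]] := multiplicity_XsubC A p; exists e.
rewrite A0 in qp; have q0 : 0 < modulus q.[p] by rewrite modulus_gt0.
have q2 : 0 < modulus q.[p] / 2 by rewrite divr_gt0.
exists (modulus q.[p] / 2) => //; have [d d0 hd] := poly_continuous q p q2.
exists d => // z hz; rewrite AE hornerM horner_exp hornerXsubC modulusM modulusX.
rewrite ler_wpM2r ?exprn_ge0 ?modulus_ge0//.
have := hd z hz; have := lerB_modulus q.[p] q.[z]; rewrite modulusBC; lra.
Qed.

Lemma bernoulli (x : R) n : 0 <= x -> 1 + n%:R * x <= (1 + x) ^+ n.
Proof.
move=> x0; elim: n => [|n IH]; first by rewrite mul0r addr0.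
rewrite exprS; have h : 0 <= n%:R * x by rewrite mulr_ge0.
have h2 := ler_wpM2l (_ : 0 <= 1 + x) IH.
by apply: le_trans (h2 _); rewrite ?addr_ge0// -natr1; nra.
Qed.

Lemma expr_large (mu x : R) : 1 < mu -> exists n, x <= mu ^+ n.
Proof.
move=> mu1; have m0 : 0 < mu - 1 by rewrite subr_gt0.
exists (Num.bound (`|x| / (mu - 1))).
have h : 0 <= `|x| / (mu - 1) by rewrite divr_ge0// ltW.
have := bernoulli (Num.bound (`|x| / (mu - 1))) (ltW m0); rewrite [1 + (mu - 1)]addrC subrK.
have := archi_boundP h; rewrite ltr_pdivrMr// => h1 h2.
by have := ler_norm x; lra.
Qed.

(* The first time [N k] at which [d] reaches [d2] on the disc of radius
   [rho / 64 ^ k] grows at most linearly, so [N k.+1 - N k] is bounded for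
   infinitely many [k]; at such a scale [d] is still controlled on the 64 times
   larger disc. *)
Lemma escape_scale (d : nat -> R[i] -> R) p (rho mu Lam dl a Cb : R) (e M : nat) :
    0 < rho -> 1 < mu -> 1 <= Lam -> 0 < dl -> 0 < a -> 0 <= Cb ->
    (forall n z, (M <= n)%N -> modulus (z - p) <= rho -> d n z <= dl ->
       mu * d n z <= d n.+1 z <= Lam * d n z) ->
    (forall z, modulus (z - p) <= rho -> a * modulus (z - p) ^+ e <= d M z <= Cb * modulus (z - p)) ->
  exists2 d2, 0 < d2 <= dl & exists C1 C2 : nat, forall k0, exists k n,
    [/\ (k0 <= k)%N, (M <= n <= C1 * k + C2)%N,
        forall j z, (M <= j <= n)%N -> modulus (z - p) <= rho / 64 ^+ k -> d j z <= dl &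
        exists2 z, modulus (z - p) <= rho / 64 ^+ k.+1 & d2 < d n z].
Proof.
move=> rho0 mu1 Lam1 dl0 a0 Cb0 dS dM.
have p64 k : 0 < (64 : R) ^+ k by rewrite exprn_gt0// ltr0n.
have sc k : rho / 64 ^+ k <= rho by rewrite ler_pdivrMr// ler_peMr ?(ltW rho0)// exprn_ege1// ler1n.
(* At distance [rho / 64 ^ k] from p the initial size is at least [a (rho / 64 ^ k) ^ e]; growth by
   mu during [C1 * k + C2] steps would bring it above [dl]. *)
have [C1 hC1] := expr_large (64 ^+ e) mu1.
have [C2 hC2] := expr_large ((dl + 1) / (a * rho ^+ e)) mu1.
(* As [N k] is at most linear with slope C1, its increments cannot all exceed L. When one does not,
   at most [L.+1] steps lead from the time before [N k] to [N k.+1]; this [d2] keeps d below [dl]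
   during them. *)
pose L := C1.+1; pose d2 := dl / Lam ^+ L.+1.
have LL k : 1 <= Lam ^+ k by rewrite exprn_ege1.
have Lp k : 0 < Lam ^+ k by apply: lt_le_trans (LL k).
have d20 : 0 < d2 by rewrite divr_gt0.
have d2l : d2 <= dl by rewrite ler_pdivrMr// ler_peMr// ltW.
have esc k : exists i, (i <= C1 * k + C2)%N /\ exists2 z, modulus (z - p) <= rho / 64 ^+ k & d2 < d (M + i)%N z.
  pose z := p + (rho / 64 ^+ k)%:C%C.
  have zE : modulus (z - p) = rho / 64 ^+ k.
    by rewrite /z addrC addKr modulus_real ger0_norm// divr_ge0// ltW.
  apply: contrapT => nex.
  have small i : (i <= C1 * k + C2)%N -> d (M + i)%N z <= d2.
    move=> hi; rewrite leNgt; apply/negP => h; apply: nex; exists i; split=> //.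
    by exists z; rewrite ?zE.
  have grow i : (i <= C1 * k + C2)%N -> mu ^+ i * (a * (rho / 64 ^+ k) ^+ e) <= d (M + i)%N z.
    elim: i => [|i IH] hi.
      by rewrite mul1r addn0; have := dM z; rewrite zE => /(_ (sc k))/andP[].
    have hi' := ltnW hi; have /andP[h _] := dS (M + i)%N z (leq_addr _ _) ltac:(by rewrite zE) (le_trans (small i hi') d2l).
    rewrite addnS; apply: le_trans h; rewrite exprS -mulrA ler_pM2l ?IH//; lra.
  have := le_trans (grow _ (leqnn _)) (le_trans (small _ (leqnn _)) d2l).
  rewrite leNgt => /negP; apply.
  have ar0 : 0 < a * rho ^+ e by rewrite mulr_gt0 ?exprn_gt0.
  have h1 : dl + 1 <= mu ^+ C2 * (a * rho ^+ e) by rewrite -ler_pdivrMr.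
  have h2 : 64 ^+ (e * k) <= mu ^+ (C1 * k).
    by rewrite !exprM; apply: lerXn2r; rewrite ?nnegrE ?exprn_ge0//; lra.
  rewrite exprD expr_div_n -exprM -mulrA.
  have -> : mu ^+ (C1 * k) * (mu ^+ C2 * (a * (rho ^+ e / 64 ^+ (k * e)))) =
    (mu ^+ (C1 * k) / 64 ^+ (e * k)) * (mu ^+ C2 * (a * rho ^+ e)) by rewrite [(k * e)%N]mulnC; ring.
  have h3 : 1 <= mu ^+ (C1 * k) / 64 ^+ (e * k) by rewrite ler_pdivlMr// mul1r.
  have : 1 * (dl + 1) <= mu ^+ (C1 * k) / 64 ^+ (e * k) * (mu ^+ C2 * (a * rho ^+ e)).
    by apply: ler_pM => //; lra.
  by lra.
pose P k := [pred i | `[< exists2 z, modulus (z - p) <= rho / 64 ^+ k & d2 < d (M + i)%N z >]].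
have exP k : exists i, P k i by have [i [_ h]] := esc k; exists i; apply/asboolP.
pose N k := ex_minn (exP k).
have NP k : exists2 z, modulus (z - p) <= rho / 64 ^+ k & d2 < d (M + N k)%N z.
  by rewrite /N; case: ex_minnP => i /asboolP.
have Nmin k i z : (i < N k)%N -> modulus (z - p) <= rho / 64 ^+ k -> d (M + i)%N z <= d2.
  rewrite /N; case: ex_minnP => n _ hn hi hz; rewrite leNgt; apply/negP => h.
  have /hn : P k i by apply/asboolP; exists z.
  by rewrite leqNgt hi.
have Nle k : (N k <= C1 * k + C2)%N.
  have [i [hi h]] := esc k; apply: leq_trans hi; rewrite /N; case: ex_minnP => n _ hn.
  by apply: hn; apply/asboolP.
have [k1 hk1] : exists k1, forall k, (k1 <= k)%N -> Cb * (rho / 64 ^+ k) <= d2.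
  have [k1 hk1] := @expr_large 64 (Cb * rho / d2) (ltr1n _ 64).
  exists k1 => k hk; rewrite mulrA ler_pdivrMr// [d2 * _]mulrC -ler_pdivrMr//.
  by apply: le_trans hk1 _; rewrite ler_eXn2l// ltr1n.
exists d2; first by rewrite d20.
exists C1, (M + C1 + C2)%N => k0.
pose k2 := maxn k0 k1.
have [k hk hN] : exists2 k, (k2 <= k)%N & (N k.+1 <= N k + L)%N.
  apply: contrapT => nex.
  have far k : (k2 <= k)%N -> (N k + L < N k.+1)%N.
    by move=> hk; rewrite ltnNge; apply/negP => h; apply: nex; exists k.
  have far2 j : (j * C1.+1 <= N (k2 + j)%N)%N.
    elim: j => [//|j IH]; have := far (k2 + j)%N (leq_addr _ _); by move: IH; rewrite addnS /L mulSn; clear; lia.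
  have h1 := far2 (C1 * k2 + C2).+1; have h2 := Nle (k2 + (C1 * k2 + C2).+1)%N.
  by have := leq_trans h1 h2; rewrite mulnDr mulnSr; clear; move: (C1 * k2)%N => x; rewrite [((x + C2).+1 * C1)%N]mulnC; move: (C1 * (x + C2).+1)%N => y; lia.
have hk0 : (k0 <= k)%N by apply: leq_trans hk; exact: leq_maxl.
have hkk1 : (k1 <= k)%N by apply: leq_trans hk; exact: leq_maxr.
exists k, (M + N k.+1)%N; split=> //.
- by rewrite leq_addr /=; have := Nle k.+1; rewrite mulnS; clear; lia.
- move=> j z /andP[Mj jn] hz.
  have hzr := le_trans hz (sc k).
  have N0 : (0 < N k)%N.
    rewrite lt0n; apply/eqP => N0; have [w hw] := NP k; rewrite N0 addn0 ltNge => /negP; apply.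
    have /andP[_ h] := dM w (le_trans hw (sc k)); apply: le_trans h _.
    by apply: le_trans (hk1 k hkk1); rewrite ler_wpM2l.
  have ext s : (s <= L.+1)%N -> d (M + (N k).-1 + s)%N z <= d2 * Lam ^+ s.
    elim: s => [_|s IH hs]; first by rewrite mulr1 addn0; apply: Nmin hz; rewrite prednK.
    have h := IH (ltnW hs).
    have hdl : d (M + (N k).-1 + s)%N z <= dl.
      apply: le_trans h _; rewrite -[X in _ <= X](divfK (lt0r_neq0 (Lp L.+1))).
      by rewrite ler_pM2l// ler_weXn2l// ltnW.
    have /andP[_ h2] := dS (M + (N k).-1 + s)%N z ltac:(clear; lia) hzr hdl.
    by rewrite addnS; apply: le_trans h2 _; rewrite exprS mulrCA ler_pM2l//; apply: lt_le_trans Lam1.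
  have [jN|jN] := ltnP (j - M)%N (N k).
    have -> : j = (M + (j - M))%N by clear -Mj; lia.
    exact: le_trans (Nmin _ _ _ jN hz) d2l.
  have -> : j = (M + (N k).-1 + (j - M - (N k).-1))%N by clear -Mj jN; lia.
  have hs : (j - M - (N k).-1 <= L.+1)%N by clear -Mj jN jn hN N0; lia.
  apply: le_trans (ext _ hs) _; rewrite -[X in _ <= X](divfK (lt0r_neq0 (Lp L.+1))).
  by rewrite ler_pM2l// ler_weXn2l.
Qed.

(* If [C / D] had no zero, Hurwitz would keep it away from zero near [p], while
   [A / B] covers [w]. *)
Lemma parameter_hit p (r d1 d2 s0 Mb : R) A B (C D : {poly R[i]}) z w :
    0 < r -> 0 < d2 <= d1 -> 0 < Mb -> 0 < s0 ->
    (forall y, modulus (y - p) <= r -> B.[y] != 0) ->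
    (forall y, modulus (y - p) <= r -> modulus (A.[y] / B.[y]) <= d1) ->
    A.[p] = 0 -> modulus (z - p) <= r / 64 -> d2 <= modulus (A.[z] / B.[z]) ->
    modulus w < d2 ^+ 2 / (16 * d1) ->
    (forall y, modulus (y - p) <= r -> D.[y] != 0) ->
    (forall y, modulus (y - p) <= r -> modulus (C.[y] / D.[y]) <= Mb) ->
    modulus (C.[p] / D.[p]) = s0 ->
    (forall y, modulus (y - p) <= r -> A.[y] / B.[y] = w ->
       modulus (C.[y] / D.[y]) < expR ((3 * ln s0 - ln Mb) / 2)) ->
  exists2 y, modulus (y - p) <= r & C.[y] = 0.
Proof.
move=> r0 d12 Mb0 s00 B0 AB Ap zr zd ww D0 CD Cp Cw.
apply: contrapT => nex.
have C0 y : modulus (y - p) <= r -> C.[y] != 0.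
  by move=> hy; apply/eqP => h; apply: nex; exists y.
have r8 : r / 8 <= r by lra.
(* Covering is applied on the disc of radius [r / 8], so that the parameter y it produces is close
   enough to p for Hurwitz on the disc of radius r. This is why z has to lie within [r / 64]. *)
have [||||||||y hy yw] := @frac_cover R p (r / 8) A B 0 d1 d2 z w.
- by rewrite divr_gt0.
- exact: d12.
- by move=> y hy; apply: B0; lra.
- by move=> y hy; rewrite subr0; apply: AB; lra.
- by rewrite Ap mul0r.
- lra.
- by rewrite subr0.
- by rewrite subr0.
have hyr : modulus (y - p) <= r by lra.
(* Without a zero, [ln |C / D|] at y would be at least [(3 ln s0 - ln Mb) / 2], which is the
   threshold in the hypothesis. *)
have /andP[_] := frac_hurwitz r0 Mb0 C0 D0 CD hy.
rewrite Cp => h; have := Cw y hyr yw; rewrite ltNge => /negP; apply.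
have Cy : 0 < modulus (C.[y] / D.[y]) by rewrite modulus_gt0 mulf_neq0 ?invr_eq0 ?C0 ?D0.
by rewrite -[X in _ <= X]lnK ?posrE// ler_expR; lra.
Qed.

(** By induction [d m <= a e (1 + m x)] with x proportional to e: a factor [1 + C (e + d)] per step
    lets the bound double only after about [1 / e] steps. This is the source of the estimates
    [c / N <= |b - b0|]. *)
Lemma slow_growth (d : nat -> R) (C a dl e : R) n : 0 <= C -> 0 <= a -> 0 <= e ->
    (forall k, 0 <= d k) -> d 0%N <= a * e -> 2 * a * e <= dl ->
    (forall k, d k <= dl -> d k.+1 <= d k * (1 + C * (e + d k))) ->
    n%:R * (2 * C * (1 + 2 * a)) * e <= 1 ->
  d n <= 2 * a * e.
Proof.
move=> C0 a0 e0 d_ge0 d0 edl dS hn.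
have ae : 0 <= a * e by exact: mulr_ge0.
suff : d n <= a * e * (1 + n%:R * (2 * C * (1 + 2 * a)) * e).
  by move=> h; apply: le_trans h _; have := ler_wpM2l ae hn; nra.
have : (n <= n)%N by []; move: {1 3 4}n => m; elim: m => [|m IH] hm.
  by rewrite !mul0r addr0 mulr1.
have h := IH (ltnW hm).
pose x := 2 * C * (1 + 2 * a) * e.
have x0 : 0 <= x by rewrite /x !mulr_ge0// addr_ge0// mulr_ge0.
have hm1 : m%:R * x <= 1.
  apply: le_trans (_ : n%:R * x <= 1); last by rewrite /x !mulrA in hn *.
  by rewrite ler_wpM2r// ler_nat ltnW.
have h2 : d m <= 2 * a * e.
  apply: le_trans h _; have -> : m%:R * (2 * C * (1 + 2 * a)) * e = m%:R * x by rewrite /x; ring.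
  by have := ler_wpM2l ae hm1; lra.
have h3 := dS m (le_trans h2 edl); apply: le_trans h3 _.
have h4 : d m * (C * (e + d m)) <= a * e * x.
  have : C * (e + d m) <= C * (e + 2 * a * e) by rewrite ler_wpM2l// lerD2l.
  have : 0 <= C * (e + d m) by rewrite mulr_ge0// addr_ge0.
  move=> g0 g1; apply: le_trans (ler_pM (d_ge0 m) g0 h2 g1) _.
  by rewrite /x le_eqVlt; apply/orP; left; apply/eqP; ring.
rewrite mulrDr mulr1; apply: le_trans (lerD h h4) _.
by rewrite -natr1 /x le_eqVlt; apply/orP; left; apply/eqP; ring.
Qed.

End ParameterPlane.

(** * Quadratic polynomials parametrized by the multiplier of a fixed point *)

Section QuadraticPolynomials.
Context {R : realType}.
Implicit Types (z w y l c : R[i]).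

Definition qiter (K P : {poly R[i]}) n := iter n (fun Q => Q ^+ 2 + K) P.

Lemma horner_qiter K P n z : (qiter K P n).[z] = iter n (quad K.[z]) P.[z].
Proof. by elim: n => //= n <-; rewrite hornerD horner_exp. Qed.

Lemma iter_quad_bounded (K1 K2 : R) n : exists2 Mb : R, 0 < Mb & forall c z,
  modulus c <= K1 -> modulus z <= K2 -> modulus (iter n (quad c) z) <= Mb.
Proof.
elim: n => [|n [Mb Mb0 h]].
  by exists (`|K2| + 1); [rewrite ltr_wpDl|move=> c z _ hz /=; have := ler_norm K2; lra].
exists (Mb ^+ 2 + `|K1|); first by rewrite ltr_wpDr// exprn_gt0.
move=> c z hc hz; rewrite iterS /quad; apply: le_trans (ler_modulusD _ _) _.
apply: lerD; last by apply: le_trans hc _; exact: ler_norm.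
by rewrite modulusX lerXn2r ?nnegrE ?modulus_ge0 ?(ltW Mb0)// h.
Qed.

Lemma poly_root_upper (P : {poly R[i]}) p r : P.[p] = 0 -> exists2 C : R, 0 < C & forall z,
  modulus (z - p) <= r -> modulus P.[z] <= C * modulus (z - p).
Proof.
move=> /eqP/factor_theorem[Q ->]; have [C C0 hC] := poly_bounded Q p r.
exists C => // z /hC h; rewrite hornerM hornerXsubC modulusM.
by rewrite ler_wpM2r ?modulus_ge0.
Qed.

Lemma geometric_escape (d : nat -> R) (mu dl : R) : 1 < mu -> 0 < d 0%N ->
  (forall n, d n <= dl -> mu * d n <= d n.+1) -> exists n, dl < d n.
Proof.
move=> mu1 d0 dS; apply: contrapT => nex.
have h n : d n <= dl by rewrite leNgt; apply/negP => hn; apply: nex; exists n.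
have g n : mu ^+ n * d 0%N <= d n.
  elim: n => [|n IH]; first by rewrite mul1r.
  by apply: le_trans (dS n (h n)); rewrite exprS -mulrA ler_pM2l//; lra.
have [n hn] := expr_large ((dl + 1) / d 0%N) mu1.
rewrite ler_pdivrMr// in hn; have := g n; have := h n; lra.
Qed.

Lemma fixed_not_absorbed c y : quad c y = y -> modulus y <= modulus c + 2.
Proof.
move=> yE; rewrite leNgt; apply/negP => h; have := quad_growth (ltW h); rewrite yE.
by have := modulus_ge0 c; lra.
Qed.

Lemma landing_fixed_Mandelbrot c n : quad c (iter n (quad c) 0) = iter n (quad c) 0 -> Mandelbrot c.
Proof.
move=> yE; apply/MandelbrotP/quad_nonabsorbedP.
rewrite -(absorbed_iter (@quad_exterior_f R c) n) iter_quad_finite; apply/quad_nonabsorbedP => k.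
have -> : iter k (quad c) (iter n (quad c) 0) = iter n (quad c) 0 by elim: k => //= k ->.
exact: fixed_not_absorbed.
Qed.

Lemma periodic_Mandelbrot c n : (0 < n)%N -> iter n (quad c) 0 = 0 -> Mandelbrot c.
Proof.
move=> n0 E; apply/MandelbrotP/quad_nonabsorbedP => -[m Hm].
have En k : iter (k * n) (quad c) 0 = 0 by elim: k => // k IH; rewrite mulSn iterD IH.
have := iterH (@quad_exterior_f R c) (m * n - m)%N Hm; rewrite -iterD subnK ?leq_pmulr//.
rewrite iter_quad_finite En /quad_exterior/exterior/= modulus0.
by have := modulus_ge0 c; lra.
Qed.

Lemma Mandelbrot_escape c : ~ Mandelbrot c -> forall M : R, exists i, M < modulus (iter i (quad c) 0).
Proof.
move=> nM M; have [n hn] : exists n, modulus c + 2 < modulus (iter n (quad c) 0).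
  apply: contrapT => h; apply: nM; apply/MandelbrotP => n; rewrite leNgt; apply/negP => hn.
  by apply: h; exists n.
have [k hk] := exp2_large M; exists (k + n)%N; rewrite iterD.
have h1 := iter_quad_growth k (ltW hn); apply: lt_le_trans hk _; apply: le_trans h1.
by rewrite ler_peMr ?exprn_ge0//; have := modulus_ge0 c; lra.
Qed.

Lemma escape_of_filled c z : ~ filled_quad c z -> forall M : R, exists i, M < modulus (iter i (quad c) z).
Proof.
move=> nK M; have [n hn] : exists n, modulus c + 2 < modulus (iter n (quad c) z).
  apply: contrapT => h; apply: nK; apply/filled_quadP => n; rewrite leNgt; apply/negP => hn.
  by apply: h; exists n.
have [k hk] := exp2_large M; exists (k + n)%N; rewrite iterD.
have h1 := iter_quad_growth k (ltW hn); apply: lt_le_trans hk _; apply: le_trans h1.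
by rewrite ler_peMr ?exprn_ge0//; have := modulus_ge0 c; lra.
Qed.

(* [l] is the multiplier of the fixed point [l / 2] of [z ^+ 2 + kap l]. *)
Definition kap l : R[i] := l / 2 - l ^+ 2 / 4.

Definition kap_poly : {poly R[i]} := 2^-1 *: 'X - 4^-1 *: 'X^2.

Lemma horner_kap l : kap_poly.[l] = kap l.
Proof. by rewrite /kap_poly hornerD hornerN !hornerZ hornerX hornerXn /kap mulrC [4^-1 * _]mulrC. Qed.

(* The critical orbit, as polynomials in the multiplier. *)
Definition crit n := qiter kap_poly 0 n.

Lemma horner_crit n l : (crit n).[l] = iter n (quad (kap l)) 0.
Proof. by rewrite horner_qiter horner_kap horner0. Qed.

Lemma quad_kap l : quad (kap l) (l / 2) = l / 2.
Proof. by rewrite /quad /kap; field. Qed.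

Lemma kap_fixed c y : quad c y = y -> kap (2 * y) = c.
Proof.
move=> h; have E : c = quad c y - y ^+ 2 by rewrite /quad; ring.
by rewrite E h /kap; field.
Qed.

(** Since [(l - 1) ^ 2 = 1 - 4 kap l], lifting a parameter amounts to choosing a square root near
    [l - 1]. *)
Lemma kap_lift l c (e : R) : 0 < e -> 4 * modulus (c - kap l) < e ^+ 2 ->
  exists2 l', kap l' = c & modulus (l' - l) < e.
Proof.
move=> e0 h; have [|s sE hs] := @near_sqrt R (l - 1) (1 - 4 * c) e e0.
  have -> : 1 - 4 * c - (l - 1) ^+ 2 = - (4 * (c - kap l)) by rewrite /kap; field.
  by rewrite modulusN modulusM modulus_nat.
exists (s + 1); last by have -> : s + 1 - l = s - (l - 1) by ring.
have -> : kap (s + 1) = (1 - s ^+ 2) / 4 by rewrite /kap; field.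
by rewrite sE; field.
Qed.

Lemma kap_continuous l (e : R) : 0 < e -> exists2 d, 0 < d &
  forall l', modulus (l' - l) <= d -> modulus (kap l' - kap l) <= e.
Proof. by move=> /(poly_continuous kap_poly l)[d d0 h]; exists d => // l' /h; rewrite !horner_kap. Qed.

(** The fixed points have the multipliers [1 + s] and [1 - s] with [s ^ 2 = 1 - 4 c]. Their squared
    moduli add up to [2 + 2 |s| ^ 2 > 2], so one of them is repelling. *)
Lemma kap_repelling c : c != 1 / 4 -> exists2 l, kap l = c & 1 < modulus l.
Proof.
move=> c4; pose s := sqrtC (1 - 4 * c); have sE : s ^+ 2 = 1 - 4 * c by exact: sqrtCK.
have s0 : s != 0.
  apply: contraNneq c4 => s0; move: sE; rewrite s0 expr0n/= => /eqP; rewrite eq_sym subr_eq0 => /eqP h.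
  apply/eqP; have -> : c = (4 * c) / 4 by field.
  by rewrite -h.
have kE t : t ^+ 2 = 1 - 4 * c -> kap (1 + t) = c.
  move=> h; have -> : c = (1 - t ^+ 2) / 4 by rewrite h; field.
  by rewrite /kap; field.
have [h|h] := ltP 1 (modulus (1 + s)); first by exists (1 + s) => //; exact: kE.
exists (1 - s); first by apply: kE; rewrite sqrrN.
have h2 : modulus (1 + s) ^+ 2 + modulus (1 - s) ^+ 2 = 2 + 2 * modulus s ^+ 2.
  by rewrite !sqr_modulus; case: (s) => x y /=; ring.
have h3 : modulus (1 + s) ^+ 2 <= 1 by rewrite expr_le1// modulus_ge0.
have h4 : 0 < modulus s ^+ 2 by rewrite exprn_gt0// modulus_gt0.
have h5 : 1 < modulus (1 - s) ^+ 2 by lra.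
rewrite ltNge; apply/negP => h6; move: h5; rewrite ltNge => /negP; apply.
by rewrite expr_le1// modulus_ge0.
Qed.

Definition landing l n := iter n (quad (kap l)) 0 = l / 2.

Lemma closure_Mandelbrot c : closure (@Mandelbrot R) c -> Mandelbrot c.
Proof. by move=> h; apply: Mandelbrot_closed. Qed.

Lemma not_interior_Mandelbrot c (e : R) : ~ (@Mandelbrot R)° c -> 0 < e ->
  exists2 c', ~ Mandelbrot c' & modulus (c' - c) < e.
Proof.
move=> nint e0; apply: contrapT => nex; apply: nint; apply/nbhs_modulusP; exists e => // w hw.
by apply: contrapT => nM; apply: nex; exists w.
Qed.

(** The critical orbit is bounded at [l1] and escapes at parameters arbitrarily close to it, so
    nearby it meets [l / 2] or [- l / 2]. Both are sent to the fixed point by one more step, hence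
    the witness [i.+1]. *)
Lemma landing_dense c1 (e : R) : boundary (@Mandelbrot R) c1 -> c1 != 1 / 4 -> 0 < e ->
  exists l n, [/\ landing l n, 1 < modulus l & modulus (kap l - c1) <= e].
Proof.
move=> [/closure_Mandelbrot cM nint] c4 e0; have [l1 l1c l11] := kap_repelling c4.
have [d d0 hd] := kap_continuous l1 e0.
pose r := Num.min d ((modulus l1 - 1) / 2).
have r0 : 0 < r by rewrite lt_min d0 divr_gt0// subr_gt0.
have rl l : modulus (l - l1) <= r -> 1 < modulus l.
  rewrite le_min => /andP[_ h]; have := lerB_modulus l1 l; rewrite modulusBC; lra.
pose t1 : {poly R[i]} := 2^-1 *: 'X; pose t2 : {poly R[i]} := - t1.
have t1E l : t1.[l] = l / 2 by rewrite hornerZ hornerX mulrC.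
have [||||||i [l [hl lE]]] := @hit_of_two_targets R kap_poly t1 t2 crit l1 r 1 (modulus c1 + 2).
- by [].
- exact: r0.
- exact: ltr01.
- move=> z hz; rewrite hornerN t1E opprK.
  have -> : z / 2 + z / 2 = z by field.
  exact: ltW (rl _ hz).
- move=> x x0; exists l1; first by rewrite subrr modulus0.
  by move=> i; rewrite horner_crit l1c; exact: Mandelbrot_bounded.
- move=> x x0; have x4 : 0 < x ^+ 2 / 4 by rewrite divr_gt0// exprn_gt0.
  have [c' nM hc'] := not_interior_Mandelbrot nint x4.
  have [|l lc hl] := @kap_lift l1 c' x x0; first by rewrite l1c; lra.
  exists l => // M; have [i hi] := Mandelbrot_escape nM M.
  by exists i; rewrite horner_crit lc.
exists l, i.+1; split; last 2 first.
- exact: rl hl.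
- by rewrite -l1c; apply: hd; apply: le_trans hl _; rewrite ge_min lexx.
rewrite /landing iterS -horner_crit; case: lE => ->; rewrite ?hornerN t1E; last first.
  by rewrite /quad sqrrN; exact: quad_kap.
exact: quad_kap.
Qed.

End QuadraticPolynomials.

Lemma poly_lipschitz (R : realType) (P : {poly R[i]}) p (r K : R) z : 0 < r -> 0 < K ->
  (forall z, modulus (z - p) <= r -> modulus P.[z] <= K) -> modulus (z - p) <= r / 2 ->
  modulus (P.[z] - P.[p]) <= 72 * K / r * modulus (z - p).
Proof.
move=> r0 K0 PK zr.
have z1 y : (1 : {poly R[i]}).[y] != 0 by rewrite hornerC oner_neq0.
have h1 y : modulus (y - p) <= r -> (1 : {poly R[i]}).[y] != 0 by move=> _; exact: z1.
have h2 y : modulus (y - p) <= r -> modulus (P.[y] / (1 : {poly R[i]}).[y]) <= K.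
  by move=> hy; rewrite hornerC divr1; exact: PK.
have := frac_lipschitz r0 K0 h1 h2 zr; rewrite !hornerC !divr1 => h.
by apply: le_trans h _; rewrite le_eqVlt; apply/orP; left; apply/eqP; ring.
Qed.

(** * Critical orbits landing on a repelling fixed point *)

Section Landing.
Context {R : realType}.
Implicit Types (z w y : R[i]).
Variables (l0 : R[i]) (M : nat).
Hypotheses (l0_landing : landing l0 M) (l0_gt1 : 1 < modulus l0).

Let c0 := kap l0.
Let y0 := l0 / 2.

Let l0_neq0 : l0 != 0. Proof. by rewrite -modulus_gt0; apply: lt_trans l0_gt1. Qed.

Let y0_neq0 : y0 != 0. Proof. by rewrite mulf_neq0// invr_eq0 pnatr_eq0. Qed.

Lemma landing_iter k : iter (k + M) (quad c0) 0 = y0.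
Proof. by rewrite iterD l0_landing; elim: k => //= k ->; exact: quad_kap. Qed.

(** The multiplier 2 belongs to [c0 = 0], where the critical point 0 is fixed and never reaches the
    other fixed point 1. *)
Lemma landing_neq2 : l0 != 2.
Proof.
apply/eqP => l2; have k0 : kap 2 = 0 :> R[i] by rewrite /kap; field.
have : iter M (quad (0 : R[i])) 0 = 0 by elim: M => //= n ->; rewrite /quad addr0 expr0n.
have := l0_landing; rewrite /landing l2 k0 => -> /eqP.
by rewrite mulfV ?pnatr_eq0// oner_eq0.
Qed.

Lemma landing_c_neq0 : c0 != 0.
Proof.
have -> : c0 = l0 * (2 - l0) / 4 by rewrite /c0 /kap; field.
by rewrite !mulf_neq0 ?invr_eq0 ?pnatr_eq0// subr_eq0 eq_sym landing_neq2.
Qed.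

Lemma landing_Mandelbrot : Mandelbrot c0.
Proof. by apply: (@landing_fixed_Mandelbrot R _ M); rewrite l0_landing quad_kap. Qed.

Let dl := (modulus l0 - 1) / 4.
Let mu := (1 + modulus l0) / 2.

Let dl_gt0 : 0 < dl. Proof. by rewrite divr_gt0// subr_gt0. Qed.
Let mu_gt1 : 1 < mu. Proof. by rewrite /mu; have := l0_gt1; lra. Qed.

Let dist n (l : R[i]) : R := modulus ((crit n).[l] - l / 2).

(** The deviation is multiplied by [x + l / 2], which differs from [l0] by at most [2 dl], half of
    [|l0| - 1]. *)
Lemma dist_step n l : modulus (l - l0) <= dl -> dist n l <= dl ->
  mu * dist n l <= dist n.+1 l <= 2 * modulus l0 * dist n l.
Proof.
move=> hl hd; rewrite /dist; set x := (crit n).[l].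
have E : (crit n.+1).[l] - l / 2 = (x - l / 2) * (x + l / 2).
  rewrite -{1}(quad_kap l) /x !horner_crit iterS /quad; ring.
have d0 := modulus_ge0 (x - l / 2).
have E2 : x + l / 2 = l0 + ((l - l0) + (x - l / 2)) by field.
have h1 := ler_modulusD (l - l0) (x - l / 2).
have h2 := lerB_modulusD l0 ((l - l0) + (x - l / 2)).
have h3 := ler_modulusD l0 ((l - l0) + (x - l / 2)).
rewrite -E2 in h2 h3; have hd' : modulus (x - l / 2) <= dl by exact: hd.
rewrite E modulusM mulrC [X in _ <= _ <= X]mulrC !ler_wpM2l//.
  by rewrite /dl in hl hd'; have := l0_gt1; lra.
by rewrite /mu; rewrite /dl in hl hd'; have := l0_gt1; lra.
Qed.

(** The critical iterate minus the fixed point is a nonzero polynomial in l, since at [l = 2] the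
    critical orbit is 0 and the fixed point 1. The exponent e is its order of vanishing at [l0]. *)
Lemma dist_landing : exists e : nat, exists a Cb rho : R, [/\ 0 < a, 0 <= Cb, 0 < rho <= dl &
  forall l, modulus (l - l0) <= rho -> a * modulus (l - l0) ^+ e <= dist M l <= Cb * modulus (l - l0)].
Proof.
pose D : {poly R[i]} := crit M - 2^-1 *: 'X.
have DE l : D.[l] = (crit M).[l] - l / 2 by rewrite hornerD hornerN hornerZ hornerX [2^-1 * l]mulrC.
have D0 : D != 0.
  apply/eqP => D0; have := DE 2; rewrite D0 horner0 horner_crit.
  have k0 : kap 2 = 0 :> R[i] by rewrite /kap; field.
  have -> : iter M (quad (kap 2)) 0 = 0 :> R[i].
    by rewrite k0; elim: M => //= n ->; rewrite /quad addr0 expr0n.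
  by rewrite mulfV ?pnatr_eq0// sub0r => /eqP; rewrite eq_sym oppr_eq0 oner_eq0.
have Dl : D.[l0] = 0 by rewrite DE horner_crit l0_landing subrr.
have [e [a a0 [rho rho0 lower]]] := poly_lower l0 D0.
have [Cb Cb0 upper] := poly_root_upper dl Dl.
exists e, a, Cb, (Num.min rho dl); split; [by []|exact: ltW|by rewrite lt_min rho0 dl_gt0 ge_min lexx orbT|].
move=> l; rewrite le_min => /andP[h1 h2]; rewrite /dist -DE.
by rewrite lower//= upper.
Qed.

(** Otherwise all critical iterates would be uniformly bounded on a disc about [l0], hence
    equi-Lipschitz there; at a close parameter the orbit would then stay near the repelling fixed
    point for ever, against the geometric growth of the deviation. *)
Lemma landing_not_interior : ~ (@Mandelbrot R)° c0.
Proof.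
move=> /nbhs_modulusP[e e0 he]; have e2 : 0 < e / 2 by rewrite divr_gt0.
have [d d0 hd] := kap_continuous l0 e2.
have [q [a [Cb [rho [a0 _ /andP[rho0 rhodl] hD]]]]] := dist_landing.
pose r := Num.min d rho; have r0 : 0 < r by rewrite lt_min d0.
pose K := modulus c0 + e / 2 + 2.
have K0 : 0 < K by rewrite addr_gt0// ltr_wpDl ?modulus_ge0.
have Fb n l : modulus (l - l0) <= r -> modulus (crit n).[l] <= K.
  rewrite le_min => /andP[h1 _]; have h2 := hd l h1.
  have cM : Mandelbrot (kap l) by apply: he; rewrite -/c0; lra.
  rewrite horner_crit; apply: le_trans (Mandelbrot_bounded cM n) _.
  by have := lerB_modulus (kap l) c0; rewrite /K -/c0 in h2 *; lra.
pose C := 72 * K / r + 1; have C0 : 0 < C by rewrite addr_gt0// divr_gt0// mulr_gt0.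
pose s := Num.min (r / 2) (dl / C).
have s0 : 0 < s by rewrite lt_min; apply/andP; split; exact: divr_gt0.
pose l := l0 + s%:C%C.
have ls : modulus (l - l0) = s by rewrite /l addrC addKr modulus_real ger0_norm// ltW.
have sr : s <= r / 2 by rewrite ge_min lexx.
have lr : modulus (l - l0) <= r by rewrite ls; lra.
have lr2 : modulus (l - l0) <= r / 2 by rewrite ls.
have rr : r <= rho by rewrite ge_min lexx orbT.
have sC : C * s <= dl by rewrite mulrC -ler_pdivlMr// ge_min lexx orbT.
have small n : dist (n + M) l <= dl.
  have := poly_lipschitz r0 K0 (Fb (n + M)%N) lr2.
  rewrite ls [(crit _).[l0]]horner_crit -/c0 landing_iter => h.
  rewrite /dist; have := modulus_triangle y0 (crit (n + M)).[l] (l / 2).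
  have -> : y0 - l / 2 = (l0 - l) / 2 by rewrite /y0; field.
  rewrite modulusM modulusV modulus_nat [modulus (l0 - l)]modulusBC ls.
  move: sC; rewrite /C; lra.
have d00 : 0 < dist (0 + M) l.
  have /andP[h _] := hD l (le_trans lr rr); apply: lt_le_trans h.
  by rewrite mulr_gt0// exprn_gt0// ls.
have [n] := @geometric_escape R (fun n => dist (n + M) l) mu dl mu_gt1 d00
  (fun n h => (andP (dist_step (le_trans lr (le_trans rr rhodl)) h)).1).
by rewrite ltNge small.
Qed.

Lemma landing_boundary : boundary (@Mandelbrot R) c0.
Proof.
by split; [apply: subset_closure; exact: landing_Mandelbrot|exact: landing_not_interior].
Qed.

Lemma fixed_step z : modulus (z - y0) <= dl -> mu * modulus (z - y0) <= modulus (quad c0 z - y0).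
Proof.
move=> h; have -> : quad c0 z - y0 = (z - y0) * (z + y0).
  by rewrite /quad /c0 /kap /y0; field.
rewrite modulusM mulrC ler_wpM2l ?modulus_ge0//.
have := lerB_modulusD l0 (z - y0); have -> : l0 + (z - y0) = z + y0 by rewrite /y0; field.
by rewrite /mu; rewrite /dl in h; have := l0_gt1; lra.
Qed.

Lemma repelling_not_interior (e : R) : 0 < e ->
  exists2 q, modulus (q - y0) < e & ~ filled_quad c0 q.
Proof.
move=> e0; apply: contrapT => nex.
have inK q : modulus (q - y0) < e -> filled_quad c0 q.
  by move=> hq; apply: contrapT => h; apply: nex; exists q.
pose r := e / 2; have r0 : 0 < r by rewrite divr_gt0.
pose K := modulus c0 + 2; have K0 : 0 < K by rewrite ltr_wpDl ?modulus_ge0.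
have Kb n q : modulus (q - y0) <= r -> modulus (quad_poly c0 n).[q] <= K.
  move=> hq; rewrite horner_quad_poly; move: n; apply/filled_quadP; apply: inK; rewrite /r in hq; lra.
pose C := 72 * K / r; have C0 : 0 < C by rewrite divr_gt0// mulr_gt0.
pose s := Num.min (r / 2) (dl / C).
have s0 : 0 < s by rewrite lt_min; apply/andP; split; exact: divr_gt0.
have sr : s <= r / 2 by rewrite ge_min lexx.
have sC : C * s <= dl by rewrite mulrC -ler_pdivlMr// ge_min lexx orbT.
pose q := y0 + s%:C%C.
have qs : modulus (q - y0) = s by rewrite /q addrC addKr modulus_real ger0_norm// ltW.
have fixn n : iter n (quad c0) y0 = y0 by elim: n => //= n ->; exact: quad_kap.
have small n : modulus (iter n (quad c0) q - y0) <= dl.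
  have qr2 : modulus (q - y0) <= r / 2 by rewrite qs.
  have := poly_lipschitz r0 K0 (Kb n) qr2; rewrite !horner_quad_poly fixn qs -/C => h.
  exact: le_trans h sC.
have [n] := @geometric_escape R (fun n => modulus (iter n (quad c0) q - y0)) mu dl mu_gt1
  ltac:(by rewrite /= qs) (fun n h => fixed_step h).
by rewrite ltNge small.
Qed.

(** The targets t and [- t] have the same image, so hitting either one yields a preimage of
    [quad c0 t]. The point [y0] itself has a bounded orbit, and escaping points accumulate on it by
    [repelling_not_interior]. *)
Lemma preimages_near_repelling (t : R[i]) (e : R) : t != 0 -> 0 < e ->
  exists i z, modulus (z - y0) <= e /\ iter i.+1 (quad c0) z = quad c0 t.
Proof.
move=> t0 e0.
have t2 : 0 < modulus (2 * t) by rewrite modulus_gt0 mulf_neq0// pnatr_eq0.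
have [||||||i [z [hz zE]]] := @hit_of_two_targets R c0%:P t%:P (- t)%:P (quad_poly c0) y0 e (modulus (2 * t)) (modulus y0).
- by [].
- exact: e0.
- exact: t2.
- by move=> z _; rewrite !hornerC opprK; have -> : t + t = 2 * t by ring.
- move=> x x0; exists y0; first by rewrite subrr modulus0.
  move=> i; rewrite horner_quad_poly; suff -> : iter i (quad c0) y0 = y0 by [].
  by elim: i => //= i ->; exact: quad_kap.
- move=> x x0; have [q hq nK] := repelling_not_interior x0; exists q => // N.
  by have [i hi] := escape_of_filled nK N; exists i; rewrite horner_quad_poly.
exists i, z; split=> //; rewrite iterS -horner_quad_poly.
by case: zE => ->; rewrite hornerC // /quad sqrrN.
Qed.

(* Rescaling around [l0] transfers a preimage of [0] near the repelling fixed
   point to a parameter with periodic critical point. *)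
Lemma landing_centers : exists C1 C2 : nat, exists2 rho : R, 0 < rho & forall k0, exists k N l,
  [/\ (k0 <= k)%N, (0 < N <= C1 * k + C2)%N, modulus (l - l0) <= rho / 64 ^+ k &
      iter N (quad (kap l)) 0 = 0].
Proof.
have [e [a [Cb [rho [a0 Cb0 /andP[rho0 rhodl] hD]]]]] := dist_landing.
have Lam1 : 1 <= 2 * modulus l0 by have := l0_gt1; lra.
have dS n z : (M <= n)%N -> modulus (z - l0) <= rho -> dist n z <= dl ->
    mu * dist n z <= dist n.+1 z <= 2 * modulus l0 * dist n z.
  by move=> _ hz; apply: dist_step; exact: le_trans hz rhodl.
have [d2 /andP[d20 d2l] [C1 [C2 hk]]] := escape_scale rho0 mu_gt1 Lam1 dl_gt0 a0 Cb0 dS hD.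
pose eta := d2 ^+ 2 / (16 * dl) / 2.
have eps0 : 0 < d2 ^+ 2 / (16 * dl) by apply: divr_gt0; [exact: exprn_gt0|rewrite mulr_gt0// ltr0n].
have eta0 : 0 < eta by exact: divr_gt0.
(* With this t, [quad c0 t = 0]: the preimages found near [y0] are preimages of the critical
   point. *)
pose t := sqrtC (- c0); have tE : t ^+ 2 = - c0 by exact: sqrtCK.
have t0 : t != 0.
  by apply: contraNneq landing_c_neq0 => t0; rewrite -oppr_eq0 -tE t0 expr0n.
have [i [zs [zs1 zs2]]] := preimages_near_repelling t0 eta0.
have zs3 : iter i.+1 (quad c0) zs = 0 by rewrite zs2 /quad tE addNr.
(* The preimage [zs] is moved along with the fixed point [l / 2]. As S vanishes at [l0], the moved
   point still ends close to 0, which is the smallness required by [parameter_hit]. *)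
pose S := qiter kap_poly ((zs - y0)%:P + 2^-1 *: 'X) i.+1.
have SE l : S.[l] = iter i.+1 (quad (kap l)) (zs - y0 + l / 2).
  by rewrite horner_qiter horner_kap hornerD hornerC hornerZ hornerX [2^-1 * l]mulrC.
have S0 : S.[l0] = 0 by rewrite SE -/y0 subrK.
pose K := modulus l0 + dl.
have [Kc0 [Kc1 hKc]] : exists Kc : R, 0 < Kc /\ forall l, modulus (l - l0) <= dl -> modulus (kap l) <= Kc.
  by have [Kc Kc0 h] := poly_bounded kap_poly l0 dl; exists Kc; split=> // l /h; rewrite horner_kap.
have [Mb Mb0 hMb] := @iter_quad_bounded R Kc0 (K + dl) i.+1.
pose e0 := expR ((3 * ln (modulus y0) - ln Mb) / 2).
have e00 : 0 < e0 by exact: expR_gt0.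
have e02 : 0 < e0 / 2 by rewrite divr_gt0.
have [ds ds0 hds] := poly_continuous S l0 e02.
have [k1 hk1] := @expr_large R 64 (rho / ds) (ltr1n _ 64).
have p64 k : 0 < (64 : R) ^+ k by rewrite exprn_gt0// ltr0n.
exists C1, (C2 + i.+1)%N, rho => // k0.
have [k [n [hk0 /andP[Mn nC] small [z zr zd]]]] := hk (maxn k0 k1).
pose r := rho / 64 ^+ k.
have r0 : 0 < r by rewrite divr_gt0.
have rds : r <= ds.
  rewrite ler_pdivrMr// mulrC -ler_pdivrMr//; apply: le_trans hk1 _.
  by rewrite ler_eXn2l ?ltr1n//; apply: leq_trans hk0; exact: leq_maxr.
have rdl : r <= dl by apply: le_trans rhodl; rewrite ler_pdivrMr// ler_peMr ?(ltW rho0)// exprn_ege1// ler1n.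
pose A : {poly R[i]} := crit n - 2^-1 *: 'X.
have AE l : A.[l] / (1 : {poly R[i]}).[l] = (crit n).[l] - l / 2.
  by rewrite hornerC divr1 hornerD hornerN hornerZ hornerX [2^-1 * l]mulrC.
have n1 l : (1 : {poly R[i]}).[l] != 0 by rewrite hornerC oner_neq0.
have lands m : (M <= m)%N -> (crit m).[l0] = y0.
  by move=> hm; rewrite horner_crit -(subnK hm) landing_iter.
have [y hy yE] : exists2 y, modulus (y - l0) <= r & (crit (i.+1 + n)).[y] = 0.
  apply: (@parameter_hit R l0 r dl d2 (modulus y0) Mb A 1 (crit (i.+1 + n)) 1 z (zs - y0)).
  - exact: r0.
  - by rewrite d20.
  - exact: Mb0.
  - by rewrite modulus_gt0.
  - by move=> *; exact: n1.
  - by move=> l hl; rewrite AE; apply: small hl; rewrite Mn leqnn.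
  - by have := AE l0; rewrite hornerC divr1 => ->; rewrite lands// subrr.
  - apply: le_trans zr _; rewrite exprS /r invfM mulrCA mulrC; exact: lexx.
  - by rewrite AE ltW.
  - by apply: le_lt_trans zs1 _; rewrite /eta ltr_pdivrMr// ltr_pMr// ltr1n.
  - by move=> *; exact: n1.
  - move=> l hl; rewrite hornerC divr1 horner_crit iterD; apply: hMb.
      by apply: hKc; exact: le_trans hl rdl.
    have h := small n l ltac:(by rewrite Mn leqnn) hl; rewrite /dist horner_crit in h.
    have := modulus_triangle (l / 2) (iter n (quad (kap l)) 0) 0; rewrite !subr0.
    rewrite [modulus (l / 2)]modulusM modulusV modulus_nat.
    by have := lerB_modulus l l0; have := modulus_ge0 l; rewrite /K; have := le_trans hl rdl; lra.
  - by rewrite hornerC divr1 lands// (leq_trans Mn)// leq_addl.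
  - move=> l hl; rewrite AE => lE; rewrite hornerC divr1.
    have := hds l (le_trans hl rds); rewrite S0 subr0 SE -lE horner_crit subrK -iterD -horner_crit.
    by rewrite -/e0; lra.
exists k, (i.+1 + n)%N, y; split=> //.
- by apply: leq_trans hk0; exact: leq_maxl.
- by rewrite addSn ltnS leq0n /= -addSn addnC addnA leq_add2r.
- by rewrite -horner_crit.
Qed.

End Landing.

(** * Arithmetic exclusion of neutral landing points *)

Section NeutralLanding.
Context {R : realType}.

(** In the variable [y = l / 2] the parameter is [y - y ^+ 2], so the critical orbit is given by
    integer polynomials, and landing becomes an integral equation for y. *)
Fixpoint int_crit n : {poly int} := if n is n'.+1 then int_crit n' ^+ 2 + ('X - 'X^2) else 0.

Lemma horner_int_crit n (y : R[i]) :
  (map_poly intr (int_crit n)).[y] = iter n (quad (y - y ^+ 2)) 0.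
Proof.
elim: n => [|n IH] /=; first by rewrite rmorph0 horner0.
rewrite rmorphD rmorphXn rmorphB/= map_polyX map_polyXn hornerD horner_exp IH.
by rewrite hornerD hornerN hornerX hornerXn.
Qed.

(** Only [int_crit 1] has leading coefficient -1; squaring makes the later ones monic. The size
    condition ensures that adding or subtracting X leaves P monic. *)
Lemma int_crit_lead n : exists P : {poly int},
  [/\ P \is monic, (2 < size P)%N & int_crit n.+1 = P \/ int_crit n.+1 = - P].
Proof.
elim: n => [|n [P [Pm sP PE]]].
  exists ('X^2 - 'X); rewrite /= expr0n/= add0r; split; last by right; rewrite opprB.
    by rewrite monicE lead_coefDl ?lead_coefXn// size_polyN size_polyX size_polyXn.
  by rewrite size_polyDl ?size_polyXn// size_polyN size_polyX.
have E : int_crit n.+2 = P ^+ 2 + ('X - 'X^2).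
  by rewrite [LHS]/=; case: PE => /= ->; rewrite ?sqrrN.
have s2 : (4 < size (P ^+ 2)%R)%N.
  by rewrite expr2 size_monicM ?monic_neq0//; move: (size P) sP => k; lia.
have s1 : (size ('X - 'X^2 : {poly int})%R < size (P ^+ 2)%R)%N.
  by apply: leq_ltn_trans s2; rewrite (leq_trans (size_polyD _ _))// geq_max size_polyN size_polyX size_polyXn.
exists (P ^+ 2 + ('X - 'X^2)); split; last by left.
  by rewrite monicE lead_coefDl// -monicE monic_exp.
by rewrite size_polyDl// ltnW// ltnW.
Qed.

(** After multiplication by [4 ^ m] all terms but the leading one are divisible by 4, which would
    make -1 a multiple of 4. *)
Lemma quarter_not_integral : ~ integralOver (intr : int -> R[i]) (1 / 4).
Proof.
move=> [P Pm /rootP].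
rewrite horner_coef size_map_poly_id0; last by rewrite (monicP Pm) rmorph1 oner_neq0.
have sP : (0 < size P)%N by rewrite size_poly_gt0 monic_neq0.
move: (sP) Pm; case E : (size P) => [//|m] _ Pm h.
have lc : P`_m = 1 by move: Pm; rewrite monicE lead_coefE E => /eqP.
have : ((\sum_(i < m.+1) P`_i * 4 ^+ (m - i))%R : int)%:~R = 0 :> R[i].
  rewrite rmorph_sum/=; have := congr1 (fun x => 4 ^+ m * x) h; rewrite mulr0 mulr_sumr => h'.
  rewrite -[RHS]h'; apply: eq_bigr => i _; rewrite rmorphM rmorphXn/= coef_map/=.
  have im : (i <= m)%N by rewrite -ltnS.
  have -> : (4 : R[i]) ^+ m = 4 ^+ (m - i) * 4 ^+ i by rewrite -exprD subnK.
  have u0 : (4 : R[i]) ^+ i != 0 by rewrite expf_neq0// pnatr_eq0.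
  rewrite div1r exprVn; have -> : 4%:~R = 4 :> R[i] by [].
  by field.
move=> /eqP; rewrite intr_eq0 big_ord_recr /= subnn mulr1 lc => /eqP h2.
have : (4 %| \sum_(i < m) P`_i * 4 ^+ (m - i))%Z.
  apply: rpred_sum => i _; rewrite -[(m - i)%N]prednK ?subn_gt0// exprS mulrCA.
  by rewrite dvdz_mulr.
have -> : \sum_(i < m) P`_i * 4 ^+ (m - i) = -1 by apply/eqP; rewrite -addr_eq0 h2.
by [].
Qed.

(* [y = l / 2] is then an algebraic integer, and so is its conjugate, but
   [|y| ^ 2 = 1 / 4]. *)
Lemma neutral_not_landing (l : R[i]) n : landing l n -> modulus l != 1.
Proof.
rewrite /landing => lE; apply/eqP => l1.
pose y := l / 2; have kE : kap l = y - y ^+ 2 by rewrite /kap /y; field.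
rewrite kE -/y -horner_int_crit in lE.
case: n lE => [|n lE].
  rewrite horner_int_crit /= => /esym/eqP; rewrite mulf_eq0 invr_eq0 pnatr_eq0 orbF => /eqP l0.
  by move: l1; rewrite l0 modulus0 => /eqP; rewrite eq_sym oner_eq0.
have [P [Pm sP PE]] := int_crit_lead n.
have [Q Qm Qy] : integralOver (intr : int -> R[i]) y.
  have sX (e : {poly int}) : (size e <= 2)%N -> P + e \is monic.
    move=> se; rewrite monicE lead_coefDl ?(monicP Pm)//; exact: leq_ltn_trans se sP.
  case: PE => PE; rewrite PE in lE.
    exists (P - 'X); first by apply: sX; rewrite size_polyN size_polyX.
    by apply/rootP; rewrite rmorphB/= map_polyX hornerD hornerN hornerX lE subrr.
  exists (P + 'X); first by apply: sX; rewrite size_polyX.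
  apply/rootP; rewrite rmorphD/= map_polyX hornerD hornerX -[X in _ + X]lE.
  by rewrite rmorphN hornerN subrr.
have Qc : integralOver (intr : int -> R[i]) (y^*)%C.
  exists Q => //; apply/rootP.
  have -> : map_poly (intr : int -> R[i]) Q = map_poly (@conjc R) (map_poly intr Q).
    by rewrite -map_poly_comp; apply: eq_map_poly => z /=; rewrite rmorph_int.
  by rewrite horner_map (rootP Qy) rmorph0.
apply: quarter_not_integral; have -> : 1 / 4 = y * (y^*)%C :> R[i].
  have -> : y * (y^*)%C = (modulus y ^+ 2)%:C%C.
    by rewrite sqr_modulus; case: (y) => a b; apply/eqP; rewrite eq_complex /=; apply/andP; split; apply/eqP; ring.
  have -> : modulus y ^+ 2 = 4^-1 by rewrite /y modulusM modulusV modulus_nat l1; field.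
  by rewrite fmorphV rmorph_nat div1r.
by apply: integral_mul => //; exists Q.
Qed.

End NeutralLanding.

(** * Slow departure from a neutral fixed point of [z + b + 1 / z] *)

Section ParabolicParameters.
Context {R : realType}.
Implicit Types (z w y b h : R[i]).

(* Homogeneous coordinates of the orbit of the critical point [1] of
   [z + b + 1 / z], as polynomials in [b]. *)
Definition hp n : {poly R[i]} := (gpair 'X 1 1 n).1.
Definition hq n : {poly R[i]} := (gpair 'X 1 1 n).2.

Lemma gpair_hpq b n : gpair b 1 1 n = ((hp n).[b], (hq n).[b]).
Proof. by have := gpair_horner ('X : {poly R[i]}) 1 1 n b; rewrite hornerX !hornerC. Qed.

Lemma iter_gmap1 b n : iter n (gmap b) (finite_point 1) = proj (hp n).[b] (hq n).[b].
Proof. by rewrite iter_gmap_finite gpair_hpq. Qed.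

Lemma hpq_neq0 b n : ((hp n).[b] != 0) || ((hq n).[b] != 0).
Proof. by have := @gpair_neq0 R b 1 1 n; rewrite oner_neq0 gpair_hpq => /(_ isT). Qed.

Lemma hpS b n : (hp n.+1).[b] = (hp n).[b] ^+ 2 + b * (hp n).[b] * (hq n).[b] + (hq n).[b] ^+ 2.
Proof. by have := gpairS b 1 1 n; rewrite !gpair_hpq => -[]. Qed.

Lemma hqS b n : (hq n.+1).[b] = (hp n).[b] * (hq n).[b].
Proof. by have := gpairS b 1 1 n; rewrite !gpair_hpq => -[]. Qed.

Lemma proj_infinity (u v : R[i]) : proj u v = infinity R -> v = 0.
Proof. by rewrite /proj; case: eqP. Qed.

Lemma proj_finite (u v z : R[i]) : proj u v = finite_point z -> v != 0 /\ u / v = z.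
Proof. by rewrite /proj; case: eqP => // _ []. Qed.

(** The number [1 + b / h] is the exact factor in [gmap_fixed_step]. At [b = b0] and [h = - b0^-1]
    it is the multiplier [1 - b0 ^+ 2], and the estimate controls its variation in both
    variables. *)
Lemma multiplier_near b0 b h : b0 != 0 -> modulus (b - b0) <= modulus b0 / 2 ->
    modulus (b - b0) <= 1 -> modulus (h + b^-1) <= (2 * (modulus b0 + 1))^-1 ->
  [/\ b != 0, h != 0 & modulus (1 + b / h - (1 - b0 ^+ 2)) <=
     2 * (modulus b0 + 1) ^+ 3 * modulus (h + b^-1) + 2 * (modulus b0 + 1) * modulus (b - b0)].
Proof.
move=> b00 h1 h2 h3; set K := modulus b0 + 1 in h3 *.
have b0p : 0 < modulus b0 by rewrite modulus_gt0.
have K0 : 0 < K by rewrite addr_gt0.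
have bK : modulus b <= K by have := lerB_modulus b b0; rewrite /K; lra.
have bp : 0 < modulus b by have := lerB_modulus b0 b; rewrite modulusBC; lra.
have bn : b != 0 by rewrite -modulus_gt0.
have h4 : modulus b^-1 / 2 <= modulus h.
  have h5 := lerB_modulusD (- b^-1) (h + b^-1); rewrite addrCA addNr addr0 modulusN in h5.
  have h6 : K^-1 <= modulus b^-1 by rewrite modulusV lef_pV2 ?posrE.
  by rewrite invfM in h3; lra.
have hpos : 0 < modulus h by apply: lt_le_trans h4; rewrite divr_gt0// modulus_gt0 invr_eq0.
have hn : h != 0 by rewrite -modulus_gt0.
split=> //.
have E : 1 + b / h - (1 - b0 ^+ 2) = b ^+ 2 * (h + b^-1) / h - (b + b0) * (b - b0).
  by field; rewrite hn bn.
rewrite E; apply: le_trans (ler_modulusB _ _) _; apply: lerD.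
  rewrite modulusM [modulus (_ * (h + _))]modulusM [modulus (b ^+ 2)]modulusX modulusV ler_pdivrMr//.
  have h7 : 1 <= 2 * K * modulus h.
    apply: le_trans (_ : 2 * modulus b * modulus h <= _); last first.
      by rewrite ler_wpM2r ?modulus_ge0// ler_pM2l.
    by have h5 := ler_wpM2l (ltW bp) h4; rewrite modulusV mulrA mulfV ?gt_eqF// in h5; lra.
  have h8 : modulus b ^+ 2 <= K ^+ 2 by rewrite lerXn2r ?nnegrE ?modulus_ge0 ?(ltW K0).
  have h9 := ler_wpM2l (_ : 0 <= K ^+ 2 * modulus (h + b^-1)) h7.
  have h10 := ler_wpM2r (modulus_ge0 (h + b^-1)) h8.
  apply: le_trans h10 _; rewrite -[X in X <= _]mulr1.
  apply: le_trans (h9 _) _; first by rewrite mulr_ge0 ?modulus_ge0// exprn_ge0// ltW.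
  by rewrite le_eqVlt; apply/orP; left; apply/eqP; ring.
rewrite modulusM ler_wpM2r ?modulus_ge0//; have := ler_modulusD b b0; rewrite /K in bK *; lra.
Qed.

Lemma gmap_fixed_step b h : b != 0 -> h != 0 -> h + b + h^-1 + b^-1 = (h + b^-1) * (1 + b / h).
Proof. by move=> b0 h0; field; rewrite b0 h0. Qed.

Lemma poly_away0 (P : {poly R[i]}) b0 : P.[b0] != 0 ->
  exists2 r : R, 0 < r & forall b, modulus (b - b0) <= r -> modulus P.[b0] / 2 <= modulus P.[b].
Proof.
move=> P0; have p0 : 0 < modulus P.[b0] / 2 by rewrite divr_gt0// modulus_gt0.
have [d d0 hd] := poly_continuous P b0 p0; exists d => // b /hd.
by have := lerB_modulus P.[b0] P.[b]; rewrite modulusBC; lra.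
Qed.

(* [h n b] is the size of [1 / z] or of [z + 1 / b] at the [n]-th critical
   iterate [z], according to the fixed point on which the critical orbit lands. *)
Lemma slow_from_step b0 M (h : nat -> R[i] -> R) (C a r dl : R) :
    0 <= C -> 0 < a -> 0 < r -> 0 < dl -> (forall n b, 0 <= h n b) ->
    (forall n b, modulus (b - b0) <= r -> h n b <= dl ->
       h n.+1 b <= h n b * (1 + C * (modulus (b - b0) + h n b))) ->
    (forall b, modulus (b - b0) <= r -> h M b <= a * modulus (b - b0)) ->
    (forall n b, modulus (b - b0) <= r -> h n b <= dl -> iter n (gmap b) (finite_point 1) <> finite_point 1) ->
    (forall n, (0 < n < M)%N -> iter n (gmap b0) (finite_point 1) <> finite_point 1) ->
  exists2 c, 0 < c & exists2 eta, 0 < eta & forall b N, modulus (b - b0) <= eta -> (0 < N)%N ->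
    iter N (gmap b) (finite_point 1) = finite_point 1 -> c / N%:R <= modulus (b - b0).
Proof.
move=> C0 a0 r0 dl0 h0 hS hM h1 hlt.
(* Before the landing time M the orbit of 1 under [gmap b0] does not return to 1. This is an open
   condition on b, so periods below M do not occur near [b0]. *)
have small : forall m, (m <= M)%N -> exists2 r' : R, 0 < r' & forall n b, (0 < n < m)%N ->
    modulus (b - b0) <= r' -> iter n (gmap b) (finite_point 1) <> finite_point 1.
  elim=> [_|m IH mM]; first by exists 1 => // n b; rewrite ltn0 andbF.
  have [r' r'0 hr'] := IH (ltnW mM).
  case: m mM {IH} hr' => [_ _|m mM hr']; first by exists 1 => // n b; rewrite ltnS => /andP[n0]; rewrite leqn0 => /eqP n1; rewrite n1 in n0.
  have nz : (hp m.+1 - hq m.+1).[b0] != 0.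
    rewrite hornerD hornerN subr_eq0; apply/eqP => E; apply: (hlt m.+1); first by rewrite mM.
    rewrite iter_gmap1 /proj E; case: eqP => [q0|/eqP q0]; last by rewrite divff.
    by have := hpq_neq0 b0 m.+1; rewrite E q0 eqxx.
  have [r2 r20 hr2] := poly_away0 nz; exists (Num.min r' r2); first by rewrite lt_min r'0.
  move=> n b /andP[n0]; rewrite ltnS leq_eqVlt le_min => /orP[/eqP ->|nm] /andP[e1 e2].
    rewrite iter_gmap1 => /proj_finite[q0 E]; have := hr2 b e2.
    rewrite leNgt => /negP; apply; rewrite hornerD hornerN.
    have -> : (hp m.+1).[b] = (hq m.+1).[b] by apply: (mulIf (invr_neq0 q0)); rewrite E divff.
    by rewrite subrr modulus0 divr_gt0// modulus_gt0.
  by apply: hr' => //; rewrite n0.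
have [r' r'0 hr'] := small M (leqnn M).
(* X dominates the rate in [slow_growth]; the added 1 makes it positive. If [|b - b0|] were below
   [X^-1 / N], the orbit could not get back to 1 by the time N. *)
pose X := 2 * C * (1 + 2 * a) + 1.
have X0 : 0 < X by rewrite ltr_wpDl// !mulr_ge0// addr_ge0// mulr_ge0// ltW.
exists X^-1; first by rewrite invr_gt0.
exists (Num.min (Num.min r r') (dl / (2 * a))); first by rewrite !lt_min r0 r'0 divr_gt0// mulr_gt0.
move=> b N; rewrite !le_min => /andP[/andP[e1 e2] e3] N0 per.
have [NM|NM] := ltnP N M; first by case: (hr' N b); rewrite ?N0.
have NR : 0 < N%:R :> R by rewrite ltr0n.
rewrite ler_pdivrMr// leNgt; apply/negP => small_b; apply: (h1 N b e1 _ per).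
have edl : 2 * a * modulus (b - b0) <= dl by rewrite mulrC -ler_pdivlMr// mulr_gt0.
have hstep k : h (k + M)%N b <= dl -> h (k.+1 + M)%N b <= h (k + M)%N b * (1 + C * (modulus (b - b0) + h (k + M)%N b)).
  by move=> hk; rewrite addSn; apply: hS.
have cond : (N - M)%:R * (2 * C * (1 + 2 * a)) * modulus (b - b0) <= 1.
  have g1 : 2 * C * (1 + 2 * a) <= X by rewrite /X lerDl.
  have g2 : (N - M)%:R <= N%:R :> R by rewrite ler_nat leq_subr.
  have g0 : 0 <= 2 * C * (1 + 2 * a) by rewrite !mulr_ge0// addr_ge0// mulr_ge0// ltW.
  have g3 := ler_pM (ler0n R _) g0 g2 g1.
  apply: le_trans (ler_wpM2r (modulus_ge0 _) g3) _.
  rewrite -[X in _ <= X](mulfV (lt0r_neq0 X0)) -mulrA mulrCA ler_pM2l//.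
  by rewrite mulrC ltW.
have := @slow_growth R (fun k => h (k + M)%N b) C a dl (modulus (b - b0)) (N - M) C0 (ltW a0) (modulus_ge0 _)
  (fun k => h0 _ b) (hM b e1) edl hstep cond.
by rewrite subnK// => hN; apply: le_trans hN edl.
Qed.

Lemma landing_not_periodic b p M n : gmap b p = p -> p <> finite_point 1 ->
  iter M (gmap b) (finite_point 1) = p -> (0 < n)%N -> iter n (gmap b) (finite_point 1) <> finite_point 1.
Proof.
move=> pf p1 hM n0 per; apply: p1.
have E1 k : iter (k * n) (gmap b) (finite_point 1) = finite_point 1.
  by elim: k => // k IH; rewrite mulSn iterD IH.
have E2 k : iter (k + M) (gmap b) (finite_point 1) = p by rewrite iterD hM; elim: k => //= k ->.
by rewrite -(E1 M) -[in RHS](subnK (leq_pmulr M n0)) E2.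
Qed.

(** In the coordinate [u = 1 / z] the map is [u / (1 + b u + u ^ 2)], tangent to the identity at 0
    for every b. *)
Lemma slow_infinity b0 M : iter M (gmap b0) (finite_point 1) = infinity R ->
  exists2 c, 0 < c & exists2 eta, 0 < eta & forall b N, modulus (b - b0) <= eta -> (0 < N)%N ->
    iter N (gmap b) (finite_point 1) = finite_point 1 -> c / N%:R <= modulus (b - b0).
Proof.
move=> hM; have q0 : (hq M).[b0] = 0 by move: hM; rewrite iter_gmap1 => /proj_infinity.
have p0 : (hp M).[b0] != 0 by have := hpq_neq0 b0 M; rewrite q0 eqxx orbF.
have [r1 r10 hp0] := poly_away0 p0; have [C1 C10 hq0] := poly_root_upper r1 q0.
pose K := modulus b0 + 2; have K0 : 0 < K by rewrite ltr_wpDl ?modulus_ge0.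
have m0 : 0 < modulus (hp M).[b0] by rewrite modulus_gt0.
have K1 : 1 <= K by have := modulus_ge0 b0; rewrite /K; lra.
apply: (@slow_from_step b0 M (fun n b => modulus ((hq n).[b] / (hp n).[b])) (2 * K) (2 * C1 / modulus (hp M).[b0])
   (Num.min r1 1) (2 * K)^-1).
- by rewrite mulr_ge0// ltW.
- by rewrite divr_gt0// mulr_gt0.
- by rewrite lt_min r10 ltr01.
- by rewrite invr_gt0 mulr_gt0.
- by move=> n b; exact: modulus_ge0.
- move=> n b; rewrite le_min => /andP[_ b1] hd.
  have bK : modulus b + 1 <= K by have := lerB_modulus b b0; rewrite /K; lra.
  rewrite hpS hqS; set x := (hp n).[b] in hd *; set v := (hq n).[b] in hd *.
  (* When x vanishes the iterate is 0 and the quotient has the default value 0; the next iterate is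
     infinity, where the quotient is 0 as well. *)
  have [x0|x0] := eqVneq x 0; first by rewrite x0 !mul0r modulus0 invr0 mulr0 modulus0 mul0r.
  pose u := v / x; have uE : v = u * x by rewrite /u divfK.
  have -> : x * v / (x ^+ 2 + b * x * v + v ^+ 2) = u / (1 + b * u + u ^+ 2).
    have -> : x ^+ 2 + b * x * v + v ^+ 2 = x ^+ 2 * (1 + b * u + u ^+ 2) by rewrite uE; ring.
    have -> : x * v = x ^+ 2 * u by rewrite uE; ring.
    by rewrite -mulf_div mulfV ?mul1r// sqrf_eq0.
  rewrite -/u in hd *; set D := 1 + b * u + u ^+ 2.
  have u0 := modulus_ge0 u.
  have Ku : K * modulus u <= 1 / 2.
    by have := ler_wpM2l (ltW K0) hd; rewrite invfM mulrCA mulfV ?gt_eqF// mulr1; lra.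
  have Db : 1 - K * modulus u <= modulus D.
    have := lerB_modulusD 1 (b * u + u ^+ 2); rewrite modulus1 addrA -/D.
    have := ler_modulusD (b * u) (u ^+ 2); rewrite modulusM modulusX expr2.
    have u1 : modulus u <= 1 by nra.
    by nra.
  have D0 : 0 < modulus D by lra.
  rewrite modulusM modulusV ler_pdivrMr//.
  suff g3 : 1 <= (1 + 2 * K * (modulus (b - b0) + modulus u)) * modulus D.
    by have := ler_wpM2l u0 g3; rewrite mulr1 mulrA.
  have e0 := modulus_ge0 (b - b0).
  have g : 1 + 2 * (K * modulus u) <= 1 + 2 * K * (modulus (b - b0) + modulus u) by nra.
  have k0 : 0 <= K * modulus u by rewrite mulr_ge0// ltW.
  apply: le_trans (_ : (1 + 2 * (K * modulus u)) * (1 - K * modulus u) <= _); first by nra.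
  by apply: ler_pM => //; lra.
- move=> b; rewrite le_min => /andP[b1 _]; rewrite modulusM modulusV.
  have h1 := hp0 b b1; have h2 := hq0 b b1.
  rewrite ler_pdivrMr; last by apply: lt_le_trans h1; rewrite divr_gt0.
  apply: le_trans h2 _; rewrite -mulrA mulrAC [X in _ <= X](_ : _ = C1 * modulus (b - b0) * (2 / modulus (hp M).[b0] * modulus (hp M).[b])); last by field; rewrite gt_eqF.
  rewrite ler_peMr ?mulr_ge0 ?modulus_ge0 ?(ltW C10)// mulrAC ler_pdivlMr//; lra.
- move=> n b _ hd; rewrite iter_gmap1 => /proj_finite[q1 E].
  have E2 : (hp n).[b] = (hq n).[b] by apply: (mulIf (invr_neq0 q1)); rewrite E divff.
  move: hd; rewrite E2 divff// modulus1 leNgt => /negP; apply; rewrite invf_lt1 ?mulr_gt0//; lra.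
- by move=> n /andP[n0 _]; apply: landing_not_periodic hM n0.
Qed.

(** As the multiplier at [b0] has modulus at most 1, growth comes only from its variation. The
    condition [b0 != -1] separates the landing point from the critical point 1. *)
Lemma slow_neutral b0 M : b0 != 0 -> modulus (1 - b0 ^+ 2) <= 1 -> b0 != -1 ->
    iter M (gmap b0) (finite_point 1) = finite_point (- b0^-1) ->
  exists2 c, 0 < c & exists2 eta, 0 < eta & forall b N, modulus (b - b0) <= eta -> (0 < N)%N ->
    iter N (gmap b) (finite_point 1) = finite_point 1 -> c / N%:R <= modulus (b - b0).
Proof.
move=> b00 t1 bN1 hM; have [q0 hM'] : (hq M).[b0] != 0 /\ (hp M).[b0] / (hq M).[b0] = - b0^-1.
  by move: hM; rewrite iter_gmap1 => /proj_finite.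
pose K := modulus b0 + 1; have K0 : 0 < K by rewrite ltr_wpDl ?modulus_ge0.
have b0p : 0 < modulus b0 by rewrite modulus_gt0.
pose D : {poly R[i]} := 'X * hp M + hq M; pose Q : {poly R[i]} := 'X * hq M.
have D0 : D.[b0] = 0.
  rewrite hornerD hornerM hornerX -[(hp M).[b0]](divfK q0) hM'.
  by rewrite mulNr mulrN mulrA divff// mul1r addNr.
have Q0 : Q.[b0] != 0 by rewrite hornerM hornerX mulf_neq0.
have [r1 r10 hQ] := poly_away0 Q0; have [C1 C10 hD] := poly_root_upper r1 D0.
have m0 : 0 < modulus Q.[b0] by rewrite modulus_gt0.
pose r := Num.min r1 (Num.min 1 (Num.min (modulus b0 / 2) (modulus (b0 + 1) / 4))).
have b1p : 0 < modulus (b0 + 1) by rewrite modulus_gt0 -[1]opprK subr_eq0.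
(* The first bound is the one required by [multiplier_near]; the second keeps the critical point 1
   out of the region. *)
pose dl := Num.min (2 * K)^-1 (modulus (b0 + 1) / (8 * K)).
have dl0 : 0 < dl by rewrite lt_min invr_gt0 mulr_gt0//= divr_gt0// mulr_gt0// ltr0n.
pose L := 2 * K ^+ 3 + 2 * K; have L0 : 0 <= L by rewrite addr_ge0// mulr_ge0// ?exprn_ge0// ltW.
have r0 : 0 < r by rewrite !lt_min r10 ltr01 !divr_gt0.
have rP b : modulus (b - b0) <= r -> [/\ modulus (b - b0) <= r1, modulus (b - b0) <= 1,
    modulus (b - b0) <= modulus b0 / 2 & modulus (b - b0) <= modulus (b0 + 1) / 4].
  by rewrite !le_min => /and4P[].
apply: (@slow_from_step b0 M (fun n b => modulus ((hp n).[b] / (hq n).[b] + b^-1)) L (2 * C1 / modulus Q.[b0]) r dl) => //.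
- by rewrite divr_gt0// mulr_gt0.
- by move=> n b; exact: modulus_ge0.
- move=> n b /rP[_ e1 e2 _]; rewrite le_min => /andP[hd _].
  have [b_n h_n mn] := multiplier_near b00 e2 e1 hd.
  have [x0 y0] : (hp n).[b] != 0 /\ (hq n).[b] != 0 by move: h_n; rewrite mulf_eq0 invr_eq0 negb_or => /andP.
  set h := (hp n).[b] / (hq n).[b] in hd h_n mn *.
  have -> : (hp n.+1).[b] / (hq n.+1).[b] = h + b + h^-1.
    by rewrite hpS hqS /h; field; rewrite x0 y0.
  rewrite gmap_fixed_step// modulusM ler_wpM2l ?modulus_ge0//.
  have := ler_modulusD (1 + b / h - (1 - b0 ^+ 2)) (1 - b0 ^+ 2); rewrite subrK => g.
  apply: le_trans g _; have e0 := modulus_ge0 (b - b0); have d0 := modulus_ge0 (h + b^-1).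
  have k3 : 0 <= K ^+ 3 by rewrite exprn_ge0// ltW.
  have p1 : 0 <= K ^+ 3 * modulus (b - b0) by exact: mulr_ge0.
  have p2 : 0 <= K * modulus (h + b^-1) by rewrite mulr_ge0// ltW.
  by rewrite -/K in mn; rewrite /L; lra.
- move=> b /rP[e1 _ _ _].
  have h1 := hQ b e1; have h2 := hD b e1.
  have Qb : 0 < modulus Q.[b] by apply: lt_le_trans h1; rewrite divr_gt0.
  have [b_n q_n] : b != 0 /\ (hq M).[b] != 0.
    by move: Qb; rewrite modulus_gt0 hornerM hornerX mulf_eq0 negb_or => /andP.
  have -> : (hp M).[b] / (hq M).[b] + b^-1 = D.[b] / Q.[b].
    by rewrite /D /Q hornerD !hornerM hornerX; field; rewrite b_n q_n.
  rewrite modulusM modulusV ler_pdivrMr//; apply: le_trans h2 _.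
  rewrite [X in _ <= X](_ : _ = C1 * modulus (b - b0) * (2 / modulus Q.[b0] * modulus Q.[b])); last by field; rewrite gt_eqF.
  rewrite ler_peMr ?mulr_ge0 ?modulus_ge0 ?(ltW C10)// mulrAC ler_pdivlMr//; lra.
- move=> n b /rP[_ e1 e2 e3]; rewrite le_min => /andP[_ hd]; rewrite iter_gmap1 => /proj_finite[q1 E].
  rewrite E in hd.
  have bK : modulus b <= K by have := lerB_modulus b b0; rewrite /K; lra.
  have bp : 0 < modulus b by have := lerB_modulus b0 b; rewrite modulusBC; lra.
  have b_n : b != 0 by rewrite -modulus_gt0.
  have g1 : modulus (b + 1) <= modulus (b0 + 1) / 8.
    have -> : b + 1 = b * (1 + b^-1) by field.
    rewrite modulusM; apply: le_trans (ler_pM (modulus_ge0 _) (modulus_ge0 _) bK hd) _.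
    by rewrite invfM le_eqVlt; apply/orP; left; apply/eqP; field; rewrite gt_eqF.
  have := lerB_modulus (b0 + 1) (b + 1); have -> : b0 + 1 - (b + 1) = b0 - b by ring.
  by rewrite modulusBC in e3; lra.
- move=> n /andP[n0 _]; apply: (@landing_not_periodic b0 (finite_point (- b0^-1)) M n) => //.
    rewrite /= oppr_eq0 invr_eq0 (negbTE b00); congr finite_point; rewrite invrN invrK.
    by rewrite addrK.
  move=> [E]; move/eqP: bN1; apply; rewrite -[b0]invrK -[b0^-1]opprK E invrN1//.
Qed.

End ParabolicParameters.

(** * Parameters whose critical orbit lands on infinity *)

Section PrepoleParameters.
Context {R : realType}.
Implicit Types (z w y b h : R[i]).

Lemma gpair_bounded (K1 K2 : R) k : exists2 Mb : R, 0 < Mb & forall b z,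
  modulus b <= K1 -> modulus z <= K2 ->
  modulus (gpair b z 1 k).1 <= Mb /\ modulus (gpair b z 1 k).2 <= Mb.
Proof.
elim: k => [|k [Mb Mb0 hM]].
  exists (`|K2| + 1); first by rewrite ltr_wpDl.
  move=> b z _ hz /=; rewrite modulus1; split; first by have := ler_norm K2; lra.
  by rewrite lerDr.
exists (Mb ^+ 2 + `|K1| * Mb * Mb + Mb ^+ 2).
  by rewrite ltr_wpDl ?exprn_gt0// addr_ge0 ?exprn_ge0 ?mulr_ge0// ltW.
move=> b z hb hz; have [h1 h2] := hM b z hb hz; rewrite gpairS /=.
set u := (gpair b z 1 k).1 in h1 *; set v := (gpair b z 1 k).2 in h2 *.
have u0 := modulus_ge0 u; have v0 := modulus_ge0 v; have b0 := modulus_ge0 b.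
have hb' : modulus b <= `|K1| by apply: le_trans hb (ler_norm _).
have uv : modulus u * modulus v <= Mb * Mb by exact: ler_pM.
have uu : modulus u ^+ 2 <= Mb ^+ 2 by rewrite lerXn2r ?nnegrE// ltW.
have vv : modulus v ^+ 2 <= Mb ^+ 2 by rewrite lerXn2r ?nnegrE// ltW.
have M0 : 0 <= Mb ^+ 2 by rewrite exprn_ge0// ltW.
have K0 : 0 <= `|K1| * Mb * Mb by rewrite !mulr_ge0// ltW.
split; last by rewrite modulusM; apply: le_trans uv _; rewrite -expr2; lra.
apply: le_trans (ler_modulusD _ _) _; rewrite modulusX; apply: lerD => //.
apply: le_trans (ler_modulusD _ _) _; rewrite modulusX; apply: lerD => //.
rewrite !modulusM -!mulrA; apply: ler_pM => //; exact: mulr_ge0.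
Qed.

(** At [b = 0] the coordinates of the orbit of 1 stay positive; in [dist_landing_g] this shows that
    the landing equation is not an identity in b. *)
Lemma gpair0_pos n : exists a v : R, [/\ 0 < a, 0 < v & gpair (0 : R[i]) 1 1 n = (a%:C%C, v%:C%C)].
Proof.
elim: n => [|n [a [v [a0 v0 E]]]]; first by exists 1, 1.
exists (a ^+ 2 + v ^+ 2), (a * v); split; rewrite ?mulr_gt0 ?addr_gt0 ?exprn_gt0//.
by rewrite gpairS E /= !mul0r addr0 rmorphD !rmorphXn rmorphM.
Qed.

Variables (b0 : R[i]) (M : nat).
Hypotheses (b0_neq0 : b0 != 0) (b0_landing : iter M (gmap b0) (finite_point 1) = finite_point (- b0^-1))
  (b0_repelling : 1 < modulus (1 - b0 ^+ 2))
  (prepoles : forall e : R, 0 < e -> exists k z, modulus (z + b0^-1) <= e /\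
     iter k (gmap b0) (finite_point z) = infinity R).

Let t0 := modulus (1 - b0 ^+ 2).
Let K := modulus b0 + 1.
Let K_gt0 : 0 < K. Proof. by rewrite ltr_wpDl ?modulus_ge0. Qed.
Let b0_gt0 : 0 < modulus b0. Proof. by rewrite modulus_gt0. Qed.
Let t0_gt0 : 0 < t0 - 1. Proof. by rewrite subr_gt0. Qed.
Let L := 8 * (K ^+ 3 + K).
Let L_gt0 : 0 < L. Proof. by rewrite /L mulr_gt0 ?ltr0n// addr_gt0// exprn_gt0. Qed.

Let dist n (b : R[i]) : R := modulus ((hp n).[b] / (hq n).[b] + b^-1).
Let dl := Num.min (2 * K)^-1 ((t0 - 1) / L).
Let rho0 := Num.min 1 (Num.min (modulus b0 / 2) ((t0 - 1) / L)).

Let dl_gt0 : 0 < dl.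
Proof. by rewrite lt_min invr_gt0 mulr_gt0//= divr_gt0. Qed.

Let rho0_gt0 : 0 < rho0.
Proof. by rewrite !lt_min ltr01 !divr_gt0. Qed.

(** The constants L, [dl] and [rho0] keep the factor [1 + b / h] within [(t0 - 1) / 2] of the
    multiplier at [b0], whose modulus is [t0]. *)
Lemma parameter_step n b : modulus (b - b0) <= rho0 -> dist n b <= dl ->
  [/\ b != 0, (hp n).[b] != 0, (hq n).[b] != 0 &
      (1 + t0) / 2 * dist n b <= dist n.+1 b <= 2 * t0 * dist n b].
Proof.
rewrite !le_min => /and3P[e1 e2 e3] /andP[d1 d2].
have [b_n h_n mn] := multiplier_near b0_neq0 e2 e1 d1.
have [x0 y0] : (hp n).[b] != 0 /\ (hq n).[b] != 0 by move: h_n; rewrite mulf_eq0 invr_eq0 negb_or => /andP.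
split=> //; rewrite /dist.
have -> : (hp n.+1).[b] / (hq n.+1).[b] = (hp n).[b] / (hq n).[b] + b + ((hp n).[b] / (hq n).[b])^-1.
  by rewrite hpS hqS; field; rewrite x0 y0.
rewrite gmap_fixed_step//; rewrite /dist in d1 d2; set h := (hp n).[b] / (hq n).[b] in d1 d2 mn h_n *.
have d0 := modulus_ge0 (h + b^-1).
rewrite modulusM mulrC [X in _ <= _ <= X]mulrC.
have g1 := ler_modulusD (1 + b / h - (1 - b0 ^+ 2)) (1 - b0 ^+ 2); rewrite subrK -/t0 in g1.
have g2 := lerB_modulusD (1 - b0 ^+ 2) (1 + b / h - (1 - b0 ^+ 2)).
have E2 : 1 - b0 ^+ 2 + (1 + b / h - (1 - b0 ^+ 2)) = 1 + b / h by ring.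
rewrite E2 -/t0 in g2.
have small : modulus (1 + b / h - (1 - b0 ^+ 2)) <= (t0 - 1) / 2.
  apply: le_trans mn _; rewrite -/K.
  have k3 : 0 <= K ^+ 3 by rewrite exprn_ge0// ltW.
  have g3 := ler_wpM2l k3 d2; have g4 := ler_wpM2l (ltW K_gt0) e3.
  have -> : (t0 - 1) / 2 = 4 * (K ^+ 3 * ((t0 - 1) / L) + K * ((t0 - 1) / L)).
    by rewrite -mulrDl mulrCA mulrA /L; field; rewrite gt_eqF// addr_gt0// exprn_gt0.
  have g5 : 0 <= (t0 - 1) / L by rewrite divr_ge0// ltW.
  have g6 := mulr_ge0 k3 g5; have g7 := mulr_ge0 (ltW K_gt0) g5.
  by rewrite -!mulrA; lra.
apply/andP; split; apply: ler_wpM2l => //; lra.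
Qed.

Lemma dist_landing_g : exists e : nat, exists a Cb rho : R, [/\ 0 < a, 0 <= Cb, 0 < rho <= rho0 &
  forall b, modulus (b - b0) <= rho -> a * modulus (b - b0) ^+ e <= dist M b <= Cb * modulus (b - b0)].
Proof.
have [q0 hM'] : (hq M).[b0] != 0 /\ (hp M).[b0] / (hq M).[b0] = - b0^-1.
  by move: b0_landing; rewrite iter_gmap1 => /proj_finite.
pose D : {poly R[i]} := 'X * hp M + hq M; pose Q : {poly R[i]} := 'X * hq M.
have Db0 : D.[b0] = 0.
  rewrite hornerD hornerM hornerX -[(hp M).[b0]](divfK q0) hM'.
  by rewrite mulNr mulrN mulrA divff// mul1r addNr.
have Dn0 : D != 0.
  apply/eqP => D0; have [a [v [_ v0 E]]] := gpair0_pos M.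
  have := congr1 (fun P => P.[0]) D0; rewrite hornerD hornerM hornerX mul0r add0r horner0.
  have -> : (hq M).[0] = v%:C%C by move: E; rewrite gpair_hpq => -[].
  by move=> /(congr1 (@modulus R)); rewrite modulus_real modulus0 gtr0_norm// => v00; rewrite v00 ltxx in v0.
have Qb0 : Q.[b0] != 0 by rewrite hornerM hornerX mulf_neq0.
have m0 : 0 < modulus Q.[b0] by rewrite modulus_gt0.
have [r1 r10 hQ] := poly_away0 Qb0; have [C1 C10 hD] := poly_root_upper r1 Db0.
have [e [a a0 [r2 r20 lower]]] := poly_lower b0 Dn0.
have [CQ CQ0 hCQ] := poly_bounded Q b0 r1.
exists e, (a / CQ), (2 * C1 / modulus Q.[b0]), (Num.min rho0 (Num.min r1 r2)); split.
- exact: divr_gt0.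
- by rewrite divr_ge0 ?mulr_ge0 ?modulus_ge0// ltW.
- by rewrite lt_min rho0_gt0 lt_min r10 r20 /= ge_min lexx.
move=> b; rewrite le_min => /andP[_]; rewrite le_min => /andP[e1 e2].
have h1 := hQ b e1; have h2 := hD b e1; have h3 := hCQ b e1; have h4 := lower b e2.
have Qb : 0 < modulus Q.[b] by apply: lt_le_trans h1; rewrite divr_gt0.
have [b_n q_n] : b != 0 /\ (hq M).[b] != 0.
  by move: Qb; rewrite modulus_gt0 hornerM hornerX mulf_eq0 negb_or => /andP.
have -> : dist M b = modulus D.[b] / modulus Q.[b].
  rewrite /dist -modulusV -modulusM; congr modulus.
  by rewrite /D /Q hornerD !hornerM hornerX; field; rewrite b_n q_n.
apply/andP; split.
  rewrite mulrAC; apply: ler_pM => //; rewrite ?mulr_ge0 ?exprn_ge0 ?modulus_ge0 ?invr_ge0 ?(ltW CQ0) ?(ltW a0)//.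
  by rewrite lef_pV2 ?posrE.
rewrite ler_pdivrMr//; apply: le_trans h2 _.
rewrite [X in _ <= X](_ : _ = C1 * modulus (b - b0) * (2 / modulus Q.[b0] * modulus Q.[b])); last by field; rewrite gt_eqF.
rewrite ler_peMr ?mulr_ge0 ?modulus_ge0 ?(ltW C10)// mulrAC ler_pdivlMr//; lra.
Qed.

(* Rescaling around [b0] transfers a prepole of [gmap b0] near the repelling
   fixed point to the parameter plane. *)
Lemma prepole_parameters (eta : R) : 0 < eta ->
  exists b m, modulus (b - b0) <= eta /\ iter m (gmap b) (finite_point 1) = infinity R.
Proof.
move=> eta0.
have [e [a [Cb [rho [a0 Cb0 /andP[rhopos rhole] hD]]]]] := dist_landing_g.
have mu1 : 1 < (1 + t0) / 2 by have := t0_gt0; lra.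
have Lam1 : 1 <= 2 * t0 by have := t0_gt0; lra.
have dS n z : (M <= n)%N -> modulus (z - b0) <= rho -> dist n z <= dl ->
    (1 + t0) / 2 * dist n z <= dist n.+1 z <= 2 * t0 * dist n z.
  by move=> _ hz hd; have [] := parameter_step (le_trans hz rhole) hd.
have [d2 /andP[d20 d2l] [C1 [C2 hk]]] := escape_scale rhopos mu1 Lam1 dl_gt0 a0 Cb0 dS hD.
pose eps := d2 ^+ 2 / (16 * dl) / 2.
have eps1 : 0 < d2 ^+ 2 / (16 * dl) by apply: divr_gt0; [exact: exprn_gt0|rewrite mulr_gt0// ltr0n].
have eps0 : 0 < eps by exact: divr_gt0.
have [k [zs [zs1 zs2]]] := prepoles eps0.
pose w := zs + b0^-1.
have Pzs : (gpair b0 zs 1 k).2 = 0 by move: zs2; rewrite iter_gmap_finite => /proj_infinity.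
have fixx : gmap b0 (finite_point (- b0^-1)) = finite_point (- b0^-1).
  by rewrite /= oppr_eq0 invr_eq0 (negbTE b0_neq0); congr finite_point; rewrite invrN invrK addrK.
have Px0 : (gpair b0 (- b0^-1) 1 k).2 != 0.
  have : iter k (gmap b0) (finite_point (- b0^-1)) = finite_point (- b0^-1).
    by elim: k {zs2 Pzs} => // j IH; rewrite iterS IH.
  by rewrite iter_gmap_finite => /proj_finite[].
pose s0 := modulus (gpair b0 (- b0^-1) 1 k).2.
have s00 : 0 < s0 by rewrite modulus_gt0.
have [Mb Mb0 hMb] := @gpair_bounded K (2 / modulus b0 + dl) k.
(* The start [w - b^-1] keeps its position relative to the moving fixed point. Its homogeneous
   coordinates are multiplied by b, which makes S a polynomial in b. *)
pose S : {poly R[i]} := (gpair 'X (w *: 'X - 1) 'X k).2.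
have SE b : b != 0 -> S.[b] = b ^+ (2 ^ k) * (gpair b (w - b^-1) 1 k).2.
  move=> bn; have := gpair_horner 'X (w *: 'X - 1) 'X k b.
  rewrite hornerX hornerD hornerN hornerZ hornerX hornerC.
  have := gpairZ b b (w - b^-1) 1 k; rewrite mulr1 mulrBr divff// [b * w]mulrC => -> /=.
  by rewrite /S => -[_ <-].
have S0 : S.[b0] = 0 by rewrite SE// /w addrK Pzs mulr0.
pose e0 := expR ((3 * ln s0 - ln Mb) / 2); have e00 : 0 < e0 by exact: expR_gt0.
pose bb := (modulus b0 / 2) ^+ (2 ^ k).
have bb0 : 0 < bb by rewrite exprn_gt0// divr_gt0.
have eb0 : 0 < e0 * bb / 2 by rewrite divr_gt0// mulr_gt0.
have [ds ds0 hds] := poly_continuous S b0 eb0.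
pose de := Num.min ds eta; have de0 : 0 < de by rewrite lt_min ds0.
have [k1 hk1] := @expr_large R 64 (rho / de) (ltr1n _ 64).
have p64 j : 0 < (64 : R) ^+ j by rewrite exprn_gt0// ltr0n.
have [j [n [hk0 /andP[Mn nC] small [z zr zd]]]] := hk k1.
pose r := rho / 64 ^+ j.
have r0 : 0 < r by rewrite divr_gt0.
have rde : r <= de.
  rewrite ler_pdivrMr// mulrC -ler_pdivrMr//; apply: le_trans hk1 _.
  by rewrite ler_eXn2l ?ltr1n.
have rr0 : r <= rho0 by apply: le_trans rhole; rewrite ler_pdivrMr// ler_peMr ?(ltW rhopos)// exprn_ege1// ler1n.
have nn : (M <= n <= n)%N by rewrite Mn leqnn.
have facts b : modulus (b - b0) <= r -> [/\ b != 0, (hq n).[b] != 0, modulus b <= K & modulus b0 / 2 <= modulus b].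
  move=> hb; have [b_n _ q_n _] := parameter_step (le_trans hb rr0) (small n b nn hb).
  split=> //; move: (le_trans hb rr0); rewrite !le_min => /and3P[h1 h2 _].
    by have := lerB_modulus b b0; rewrite /K; lra.
  by have := lerB_modulus b0 b; rewrite modulusBC; lra.
pose A : {poly R[i]} := 'X * hp n + hq n; pose B : {poly R[i]} := 'X * hq n.
have AB b : modulus (b - b0) <= r -> A.[b] / B.[b] = (hp n).[b] / (hq n).[b] + b^-1.
  move=> /facts[b_n q_n _ _]; rewrite /A /B hornerD !hornerM hornerX.
  by field; rewrite b_n q_n.
(* By homogeneity of degree [2 ^ k], division by D replaces the start [(hp n, hq n)] by the affine
   point [hp n / hq n], so that the bound [Mb] does not depend on n. *)
pose D : {poly R[i]} := hq n ^+ (2 ^ k).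
have CD b : modulus (b - b0) <= r -> (hq (k + n)).[b] / D.[b] = (gpair b ((hp n).[b] / (hq n).[b]) 1 k).2.
  move=> /facts[_ q_n _ _]; have := gpair_hpq b (k + n); rewrite gpairD gpair_hpq /=.
  have -> : gpair b (hp n).[b] (hq n).[b] k = gpair b ((hq n).[b] * ((hp n).[b] / (hq n).[b])) ((hq n).[b] * 1) k.
    by rewrite mulr1 mulrC divfK.
  rewrite gpairZ => -[_ <-].
  by rewrite /D horner_exp mulrAC mulfV ?mul1r// expf_neq0.
have zb : modulus (b0 - b0) <= r by rewrite subrr modulus0 ltW.
have hn0 : (hp n).[b0] / (hq n).[b0] = - b0^-1.
  have : iter n (gmap b0) (finite_point 1) = finite_point (- b0^-1).
    by rewrite -(subnK Mn) iterD b0_landing; elim: (n - M)%N => // i IH; rewrite iterS IH.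
  by rewrite iter_gmap1 => /proj_finite[].
have [y hy yE] : exists2 y, modulus (y - b0) <= r & (hq (k + n)).[y] = 0.
  apply: (@parameter_hit R b0 r dl d2 s0 Mb A B (hq (k + n)) D z w) => //.
  - by rewrite d20.
  - by move=> b /facts[b_n q_n _ _]; rewrite hornerM hornerX mulf_neq0.
  - by move=> b hb; rewrite AB//; exact: small.
  - have [_ q_n _ _] := facts b0 zb.
    by rewrite /A hornerD hornerM hornerX -[(hp n).[b0]](divfK q_n) hn0 mulNr mulrN mulrA divff// mul1r addNr.
  - by apply: le_trans zr _; rewrite exprS /r invfM mulrCA mulrC.
  - have zr' : modulus (z - b0) <= r.
      apply: le_trans zr _; rewrite exprS invfM mulrCA -/r ler_piMl ?(ltW r0)//.
      by rewrite invf_le1 ?ltr0n// ler1n.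
    by rewrite AB//; exact: ltW.
  - by apply: le_lt_trans zs1 _; rewrite /eps ltr_pdivrMr// ltr_pMr// ltr1n.
  - by move=> b /facts[_ q_n _ _]; rewrite horner_exp expf_neq0.
  - move=> b hb; rewrite CD//; have [b_n q_n bK b2] := facts b hb.
    apply: (hMb _ _ bK _).2.
    have h1 : modulus ((hp n).[b] / (hq n).[b] + b^-1) <= dl := small n b nn hb.
    have := lerB_modulusD ((hp n).[b] / (hq n).[b]) b^-1.
    have : modulus b^-1 <= 2 / modulus b0.
      by rewrite modulusV -[2 / _]invrK invf_div lef_pV2 ?posrE ?modulus_gt0 ?divr_gt0.
    by lra.
  - by rewrite CD// hn0.
  - move=> b hb; rewrite AB// CD// => wE; have [b_n q_n bK b2] := facts b hb.
    have hE : (hp n).[b] / (hq n).[b] = w - b^-1 by rewrite -wE addrK.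
    rewrite hE; have := hds b (le_trans hb (le_trans rde _)); rewrite ge_min lexx => /(_ isT).
    rewrite S0 subr0 SE// modulusM modulusX -/e0 => h1.
    have h2 : bb <= modulus b ^+ (2 ^ k).
      by rewrite /bb lerXn2r ?nnegrE ?modulus_ge0 ?divr_ge0 ?modulus_ge0.
    have h3 := ler_wpM2r (modulus_ge0 (gpair b (w - b^-1) 1 k).2) h2.
    have h4 : bb * modulus (gpair b (w - b^-1) 1 k).2 <= bb * (e0 / 2).
      by apply: le_trans h3 (le_trans h1 _); rewrite mulrCA mulrA.
    by rewrite ler_pM2l// in h4; apply: le_lt_trans h4 _; rewrite ltr_pdivrMr// ltr_pMr// ltr1n.
exists y, (k + n)%N; split; last by rewrite iter_gmap1 /proj yE eqxx.
by apply: le_trans hy (le_trans rde _); rewrite ge_min lexx orbT.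
Qed.

End PrepoleParameters.

(** * Transfer between the two families *)

Section Stability.
Context {R : realType}.
Implicit Types (z w y b c : R[i]) (p q : sphere R).

Lemma gmap_joint b0 p A : gmap b0 p != infinity R -> nbhs (gmap b0 p) A ->
  exists2 e : R, 0 < e & \forall q \near p, forall b, modulus (b - b0) < e -> A (gmap b q).
Proof.
case E : (gmap b0 p) => [w|//] _ /(@nbhs_finiteP _ w)[r r0 hr].
exists (r / 2); first by rewrite divr_gt0.
have : nbhs (gmap b0 p) [set q | exists2 u, q = finite_point u & modulus (u - w) < r / 2].
  by rewrite E; apply/(@nbhs_finiteP _ w); exists (r / 2); [rewrite divr_gt0|move=> u hu; exists u].
move=> /(@gmap_continuous R b0 p); apply: (@filterS _ _ (nbhs_filter p)) => -[z|] [u] //=.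
case: eqP => // /eqP z0 [uE] hu b hb; apply: hr.
have -> : z + b + z^-1 - w = (b - b0) + (u - w) by rewrite -uE; ring.
by have := ler_modulusD (b - b0) (u - w); lra.
Qed.

Lemma iter_gmap_joint b0 p n A : (forall k, iter k (gmap b0) p != infinity R) -> nbhs (iter n (gmap b0) p) A ->
  exists2 e : R, 0 < e & \forall q \near p, forall b, modulus (b - b0) < e -> A (iter n (gmap b) q).
Proof.
move=> fin; elim: n A => [|n IH] A hA.
  by exists 1 => //; apply: (@filterS _ _ (nbhs_filter p) _ _ _ hA).
have [e1 e10 h1] := gmap_joint (fin n.+1) hA; have [e2 e20 h2] := IH _ h1.
exists (Num.min e1 e2); first by rewrite lt_min e10.
apply: (@filterS _ _ (nbhs_filter p) _ _ _ h2) => q hq b; rewrite lt_min => /andP[b1 b2].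
exact: hq.
Qed.

(** The half-plane of [b0] is kept as the trap for nearby b. Orbits in the basin avoid infinity, so
    the time of entrance of a point also works for nearby points and parameters; compactness makes
    this uniform. *)
Lemma basin_stable b0 (A : set (sphere R)) : b0 != 0 -> compact A -> A `<=` absorbed (gmap b0) (halfplane b0) ->
  exists2 e : R, 0 < e & forall q, A q -> forall b, modulus (b - b0) < e -> absorbed (gmap b) (halfplane b0) q.
Proof.
move=> b00 cA AW; have near0 : modulus (b0 - b0) <= modulus b0 / 4.
  by rewrite subrr modulus0 divr_ge0// modulus_ge0.
apply: (@compact_uniform R _ A (fun e q => forall b, modulus (b - b0) < e -> absorbed (gmap b) (halfplane b0) q)) => //.
  by move=> e e' x ee h b hb; apply: h; exact: lt_le_trans hb ee.
move=> q /AW Wq; have [n Hn] := Wq.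
have hA := open_nbhs_nbhs (conj (halfplane_open b00) Hn).
have [e e0 h] := iter_gmap_joint (fun k => basin_orbit_finite b00 near0 k Wq) hA; exists e => //.
by apply: (@filterS _ _ (nbhs_filter q) _ _ _ h) => y hy b hb; exists n; exact: hy.
Qed.

Lemma disc_closed z (r : R) : closed (@finite_point R @` [set w | modulus (w - z) <= r]).
Proof.
set S := _ @` _; have -> : S = ~` ~` S by rewrite setCK.
apply: open_closedC; rewrite openE => -[w|] nS; last first.
  apply/nbhs_infinityP; split; first by case.
  exists (modulus z + r) => w hw [u /= hu [uw]]; have := lerB_modulus w z; rewrite uw in hu; lra.
have hw : r < modulus (w - z) by rewrite ltNge; apply/negP => h; apply: nS; exists w.
apply/(@nbhs_finiteP _ w); exists (modulus (w - z) - r); first by rewrite subr_gt0.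
move=> u hu [v /= hv [vu]]; rewrite vu in hv.
by have := modulus_triangle u w z; rewrite modulusBC in hu; lra.
Qed.

(** The points that can be joined to p form a clopen subset of W, because a small closed disc can
    always be added to A. Compactness of A is needed in order to apply [basin_stable]. *)
Lemma compact_connected_joining (W : set (sphere R)) p q : open W -> connected W -> ~ W (infinity R) ->
  W p -> W q -> exists A : set (sphere R), [/\ compact A, connected A, A `<=` W, A p & A q].
Proof.
move=> oW cW Winf Wp.
pose P q := exists A : set (sphere R), [/\ compact A, connected A, A `<=` W, A p & A q].
have loc q' : W q' -> \forall q'' \near q', (P q' <-> P q'').
  case: q' => [z|//] Wz; have /nbhs_finiteP[r r0 hr] := open_nbhs_nbhs (conj oW Wz).
  apply/(@nbhs_finiteP _ z); exists (r / 2); first by rewrite divr_gt0.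
  move=> w hw; pose S := @finite_point R @` [set w | modulus (w - z) <= r / 2].
  have cS : compact S by apply: closed_sphere_compact; exact: disc_closed.
  have kS : connected S by apply: finite_connected; exact: ball_connected.
  have SW : S `<=` W by move=> _ [u /= hu <-]; apply: hr; lra.
  have Sz : S (finite_point z) by exists z => //=; rewrite subrr modulus0 divr_ge0// ltW.
  have Sw : S (finite_point w) by exists w => //=; exact: ltW.
  have ext p1 p2 : S p1 -> S p2 -> P p1 -> P p2.
    move=> Sx Sy [A [cA kA AW Ap Ax]]; exists (A `|` S); split.
    - exact: compactU.
    - by apply: connectedU => //; exists p1.
    - by move=> u [/AW|/SW].
    - by left.
    - by right.
  by split; exact: ext.
have Pp : P p.
  rewrite /P; case: (p) (Wp) => [z|//] Wz.
  exists (@finite_point R @` [set w | modulus (w - z) <= 0]); split.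
  - by apply: closed_sphere_compact; exact: disc_closed.
  - by apply: finite_connected; exact: ball_connected.
  - move=> _ [u /= hu <-]; have : modulus (u - z) == 0 by rewrite eq_le hu modulus_ge0.
    by rewrite modulus_eq0 subr_eq0 => /eqP ->.
  - by exists z => //=; rewrite subrr modulus0.
  - by exists z => //=; rewrite subrr modulus0.
have hP q' : W q' -> P q' -> \forall q'' \near q', W q'' -> P q''.
  move=> Wq' Pq'; apply: (@filterS _ _ (nbhs_filter q') _ _ _ (loc q' Wq')) => q'' h _; exact/h.
have hN q' : W q' -> ~ P q' -> \forall q'' \near q', W q'' -> ~ P q''.
  move=> Wq' Pq'; apply: (@filterS _ _ (nbhs_filter q') _ _ _ (loc q' Wq')) => q'' h _ /h.
  exact: Pq'.
move=> Wq; have [h|h] := connected_dichotomy cW hP hN; first exact: h.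
by case: (h p Wp).
Qed.

(** Conjugates [gmap b] to [gmap (- b)], the other map of the family that represents
    [1 - b ^+ 2]. *)
Definition sphere_opp p : sphere R := if p is Some z then finite_point (- z) else infinity R.

Lemma gmap_opp b p : gmap (- b) (sphere_opp p) = sphere_opp (gmap b p).
Proof.
case: p => [z|] //=; rewrite oppr_eq0; case: eqP => //= _.
by rewrite invrN -!opprD.
Qed.

Lemma basin_opp b p : absorbed (gmap (- b)) (halfplane (- b)) (sphere_opp p) <-> absorbed (gmap b) (halfplane b) p.
Proof.
have it n : iter n (gmap (- b)) (sphere_opp p) = sphere_opp (iter n (gmap b) p).
  by elim: n => //= n ->; exact: gmap_opp.
have hE q : halfplane (- b) (sphere_opp q) = halfplane b q.
  by case: q => [z|] //=; rewrite /halfplane/= modulusN invrN mulrNN.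
by split=> -[n hn]; exists n; move: hn; rewrite it hE.
Qed.

Definition g_basin b := parabolic_basin (gmap b) (infinity R).

Lemma g_basinE b : b != 0 -> g_basin b = absorbed (gmap b) (halfplane b).
Proof.
by move=> b0; apply: parabolic_basinE => //; rewrite subrr modulus0 divr_ge0// modulus_ge0.
Qed.

Lemma g_basin_f b p : g_basin b p -> g_basin b (gmap b p).
Proof.
move=> [cp np]; split; last by move=> n; rewrite -iterSr; exact: np.
move=> A /cp [N _ hN]; exists N => // n hn; rewrite /= -iterSr; apply: hN; exact: leqW hn.
Qed.

Lemma g_basin_iter b p n : iter n (gmap b) p = infinity R -> ~ g_basin b p.
Proof. by move=> E [_ /(_ n)]; rewrite E eqxx. Qed.

Lemma sphere_inv_fixed p : sphere_inv p = p -> p = finite_point 1 \/ p = finite_point (- 1).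
Proof.
case: p => [z|] //=; case: eqP => // /eqP z0 [zE].
have : z ^+ 2 == 1 by rewrite expr2 -{1}zE mulVf.
by rewrite sqrf_eq1 => /orP[]/eqP ->; [left|right].
Qed.

End Stability.

(** * Topological conjugacies on filled Julia sets *)

Section Conjugacy.
Context {R : realType}.
Implicit Types (z w y b c : R[i]) (p q : sphere R) (rho : sphere R -> sphere R).

Definition filled_conjugacy c b rho := [/\ homeomorphism_on setT setT rho,
  rho @` (@finite_point R @` filled_quad c) = ~` g_basin b &
  forall z, filled_quad c z -> rho (finite_point (quad c z)) = gmap b (rho (finite_point z))].

Lemma filled_f c z : filled_quad c z -> filled_quad c (quad c z).
Proof. by move=> /filled_quadP h; apply/filled_quadP => n; rewrite -iterSr. Qed.

Lemma filled_iter c z n : filled_quad c z -> filled_quad c (iter n (quad c) z).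
Proof. by move=> h; elim: n => //= n; exact: filled_f. Qed.

Lemma filled_iter_inv c z n : filled_quad c (iter n (quad c) z) -> filled_quad c z.
Proof.
move=> /filled_quadE h; apply/filled_quadE => h2; apply: h; rewrite -iter_quad_finite.
exact/(absorbed_iter (@quad_exterior_f R c)).
Qed.

Lemma filledN c z : filled_quad c z -> filled_quad c (- z).
Proof. by move=> /filled_quadE h; apply/filled_quadE; rewrite quad_absorbedN. Qed.

Lemma filled_fixed c y : quad c y = y -> filled_quad c y.
Proof.
move=> yE; apply/filled_quadP => n; have -> : iter n (quad c) y = y by elim: n => //= n ->.
exact: fixed_not_absorbed.
Qed.

Section WithConjugacy.
Variables (c b : R[i]) (rho : sphere R -> sphere R).
Hypothesis conj : filled_conjugacy c b rho.

Lemma conj_inj : injective rho.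
Proof.
by case: conj => -[[_ inj _] _ _] _ _ p q E; apply: inj; rewrite ?inE.
Qed.

Lemma conj_not_basin z : filled_quad c z -> ~ g_basin b (rho (finite_point z)).
Proof.
case: conj => _ E _ Kz; have : (~` g_basin b) (rho (finite_point z)) by rewrite -E; exists (finite_point z) => //; exists z.
by [].
Qed.

Lemma conj_onto p : ~ g_basin b p -> exists2 z, filled_quad c z & rho (finite_point z) = p.
Proof.
case: conj => _ E _ np; have : (~` g_basin b) p by [].
by rewrite -E => -[_ [z Kz <-] <-]; exists z.
Qed.

Lemma conj_iter z n : filled_quad c z -> rho (finite_point (iter n (quad c) z)) = iter n (gmap b) (rho (finite_point z)).
Proof.
case: conj => _ _ E Kz; elim: n => //= n IH; rewrite E ?IH//.
exact: filled_iter.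
Qed.

(** If rho sends z to p, it sends [- z] into the fibre of [gmap b p], which is reduced to p because
    [sphere_inv p = p]. Injectivity then gives [- z = z]. *)
Lemma conj_critical_unique p : sphere_inv p = p -> ~ g_basin b p -> rho (finite_point 0) = p.
Proof.
case: (conj) => _ _ E pE /conj_onto[z Kz zp].
have : gmap b (rho (finite_point (- z))) = gmap b p.
  by rewrite -E; [rewrite /quad sqrrN -/(quad c z) E// zp|exact: filledN].
move=> /gmap_fiber; rewrite pE => h.
have : finite_point (- z) = finite_point z by apply: conj_inj; rewrite zp; case: h.
move=> [zN]; suff z0 : z = 0 by rewrite -zp z0.
have : 2 * z = 0 by rewrite mulr_natl mulr2n -{1}zN addNr.
by move=> /eqP; rewrite mulf_eq0 pnatr_eq0 => /eqP.
Qed.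

(* [1 / rho 0] has the same image as [rho 0], and [0] is the only preimage of
   [c]. *)
Lemma conj_critical : filled_quad c 0 ->
  rho (finite_point 0) = finite_point 1 \/ rho (finite_point 0) = finite_point (- 1).
Proof.
case: (conj) => _ _ E K0; apply: sphere_inv_fixed; set p := rho (finite_point 0).
have nW : ~ g_basin b (sphere_inv p).
  move=> /g_basin_f; rewrite gmap_inv -E//; apply: conj_not_basin; exact: filled_f.
have [z Kz zp] := conj_onto nW.
have : finite_point (quad c z) = finite_point (quad c 0).
  by apply: conj_inj; rewrite !E// zp gmap_inv.
move=> [/addIr]; rewrite expr0n/= => /eqP; rewrite sqrf_eq0 => /eqP z0.
by rewrite -zp z0.
Qed.

Lemma conj_basin : g_basin b = rho @` absorbed (quad_sphere c) (quad_exterior c).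
Proof.
case: (conj) => -[[_ _ surj] _ _] E _; apply/seteqP; split=> p.
  move=> Wp; have [q _ qp] := surj p I; exists q => //; case: q qp => [z|] qp; last by exists 0%N; exact: I.
  apply: contrapT => nW; apply: (@conj_not_basin z); first exact/filled_quadE.
  by rewrite [finite_point z]/(finite_point z) qp.
move=> [q Wq <-]; apply: contrapT => /conj_onto[z /filled_quadE Kz /conj_inj zq].
by apply: Kz; rewrite zq.
Qed.

Lemma conj_continuous : continuous rho.
Proof. by case: (conj) => -[_ cr _] _ _; exact/continuous_subspace_setT. Qed.

Lemma conj_basin_connected : connected (g_basin b).
Proof.
rewrite conj_basin; apply: connected_continuous_connected (@quad_absorbed_connected R c) _.
by apply: continuous_subspaceT; exact: conj_continuous.
Qed.

Lemma conj_open p A : nbhs p A -> nbhs (rho p) (rho @` A).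
Proof.
case: (conj) => -[[_ _ surj] _ [g cg gK]] _ _ hA.
have cg' : continuous g by exact/continuous_subspace_setT.
have gE q : g (rho q) = q by apply: gK; rewrite inE.
have : nbhs (g (rho p)) A by rewrite gE.
move=> /cg'; apply: (@filterS _ _ (nbhs_filter (rho p))) => q /= gq.
have [x _ xq] := surj q I; by exists x => //; rewrite -[x]gE xq.
Qed.

End WithConjugacy.
End Conjugacy.

Section Asymptotics.
Context {R : realType}.

Lemma linear_geometric (th : R) (C1 C2 : nat) (X e : R) : 0 < th < 1 -> 0 <= X -> 0 < e ->
  exists k0, forall k, (k0 <= k)%N -> X * (th ^+ 2) ^+ k * (C1 * k + C2 + 1)%:R < e.
Proof.
move=> /andP[th0 th1] X0 e0.
pose s := th^-1; have s1 : 1 < s by rewrite invf_gt1.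
have s0 : 0 < s by apply: lt_trans s1.
pose a := C1%:R / (s - 1) + C2%:R + 1.
have sm : 0 < s - 1 by rewrite subr_gt0.
have a0 : 0 < a by rewrite ltr_wpDl// addr_ge0// divr_ge0// ltW.
have lin k : (C1 * k + C2 + 1)%:R <= a * s ^+ k.
  have h := bernoulli k (ltW sm); rewrite [1 + (s - 1)]addrC subrK in h.
  have h2 : 1 <= s ^+ k by rewrite exprn_ege1// ltW.
  have h3 : k%:R <= s ^+ k / (s - 1) by rewrite ler_pdivlMr//; lra.
  have h4 := ler_wpM2l (ler0n R C1) h3; have h5 := ler_wpM2l (ler0n R C2) h2.
  by rewrite !natrD natrM /a !mulrDl mul1r -[C1%:R / _ * _]mulrA [(s - 1)^-1 * _]mulrC; lra.
have [k0 hk0] := @expr_large R s ((X * a + 1) / e) s1.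
exists k0 => k hk.
have sk : 0 < s ^+ k by rewrite exprn_gt0.
have hs : (X * a + 1) / e <= s ^+ k by apply: le_trans hk0 _; rewrite ler_eXn2l.
have -> : (th ^+ 2) ^+ k = (s ^+ k * s ^+ k)^-1.
  by rewrite -exprM mulnC exprM expr2 invfM -exprVn invrK.
have h6 : X / (s ^+ k * s ^+ k) * (C1 * k + C2 + 1)%:R <= X / (s ^+ k * s ^+ k) * (a * s ^+ k).
  by rewrite ler_wpM2l// divr_ge0// mulr_ge0// ltW.
apply: le_lt_trans h6 _.
have -> : X / (s ^+ k * s ^+ k) * (a * s ^+ k) = X * a / s ^+ k by field; rewrite gt_eqF.
rewrite ltr_pdivrMr//; rewrite ler_pdivrMr// mulrC in hs; lra.
Qed.

(** With [th = 64 ^- (kappa / 2)] the Hoelder bound at scale [64 ^- k] is a multiple of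
    [(th ^ 2) ^ k]; one factor [th ^ k] absorbs the linear bound on the period, the other one tends
    to 0. *)
Lemma powR_geometric (C r kappa : R) (C1 C2 : nat) (e : R) : 0 < r -> 0 < kappa -> 0 < e ->
  exists k0, forall k, (k0 <= k)%N -> `|C| * (r / 64 ^+ k) `^ kappa * (C1 * k + C2 + 1)%:R < e.
Proof.
move=> r0 ka0 e0; pose th : R := 64^-1 `^ (kappa / 2).
have i0 : 0 < (64^-1 : R) by rewrite invr_gt0 ltr0n.
have th0 : 0 < th by rewrite powR_gt0.
have th1 : th < 1.
  rewrite -[X in _ < X](_ : 1 `^ (kappa / 2) = 1); last by rewrite powR1.
  rewrite /th gt0_ltr_powR ?divr_gt0 ?nnegrE ?(ltW i0)//.
  by rewrite invf_lt1 ?ltr0n// ltr1n.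
have thE k : (64 ^+ k)^-1 `^ kappa = (th ^+ 2) ^+ k.
  have -> : (64 ^+ k)^-1 = 64^-1 `^ k%:R :> R by rewrite powR_mulrn ?(ltW i0)// exprVn.
  rewrite powRAC powR_mulrn ?powR_ge0//; congr (_ ^+ k).
  by rewrite -powR_mulrn ?powR_ge0// /th -powRrM divfK.
have h0 : 0 <= `|C| * r `^ kappa by rewrite mulr_ge0// powR_ge0.
have th01 : 0 < th < 1 by rewrite th0.
have [k0 hk0] := linear_geometric C1 C2 th01 h0 e0; exists k0 => k /hk0.
by rewrite powRM ?(ltW r0) ?invr_ge0 ?exprn_ge0// thE mulrA.
Qed.

End Asymptotics.

(** * The parameter 1/4 as a limit of other boundary points *)

Section QuarterBoundary.
Context {R : realType}.

Lemma quarter_left_Mandelbrot (s : R) : 0 <= s <= 1 / 4 -> Mandelbrot (1 / 4 - s)%:C%C.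
Proof.
move=> /andP[s0 s1]; pose x := 1 / 4 - s; apply/MandelbrotP => n.
have [a [a0 a1 ->]] : exists a : R, [/\ 0 <= a, a <= 1 / 2 & iter n (quad x%:C%C) 0 = a%:C%C].
  elim: n => [|n [a [a0 a1 E]]]; first by exists 0; split=> //; lra.
  exists (a ^+ 2 + x); split; last by rewrite iterS E /quad -rmorphXn -rmorphD.
    by rewrite addr_ge0 ?sqr_ge0// /x; lra.
  by rewrite /x; nra.
by rewrite !modulus_real ger0_norm//; have := normr_ge0 x; rewrite /x; lra.
Qed.

(** A segment from a real point of the Mandelbrot set left of 1/4 to a nearby point outside the set
    and off the real axis must cross the boundary, and it misses 1/4. *)
Lemma boundary_near_quarter (e : R) : boundary (@Mandelbrot R) (1 / 4) -> 0 < e ->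
  exists c, [/\ boundary (@Mandelbrot R) c, c != 1 / 4 & modulus (c - 1 / 4) < e].
Proof.
move=> [_ nint] e0; have e2 : 0 < e / 2 by rewrite divr_gt0.
have [c nM hc] := not_interior_Mandelbrot nint e2.
have oM : open (~` @Mandelbrot R) by apply: closed_openC; exact: Mandelbrot_closed.
have /nbhs_modulusP[d d0 hd] := open_nbhs_nbhs (conj oM nM).
have [b [nMb hb Imb]] : exists b, [/\ ~ Mandelbrot b, modulus (b - 1 / 4) < e & complex.Im b != 0].
  have [Im0|Im0] := eqVneq (complex.Im c) 0; last by exists c; split=> //; lra.
  pose s := Num.min (d / 2) (e / 4).
  have s0 : 0 < s by rewrite lt_min !divr_gt0.
  have ms : modulus (0 +i* s)%C = s by rewrite modulusE /= expr0n/= add0r sqrtr_sqr gtr0_norm.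
  exists (c + (0 +i* s)%C); split.
  - apply: hd; rewrite addrC addKr ms.
    have : s <= d / 2 by rewrite ge_min lexx.
    by lra.
  - have -> : c + (0 +i* s)%C - 1 / 4 = (c - 1 / 4) + (0 +i* s)%C by ring.
    have := ler_modulusD (c - 1 / 4) (0 +i* s)%C; rewrite ms.
    have : s <= e / 4 by rewrite ge_min lexx orbT.
    by lra.
  - by case: (c) Im0 => x y /= ->; rewrite add0r gt_eqF.
pose s := Num.min (1 / 4) (e / 2); have s0 : 0 < s by rewrite lt_min !divr_gt0.
have s4 : s <= 1 / 4 by rewrite ge_min lexx.
pose a : R[i] := (1 / 4 - s)%:C%C.
have aM : Mandelbrot a by apply: quarter_left_Mandelbrot; rewrite (ltW s0).
have quarterE : 1 / 4 = (1 / 4)%:C%C :> R[i] by rewrite rmorphM rmorph1 fmorphV rmorph_nat.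
have ha : modulus (a - 1 / 4) < e.
  rewrite /a quarterE -rmorphB modulus_real addrAC subrr add0r normrN gtr0_norm//.
  have : s <= e / 2 by rewrite ge_min lexx orbT.
  by lra.
pose S := [set a + (t%:C)%C * (b - a) | t in [set t : R | 0 <= t <= 1]].
have cS : connected S by exact: segment_connected.
have Sa : S a by exists 0; rewrite /= ?ler01 ?lexx// mul0r addr0.
have Sb : S b by exists 1; rewrite /= ?ler01 ?lexx// mul1r addrC subrK.
have Sq z : S z -> z != 1 / 4.
  move=> [t /= t01 <-]; apply/eqP => E.
  have := congr1 (@complex.Im R) E; rewrite quarterE.
  have -> : complex.Im (a + t%:C%C * (b - a)) = t * complex.Im b.
    by rewrite /a; case: (b) => x y /=; ring.
  move=> /= /eqP; rewrite mulf_eq0 (negbTE Imb) orbF => /eqP t0.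
  move: E; rewrite t0 mul0r addr0 quarterE /a => -[] h; lra.
have Se z : S z -> modulus (z - 1 / 4) < e.
  move=> [t /= /andP[t0 t1] <-].
  have -> : a + t%:C%C * (b - a) - 1 / 4 = (1 - t)%:C%C * (a - 1 / 4) + t%:C%C * (b - 1 / 4).
    by rewrite rmorphB rmorph1; ring.
  apply: le_lt_trans (ler_modulusD _ _) _; rewrite !modulusM !modulus_real !ger0_norm ?subr_ge0//.
  have [t2|t2] := ltP t 1.
    have g1 : (1 - t) * modulus (a - 1 / 4) < (1 - t) * e by rewrite ltr_pM2l// subr_gt0.
    have g2 : t * modulus (b - 1 / 4) <= t * e by rewrite ler_wpM2l// ltW.
    by lra.
  have -> : t = 1 by apply/eqP; rewrite eq_le t1.
  by rewrite subrr mul0r add0r mul1r.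
apply: contrapT => nex.
have nb z : S z -> ~ boundary (@Mandelbrot R) z.
  by move=> Sz bz; apply: nex; exists z; split; [|exact: Sq|exact: Se].
have hP z : S z -> Mandelbrot z -> \forall w \near z, S w -> Mandelbrot w.
  move=> Sz Mz; have : (@Mandelbrot R)° z.
    by apply: contrapT => ni; apply: (nb z Sz); split=> //; exact: subset_closure.
  by move=> /nbhs_modulusP[r r0 hr]; apply/nbhs_modulusP; exists r => // w /hr.
have hN z : S z -> ~ Mandelbrot z -> \forall w \near z, S w -> ~ Mandelbrot w.
  move=> Sz nMz; have /nbhs_modulusP[r r0 hr] := open_nbhs_nbhs (conj oM nMz).
  by apply/nbhs_modulusP; exists r => // w /hr.
have [h|h] := connected_dichotomy cS hP hN; first by apply: nMb; exact: h.
exact: (h a).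
Qed.

End QuarterBoundary.

(** * Failure of every Hoelder estimate on a dense set *)

Section NonHolder.
Context {R : realType}.
Implicit Types (z w y b c : R[i]) (p q : sphere R) (rho : sphere R -> sphere R).
Variable Phi : R[i] -> R[i].
Hypothesis Phi_homeo : homeomorphism_on (@Mandelbrot R) (@parabolic_Mandelbrot R) Phi.
Hypothesis Phi_dyn : dynamics_preserving Phi.

Definition holder_at (f : R[i] -> R[i]) (c0 : R[i]) (kappa : R) := exists (C : R) (N : set R[i]), nbhs c0 N /\
  forall c : R[i], Mandelbrot c -> N c -> modulus (f c - f c0) <= C * modulus (c - c0) `^ kappa.

Lemma kap_quarter (l : R[i]) : 1 < modulus l -> kap l != 1 / 4.
Proof.
move=> l1; apply: contraTneq l1 => h; have : (l - 1) ^+ 2 = 0.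
  have -> : (l - 1) ^+ 2 = 1 - 4 * kap l by rewrite /kap; field.
  by rewrite h mul1r mulfV ?subrr// pnatr_eq0.
by move=> /eqP; rewrite sqrf_eq0 subr_eq0 => /eqP ->; rewrite modulus1 ltxx.
Qed.

(** The parameter [b = 0] is excluded because [gmap 0] fixes only infinity, while for [c != 1 / 4]
    the polynomial has two fixed points in its filled Julia set. *)
Lemma conjugacy_exists c b : Mandelbrot c -> c != 1 / 4 -> Phi c = 1 - b ^+ 2 ->
  b != 0 /\ exists rho, filled_conjugacy c b rho.
Proof.
move=> cM c4 cb; have rep := g_rat_represents b; rewrite -cb in rep.
have [W [rho [bW hrho _ rhoE dyn]]] := Phi_dyn cM rep; rewrite rat_map_g in dyn.
have b0 : b != 0.
  apply/eqP => b0; have [l lc l1] := kap_repelling c4.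
  have f1 := quad_kap l; have f2 : quad (kap l) (1 - l / 2) = 1 - l / 2 by rewrite /quad /kap; field.
  rewrite lc in f1 f2.
  have inf y : quad c y = y -> rho (finite_point y) = infinity R.
    by move=> fy; have := dyn y (filled_fixed fy); rewrite fy b0 => /esym/gmap_fixed_infinity.
  have : finite_point (l / 2) = finite_point (1 - l / 2).
    by case: hrho => -[_ inj _] _ _; apply: inj; rewrite ?inE// !inf.
  move=> [E]; move: l1; have -> : l = 1.
    have -> : l = l / 2 + l / 2 by field.
    by rewrite {2}E addrCA subrr addr0.
  by rewrite modulus1 ltxx.
split=> //; exists rho; split=> //; rewrite rhoE /g_basin.
have t1 : Phi c != 1 by rewrite cb -subr_eq0 addrAC subrr add0r oppr_eq0 sqrf_eq0.
by rewrite (external_basin_g b0 t1 bW).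
Qed.

Lemma Mandelbrot_filled0 c : Mandelbrot c -> filled_quad c 0.
Proof. by move=> /MandelbrotP h; apply/filled_quadP. Qed.

(* Both [b] and [- b] represent [Phi c]; the choice is the one for which [rho]
   sends the critical point [0] to [1]. *)
Definition normalized c b rho := [/\ b != 0, Phi c = 1 - b ^+ 2, filled_conjugacy c b rho &
  rho (finite_point 0) = finite_point 1].

Lemma normalized_of_critical c b : Mandelbrot c -> c != 1 / 4 -> Phi c = 1 - b ^+ 2 ->
  ~ g_basin b (finite_point 1) -> exists rho, normalized c b rho.
Proof.
move=> cM c4 cb n1; have [b0 [rho conj]] := conjugacy_exists cM c4 cb.
exists rho; split=> //; apply: (conj_critical_unique conj) => //.
by rewrite /= oner_eq0 invr1.
Qed.

Lemma normalized_exists c : Mandelbrot c -> c != 1 / 4 -> exists b rho, normalized c b rho.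
Proof.
move=> cM c4; pose b := sqrtC (1 - Phi c).
have bE : Phi c = 1 - b ^+ 2 by rewrite /b sqrtCK; ring.
have [b0 [rho conj]] := conjugacy_exists cM c4 bE.
have K0 := Mandelbrot_filled0 cM.
have [r0|r0] := conj_critical conj K0; first by exists b, rho.
have nb : ~ g_basin (- b) (finite_point 1).
  rewrite g_basinE ?oppr_eq0// => h; apply: (conj_not_basin conj K0); rewrite r0 g_basinE//.
  by apply/basin_opp; rewrite /= opprK.
have bN : Phi c = 1 - (- b) ^+ 2 by rewrite sqrrN.
by have [rho' h] := normalized_of_critical cM c4 bN nb; exists (- b), rho'.
Qed.

Lemma normalized_orbit c b rho n : Mandelbrot c -> normalized c b rho ->
  rho (finite_point (iter n (quad c) 0)) = iter n (gmap b) (finite_point 1).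
Proof.
move=> cM [_ _ conj r0]; rewrite (conj_iter conj); last exact: Mandelbrot_filled0.
by rewrite r0.
Qed.

Lemma finite1N1 : finite_point (1 : R[i]) <> finite_point (- 1).
Proof.
move=> [/eqP h _]; move: h; rewrite -subr_eq0 opprK.
by have -> : (1 + 1 : R) = 2 by []; rewrite pnatr_eq0.
Qed.

(** If -1 were outside the basin, [conj_critical_unique] would force the image of 0 to be -1 instead
    of 1. *)
Lemma normalized_free_critical c b rho : normalized c b rho -> g_basin b (finite_point (- 1)).
Proof.
move=> [_ _ conj r0]; apply: contrapT => nW; apply: finite1N1; rewrite -r0.
by apply: (conj_critical_unique conj) => //; rewrite /= oppr_eq0 oner_eq0 invrN1.
Qed.

Lemma normalized_critical c b rho : Mandelbrot c -> normalized c b rho -> ~ g_basin b (finite_point 1).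
Proof. by move=> cM [_ _ conj <-]; apply: (conj_not_basin conj); exact: Mandelbrot_filled0. Qed.

(* Prevents the parameters of nearby maps from converging to [- b]. *)
Lemma normalized_opp_stable c b rho : normalized c b rho -> exists2 e : R, 0 < e &
  forall b', modulus (b' + b) < e -> g_basin b' (finite_point 1).
Proof.
move=> nrm; have [b0 _ _ _] := nrm; have Nb0 : - b != 0 by rewrite oppr_eq0.
have W1 : absorbed (gmap (- b)) (halfplane (- b)) (finite_point 1).
  have := normalized_free_critical nrm; rewrite g_basinE// => /basin_opp.
  by rewrite /= opprK.
have cA : compact [set finite_point (1 : R[i])] by exact: compact_set1.
have AW : [set finite_point (1 : R[i])] `<=` absorbed (gmap (- b)) (halfplane (- b)) by move=> _ ->.
have [e e0 he] := basin_stable Nb0 cA AW.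
exists (Num.min e (modulus (- b) / 4)); first by rewrite lt_min e0 divr_gt0// modulus_gt0.
move=> b'; rewrite lt_min => /andP[h1 /ltW h2].
rewrite -[b in X in modulus X]opprK in h1 h2.
by rewrite /g_basin (parabolic_basinE Nb0 h2); apply: he.
Qed.

(** As [|Phi c - Phi c0| = |b - b0| |b + b0|] with the second factor bounded below, a Hoelder
    estimate at the parameters of [landing_centers] makes [|b - b0|] decrease geometrically in k.
    This contradicts [c / N <= |b - b0|], where N is at most linear in k. *)
Lemma not_holder l n b0 rho0 kappa : landing l n -> 1 < modulus l -> normalized (kap l) b0 rho0 ->
    (exists2 c, 0 < c & exists2 eta, 0 < eta & forall b N, modulus (b - b0) <= eta -> (0 < N)%N ->
      iter N (gmap b) (finite_point 1) = finite_point 1 -> c / N%:R <= modulus (b - b0)) ->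
  0 < kappa -> ~ holder_at Phi (kap l) kappa.
Proof.
move=> ll l1 nrm [c c0 [eta eta0 slow]] ka0 [C [N0 [/nbhs_modulusP[d d0 hd] hN0]]].
have [b00 b0E _ _] := nrm.
have [e2 e20 opp] := normalized_opp_stable nrm.
have [C1 [C2 [rho rho0' centers]]] := landing_centers ll l1.
have root0 : (kap_poly - (kap l)%:P).[l] = 0 by rewrite hornerD hornerN hornerC horner_kap subrr.
have [Lk Lk0 hLk] := poly_root_upper rho root0.
have p64 k : 0 < (64 : R) ^+ k by rewrite exprn_gt0// ltr0n.
have r0 : 0 < Lk * rho by exact: mulr_gt0.
(* The first term contradicts the lower bound on [|b - b0|]; the second brings b into its range of
   validity. *)
pose eps := Num.min (c * e2) (eta * e2).
have eps0 : 0 < eps by rewrite lt_min !mulr_gt0.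
have [k1 hk1] := powR_geometric C C1 C2 r0 ka0 eps0.
have c4 := kap_quarter l1.
pose d' := Num.min d (modulus (kap l - 1 / 4)).
have d'0 : 0 < d' by rewrite lt_min d0 modulus_gt0 subr_eq0.
have [k2 hk2] := @expr_large R 64 ((Lk * rho + 1) / d') (ltr1n _ 64).
have [k [N [lam [hk /andP[N1 NC] hlam per]]]] := centers (maxn k1 k2).
have hk1' : (k1 <= k)%N by apply: leq_trans hk; exact: leq_maxl.
have hk2' : (k2 <= k)%N by apply: leq_trans hk; exact: leq_maxr.
pose cc := kap lam; have cM : Mandelbrot cc by exact: periodic_Mandelbrot per.
have lamr : modulus (lam - l) <= rho by apply: le_trans hlam _; rewrite ler_pdivrMr// ler_peMr ?(ltW rho0')// exprn_ege1// ler1n.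
have dist : modulus (cc - kap l) <= Lk * rho / 64 ^+ k.
  have := hLk lam lamr; rewrite hornerD hornerN hornerC horner_kap => h.
  by apply: le_trans h _; rewrite -mulrA ler_pM2l.
have near : modulus (cc - kap l) < d'.
  apply: le_lt_trans dist _; rewrite ltr_pdivrMr//.
  have h : (64 : R) ^+ k2 <= 64 ^+ k by rewrite ler_eXn2l// ltr1n.
  have := le_trans hk2 h; rewrite ler_pdivrMr// mulrC; lra.
have [nd n4] : modulus (cc - kap l) < d /\ modulus (cc - kap l) < modulus (kap l - 1 / 4).
  by move: near; rewrite lt_min => /andP.
have cc4 : cc != 1 / 4 by apply: contraTneq n4 => ->; rewrite modulusBC ltxx.
have [b [rho' nrm']] := normalized_exists cM cc4; have [b_n bE _ r0'] := nrm'.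
have per' : iter N (gmap b) (finite_point 1) = finite_point 1.
  by rewrite -(normalized_orbit N cM nrm') per r0'.
have hol := hN0 cc cM (hd cc nd).
pose X := `|C| * (Lk * rho / 64 ^+ k) `^ kappa.
have holX : modulus (Phi cc - Phi (kap l)) <= X.
  apply: le_trans hol _; apply: le_trans (ler_wpM2r (powR_ge0 _ _) (ler_norm C)) _.
  rewrite ler_wpM2l// ge0_ler_powR ?nnegrE ?modulus_ge0 ?(ltW ka0)//.
  by rewrite divr_ge0// ?(ltW r0)// ltW.
have X0 : 0 <= X by rewrite mulr_ge0// powR_ge0.
have XN : X * (C1 * k + C2 + 1)%:R < eps by exact: hk1.
have Phi2 : modulus (b - b0) * modulus (b + b0) <= X.
  rewrite -modulusM; apply: le_trans holX; rewrite bE b0E.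
  have -> : 1 - b ^+ 2 - (1 - b0 ^+ 2) = - ((b - b0) * (b + b0)) by ring.
  by rewrite modulusN.
(* Near [- b0] the critical point 1 would lie in the basin, against the normalization of b. *)
have far : e2 <= modulus (b + b0).
  by rewrite leNgt; apply/negP => /opp; exact: normalized_critical nrm'.
have hb : modulus (b - b0) * e2 <= X by apply: le_trans Phi2; rewrite ler_wpM2l ?modulus_ge0.
have n1 : 1 <= (C1 * k + C2 + 1)%:R :> R by rewrite ler1n addn1.
have XX : X <= X * (C1 * k + C2 + 1)%:R by rewrite ler_peMr.
move: XN; rewrite lt_min => /andP[x1 x2].
have b_eta : modulus (b - b0) <= eta.
  by rewrite -(ler_pM2r e20); apply: le_trans hb _; apply: le_trans XX _; exact: ltW.
have := slow b N b_eta N1 per'.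
rewrite ler_pdivrMr ?ltr0n// leNgt => /negP; apply.
have NN : N%:R <= (C1 * k + C2 + 1)%:R :> R by rewrite ler_nat addn1 ltnW.
rewrite -(ltr_pM2r e20) mulrAC; apply: le_lt_trans x1.
by apply: ler_pM => //; rewrite mulr_ge0 ?modulus_ge0 ?(ltW e20).
Qed.

Definition non_holder : set R[i] := [set c0 | boundary (@Mandelbrot R) c0 /\
  forall kappa, 0 < kappa -> ~ holder_at Phi c0 kappa].

(* Infinity is a limit of basin points, while an attracting [y] is interior to
   the filled Julia set. *)
Lemma attracting_not_infinity c b rho y : filled_conjugacy c b rho -> b != 0 ->
  quad c y = y -> modulus (2 * y) < 1 -> rho (finite_point y) <> infinity R.
Proof.
move=> conj b0 fy y1 yinf.
pose r := 1 - modulus (2 * y); have r0 : 0 < r by rewrite subr_gt0.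
have disc z : modulus (z - y) <= r -> forall n, modulus (iter n (quad c) z - y) <= r.
  move=> hz; elim=> [//|n IH]; rewrite iterS -{1}fy.
  set x := iter n (quad c) z in IH *.
  have -> : quad c x - quad c y = (x - y) * (2 * y + (x - y)) by rewrite /quad; ring.
  rewrite modulusM; apply: le_trans (IH); rewrite ler_piMr ?modulus_ge0//.
  by have := ler_modulusD (2 * y) (x - y); rewrite /r in IH *; lra.
have Ky : nbhs (finite_point y) (@finite_point R @` filled_quad c).
  apply/nbhs_finiteP; exists r => // z /ltW hz; exists z => //.
  apply: contrapT => nK; have [j] := escape_of_filled nK (modulus y + r).
  have := disc z hz j; have := lerB_modulus (iter j (quad c) z) y; lra.
have := conj_open conj Ky; rewrite yinf => /(infinity_closure_halfplane b0)[q Hq].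
case: (conj) => _ -> _; apply; rewrite g_basinE//; by exists 0%N.
Qed.

(** The point y that rho sends to infinity is fixed. It is not neutral by [neutral_not_landing] and
    not attracting by [attracting_not_infinity], so it is repelling, and [slow_infinity] applies. *)
Lemma parabolic_landing_not_holder c b rho m : Mandelbrot c -> normalized c b rho ->
  iter m (gmap b) (finite_point 1) = infinity R -> non_holder c.
Proof.
move=> cM nrm hm; pose y := iter m (quad c) 0.
have [b0 bE conj r0] := nrm.
have Ky : filled_quad c y by apply: filled_iter; exact: Mandelbrot_filled0.
have ry : rho (finite_point y) = infinity R by rewrite /y (normalized_orbit m cM nrm).
have fy : quad c y = y.
  have : finite_point (quad c y) = finite_point y.
    by apply: (conj_inj conj); case: (conj) => _ _ ->//; rewrite ry.
  by case.
have kc := kap_fixed fy.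
have ll : landing (2 * y) m by rewrite /landing kc -/y; field.
have l1 : 1 < modulus (2 * y).
  rewrite lt_neqAle eq_sym (neutral_not_landing ll) /= leNgt; apply/negP => h.
  exact: (attracting_not_infinity conj b0 fy h ry).
split; first by rewrite -kc; exact: landing_boundary ll l1.
move=> kappa ka0; rewrite -kc; rewrite -kc in nrm.
exact: (not_holder ll l1 nrm (slow_infinity hm) ka0).
Qed.

(** A compact connected set joins -1 to the half-plane inside the basin of [gmap b0], and it stays
    in the basin for b near [b0]. The critical point 1 is kept out of the basin by its landing on
    infinity. *)
Lemma parabolic_Mandelbrot_near c0 b0 rho0 : Mandelbrot c0 -> normalized c0 b0 rho0 ->
  exists2 e : R, 0 < e & forall b m, modulus (b - b0) < e -> iter m (gmap b) (finite_point 1) = infinity R ->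
    parabolic_Mandelbrot (1 - b ^+ 2).
Proof.
move=> cM nrm; have [b00 _ conj r0] := nrm.
have W1 := normalized_free_critical nrm.
have [q Hq _] := infinity_closure_halfplane b00 (@filterT _ (nbhs (infinity R)) _).
have Wq : g_basin b0 q by rewrite g_basinE//; exists 0%N.
have oW : open (g_basin b0).
  by rewrite g_basinE//; apply: basin_open => //.
have nWinf : ~ g_basin b0 (infinity R) by exact: (@g_basin_iter R b0 (infinity R) 0).
have [A [cA kA AW A1 Aq]] := compact_connected_joining oW (conj_basin_connected conj) nWinf W1 Wq.
rewrite g_basinE// in AW.
have [e e0 he] := basin_stable b00 cA AW.
exists (Num.min e (modulus b0 / 4)); first by rewrite lt_min e0 divr_gt0// modulus_gt0.
move=> b m; rewrite lt_min => /andP[h1 /ltW h2] hm.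
exists (g_rat b); first exact: g_rat_represents.
rewrite rat_map_g; apply: (parabolic_Julia_connected b00 h2 kA A1).
- by move=> p Ap; exact: he.
- by exists q.
- by rewrite -(parabolic_basinE b00 h2); exact: g_basin_iter hm.
Qed.

Lemma Phi_inverse_near c0 (e : R) : Mandelbrot c0 -> 0 < e -> exists2 d : R, 0 < d &
  forall t, parabolic_Mandelbrot t -> modulus (t - Phi c0) < d ->
  exists c, [/\ Mandelbrot c, Phi c = t & modulus (c - c0) < e].
Proof.
move=> cM e0; case: Phi_homeo => -[fun_ _ surj] _ [g cg gK].
have tM : parabolic_Mandelbrot (Phi c0) by exact: fun_.
have /subspace_continuousP/(_ (Phi c0) tM) := cg.
have hA : nbhs (g (Phi c0)) [set c | modulus (c - c0) < e].
  by rewrite gK ?inE//; apply/nbhs_modulusP; exists e.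
move=> /(_ _ hA) /nbhs_modulusP[d d0 hd]; exists d => // t tP ht.
have [c cM' ct] := surj t tP; exists c; split=> //.
have gt : g t = c by rewrite -ct gK// inE.
by have := hd t ht tP; rewrite /preimage /= /from_subspace gt.
Qed.

Lemma non_holder_near c1 (e : R) : boundary (@Mandelbrot R) c1 -> c1 != 1 / 4 -> 0 < e ->
  exists2 c, non_holder c & modulus (c - c1) < e.
Proof.
move=> bc1 c14 e0; have e4 : 0 < e / 4 by rewrite divr_gt0.
have [l [n [ll l1 hl]]] := landing_dense bc1 c14 e4.
pose c0 := kap l; have cM : Mandelbrot c0 by exact: landing_Mandelbrot ll.
have c4 : c0 != 1 / 4 by exact: kap_quarter.
have [b0 [rho0 nrm]] := normalized_exists cM c4; have [b00 bE conj r0] := nrm.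
have Ky : filled_quad c0 (l / 2) by apply: filled_fixed; exact: quad_kap.
have ry : rho0 (finite_point (l / 2)) = iter n (gmap b0) (finite_point 1).
  by rewrite -(normalized_orbit n cM nrm) ll.
have fy : gmap b0 (rho0 (finite_point (l / 2))) = rho0 (finite_point (l / 2)).
  by case: (conj) => _ _ <-//; rewrite quad_kap.
have D0 : (exists2 c, 0 < c & exists2 eta, 0 < eta & forall b N, modulus (b - b0) <= eta -> (0 < N)%N ->
      iter N (gmap b) (finite_point 1) = finite_point 1 -> c / N%:R <= modulus (b - b0)) ->
    exists2 c, non_holder c & modulus (c - c1) < e.
  move=> slow; exists c0; last by rewrite /c0; lra.
  split; first exact: landing_boundary ll l1.
  by move=> kappa; exact: not_holder ll l1 nrm slow.
have [yinf|yx] := gmap_fixed fy b00.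
  by apply: D0; apply: (@slow_infinity R b0 n); rewrite -ry.
have hn : iter n (gmap b0) (finite_point 1) = finite_point (- b0^-1) by rewrite -ry.
have bN1 : b0 != -1.
  apply/eqP => b01; have : finite_point (l / 2) = finite_point 0.
    by apply: (conj_inj conj); rewrite yx r0 b01 invrN1 opprK.
  move=> [/eqP]; rewrite mulf_eq0 invr_eq0 pnatr_eq0 orbF => /eqP l0.
  by move: l1; rewrite l0 modulus0 ltr10.
have [t1|t1] := leP (modulus (1 - b0 ^+ 2)) 1.
  by apply: D0; exact: slow_neutral b00 t1 bN1 hn.
(* This is the other fixed point. As [rho0] sends [l / 2] to [- b0^-1], it sends a to infinity, so
   that preimages of a near [l / 2] become prepoles near [- b0^-1]. *)
pose a := 1 - l / 2; have fa : quad c0 a = a by rewrite /quad /c0 /a /kap; field.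
have a0 : a != 0.
  apply/eqP => /eqP; rewrite subr_eq0 => /eqP h; have := landing_neq2 ll.
  have -> : l = 2 * (l / 2) by field.
  by rewrite -h mulr1 eqxx.
have Ka : filled_quad c0 a by exact: filled_fixed.
have ra : rho0 (finite_point a) = infinity R.
  have fra : gmap b0 (rho0 (finite_point a)) = rho0 (finite_point a).
    by case: (conj) => _ _ <-//; rewrite fa.
  have [//|ax] := gmap_fixed fra b00; exfalso.
  have : finite_point a = finite_point (l / 2) by apply: (conj_inj conj); rewrite ax yx.
  move=> [E]; move: l1; have -> : l = 1; last by rewrite modulus1 ltxx.
  have -> : l = a + l / 2; last by rewrite /a subrK.
  by rewrite E; field.
have prep (eta : R) : 0 < eta -> exists k z, modulus (z + b0^-1) <= eta /\
    iter k (gmap b0) (finite_point z) = infinity R.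
  move=> eta0.
  have nx : nbhs (rho0 (finite_point (l / 2))) [set p | exists2 z, p = finite_point z & modulus (z + b0^-1) < eta].
    by rewrite yx; apply/nbhs_finiteP; exists eta => // w; rewrite opprK => hw; exists w.
  have /nbhs_finiteP[s s0 hs] := conj_continuous conj nx.
  have s2 : 0 < s / 2 by rewrite divr_gt0.
  have [i [z [hz zE]]] := preimages_near_repelling l1 a0 s2; rewrite -/c0 fa in zE.
  have Kz : filled_quad c0 z by apply: (@filled_iter_inv R c0 z i.+1); rewrite zE.
  have [z' zz' hz'] := hs z ltac:(lra).
  exists i.+1, z'; split; first exact: ltW.
  by rewrite -zz' -(conj_iter conj i.+1 Kz) zE ra.
have [e1 e10 near1] := parabolic_Mandelbrot_near cM nrm.
(* The second term keeps the parameter found below different from 1/4, as [normalized_of_critical]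
   requires. *)
pose ee := Num.min (e / 4) (modulus (c0 - 1 / 4)).
have ee0 : 0 < ee by rewrite lt_min e4 modulus_gt0 subr_eq0.
have [d d0 hd] := Phi_inverse_near cM ee0.
pose dd := Num.min (e1 / 2) (Num.min 1 (d / (2 * (2 * modulus b0 + 1)))).
have k0 : 0 < 2 * modulus b0 + 1 by rewrite ltr_wpDl// mulr_ge0// modulus_ge0.
have dd0 : 0 < dd by rewrite !lt_min ltr01 !divr_gt0// mulr_gt0.
have [b [m [hb hm]]] := prepole_parameters b00 hn t1 prep dd0.
move: hb; rewrite !le_min => /and3P[hb1 hb2 hb3].
have tP : parabolic_Mandelbrot (1 - b ^+ 2) by apply: (near1 b m) => //; lra.
have ht : modulus (1 - b ^+ 2 - Phi c0) < d.
  rewrite bE; have -> : 1 - b ^+ 2 - (1 - b0 ^+ 2) = - ((b - b0) * (b - b0 + 2 * b0)) by ring.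
  rewrite modulusN modulusM; have := ler_modulusD (b - b0) (2 * b0); rewrite [modulus (2 * b0)]modulusM modulus_nat => g.
  have g2 : modulus (b - b0) * modulus (b - b0 + 2 * b0) <= d / (2 * (2 * modulus b0 + 1)) * (2 * modulus b0 + 1).
    by apply: ler_pM => //; rewrite ?modulus_ge0//; lra.
  apply: le_lt_trans g2 _; have -> : d / (2 * (2 * modulus b0 + 1)) * (2 * modulus b0 + 1) = d / 2 by field; rewrite gt_eqF.
  by lra.
have [c [cM' ct hc]] := hd _ tP ht.
move: hc; rewrite lt_min => /andP[hc1 hc2].
have cc4 : c != 1 / 4 by apply: contraTneq hc2 => ->; rewrite modulusBC ltxx.
have [rho nrm'] := normalized_of_critical cM' cc4 ct (g_basin_iter hm).
exists c; first exact: parabolic_landing_not_holder cM' nrm' hm.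
by have := modulus_triangle c0 c c1; rewrite -/c0 in hl; lra.
Qed.

Lemma non_holder_dense : boundary (@Mandelbrot R) `<=` closure non_holder.
Proof.
move=> c1 bc1 A /nbhs_modulusP[e e0 hA].
have [c14|c14] := eqVneq c1 (1 / 4); last first.
  by have [c Dc hc] := non_holder_near bc1 c14 e0; exists c; split=> //; exact: hA.
rewrite c14 in bc1 hA; have e2 : 0 < e / 2 by rewrite divr_gt0.
have [c2 [bc2 c24 hc2]] := boundary_near_quarter bc1 e2.
have [c Dc hc] := non_holder_near bc2 c24 e2; exists c; split=> //; apply: hA.
by have := modulus_triangle c2 c (1 / 4); lra.
Qed.

End NonHolder.

Theorem theoremB (R : realType) (Phi : R[i] -> R[i])
    (Phi_homeo : homeomorphism_on (@Mandelbrot R) (@parabolic_Mandelbrot R) Phi)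
    (Phi_dyn : dynamics_preserving Phi) :
  exists D : set R[i],
    [/\ D `<=` boundary (@Mandelbrot R),
        boundary (@Mandelbrot R) `<=` closure D &
        forall c0 : R[i], D c0 -> forall kappa : R, 0 < kappa ->
        ~ exists (C : R) (N : set R[i]), nbhs c0 N /\
            forall c : R[i], Mandelbrot c -> N c ->
              modulus (Phi c - Phi c0) <= C * modulus (c - c0) `^ kappa].
Proof.
exists (non_holder Phi); split.
- by move=> c [].
- exact: non_holder_dense Phi_homeo Phi_dyn.
- by move=> c [_ h] kappa /h.
Qed.
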